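(* Assume Hypothesis B (stated in the context) holds. Then for all sufficiently large integers $r$, \[h_{\mathcal{GM}}(r)=h_{\mathcal{AC}_4}(r)=h_{\mathcal{SL}_4}(r)=h_{\mathcal{AF}_4}(r)=\binom{r+3}{2}-5.\]
   Context: Classes of (abstract) matroids: $\mathcal{GM}$ is the class of golden-mean matroids, i.e. matroids representable by a real matrix all of whose nonzero subdeterminants are of the form $\pm\tau^i$ ($i\in\mathbb{Z}$), where $\tau=\frac{1+\sqrt5}{2}$. $\mathcal{AC}_4$ is the class of $\mathrm{GF}(4)$-representable matroids that are representable over some field of every characteristic (every prime and $0$). $\mathcal{AF}_4$ is the class of matroids representable over every field with at least $4$ elements. $\mathcal{SL}_4$ is the class of $\mathrm{GF}(4)$-representable matroids $M$ for which there is a prime power $q$ such that $M$ is representable over every field with at least $q$ elements. For a minor-closed class $\mathcal{M}$, $h_{\mathcal{M}}(r)$ is the maximum number of elements of a simple matroid in $\mathcal{M}$ of rank at most $r$. Represented matroids: for a field $\mathbb{F}$, an $\mathbb{F}$-represented matroid is a pair $(E,U)$ with $U$ a subspace of $\mathbb{F}^E$; a matrix $A$ whose row space is $U$ represents it, written $M(A)$; two are equal if representing matrices are row equivalent up to column scaling. Its dual is $(E,U^\perp)$; $\widetilde M$ denotes the underlying abstract matroid (column matroid of $A$); restriction is $M|X=(X,U|X)$, deletion $M\backslash X=M|(E-X)$, contraction $M/X=(M^*\backslash X)^*$; simplicity, connectivity and minors are taken from $\widetilde M$. $\mathbb{F}_p$ is the prime subfield of $\mathbb{F}$. A matroid is vertically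 $k$-connected if for every $X\subseteq E$ with $r(X)+r(E-X)-r(M)<k$, $X$ or $E-X$ is spanning; $M$ is cyclically $k$-connected if $M^*$ is vertically $k$-connected. Frame templates: for a subgroup $\Gamma\le\mathbb{F}^\times$, a $\Gamma$-frame matrix is a matrix each of whose columns has at most two nonzero entries, each nonzero column contains an entry $1$, and a second nonzero entry (if present) equals $-\gamma$ for some $\gamma\in\Gamma$. A frame template over $\mathbb{F}$ is a tuple $\Phi=(\Gamma,C,X,Y_0,Y_1,A_1,\Delta,\Lambda)$ with $\Gamma\le\mathbb{F}^\times$; $C,X,Y_0,Y_1$ pairwise disjoint finite sets; $A_1\in\mathbb{F}^{X\times(C\cup Y_0\cup Y_1)}$; $\Lambda$ an additive subgroup of $\mathbb{F}^X$ closed under scaling by $\Gamma$; $\Delta$ an additive subgroup of $\mathbb{F}^{C\cup Y_0\cup Y_1}$ closed under scaling by $\Gamma$. A matrix $A'\in\mathbb{F}^{B\times E}$ respects $\Phi$ if $X\subseteq B$, $C,Y_0,Y_1\subseteq E$, $A'[X,C\cup Y_0\cup Y_1]=A_1$, and there is $Z\subseteq E-(C\cup Y_0\cup Y_1)$ with $A'[X,Z]=0$, every column of $A'[B-X,Z]$ a unit vector, $A'[B-X,E-(C\cup Y_0\cup Y_1\cup Z)]$ a $\Gamma$-frame matrix, every column of $A'[X,E-(C\cup Y_0\cup Y_1\cup Z)]$ in $\Lambda$, and every row of $A'[B-X,C\cup Y_0\cup Y_1]$ in $\Delta$. A matrix $A\in\mathbb{F}^{B\times E}$ conforms to $\Phi$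 if for some such $A'$ and $Z$ we have $A[B,E-Z]=A'[B,E-Z]$ and for each $i\in Z$ there is $j\in Y_1$ such that column $i$ of $A$ is the sum of columns $i$ and $j$ of $A'$. An $\mathbb{F}$-represented matroid conforms to $\Phi$ if it is isomorphic to $M(A)/C\backslash Y_1$ for some $A$ conforming to $\Phi$; $\mathcal{M}(\Phi)$ is the set of these. Hypothesis B: for every finite field $\mathbb{F}$, positive integer $m$, and minor-closed class $\mathcal{M}$ of $\mathbb{F}$-represented matroids, there exist $k,n\in\mathbb{Z}_+$ and frame templates $\Phi_1,\dots,\Phi_s,\Psi_1,\dots,\Psi_t$ over $\mathbb{F}$ such that (1) $\mathcal{M}\supseteq\mathcal{M}(\Phi_i)$ for all $i$; (2) $\mathcal{M}$ contains the duals of all members of each $\mathcal{M}(\Psi_j)$; (3) every simple vertically $k$-connected $M\in\mathcal{M}$ with an $M(K_n)$-minor but no $\mathrm{PG}(m-1,\mathbb{F}_p)$-minor lies in some $\mathcal{M}(\Phi_i)$; (4) for every cosimple cyclically $k$-connected $M\in\mathcal{M}$ with an $M^*(K_n)$-minor but no $\mathrm{PG}(m-1,\mathbb{F}_p)$-minor, $M^*$ lies in some $\mathcal{M}(\Psi_j)$. *)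

(* Defs.v *)
From HB Require Import structures.
From mathcomp Require Import all_boot all_order all_algebra.
From mathcomp Require Import zify.
From mathcomp Require Import reals.

Set Implicit Arguments.
Unset Strict Implicit.
Unset Printing Implicit Defensive.

Import Order.TTheory GRing.Theory Num.Theory.
Local Open Scope ring_scope.

Record matroid := Matroid {
  ground :> finType;
  rk : {set ground} -> nat;
  rk_card : forall X, (rk X <= #|X|)%N;
  rk_mono : forall X Y : {set ground}, X \subset Y -> (rk X <= rk Y)%N;
  rk_submod : forall X Y, (rk (X :|: Y) + rk (X :&: Y) <= rk X + rk Y)%N }.

Definition rank (M : matroid) : nat := @rk M setT.
Definition indep (M : matroid) (X : {set M}) : bool := rk X == #|X|.
Definition spanning (M : matroid) (X : {set M}) : bool := rk X == rank M.

Definition simple (M : matroid) : Prop :=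
  forall X : {set M}, (#|X| <= 2)%N -> indep X.

Section Dual.
Variable M : matroid.

Definition dual_rk (X : {set M}) : nat := (#|X| + rk (~: X) - rank M)%N.

Lemma dual_rk_bound (X : {set M}) : (rank M <= #|X| + rk (~: X))%N.
Proof.
rewrite /rank -(setUCr X); have := rk_submod X (~: X); have := rk_card X; lia.
Qed.

Lemma dual_rk_card X : (dual_rk X <= #|X|)%N.
Proof.
rewrite /dual_rk; have : (rk (~: X) <= rank M)%N by apply/rk_mono/subsetT.
lia.
Qed.

Lemma dual_rk_mono (X Y : {set M}) : X \subset Y -> (dual_rk X <= dual_rk Y)%N.
Proof.
move=> sXY; rewrite /dual_rk.
have eX : ~: X = ~: Y :|: (Y :\: X).
  apply/setP=> e; rewrite !inE; have := subsetP sXY e.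
  by case: (e \in X); case: (e \in Y) => //= /(_ isT).
have := rk_submod (~: Y) (Y :\: X); rewrite -eX.
have := rk_card (Y :\: X); have := cardsD Y X; rewrite (setIidPr sXY).
have := subset_leq_card sXY; lia.
Qed.

Lemma dual_rk_submod X Y :
  (dual_rk (X :|: Y) + dual_rk (X :&: Y) <= dual_rk X + dual_rk Y)%N.
Proof.
rewrite /dual_rk; have := rk_submod (~: X) (~: Y).
rewrite -setCI -setCU.
have := cardsUI X Y; have := dual_rk_bound X; have := dual_rk_bound Y.
have := dual_rk_bound (X :|: Y); have := dual_rk_bound (X :&: Y); lia.
Qed.

Definition dual : matroid :=
  Matroid dual_rk_card dual_rk_mono dual_rk_submod.

End Dual.

Section Delete.
Variables (M : matroid) (D : {set M}).

Let T : finType := {e : M | e \in ~: D}.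

Definition delete_rk (X : {set T}) : nat := @rk M (val @: X).

Lemma delete_rk_card X : (delete_rk X <= #|X|)%N.
Proof. by rewrite -(card_imset (mem X) val_inj); apply: rk_card. Qed.

Lemma delete_rk_mono (X Y : {set T}) :
  X \subset Y -> (delete_rk X <= delete_rk Y)%N.
Proof. by move=> sXY; apply/rk_mono/imsetS. Qed.

Lemma delete_rk_submod X Y :
  (delete_rk (X :|: Y) + delete_rk (X :&: Y) <= delete_rk X + delete_rk Y)%N.
Proof.
rewrite /delete_rk imsetU imsetI; first exact: rk_submod.
by move=> x y _ _; apply: val_inj.
Qed.

Definition delete : matroid :=
  Matroid delete_rk_card delete_rk_mono delete_rk_submod.

End Delete.

Definition contract (M : matroid) (C : {set M}) : matroid :=
  dual (@delete (dual M) C).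

Definition misom (M N : matroid) : Prop :=
  exists2 f : M -> N, bijective f & forall X : {set M}, rk X = rk (f @: X).

(* [P] stands for an isomorphism type of matroids. *)
Definition has_minor (M : matroid) (P : matroid -> Prop) : Prop :=
  exists (C : {set M}) (D : {set contract C}), P (delete D).

Definition vertically_connected (k : nat) (M : matroid) : Prop :=
  forall X : {set M}, (rk X + rk (~: X) - rank M < k)%N ->
    spanning X \/ spanning (~: X).

Definition cosimple (M : matroid) : Prop := simple (dual M).

Definition cyclically_connected (k : nat) (M : matroid) : Prop :=
  vertically_connected k (dual M).

Section ColumnMatroid.
Variables (F : fieldType) (B E : finType) (A : B -> E -> F).

Definition mxcol (e : E) : {ffun B -> F^o} := [ffun b => A b e].
Definition mxrow (b : B) : {ffun E -> F^o} := [ffun e => A b e].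

Definition col_rk (X : {set E}) : nat := \dim <<[seq mxcol e | e in X]>>%VS.

Lemma col_rk_card X : (col_rk X <= #|X|)%N.
Proof. by apply: leq_trans (dim_span _) _; rewrite size_image. Qed.

Lemma sub_col_span (X Y : {set E}) : X \subset Y ->
  (<<[seq mxcol e | e in X]>> <= <<[seq mxcol e | e in Y]>>)%VS.
Proof.
move=> /subsetP sXY; apply: sub_span => _ /imageP[e eX ->].
by apply: image_f; apply: sXY.
Qed.

Lemma col_rk_mono (X Y : {set E}) : X \subset Y -> (col_rk X <= col_rk Y)%N.
Proof. by move=> sXY; apply/dimvS/sub_col_span. Qed.

Lemma col_rk_submod X Y :
  (col_rk (X :|: Y) + col_rk (X :&: Y) <= col_rk X + col_rk Y)%N.
Proof.
rewrite /col_rk -[leqRHS]dimv_sum_cap leq_add //; apply: dimvS.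
  apply/span_subvP => _ /imageP[e eXY ->]; move: eXY; rewrite inE.
  by case/orP=> eXY; [apply: (subvP (addvSl _ _)) | apply: (subvP (addvSr _ _))];
    apply/memv_span/image_f.
by rewrite subv_cap !sub_col_span ?subsetIl ?subsetIr.
Qed.

Definition column_matroid : matroid :=
  Matroid col_rk_card col_rk_mono col_rk_submod.

End ColumnMatroid.

Definition represents (F : fieldType) (M : matroid) (B : finType)
    (A : B -> M -> F) : Prop :=
  forall X : {set M}, rk X = @rk (column_matroid A) X.

Definition representable (F : fieldType) (M : matroid) : Prop :=
  exists (B : finType) (A : B -> M -> F), represents A.

Definition tau (R : realType) : R := (1 + Num.sqrt 5%:R) / 2%:R.

Definition golden_mean (R : realType) (M : matroid) : Prop :=
  exists (B : finType) (A : B -> M -> R), represents A /\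
    forall (k : nat) (f : 'I_k -> B) (g : 'I_k -> M),
      injective f -> injective g ->
      let d := \det (\matrix_(i < k, j < k) A (f i) (g j)) in
      d != 0 -> exists i : int, d = tau R ^ i \/ d = - tau R ^ i.

Definition GF4_representable (M : matroid) : Prop :=
  exists F : finFieldType, #|F| = 4%N /\ representable F M.

Definition at_least (q : nat) (T : Type) : Prop :=
  exists f : 'I_q -> T, injective f.

Definition prime_power (q : nat) : Prop :=
  exists p k : nat, [/\ prime p, (0 < k)%N & q = (p ^ k)%N].

Definition AC4 (M : matroid) : Prop :=
  [/\ GF4_representable M,
      forall p : nat, prime p ->
        exists F : fieldType, p \in [pchar F] /\ representable F M
    & exists F : fieldType, [pchar F] =i pred0 /\ representable F M].

Definition AF4 (M : matroid) : Prop :=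
  forall F : fieldType, at_least 4 F -> representable F M.

Definition SL4 (M : matroid) : Prop :=
  GF4_representable M /\
  exists2 q : nat, prime_power q &
    forall F : fieldType, at_least q F -> representable F M.

(* [extremal P r h] says that the maximum defining h_P(r) exists and is [h]. *)
Definition extremal (P : matroid -> Prop) (r h : nat) : Prop :=
  (exists M : matroid, [/\ P M, simple M, (rank M <= r)%N & #|M| = h]) /\
  (forall M : matroid, P M -> simple M -> (rank M <= r)%N -> (#|M| <= h)%N).

Record rmatroid (F : fieldType) := RMatroid {
  rground :> finType;
  rspace : {vspace {ffun rground -> F^o}} }.

Section Represented.
Variable F : fieldType.
Implicit Types M N : rmatroid F.

Definition of_matrix (B E : finType) (A : B -> E -> F) : rmatroid F :=
  RMatroid <<[seq mxrow A b | b : B]>>%VS.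

(* The rows of this matrix are a basis of the subspace. *)
Definition rep_matrix M (i : 'I_(\dim (rspace M))) (e : M) : F :=
  (vbasis (rspace M))`_i e.

Definition underlying M : matroid := column_matroid (@rep_matrix M).

Definition dotf (E : finType) (u w : {ffun E -> F^o}) : F^o :=
  \sum_e u e * w e.

Definition orthv (E : finType) (U : {vspace {ffun E -> F^o}}) :
    {vspace {ffun E -> F^o}} :=
  (\bigcap_(i < \dim U) lker (linfun (dotf (vbasis U)`_i)))%VS.

Definition resf (E : finType) (X : {set E}) (u : {ffun E -> F^o}) :
    {ffun {e : E | e \in X} -> F^o} :=
  [ffun e => u (val e)].

Fact dotf_linear (E : finType) (u : {ffun E -> F^o}) : linear (dotf u).
Proof.
move=> a v w; rewrite /dotf scaler_sumr -big_split; apply: eq_bigr => e _ /=.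
by rewrite !ffunE mulrDr; congr (_ + _); rewrite /GRing.scale /= mulrCA.
Qed.

HB.instance Definition _ (E : finType) (u : {ffun E -> F^o}) :=
  GRing.isLinear.Build F {ffun E -> F^o} F^o _ (dotf u) (dotf_linear u).

Fact resf_linear (E : finType) (X : {set E}) : linear (@resf E X).
Proof. by move=> a v w; apply/ffunP=> e; rewrite !ffunE. Qed.

HB.instance Definition _ (E : finType) (X : {set E}) :=
  GRing.isLinear.Build F {ffun E -> F^o} {ffun {e : E | e \in X} -> F^o} _
    (@resf E X) (@resf_linear E X).

Lemma orthvP (E : finType) (U : {vspace {ffun E -> F^o}}) w :
  reflect (forall u, u \in U -> dotf u w = 0) (w \in orthv U).
Proof.
have lE u v : linfun (dotf u) v = dotf u v by rewrite lfunE.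
rewrite memvE; apply: (iffP subv_bigcapP) => [wU u uU | wU i _].
  rewrite (coord_vbasis uU) /dotf.
  under eq_bigr do rewrite sum_ffunE mulr_suml.
  rewrite exchange_big big1 // => i _.
  have := wU i isT; rewrite -memvE memv_ker lE => /eqP wi.
  under eq_bigr do rewrite ffunE -scalerAl.
  by rewrite -scaler_sumr [X in _ *: X]wi scaler0.
rewrite -memvE memv_ker lE; apply/eqP/wU.
by apply/vbasis_mem/mem_nth; rewrite size_tuple.
Qed.

Definition rrestrict M (X : {set M}) : rmatroid F :=
  @RMatroid F {e : M | e \in X} (linfun (@resf M X) @: rspace M)%VS.

Lemma mem_rrestrict M (X : {set M}) (w : {ffun {e : M | e \in X} -> F^o}) :
  w \in rspace (rrestrict X) <-> exists2 u, u \in rspace M & w = resf X u.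
Proof.
have lE v : linfun (@resf M X) v = resf X v by rewrite lfunE.
by split=> [/memv_imgP[u uU ->] | [u uU ->]];
  [exists u | rewrite -lE memv_img].
Qed.

Definition rdelete M (X : {set M}) : rmatroid F := rrestrict (~: X).

Definition rdual M : rmatroid F := RMatroid (orthv (rspace M)).

Definition rcontract M (X : {set M}) : rmatroid F :=
  rdual (@rdelete (rdual M) X).

(* Equality of represented matroids is taken up to column scaling, so an
   isomorphism is a relabelling combined with a scaling of the coordinates. *)
Definition risom M N : Prop :=
  exists (f : M -> N) (c : M -> F),
    [/\ bijective f, forall e, c e != 0
      & forall u : {ffun N -> F^o},
          (u \in rspace N) = ([ffun e => c e * u (f e)] \in rspace M)].

Definition minor_closed (P : rmatroid F -> Prop) : Prop :=
  [/\ forall M N, risom M N -> P M -> P N,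
      forall M (X : {set M}), P M -> P (rdelete X)
    & forall M (X : {set M}), P M -> P (rcontract X)].

End Represented.

(* Taking the index sets as types makes them disjoint. *)
Record frame_template (F : fieldType) := FrameTemplate {
  ft_Gamma : {pred F};
  ft_C : finType;
  ft_X : finType;
  ft_Y0 : finType;
  ft_Y1 : finType;
  ft_A1 : ft_X -> ft_C + (ft_Y0 + ft_Y1) -> F;
  ft_Delta : {pred {ffun ft_C + (ft_Y0 + ft_Y1) -> F^o}};
  ft_Lambda : {pred {ffun ft_X -> F^o}};
  ft_Gamma0 : 0 \notin ft_Gamma;
  ft_Gamma_group : divr_closed ft_Gamma;
  ft_Delta_group : zmod_closed ft_Delta;
  ft_Delta_scale : forall g u, g \in ft_Gamma -> u \in ft_Delta ->
    g *: u \in ft_Delta;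
  ft_Lambda_group : zmod_closed ft_Lambda;
  ft_Lambda_scale : forall g u, g \in ft_Gamma -> u \in ft_Lambda ->
    g *: u \in ft_Lambda }.

Arguments ft_A1 {F} _ _ _.
Arguments ft_Delta {F} _ _.
Arguments ft_Lambda {F} _ _.

Definition frame_column (F : fieldType) (Gamma : {pred F}) (B : finType)
    (v : B -> F) : Prop :=
  (#|[set b | v b != 0%R]| <= 2)%N /\
  ((exists b, v b != 0) ->
   exists b, v b = 1 /\
     forall b', b' != b -> v b' != 0 -> exists2 g, g \in Gamma & v b' = - g).

Section Conforming.
Variables (F : fieldType) (Phi : frame_template F).

Let X := ft_X Phi.
Let W : finType := (ft_C Phi + (ft_Y0 Phi + ft_Y1 Phi))%type.

(* A row index set containing X is written X + B and a column index set
   containing C, Y0 and Y1 is written (C + (Y0 + Y1)) + E, so that B and E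
   are the complements. *)
Definition respects (B E : finType) (A : X + B -> W + E -> F) (Z : {set E}) :
    Prop :=
  (forall x w, A (inl x) (inl w) = ft_A1 Phi x w) /\
  (forall e, e \in Z ->
     (forall x, A (inl x) (inr e) = 0) /\
     (exists b0, forall b, A (inr b) (inr e) = (b == b0)%:R)) /\
  (forall e, e \notin Z ->
     frame_column (ft_Gamma Phi) (fun b => A (inr b) (inr e)) /\
     [ffun x => A (inl x) (inr e)] \in ft_Lambda Phi) /\
  (forall b, [ffun w => A (inr b) (inl w)] \in ft_Delta Phi).

Definition conforms (B E : finType) (A : X + B -> W + E -> F) : Prop :=
  exists (A' : X + B -> W + E -> F) (Z : {set E}),
    [/\ respects A' Z,
        forall b w, A b (inl w) = A' b (inl w),
        forall b e, e \notin Z -> A b (inr e) = A' b (inr e)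
      & forall e, e \in Z -> exists y : ft_Y1 Phi, forall b,
          A b (inr e) = A' b (inr e) + A' b (inl (inr (inr y)))].

Definition ftC_set (E : finType) : {set W + E} :=
  [set inl (inl c) | c : ft_C Phi].
Definition ftY1_set (E : finType) : {set W + E} :=
  [set inl (inr (inr y)) | y : ft_Y1 Phi].

Definition template_class (M : rmatroid F) : Prop :=
  exists (B E : finType) (A : X + B -> W + E -> F), conforms A /\
    let N := @rcontract F (of_matrix A) (ftC_set E) in
    risom M (@rdelete F N [set e : N | val e \in ftY1_set E]).

End Conforming.

Definition forest (n : nat) (S : {set {set 'I_n}}) : Prop :=
  forall c : seq 'I_n, (2 < size c)%N -> uniq c ->
    ~~ cycle [rel i j | [set i; j] \in S] c.

Definition is_MK (n : nat) (M : matroid) : Prop :=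
  exists f : M -> {set 'I_n},
    [/\ injective f, f @: setT = [set e : {set 'I_n} | #|e| == 2%N]
      & forall X : {set M}, indep X <-> forest (f @: X)].

(* The points of the projective geometry are the nonzero vectors whose first
   nonzero coordinate is 1. *)
Definition normalized (F : finFieldType) (m : nat) (v : 'rV[F]_m) : bool :=
  [exists i, (v 0 i == 1) && [forall j : 'I_m, (j < i)%N ==> (v 0 j == 0)]].

(* The parameter m is the rank, so this is PG(m-1, F). *)
Definition PG (m : nat) (F : finFieldType) : matroid :=
  column_matroid
    (fun (i : 'I_m) (v : {v : 'rV[F]_m | normalized v}) => val v 0 i).

Definition hypothesis_B : Prop :=
  forall (F : finFieldType) (p m : nat) (P : rmatroid F -> Prop),
    p \in [pchar F] -> (0 < m)%N -> minor_closed P ->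
  exists k n s t : nat, [/\ (0 < k)%N, (0 < n)%N &
  exists (Phi : 'I_s -> frame_template F) (Psi : 'I_t -> frame_template F),
  [/\ forall i M, template_class (Phi i) M -> P M,
      forall j M, template_class (Psi j) M -> P (rdual M),
      forall M, P M ->
        simple (underlying M) -> vertically_connected k (underlying M) ->
        has_minor (underlying M) (is_MK n) ->
        ~ has_minor (underlying M) (misom (PG m 'F_p)) ->
        exists i, template_class (Phi i) M
    & forall M, P M ->
        cosimple (underlying M) -> cyclically_connected k (underlying M) ->
        has_minor (underlying M) (fun N => is_MK n (dual N)) ->
        ~ has_minor (underlying M) (misom (PG m 'F_p)) ->
        exists j, template_class (Psi j) (rdual M)]].

(* Main.v *)
(* Every matroid in the four classes is representable over GF(4) and over a field
   of characteristic 3, so it suffices to bound the matroids M with both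
   properties.  Represented over both fields, the same matroid gives two vector
   configurations with the same rank function ("twins"); small configurations
   such as the Fano plane, the parallelogram or the rank-3 Dowling geometry of
   the cubic roots of unity have no twin in characteristic 3.

   A simple M of large rank r with at least r^2/2 elements has an M(K_n)-minor: if
   no contraction stays dense, then many elements lie on linearly many long lines,
   and these lines contract onto a clique.  Hence, after an induction over
   separations of small order, M belongs by Hypothesis B to one of finitely many
   frame templates.  The absence of a Fano minor and of a Dowling minor forces
   Gamma = 1, Lambda to vanish modulo C and Delta to lie in the row space of A_1,
   so that the elements of M become vectors e_b + e_b', e_b + s_i and t_z, where
   the s_i and t_z range over fixed finite families.  The differences s_i - s_j
   together with the t_z have a twin in characteristic 3, which bounds the affine
   nullity of the s_i by 2 and, in case of equality, the number of directions of
   the s_i - s_j by C(n, 2) - 5; counting then gives the upper bound.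

   The bound is attained by the vectors x, e_i - e_j and e_i + c x, where c ranges
   over the four values 0, 1, tau, tau^2 (or over any four scalars). *)

From HB Require Import structures.
From mathcomp Require Import all_boot all_order all_algebra all_field.
From mathcomp Require Import zify ring.
From mathcomp Require Import reals.
From mathcomp Require boolp.
Require Import Defs.

Set Implicit Arguments.
Unset Strict Implicit.
Unset Printing Implicit Defensive.

Import Order.TTheory GRing.Theory Num.Theory.
Local Open Scope ring_scope.

(** * Vector configurations and twins *)

(** The bound is Vandermonde's identity in disguise. If the spokes [e_b + s_i] at each of n vertices
    lie in a coset of a space of dimension d, the rank is n + d, and C(n+d+3, 2) - 5 is the sum of
    C(n, 2) edges, n(d+3) spokes and C(d+3, 2) - 5 tips. The 3 comes from affine nullity at most 2
    (at most d + 1 + 2 points), the 5 from parallel differences when the nullity is 2. Since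
    2(C(r+3, 2) - 5) = r^2 + 5r - 4, bounds on a number m of elements are written 2m + 4 <= r^2 +
    5r, without division or truncated subtraction.

    Two representations of one matroid share no coordinates; only the ranks of subfamilies can be
    compared. Each obstruction therefore starts from a basis, expresses the other points of the twin
    by unknown coefficients, and derives a scalar equation that fails in characteristic 3.
    Contraction respects twins, so an obstruction may be sought after any contraction. This is how
    the differences [s_i - s_j] arise: contracting one spoke at each vertex leaves them.

    Hypothesis B is applied with m = 3: the excluded PG(2, F_2) is the Fano plane, which no member
    of the class has as a minor. *)

Lemma span_image (F : fieldType) (V : vectType F) (T : finType) (v : T -> V)
    (X : {set T}) : <<[seq v x | x in X]>>%VS = <<map v (enum X)>>%VS.
Proof. by []. Qed.

Lemma eq_span_map (F : fieldType) (V : vectType F) (T : eqType) (v : T -> V)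
    (l1 l2 : seq T) : l1 =i l2 -> <<map v l1>>%VS = <<map v l2>>%VS.
Proof. by move=> e; apply/eq_span/eq_mem_map. Qed.

(** Contraction is modelled throughout by a linear map whose kernel is the span of the contracted
    vectors. An endomorphism keeps the configuration inside one space and avoids quotients. *)
Lemma exists_ker (F : fieldType) (V : vectType F) (K : {vspace V}) :
  exists p : 'End(V), lker p = K.
Proof.
exists (\1 - projv K)%VF; apply/vspaceP => u.
rewrite memv_ker add_lfunE opp_lfunE id_lfunE subr_eq0.
by apply/eqP/idP => [->|/projv_id //]; apply: memv_proj.
Qed.

Lemma dim_limg_addker (F : fieldType) (V W : vectType F) (p : 'Hom(V, W))
    (U : {vspace V}) :
  (\dim (p @: U) + \dim (lker p) = \dim (U + lker p))%N.
Proof.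
have -> : (p @: U = p @: (U + lker p))%VS.
  by rewrite limgD; have /eqP -> : (p @: lker p == 0)%VS;
     rewrite ?addv0 // -lkerE subvv.
by rewrite -(limg_ker_dim p (U + lker p)) (capv_idPr (addvSr _ _)) addnC.
Qed.

Lemma dim_map_ker (F : fieldType) (V W : vectType F) (T : Type) (v : T -> V)
    (p : 'Hom(V, W)) (l : seq T) :
  (\dim <<map (fun x => p (v x)) l>> + \dim (lker p) =
   \dim (<<map v l>> + lker p))%N.
Proof. by rewrite -dim_limg_addker limg_span -map_comp. Qed.

Lemma dim_map_inj (F : fieldType) (V W : vectType F) (T : Type) (v : T -> V)
    (p : 'Hom(V, W)) (l : seq T) : injective p ->
  \dim <<map (fun x => p (v x)) l>> = \dim <<map v l>>.
Proof.
move=> /lker0P/eqP k0.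
by have := dim_map_ker v p l; rewrite k0 addv0 dimv0 addn0.
Qed.

(* [twin v v'] : [v] and [v'] represent the same matroid. *)
Definition twin (F F' : fieldType) (V : vectType F) (V' : vectType F')
    (T : Type) (v : T -> V) (v' : T -> V') : Prop :=
  forall l, \dim <<map v l>> = \dim <<map v' l>>.

Section Twin.
Variables (F F' : fieldType) (V : vectType F) (V' : vectType F').
Implicit Type T : Type.

Lemma twin_comp T S (h : S -> T) (v : T -> V) (v' : T -> V') :
  twin v v' -> twin (fun x => v (h x)) (fun x => v' (h x)).
Proof. by move=> tw l; have := tw (map h l); rewrite -!map_comp. Qed.

Lemma eq_twin T (v w : T -> V) (v' w' : T -> V') :
  v =1 w -> v' =1 w' -> twin v v' -> twin w w'.
Proof. by move=> e e' tw l; rewrite -(eq_map e) -(eq_map e'). Qed.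

Lemma span_scale T (v : T -> V) (c : T -> F) (l : seq T) :
  (forall x, c x != 0) -> <<map (fun x => c x *: v x) l>>%VS = <<map v l>>%VS.
Proof.
move=> c0; elim: l => //= x l IH; rewrite !span_cons IH; congr (_ + _)%VS.
apply/vspaceP => u; apply/vlineP/vlineP => -[k ->].
  by exists (k * c x); rewrite scalerA.
by exists (k / c x); rewrite scalerA divfK.
Qed.

Lemma twin_free T (v : T -> V) (v' : T -> V') l :
  twin v v' -> free (map v l) = free (map v' l).
Proof. by move=> tw; rewrite /free tw !size_map. Qed.

Lemma mem_span_dim (u : V) (X : seq V) :
  (u \in <<X>>%VS) = (\dim <<u :: X>> == \dim <<X>>).
Proof.
rewrite span_cons; have s : (<<X>> <= <[u]> + <<X>>)%VS by rewrite addvSr.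
by rewrite eq_sym (dimv_leqif_sup s) subv_add subvv andbT memvE.
Qed.
End Twin.

Section Twin2.
Variables (F F' : fieldType) (V : vectType F) (V' : vectType F').

Lemma twin_scale (T : Type) (v : T -> V) (v' : T -> V') (c : T -> F)
    (c' : T -> F') : (forall x, c x != 0) -> (forall x, c' x != 0) ->
  twin v v' -> twin (fun x => c x *: v x) (fun x => c' x *: v' x).
Proof. by move=> c0 c0' tw l; rewrite !span_scale. Qed.

Lemma twin_mem (T : Type) (v : T -> V) (v' : T -> V') x l :
  twin v v' -> (v x \in <<map v l>>%VS) = (v' x \in <<map v' l>>%VS).
Proof. by move=> tw; rewrite !mem_span_dim -!map_cons !tw. Qed.

(** After contraction the rank of [l] is the rank of [l ++ Z] minus the rank of [Z], and both
    numbers are shared by twins. *)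
Lemma twin_contract (T : Type) (v : T -> V) (v' : T -> V') (Z : seq T)
    (p : 'End(V)) (p' : 'End(V')) :
  twin v v' -> lker p = <<map v Z>>%VS -> lker p' = <<map v' Z>>%VS ->
  twin (fun x => p (v x)) (fun x => p' (v' x)).
Proof.
move=> tw k k' l; have := dim_map_ker v p l; have := dim_map_ker v' p' l.
rewrite k k' -!span_cat -!map_cat; move=> e1 e2; have e3 := tw (l ++ Z); have e4 := tw Z.
by apply/eqP; rewrite -(eqn_add2r (\dim <<map v Z>>)) e2 e4 e1 e3.
Qed.

Lemma twin_contract_ex (T : Type) (v : T -> V) (v' : T -> V') (Z : seq T) :
  twin v v' -> exists (p : 'End(V)) (p' : 'End(V')),
  [/\ lker p = <<map v Z>>%VS, lker p' = <<map v' Z>>%VS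
    & twin (fun x => p (v x)) (fun x => p' (v' x))].
Proof.
move=> tw; have [p kp] := exists_ker <<map v Z>>; exists p.
have [p' kp'] := exists_ker <<map v' Z>>; exists p'.
by split=> //; apply: twin_contract tw kp kp'.
Qed.
End Twin2.

Lemma span2P (F : fieldType) (V : vectType F) (a b u : V) :
  reflect (exists x y, u = x *: a + y *: b) (u \in <<[:: a; b]>>%VS).
Proof.
rewrite span_cons span_seq1; apply: (iffP memv_addP).
  by move=> [_ /vlineP[x ->] [_ /vlineP[y ->] ->]]; exists x, y.
move=> [x [y ->]]; exists (x *: a); first by rewrite memvZ ?memv_line.
by exists (y *: b); rewrite ?memvZ ?memv_line.
Qed.

Lemma free2P (F : fieldType) (V : vectType F) (a b : V) :
  reflect (forall x y, x *: a + y *: b = 0 -> x = 0 /\ y = 0) (free [:: a; b]).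
Proof.
rewrite free_cons seq1_free span_seq1; apply: (iffP andP).
  move=> [nab b0] x y e; have x0 : x = 0.
    apply/eqP; apply: contraNT nab => x0; apply/vlineP; exists (- y / x).
    apply: (scalerI x0); rewrite scalerA mulrCA mulfV // mulr1 scaleNr.
    by apply/eqP; rewrite -addr_eq0 e.
  split=> //; move: e; rewrite x0 scale0r add0r => /eqP.
  by rewrite scaler_eq0 (negbTE b0) orbF => /eqP.
move=> H; split; last first.
  apply/eqP => b0; have [|_ /eqP] := H 0 1; rewrite ?oner_eq0 //.
  by rewrite b0 scaler0 scale0r addr0.
apply/negP => /vlineP[k e]; have [] := H 1 (- k).
  by rewrite e scale1r scaleNr subrr.
by move/eqP; rewrite oner_eq0.
Qed.

Lemma free3P (F : fieldType) (V : vectType F) (a b c : V) :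
  reflect (forall x y z, x *: a + y *: b + z *: c = 0 ->
             [/\ x = 0, y = 0 & z = 0]) (free [:: a; b; c]).
Proof.
rewrite free_cons; apply: (iffP andP).
  move=> [nab /free2P f] x y z e; have x0 : x = 0.
    apply/eqP; apply: contraNT nab => x0; apply/span2P.
    exists (- y / x), (- z / x).
    apply: (scalerI x0); rewrite scalerDr !scalerA !(mulrCA x) mulfV // !mulr1.
    by apply/eqP; rewrite !scaleNr -opprD -addr_eq0 addrA e.
  by move: e; rewrite x0 scale0r add0r => /f[-> ->].
move=> H; split; last by apply/free2P => y z e; have [] := H 0 y z;
  rewrite ?scale0r ?add0r.
apply/negP => /span2P[y [z e]]; have [] := H 1 (- y) (- z).
  by rewrite e scale1r !scaleNr -addrA -opprD subrr.
by move/eqP; rewrite oner_eq0.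
Qed.

(** * Representations and minors *)

(** Vectors of an arbitrary space replace the matrix of [representable], so that linear maps can be
    applied to a representation. *)
Definition vrep (F : fieldType) (V : vectType F) (M : matroid) (v : M -> V) :=
  forall X : {set M}, rk X = \dim <<[seq v x | x in X]>>.

Lemma vrep_representable (F : fieldType) (V : vectType F) (M : matroid)
    (v : M -> V) : vrep v -> representable F M.
Proof.
move=> rv; pose d := dim V.
pose A (i : 'I_(\dim {:V})) (e : M) : F := coord (vbasis fullv) i (v e).
exists _, A => X; rewrite rv /= /col_rk.
pose g (u : V) : {ffun 'I_(\dim {:V}) -> F^o} :=
  [ffun i => coord (vbasis fullv) i u].
have lg : linear g by move=> a x y; apply/ffunP => i; rewrite !ffunE linearP.
pose gl : {linear V -> {ffun 'I_(\dim {:V}) -> F^o}} :=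
  HB.pack g (GRing.isLinear.Build _ _ _ _ g lg).
have gi : injective (linfun gl).
  move=> x y; rewrite !lfunE => /ffunP e.
  rewrite (coord_vbasis (memvf x)) (coord_vbasis (memvf y)).
  by apply: eq_bigr => i _; have := e i; rewrite !ffunE => ->.
rewrite !span_image -(dim_map_inj _ _ gi); congr (\dim <<_>>).
by apply: eq_map => e; rewrite lfunE; apply/ffunP => i; rewrite !ffunE.
Qed.

Lemma representableP (F : fieldType) (M : matroid) :
  representable F M <-> exists (V : vectType F) (v : M -> V), vrep v.
Proof.
split=> [[B [A rA]]|[V [v rv]]]; last exact: vrep_representable rv.
by exists _, (mxcol A) => X; rewrite rA.
Qed.

Lemma vrep_seq (F : fieldType) (V : vectType F) (M : matroid) (v : M -> V)
    (l : seq M) : vrep v -> \dim <<map v l>> = rk [set x in l].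
Proof.
move=> ->; rewrite span_image; congr (\dim _); apply: eq_span_map => x.
by rewrite mem_enum inE.
Qed.

Lemma vrep_twin (F F' : fieldType) (V : vectType F) (V' : vectType F')
    (M : matroid) (v : M -> V) (v' : M -> V') : vrep v -> vrep v' -> twin v v'.
Proof. by move=> r r' l; rewrite !vrep_seq. Qed.

Lemma twin_vrep (F F' : fieldType) (V : vectType F) (V' : vectType F')
    (M : matroid) (v : M -> V) (v' : M -> V') : vrep v -> twin v v' -> vrep v'.
Proof. by move=> r tw X; rewrite r; apply: tw. Qed.

Lemma val_image_setC (T : finType) (P : pred T) (X : {set {x : T | P x}}) :
  val @: (~: X) = [set x | P x] :\: (val @: X).
Proof.
apply/setP => x; rewrite !inE; apply/imsetP/andP => [[y] | [nx Px]].
  by rewrite inE => nX ->; rewrite (mem_imset _ _ val_inj) (valP y).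
exists (Sub x Px); last by rewrite SubK.
by rewrite inE; apply: contra nx => h; apply/imsetP; exists (Sub x Px).
Qed.

(** Contraction is defined through two dualities, each with a truncated subtraction; the additive
    form recovers the usual rank formula without any. *)
Lemma rk_contract (M : matroid) (C : {set M}) (X : {set contract C}) :
  (rk X + rk C = @rk M (val @: X :|: C))%N.
Proof.
pose Y : {set M} := val @: X.
have YC : Y \subset ~: C by apply/subsetP => _ /imsetP[y _ ->]; apply: (valP y).
have ET : val @: [set: {e : M | e \in ~: C}] = ~: C.
  have := val_image_setC (set0 : {set {e : M | e \in ~: C}}).
  rewrite setC0 => ->; apply/setP => x; rewrite !inE.
  by apply: andb_idl => _; apply/imsetP => -[y]; rewrite inE.
have EX : val @: (~: X) = ~: C :\: Y.
  by rewrite val_image_setC; congr (_ :\: _); apply/setP => x; rewrite !inE.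
rewrite /= /dual_rk /rank /= /delete_rk /= /dual_rk EX ET setCD setCK -/Y.
have cX : #|X| = #|Y| by rewrite card_imset //; apply: val_inj.
have cD : (#|~: C :\: Y| + #|Y| = #|~: C|)%N.
  by rewrite cardsD (setIidPr YC) subnK // subset_leq_card.
rewrite cX -/(rank M) (setUC Y).
have := dual_rk_bound (~: C :\: Y); rewrite setCD setCK.
have := dual_rk_bound (~: C); rewrite setCK.
have := rk_mono (subsetUl C Y).
have := @rk_mono M _ _ (subsetT (C :|: Y)); rewrite -/(rank M).
lia.
Qed.

Lemma vrep_delete (F : fieldType) (V : vectType F) (M : matroid) (v : M -> V)
    (D : {set M}) : vrep v -> @vrep F V (delete D) (fun x => v (val x)).
Proof.
move=> rv X; rewrite /= /delete_rk rv !span_image.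
rewrite (map_comp v val (enum X)); congr (\dim _); apply: eq_span_map => x.
by rewrite mem_enum; apply/imsetP/mapP => [[y yX ->]|[y yX ->]]; exists y;
   rewrite ?mem_enum // -mem_enum.
Qed.

Lemma vrep_contract (F : fieldType) (V : vectType F) (M : matroid) (v : M -> V)
    (C : {set M}) (p : 'End(V)) :
  vrep v -> lker p = <<[seq v x | x in C]>>%VS ->
  @vrep F V (contract C) (fun x => p (v (val x))).
Proof.
move=> rv kp X; apply/eqP; rewrite -(eqn_add2r (rk C)) rk_contract !rv -kp.
rewrite [X in _ == X](dim_map_ker (fun x => v (val x))) kp.
rewrite (map_comp v val) !span_image -span_cat -map_cat; apply/eqP.
congr (\dim _); apply: eq_span_map => x.
rewrite mem_cat !mem_enum inE; congr (_ || _).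
by apply/imsetP/mapP => [[y yX ->]|[y yX ->]]; exists y;
   rewrite ?mem_enum // -mem_enum.
Qed.

Lemma representable_minor (F : fieldType) (M : matroid) (P : matroid -> Prop) :
  representable F M -> has_minor M P -> exists N, P N /\ representable F N.
Proof.
move=> /representableP[V [v rv]] [C [D PD]]; exists (delete D); split=> //.
have [p kp] := exists_ker <<[seq v x | x in C]>>.
have rc := vrep_contract rv kp.
exact: vrep_representable (@vrep_delete _ _ _ _ D rc).
Qed.

Lemma representable_misom (F : fieldType) (M N : matroid) :
  misom M N -> representable F M -> representable F N.
Proof.
move=> [f [g fK gK] fr] /representableP[V [v rv]]; apply/representableP.
exists V, (fun x => v (g x)) => X.
have -> : X = f @: (g @: X).
  by rewrite -imset_comp; under eq_imset => x do rewrite /= gK; rewrite imset_id.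
rewrite -fr rv !span_image (map_comp v g); congr (\dim _).
apply: eq_span_map => x; rewrite mem_enum.
apply/imsetP/mapP => [[y yX ->]|[y yX ->]].
  by exists y; rewrite // mem_enum -imset_comp; apply/imsetP; exists y; rewrite //= gK.
move: yX; rewrite mem_enum -imset_comp => /imsetP[z zX ->].
by exists z => //=; rewrite fK.
Qed.

(** * The Fano plane outside characteristic 2 *)

Section Fano.
Variables (F F' : fieldType) (V : vectType F) (V' : vectType F') (T : Type).
Variables (v : T -> V) (v' : T -> V').

(** A vanishing coefficient in the twin would put [c] in the span of [a] or of [b] alone, hence also
    in [v]. *)
Lemma twin_line a b c (x y : F) : twin v v' -> free [:: v a; v b] ->
    x != 0 -> y != 0 -> v c = x *: v a + y *: v b ->
  exists x' y', [/\ x' != 0, y' != 0 & v' c = x' *: v' a + y' *: v' b].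
Proof.
move=> tw fab x0 y0 ec.
have /span2P[x' [y' ec']] : v' c \in <<[:: v' a; v' b]>>%VS.
  by rewrite -(twin_mem c [:: a; b] tw); apply/span2P; exists x, y.
exists x', y'; split=> //.
  apply: contraTneq fab => x'0; have : v' c \in <<map v' [:: b]>>%VS.
    by rewrite ec' x'0 scale0r add0r span_seq1 memvZ ?memv_line.
  have yb : y *: v b \in <[v b]>%VS by rewrite memvZ ?memv_line.
  rewrite -(twin_mem c [:: b] tw) ec span_seq1 rpredDr //.
  move=> h; rewrite free_cons span_seq1 negb_and negbK.
  by rewrite -{1}(scalerK x0 (v a)) memvZ.
apply: contraTneq fab => y'0; have : v' c \in <<map v' [:: a]>>%VS.
  by rewrite ec' y'0 scale0r addr0 span_seq1 memvZ ?memv_line.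
have xa : x *: v a \in <[v a]>%VS by rewrite memvZ ?memv_line.
rewrite -(twin_mem c [:: a] tw) ec span_seq1 rpredDl //.
rewrite (perm_free (permEl (perm_catC [:: v a] [:: v b]))) /=.
move=> h; rewrite free_cons span_seq1 negb_and negbK.
by rewrite -{1}(scalerK y0 (v b)) memvZ.
Qed.

(** The position of [abc] on three lines fixes the coefficients of the twin relative to the basis
    [v' a], [v' b], [v' c]. The points [ab], [bc], [ac] are then collinear only if 2 = 0. *)
Lemma fano_absurd (a b c ab bc ac abc : T) :
  twin v v' -> 2 \notin [pchar F'] -> 2 \in [pchar F] ->
  free [:: v a; v b; v c] ->
  v ab = v a + v b -> v bc = v b + v c -> v ac = v a + v c ->
  v abc = v a + v b + v c -> False.
Proof.
move=> tw n2 c2 f eab ebc eac eabc.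
have add0 (u : V) : u + u = 0.
  by rewrite -mulr2n -scaler_nat (pcharf0 c2) scale0r.
have f' : free [:: v' a; v' b; v' c].
  by rewrite -[[:: _; _; _]]/(map v' [:: a; b; c]) -(twin_free _ tw).
have fs (x y z : F) : x *: v a + y *: v b + z *: v c = 0 ->
    [/\ x = 0, y = 0 & z = 0] by apply/free3P.
have fr x y z x' y' z' : x *: v' a + y *: v' b + z *: v' c =
    x' *: v' a + y' *: v' b + z' *: v' c -> [/\ x = x', y = y' & z = z'].
  move/free3P: f' => f' e; have [|/eqP h1 /eqP h2 /eqP h3] :=
    f' (x - x') (y - y') (z - z').
    rewrite !scalerBl; apply/eqP.
    by rewrite (AC (2*2*2) ((1*3*5)*(2*4*6)))/= -!opprD subr_eq0 e.
  by rewrite !subr_eq0 in h1 h2 h3; split; apply/eqP.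
have o0 : 1 != 0 :> F by rewrite oner_eq0.
have f2 : (free [:: v a; v b]) * (free [:: v b; v c]) * (free [:: v a; v c])
  * (free [:: v ab; v c]) * (free [:: v bc; v a]) * (free [:: v ac; v b]).
  do ?split; apply/free2P => x y; rewrite ?eab ?ebc ?eac ?scalerDr => e.
  - by case: (fs x y 0); rewrite ?e ?scale0r ?addr0.
  - by case: (fs 0 x y); rewrite ?scale0r ?add0r.
  - by case: (fs x 0 y); rewrite ?scale0r ?addr0.
  - by case: (fs x x y).
  - by case: (fs y x x) => //; rewrite -addrA addrC.
  - by case: (fs x y x) => //; rewrite addrAC.
have [al [be [al0 be0 e1]]] : exists x' y',
    [/\ x' != 0, y' != 0 & v' ab = x' *: v' a + y' *: v' b].
  by apply: (twin_line tw _ o0 o0); rewrite ?scale1r ?f2.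
have [ga [de [ga0 de0 e2]]] : exists x' y',
    [/\ x' != 0, y' != 0 & v' bc = x' *: v' b + y' *: v' c].
  by apply: (twin_line tw _ o0 o0); rewrite ?scale1r ?f2.
have [ep [ze [ep0 ze0 e3]]] : exists x' y',
    [/\ x' != 0, y' != 0 & v' ac = x' *: v' a + y' *: v' c].
  by apply: (twin_line tw _ o0 o0); rewrite ?scale1r ?f2.
have [x1 [y1 [x10 y10 e4]]] : exists x' y',
    [/\ x' != 0, y' != 0 & v' abc = x' *: v' ab + y' *: v' c].
  by apply: (twin_line tw _ o0 o0); rewrite ?scale1r ?f2 ?eabc ?eab.
have [x2 [y2 [x20 y20 e5]]] : exists x' y',
    [/\ x' != 0, y' != 0 & v' abc = x' *: v' bc + y' *: v' a].
  apply: (twin_line tw _ o0 o0); rewrite ?scale1r ?f2 ?eabc ?ebc //.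
  by rewrite -addrA addrC.
have [x3 [y3 [x30 y30 e6]]] : exists x' y',
    [/\ x' != 0, y' != 0 & v' abc = x' *: v' ac + y' *: v' b].
  by apply: (twin_line tw _ o0 o0); rewrite ?scale1r ?f2 ?eabc ?eac // addrAC.
(* This seventh line exists because 2 = 0 in [F]: the sum [v ab + v bc] contains [v b] twice. *)
have [x4 [y4 [x40 y40 e7]]] : exists x' y',
    [/\ x' != 0, y' != 0 & v' ac = x' *: v' ab + y' *: v' bc].
  apply: (twin_line tw _ o0 o0); rewrite ?scale1r.
    apply/free2P => x y; rewrite eab ebc !scalerDr => e.
    by case: (fs x (x + y) y); rewrite // -e scalerDl !addrA.
  by rewrite eab ebc eac addrA -(addrA (v a)) add0 addr0.
move: e4 e5 e6 e7; rewrite e1 e2 e3 !scalerDr !scalerA => -> e5 e6 e7.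
have [E1 E2 E3] : [/\ x1 * al = y2, x1 * be = x2 * ga & y1 = x2 * de].
  by apply: fr; rewrite e5 addrC addrA.
have [E4 E5 E6] : [/\ x1 * al = x3 * ep, x1 * be = y3 & y1 = x3 * ze].
  by apply: fr; rewrite e6 addrAC.
have [E7 E8 E9] : [/\ ep = x4 * al, 0 = x4 * be + y4 * ga & ze = y4 * de].
  by apply: fr; rewrite scale0r addr0 e7 scalerDl !addrA.
case/negP: n2; apply/andP; split=> //.
have : (2%:R * (y4 * ga * x1 * al * de * x2)) == 0.
  rewrite mulr_natl mulr2n; apply/eqP.
  have -> : y4 * ga = - (x4 * be) by apply/eqP; rewrite -addr_eq0 addrC -E8.
  have E10 : x3 * x4 * al = x1 * al by rewrite E4 E7 mulrA.
  have {}E10 : x3 * x4 = x1 by apply: (mulIf al0).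
  have E11 : x2 * de = x3 * (y4 * de) by rewrite -E9 -E6 E3.
  have {}E11 : x2 = x3 * y4 by apply: (mulIf de0); rewrite E11 mulrA.
  have : x1 * be = x3 * y4 * ga by rewrite E2 E11.
  rewrite -E10 -mulrA -(mulrA x3 y4) => e; have x3n : x3 != 0 by [].
  have {}e : x4 * be = y4 * ga by apply: (mulfI x3n).
  have : x4 * be = 0 \/ 2%:R = 0 :> F'.
    have : 2%:R * (x4 * be) == 0 by rewrite mulr_natl mulr2n {2}e -E8.
    by rewrite mulf_eq0; case/orP => /eqP ->; [right | left].
  case=> [->|h2]; first by rewrite oppr0 !mul0r addr0.
  by rewrite -mulr2n -mulr_natl h2 mul0r.
by rewrite !mulf_eq0 (negbTE x10) (negbTE al0) (negbTE de0) (negbTE x20)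
  (negbTE y40) (negbTE ga0) !orbF.
Qed.
End Fano.

(** * Represented matroids *)

Section RowColumn.
Variables (F : fieldType) (B E : finType) (A : B -> E -> F).

(** Coordinates of the rows in a basis of their span factor the matrix, so every column is a
    combination of the [\dim U] vectors [c i]. The converse inequality comes from the transpose. *)
Lemma col_le_row : (\dim <<[seq mxcol A e | e : E]>> <=
                    \dim <<[seq mxrow A b | b : B]>>)%N.
Proof.
set U := <<[seq mxrow A b | b : B]>>%VS.
have mU b : mxrow A b \in U by apply/memv_span/image_f.
pose c (i : 'I_(\dim U)) : {ffun B -> F^o} := [ffun b => coord (vbasis U) i (mxrow A b)].
apply: (@leq_trans (\dim <<[seq c i | i : 'I_(\dim U)]>>)); last first.
  by apply: leq_trans (dim_span _) _; rewrite size_image card_ord.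
apply/dimvS/span_subvP => _ /imageP[e _ ->].
have -> : mxcol A e = \sum_(i < \dim U) ((vbasis U)`_i e : F) *: c i.
  apply/ffunP => b; rewrite sum_ffunE ffunE.
  have := congr1 (fun u : {ffun E -> F^o} => u e) (coord_vbasis (mU b)).
  rewrite {1}/mxrow ffunE sum_ffunE => ->; apply: eq_bigr => i _.
  by rewrite !ffunE [RHS]mulrC.
by apply: memv_suml => i _; apply/memvZ/memv_span/image_f.
Qed.
End RowColumn.

Lemma row_rank_column_rank (F : fieldType) (B E : finType) (A : B -> E -> F) :
  \dim <<[seq mxcol A e | e : E]>> = \dim <<[seq mxrow A b | b : B]>>.
Proof.
apply/eqP; rewrite eqn_leq col_le_row /=.
have := col_le_row (fun e b => A b e).
have eqc : (mxcol (fun e b => A b e)) =1 mxrow A by move=> b; apply/ffunP=> e; rewrite !ffunE.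
have eqr : (mxrow (fun e b => A b e)) =1 mxcol A by move=> b; apply/ffunP=> e; rewrite !ffunE.
by rewrite (eq_image (fun=> erefl) eqc) (eq_image (fun=> erefl) eqr).
Qed.

(** Rank-nullity for the pairing with a basis of [U]: the kernel is the orthogonal space, and the
    image is the column space of the basis matrix, whose dimension is the row rank. *)
Lemma dim_orthv (F : fieldType) (E : finType) (U : {vspace {ffun E -> F^o}}) :
  (\dim (orthv U) + \dim U = #|E|)%N.
Proof.
pose A (i : 'I_(\dim U)) (e : E) : F := (vbasis U)`_i e.
pose g (w : {ffun E -> F^o}) : {ffun 'I_(\dim U) -> F^o} :=
  [ffun i : 'I_(\dim U) => dotf (vbasis U)`_i w].
have lg : linear g.
  by move=> a x y; apply/ffunP => i; rewrite !ffunE linearP.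
pose gl : {linear {ffun E -> F^o} -> {ffun 'I_(\dim U) -> F^o}} :=
  HB.pack g (GRing.isLinear.Build _ _ _ _ g lg).
have kg : lker (linfun gl) = orthv U.
  apply/vspaceP => w; rewrite memv_ker lfunE; apply/eqP/orthvP => [gw0 u uU|H].
    rewrite (coord_vbasis uU) /dotf.
    under eq_bigr do rewrite sum_ffunE mulr_suml.
    rewrite exchange_big big1 // => i _.
    have /ffunP/(_ i) := gw0; rewrite !ffunE => gi.
    under eq_bigr do rewrite ffunE -scalerAl.
    by rewrite -scaler_sumr [X in _ *: X]gi scaler0.
  apply/ffunP => i; rewrite !ffunE; apply: H.
  by apply/vbasis_mem/mem_nth; rewrite size_tuple.
have ig : limg (linfun gl) = <<[seq mxcol A e | e : E]>>%VS.
  apply/vspaceP => w; apply/idP/idP.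
    case/memv_imgP => u _ ->; rewrite lfunE.
    have -> : gl u = \sum_e (u e : F) *: mxcol A e.
      apply/ffunP => i; rewrite !ffunE sum_ffunE; apply: eq_bigr => e _.
      by rewrite !ffunE mulrC.
    by apply: memv_suml => e _; apply/memvZ/memv_span/image_f.
  apply/subvP/span_subvP => _ /imageP[e _ ->].
  apply/memv_imgP; exists [ffun x => (x == e)%:R]; rewrite ?memvf // lfunE.
  apply/ffunP => i; rewrite !ffunE /dotf (bigD1 e) //= ffunE eqxx mulr1 big1 ?addr0 //.
  by move=> x xe; rewrite ffunE (negbTE xe) mulr0.
have := limg_ker_dim (linfun gl) fullv; rewrite capfv kg ig.
rewrite row_rank_column_rank.
have -> : <<[seq mxrow A b | b : 'I_(\dim U)]>>%VS = U.
  apply/eqP; rewrite eqEsubv; apply/andP; split.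
    apply/span_subvP => _ /imageP[i _ ->]; have -> : mxrow A i = (vbasis U)`_i.
      by apply/ffunP => e; rewrite ffunE.
    by apply/vbasis_mem/mem_nth; rewrite size_tuple.
  apply/subvP => u uU; rewrite (coord_vbasis uU); apply: memv_suml => i _.
  apply/memvZ; have -> : (vbasis U)`_i = mxrow A i.
    by apply/ffunP => e; rewrite ffunE.
  by apply/memv_span/image_f.
by move=> ->; rewrite dimvf; first [by rewrite /dim /= muln1 | by rewrite /dim /= ?muln1 ?mul1n ?card_ord].
Qed.

Lemma orthv_orthv (F : fieldType) (E : finType) (U : {vspace {ffun E -> F^o}}) :
  orthv (orthv U) = U.
Proof.
apply/eqP; rewrite eq_sym eqEdim; apply/andP; split.
  apply/subvP => u uU; apply/orthvP => w /orthvP/(_ u uU) e.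
  by rewrite -e; apply: eq_bigr => x _; rewrite mulrC.
have := dim_orthv U; have := dim_orthv (orthv U); lia.
Qed.

Section UnderlyingRank.
Variable F : fieldType.

(** The rank of a set read off the row space itself: this form depends on no basis and is compatible
    with orthogonality. *)
Definition res_rk (E : finType) (U : {vspace {ffun E -> F^o}}) (X : {set E}) :=
  \dim (linfun (@resf F E X) @: U).

Lemma span_mxcol_sub (E B : finType) (A : B -> E -> F) (X : {set E}) :
  <<[seq mxcol A e | e in X]>>%VS =
  <<[seq mxcol (fun b (e : {e : E | e \in X}) => A b (val e)) e
       | e : {e : E | e \in X}]>>%VS.
Proof.
apply: eq_span => u; apply/imageP/imageP => [[e eX ->]|[e _ ->]].
  by exists (Sub e eX) => //; apply/ffunP => b; rewrite !ffunE SubK.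
by exists (val e); [apply: valP | apply/ffunP => b; rewrite !ffunE].
Qed.

Lemma rk_underlying (M : rmatroid F) (X : {set M}) :
  @rk (underlying M) X = res_rk (rspace M) X.
Proof.
rewrite /= /col_rk span_mxcol_sub row_rank_column_rank /res_rk.
transitivity (\dim <<map (linfun (@resf F M X)) (vbasis (rspace M))>>); last first.
  by rewrite -limg_span (span_basis (vbasisP _)).
congr (\dim _); apply: eq_span => u; apply/imageP/mapP => [[i _ ->]|[w wb ->]].
  exists (vbasis (rspace M))`_i; first by apply: mem_nth; rewrite size_tuple.
  by rewrite lfunE; apply/ffunP => e; rewrite !ffunE.
have wi : (index w (vbasis (rspace M)) < \dim (rspace M))%N.
  by rewrite -{2}(size_tuple (vbasis (rspace M))) index_mem.
exists (Ordinal wi) => //; rewrite lfunE; apply/ffunP => e.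
by rewrite !ffunE /rep_matrix /= nth_index.
Qed.

Lemma rk_of_matrix (B E : finType) (A : B -> E -> F) (X : {set E}) :
  @rk (underlying (of_matrix A)) X = col_rk A X.
Proof.
rewrite rk_underlying /= /col_rk span_mxcol_sub row_rank_column_rank /res_rk.
rewrite limg_span -map_comp; congr (\dim <<_>>); rewrite /image_mem.
by apply: eq_map => b /=; rewrite lfunE; apply/ffunP => e; rewrite !ffunE.
Qed.

Lemma dim_res (E : finType) (U : {vspace {ffun E -> F^o}}) (X : {set E}) :
  (\dim (U :&: lker (linfun (@resf F E X))) + res_rk U X = \dim U)%N.
Proof. exact: limg_ker_dim. Qed.

Lemma res_rkT (E : finType) (U : {vspace {ffun E -> F^o}}) :
  res_rk U setT = \dim U.
Proof.
have := dim_res U setT; have -> : (U :&: lker (linfun (@resf F E setT)) = 0)%VS.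
  apply/eqP; rewrite -subv0; apply/subvP => u /memv_capP[_].
  rewrite memv_ker lfunE memv0 => /eqP/ffunP H; apply/eqP/ffunP => e.
  by have := H (Sub e (in_setT e)); rewrite !ffunE SubK.
by rewrite dimv0.
Qed.

(** The vectors orthogonal to the restriction of [orthv U] to [X] are the restrictions of those
    vectors of [U] that vanish outside [X]. Counting dimensions on both sides gives the rank formula
    of the dual. *)
Lemma res_rk_orthv (E : finType) (U : {vspace {ffun E -> F^o}}) (X : {set E}) :
  (res_rk (orthv U) X + \dim U = #|X| + res_rk U (~: X))%N.
Proof.
set R := linfun (@resf F E X); set S := linfun (@resf F E (~: X)).
have : \dim (orthv (R @: orthv U)) = \dim (U :&: lker S).
  have -> : orthv (R @: orthv U) = (R @: (U :&: lker S))%VS.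
    apply/vspaceP => w; apply/orthvP/memv_imgP => [H|[u /memv_capP[uU uS] ->] z].
      pose u : {ffun E -> F^o} :=
        [ffun e => if insub e is Some x then w x else 0].
      exists u; last first.
        rewrite lfunE; apply/ffunP => x; rewrite !ffunE valK //.
      apply/memv_capP; split; last first.
        rewrite memv_ker lfunE; apply/eqP/ffunP => x; rewrite !ffunE.
        by case: insubP => // y yX; have := valP x; rewrite inE yX.
      rewrite -(orthv_orthv U); apply/orthvP => z zU.
      rewrite -(H (R z) (memv_img _ zU)) /dotf.
      rewrite (bigID (mem X)) /= [X in _ + X]big1 ?addr0; last first.
        move=> e eX; rewrite ffunE; case: insubP => [y yX|_]; rewrite ?mulr0 //.
        by rewrite yX in eX.
      rewrite (reindex_omap (val : {e : E | e \in X} -> E) insub) /=; last first.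
        by move=> e eX; rewrite insubT.
      apply: eq_big => [x|x _]; first by rewrite (valP x) valK eqxx.
      by rewrite lfunE !ffunE valK.
    case/memv_imgP => y yU ->; rewrite !lfunE /dotf.
    rewrite memv_ker lfunE in uS.
    have /orthvP/(_ u uU) yu := yU.
    rewrite -[RHS]yu /dotf [RHS](bigID (mem X)) /= [X in _ + X]big1 ?addr0; last first.
      move=> e eX; have eX' : e \in ~: X by rewrite inE.
      by have /eqP/ffunP/(_ (Sub e eX')) := uS; rewrite !ffunE SubK => ->; rewrite mul0r.
    rewrite [RHS](reindex_omap (val : {e : E | e \in X} -> E) insub) /=; last first.
      by move=> e eX; rewrite insubT.
    apply: eq_big => [x|x _]; first by rewrite (valP x) valK eqxx.
    by rewrite !ffunE mulrC.
  apply: limg_dim_eq; apply/eqP; rewrite -subv0; apply/subvP => u.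
  case/memv_capP => /memv_capP[_]; rewrite !memv_ker !lfunE memv0.
  move=> /eqP/ffunP H1 /eqP/ffunP H2; apply/eqP/ffunP => e; rewrite ffunE.
  case: (boolP (e \in X)) => eX.
    by have := H2 (Sub e eX); rewrite !ffunE SubK.
  have eX' : e \in ~: X by rewrite inE.
  by have := H1 (Sub e eX'); rewrite !ffunE SubK.
have := dim_orthv (R @: orthv U); have := dim_res U (~: X).
have -> : #|{: {e : E | e \in X}}| = #|X| by rewrite card_sig.
rewrite -/S => e1 e2 e3; rewrite -e1 -e2 e3 /res_rk -/R -/S.
by rewrite addnA [X in (X + _)%N]addnC.
Qed.

Lemma rk_rdual (M : rmatroid F) (X : {set M}) :
  @rk (underlying (rdual M)) X = @dual_rk (underlying M) X.
Proof.
rewrite rk_underlying /dual_rk /rank !rk_underlying res_rkT.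
have := res_rk_orthv (rspace M) X; rewrite /=; lia.
Qed.

Lemma rk_rdelete (M : rmatroid F) (D : {set M}) (X : {set rdelete D}) :
  @rk (underlying (rdelete D)) X = @rk (underlying M) (val @: X).
Proof.
rewrite !rk_underlying /res_rk /= -limg_comp.
have H u : (linfun (@resf F _ X) \o linfun (@resf F M (~: D)))%VF u = 0 <->
           linfun (@resf F M (val @: X)) u = 0.
  rewrite comp_lfunE !lfunE; split=> /ffunP h; apply/ffunP => x; rewrite !ffunE.
    have /imsetP[y yX ey] := valP x.
    by have := h (Sub y yX); rewrite !ffunE SubK -ey.
  have h' : val (val x) \in val @: X by apply/imsetP; exists (val x) => //; apply: valP.
  by have := h (Sub (val (val x)) h'); rewrite !ffunE SubK.
have := limg_ker_dim (linfun (@resf F _ X) \o linfun (@resf F M (~: D))) (rspace M).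
have := limg_ker_dim (linfun (@resf F M (val @: X))) (rspace M).
have -> : lker (linfun (@resf F M (val @: X))) =
  lker (linfun (@resf F _ X) \o linfun (@resf F M (~: D))).
  apply/vspaceP => u; rewrite !memv_ker; apply/eqP/eqP; apply H.
by move=> e1 e2; apply: addnI (etrans e2 (esym e1)).
Qed.

Lemma rk_rcontract (M : rmatroid F) (C : {set M}) (X : {set rcontract C}) :
  (@rk (underlying (rcontract C)) X + @rk (underlying M) C =
   @rk (underlying M) (val @: X :|: C))%N.
Proof.
rewrite rk_rdual -(@rk_contract (underlying M) C X); congr (_ + _)%N.
rewrite /= /dual_rk /rank !rk_rdelete !rk_rdual /=.
by rewrite /delete_rk.
Qed.

Lemma rk_risom (M N : rmatroid F) (f : M -> N) (c : M -> F) :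
  bijective f -> (forall e, c e != 0) ->
  (forall u : {ffun N -> F^o},
     (u \in rspace N) = ([ffun e => c e * u (f e)] \in rspace M)) ->
  forall X : {set M}, @rk (underlying M) X = @rk (underlying N) (f @: X).
Proof.
move=> [g fK gK] c0 H X; rewrite !rk_underlying /res_rk.
pose h (u : {ffun N -> F^o}) : {ffun M -> F^o} := [ffun e => c e * u (f e)].
have lh : linear h.
  move=> a x y; apply/ffunP => e; rewrite !ffunE mulrDr.
  by congr (_ + _); rewrite /GRing.scale /= mulrCA.
pose hl : {linear {ffun N -> F^o} -> {ffun M -> F^o}} :=
  HB.pack h (GRing.isLinear.Build _ _ _ _ h lh).
have ih : injective (linfun hl).
  move=> x y; rewrite !lfunE => /ffunP e; apply/ffunP => z.
  by have := e (g z); rewrite !ffunE gK => /(mulfI (c0 _)).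
have eS : rspace M = (linfun hl @: rspace N)%VS.
  apply/vspaceP => u; apply/idP/memv_imgP => [uM|[w wN ->]]; last first.
    by rewrite lfunE /= -H.
  exists [ffun z => (c (g z))^-1 * u (g z)]; last first.
    by rewrite lfunE; apply/ffunP => e; rewrite !ffunE fK mulVKf.
  rewrite H; suff -> : [ffun e => c e * [ffun z => (c (g z))^-1 * u (g z)] (f e)] = u by [].
  by apply/ffunP => e; rewrite !ffunE fK mulVKf.
have := limg_ker_dim (linfun (@resf F M X) \o linfun hl) (rspace N).
have := limg_ker_dim (linfun (@resf F N (f @: X))) (rspace N).
have -> : lker (linfun (@resf F N (f @: X))) = lker (linfun (@resf F M X) \o linfun hl).
  apply/vspaceP => u; rewrite !memv_ker comp_lfunE !lfunE /=.
  apply/eqP/eqP => /ffunP h1; apply/ffunP => x; rewrite !ffunE.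
    have fx : f (val x) \in f @: X by rewrite imset_f ?(valP x).
    by have := h1 (Sub (f (val x)) fx); rewrite !ffunE SubK => ->; rewrite mulr0.
  have /imsetP[y yX ey] := valP x.
  by have := h1 (Sub y yX); rewrite !ffunE SubK -ey => /eqP;
     rewrite mulf_eq0 (negbTE (c0 _)) /= => /eqP.
move=> e1 e2; rewrite eS -limg_comp; exact: addnI (etrans e2 (esym e1)).
Qed.
End UnderlyingRank.

(** * Lines through a common point *)

Lemma span3P (F : fieldType) (V : vectType F) (a b c u : V) :
  reflect (exists x y z, u = x *: a + y *: b + z *: c)
          (u \in <<[:: a; b; c]>>%VS).
Proof.
rewrite span_cons; apply: (iffP memv_addP).
  move=> [_ /vlineP[x ->] [_ /span2P[y [z ->]] ->]].
  by exists x, y, z; rewrite addrA.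
move=> [x [y [z ->]]]; exists (x *: a); first by rewrite memvZ ?memv_line.
by exists (y *: b + z *: c); rewrite ?addrA //; apply/span2P; exists y, z.
Qed.

Lemma free4P (F : fieldType) (V : vectType F) (a b c d : V) :
  reflect (forall x y z w, x *: a + y *: b + z *: c + w *: d = 0 ->
             [/\ x = 0, y = 0, z = 0 & w = 0]) (free [:: a; b; c; d]).
Proof.
rewrite free_cons; apply: (iffP andP).
  move=> [nab /free3P f] x y z w e; have x0 : x = 0.
    apply/eqP; apply: contraNT nab => x0; apply/span3P.
    exists (- y / x), (- z / x), (- w / x).
    apply: (scalerI x0); rewrite !scalerDr !scalerA !(mulrCA x) mulfV // !mulr1.
    by apply/eqP; rewrite !scaleNr -!opprD -addr_eq0 !addrA e.
  by move: e; rewrite x0 scale0r add0r => /f[-> -> ->].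
move=> H; split; last by apply/free3P => y z w e; have [] := H 0 y z w;
  rewrite ?scale0r ?add0r.
apply/negP => /span3P[y [z [w e]]]; have [] := H 1 (- y) (- z) (- w).
  by rewrite e scale1r !scaleNr (AC (3*1*1*1) ((1*2*3)*(4*5*6)))/= -!opprD subrr.
by move/eqP; rewrite oner_eq0.
Qed.

Section Collision.
Variables (F F' : fieldType) (V : vectType F) (V' : vectType F') (T : Type).
Variables (v : T -> V) (v' : T -> V').

(* Two triangles sharing a point, with all four other points doubled along the
   direction [e]; the sixth and seventh dependencies need [2 = 0]. *)
Lemma collision_absurd (e x1 x1' x2 x2' y1 y1' y2 y2' : T) :
  twin v v' -> 2 \notin [pchar F'] -> 2 \in [pchar F] ->
  free [:: v x1; v x2; v y1; v e] ->
  v x1 + v x2 = v y1 + v y2 ->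
  v x1' = v x1 + v e -> v x2' = v x2 + v e -> v y1' = v y1 + v e ->
  v y2' = v y2 + v e -> False.
Proof.
move=> tw n2 c2 f ed e1 e2 e3 e4.
have add0 (u : V) : u + u = 0.
  by rewrite -mulr2n -scaler_nat (pcharf0 c2) scale0r.
have ey2 : v y2 = v x1 + v x2 + v y1.
  by rewrite ed addrAC add0 add0r.
have f' : free [:: v' x1; v' x2; v' y1; v' e].
  by rewrite -[[:: _; _; _; _]]/(map v' [:: x1; x2; y1; e]) -(twin_free _ tw).
have fs : forall x y z w : F, _ := elimT (free4P _ _ _ _) f.
have o0 : 1 != 0 :> F by rewrite oner_eq0.
have [l1 [m1 [l10 m10 h1]]] : exists x' y',
    [/\ x' != 0, y' != 0 & v' x1' = x' *: v' x1 + y' *: v' e].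
  apply: (twin_line tw _ o0 o0); rewrite ?scale1r //.
  by apply/free2P => x y h; case: (fs x 0 0 y); rewrite ?scale0r ?addr0.
have [l2 [m2 [l20 m20 h2]]] : exists x' y',
    [/\ x' != 0, y' != 0 & v' x2' = x' *: v' x2 + y' *: v' e].
  apply: (twin_line tw _ o0 o0); rewrite ?scale1r //.
  by apply/free2P => x y h; case: (fs 0 x 0 y); rewrite ?scale0r ?addr0 ?add0r.
have [l3 [m3 [l30 m30 h3]]] : exists x' y',
    [/\ x' != 0, y' != 0 & v' y1' = x' *: v' y1 + y' *: v' e].
  apply: (twin_line tw _ o0 o0); rewrite ?scale1r //.
  by apply/free2P => x y h; case: (fs 0 0 x y); rewrite ?scale0r ?addr0 ?add0r.
have [l4 [m4 [l40 m40 h4]]] : exists x' y',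
    [/\ x' != 0, y' != 0 & v' y2' = x' *: v' y2 + y' *: v' e].
  apply: (twin_line tw _ o0 o0); rewrite ?scale1r //.
  apply/free2P => x y; rewrite ey2 !scalerDr => h.
  by case: (fs x x x y).
have s3 a b c u : v u = v a + v b + v c ->
    v' u \in <<[:: v' a; v' b; v' c]>>%VS.
  move=> h; rewrite -[[:: _; _; _]]/(map v' [:: a; b; c]) -(twin_mem _ _ tw).
  by apply/span3P; exists 1, 1, 1; rewrite !scale1r.
have fr x y z w x' y' z' w' :
    x *: v' x1 + y *: v' x2 + z *: v' y1 + w *: v' e =
    x' *: v' x1 + y' *: v' x2 + z' *: v' y1 + w' *: v' e ->
    [/\ x = x', y = y', z = z' & w = w'].
  move/free4P: f' => f' h.
  have [|/eqP a1 /eqP a2 /eqP a3 /eqP a4] :=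
    f' (x - x') (y - y') (z - z') (w - w').
    rewrite !scalerBl; apply/eqP.
    by rewrite (AC (2*2*2*2) ((1*3*5*7)*(2*4*6*8)))/= -!opprD subr_eq0 h.
  by rewrite !subr_eq0 in a1 a2 a3 a4; split; apply/eqP.
have /span3P[al [be [ga hd]]] := s3 _ _ _ _ ey2.
have al0 : al != 0.
  apply: contraTneq f => al0; have : v' y2 \in <<map v' [:: x2; y1]>>%VS.
    by rewrite hd al0 scale0r add0r; apply/span2P; exists be, ga.
  rewrite -(twin_mem _ _ tw) ey2 => /span2P[x [y h]].
  apply/negP => /free4P/(_ 1 (1 - x) (1 - y) 0)[|/eqP].
    rewrite scale0r addr0 !scalerBl !scale1r addrACA -addrACA.
    by rewrite (AC (1*2*2) ((1*2*4)*(3*5)))/= h -!opprD subrr.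
  by rewrite oner_eq0.
have /span3P[a1 [b1 [c1 k1]]] : v' y2 \in <<[:: v' x1'; v' x2; v' y1']>>%VS.
  apply: s3; rewrite e1 e3 ey2 (AC (2*1*2) ((1*3*4)*(2*5)))/=.
  by rewrite add0 addr0.
have /span3P[a2 [b2 [c2' k2]]] : v' y2 \in <<[:: v' x1'; v' x2'; v' y1]>>%VS.
  apply: s3; rewrite e1 e2 ey2 (AC (2*2*1) ((1*3*5)*(2*4)))/=.
  by rewrite add0 addr0.
have /span3P[a3 [b3 [c3 k3]]] : v' y2' \in <<[:: v' x1'; v' x2; v' y1]>>%VS.
  by apply: s3; rewrite e1 e4 ey2 [RHS](AC (2*1*1) ((1*3*4)*2))/=.
have /span3P[a4 [b4 [c4 k4]]] : v' y2' \in <<[:: v' x1'; v' x2'; v' y1']>>%VS.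
  apply: s3; rewrite e1 e2 e3 e4 ey2 (AC (2*2*2) ((1*3*5)*(2*(4*6))))/=.
  by rewrite add0 addr0.
move: k1 k2 k3 k4; rewrite h1 h2 h3 h4 hd !scalerDr !scalerA => k1 k2 k3 k4.
have [E1 _ E3 E4] : [/\ al = a1 * l1, be = b1, ga = c1 * l3
    & 0 = a1 * m1 + c1 * m3].
  apply: fr; rewrite scale0r addr0 k1 scalerDl.
  by rewrite (AC (2*1*2) (1*3*4*(2*5)))/=.
have [E5 E6 _ E7] : [/\ al = a2 * l1, be = b2 * l2, ga = c2'
    & 0 = a2 * m1 + b2 * m2].
  apply: fr; rewrite scale0r addr0 k2 scalerDl.
  by rewrite (AC (2*2*1) (1*3*5*(2*4)))/=.
have [E8 _ _ E9] : [/\ l4 * al = a3 * l1, l4 * be = b3, l4 * ga = c3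
    & m4 = a3 * m1].
  by apply: fr; rewrite k3 (AC (2*1*1) (1*3*4*2))/=.
have [E10 E11 E12 E13] : [/\ l4 * al = a4 * l1, l4 * be = b4 * l2,
    l4 * ga = c4 * l3 & m4 = a4 * m1 + b4 * m2 + c4 * m3].
  by apply: fr; rewrite k4 !scalerDl (AC (2*2*2) (1*3*5*(2*4*6)))/=.
have E14 : a4 = l4 * a1.
  by apply: (mulIf l10); rewrite -E10 E1 mulrA.
have E15 : b4 = l4 * b2 by apply: (mulIf l20); rewrite -E11 E6 mulrA.
have E16 : c4 = l4 * c1 by apply: (mulIf l30); rewrite -E12 E3 mulrA.
have E17 : a2 = a1 by apply: (mulIf l10); rewrite -E1 -E5.
have E18 : a3 = l4 * a1 by apply: (mulIf l10); rewrite -E8 E1 mulrA.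
have : 2%:R * (l4 * a1 * m1) = 0.
  have -> : 2%:R * (l4 * a1 * m1) = l4 * (a1 * m1 + c1 * m3)
     + l4 * (a2 * m1 + b2 * m2)
     - (a4 * m1 + b4 * m2 + c4 * m3) + a3 * m1.
    by rewrite E14 E15 E16 E17 E18; ring.
  by rewrite -E4 -E7 -E13 -E9 !mulr0 !add0r addNr.
move/eqP; rewrite !mulf_eq0 (negbTE l40) (negbTE m10) !orbF => /orP[h|].
  by case/negP: n2; apply/andP.
by move=> /eqP a10; move: al0; rewrite E1 a10 mul0r eqxx.
Qed.
End Collision.

(** Elements up to scaling: scalars can be absorbed into the vectors, so that relations between
    elements become plain sums. *)
Definition elt (F : fieldType) (V : vectType F) (T : Type) (v : T -> V) (z : V) :=
  exists (x : T) (c : F), c != 0 /\ z = c *: v x.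

Lemma elt_map (F : fieldType) (V : vectType F) (T : Type) (v : T -> V)
    (p : 'End(V)) z : elt v z -> elt (fun x => p (v x)) (p z).
Proof. by move=> [x [c [c0 ->]]]; exists x, c; rewrite linearZ. Qed.

Lemma collision_elt_absurd (F F' : fieldType) (V : vectType F)
    (V' : vectType F') (T : Type) (v : T -> V) (v' : T -> V')
    (e : T) (X1 X2 Y1 Y2 : V) :
  twin v v' -> 2 \notin [pchar F'] -> 2 \in [pchar F] ->
  free [:: X1; X2; Y1; v e] -> X1 + X2 = Y1 + Y2 ->
  elt v X1 -> elt v X2 -> elt v Y1 -> elt v Y2 ->
  elt v (X1 + v e) -> elt v (X2 + v e) -> elt v (Y1 + v e) ->
  elt v (Y2 + v e) -> False.
Proof.
move=> tw n2 c2 f ed [x1 [a1 [a10 E1]]] [x2 [a2 [a20 E2]]] [x3 [a3 [a30 E3]]]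
  [x4 [a4 [a40 E4]]] [y1 [b1 [b10 G1]]] [y2 [b2 [b20 G2]]]
  [y3 [b3 [b30 G3]]] [y4 [b4 [b40 G4]]].
(* The nine vectors are indexed by position, because one element may occur in two roles with
   different scalars. *)
pose h i := nth e [:: e; x1; x2; x3; x4; y1; y2; y3; y4] i.
pose c i : F := nth 1 [:: 1; a1; a2; a3; a4; b1; b2; b3; b4] i.
have c0 i : c i != 0.
  by rewrite /c; do 9?[case: i => [|i] //=]; rewrite ?oner_eq0 // nth_nil oner_eq0.
pose w i := c i *: v (h i).
have tw' : twin w (fun i => 1 *: v' (h i)).
  by apply: (twin_scale (c' := fun=> 1) c0 _ (twin_comp h tw)) => _; rewrite oner_eq0.
have w0 : w 0%N = v e by rewrite /w /= scale1r.
by apply: (@collision_absurd _ _ _ _ _ w _ 0 1 5 2 6 3 7 4 8 tw' n2 c2);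
  rewrite ?w0 /w /= -?E1 -?E2 -?E3 -?E4 -?G1 -?G2 -?G3 -?G4.
Qed.

(** * The number of long lines through a point *)

Section Star.
Variables (F : finFieldType) (F' : fieldType) (d : nat).
Local Notation V := 'rV[F]_d.
Hypotheses (n2 : 2 \notin [pchar F']) (c2 : 2 \in [pchar F]).

(** The cost of one induction step in [star_card], with q = [#|F|]: q^2 vectors in the plane of the
    centre and the contracted point, and q^3 vectors for each of the q^2 possible differences
    between a vector and its representative. *)
Definition starC := (#|F| ^ 2 + #|F| ^ 2 * #|F| ^ 3)%N.

Lemma card_sub_vspace (A : {set V}) (U : {vspace V}) k :
  {subset A <= U} -> (\dim U <= k)%N -> (#|A| <= #|F| ^ k)%N.
Proof.
move=> AU dU; apply: leq_trans (_ : #|U| <= _)%N.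
  by apply: subset_leq_card; apply/subsetP.
rewrite card_vspace leq_pexp2l //; apply/card_gt0P; by exists 0.
Qed.

(* Long lines through a point [e], each given by a vector [X] such that both
   [X] and [X + e] are elements. *)
Lemma star_card (V' : vectType F') (T : Type) n (v : T -> V) (v' : T -> V')
    (e : T) (XX : {set V}) :
  twin v v' -> v e != 0 ->
  (forall X, X \in XX -> elt v X /\ elt v (X + v e)) ->
  (forall X, X \in XX -> X \notin <[v e]>%VS) ->
  {in XX &, forall X Y, X - Y \in <[v e]>%VS -> X = Y} ->
  (\dim (<[v e]> + <<enum XX>>) <= n.+1)%N -> (#|XX| <= starC * n)%N.
Proof.
elim: n v v' XX => [|n IH] v v' XX tw e0 XE Xe XX_inj dX.
  have -> : XX = set0.
    apply/setP => X; rewrite inE; apply/negP => XX0; case/negP: (Xe X XX0).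
    have s : (<[v e]> <= <[v e]> + <<enum XX>>)%VS by apply: addvSl.
    have : (<[v e]> + <<enum XX>> <= <[v e]>)%VS.
      by rewrite -(dimv_leqif_sup s).2 eqn_leq dimvS //= dim_vline e0.
    by rewrite subv_add => /andP[_ /subvP]; apply; rewrite memv_span ?mem_enum.
  by rewrite cards0.
have [->|[a0 a0X]] := set_0Vmem XX; first by rewrite cards0.
have [[x0 [k0 [k00 ea0]]] _] := XE a0 a0X.
have [p [p' [kp kp' tw1]]] := twin_contract_ex [:: x0] tw.
have la0 : <[v x0]>%VS = <[a0]>%VS.
  apply/vspaceP => u; apply/vlineP/vlineP => -[k ->].
    by exists (k / k0); rewrite ea0 scalerA divfK.
  by exists (k * k0); rewrite ea0 scalerA.
rewrite span_seq1 la0 in kp.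
have pa0 u : (p u == 0) = (u \in <[a0]>%VS) by rewrite -memv_ker kp.
pose S := (<[v e]> + <[a0]>)%VS.
have sS : (<[v e]> <= S)%VS by apply: addvSl.
have dS : (\dim S <= 2)%N.
  apply: leq_trans (dimv_add_leqif _ _) _; rewrite !dim_vline.
  by do 2!case: (_ != 0).
pose XA := [set X in XX | X \in S]; pose XB := XX :\: XA.
have XBP X : X \in XB -> X \in XX /\ X \notin S.
  by case/setDP => h; rewrite inE h.
(* Representatives modulo the plane [S]. They still span distinct lines with the centre after the
   contraction of [a0], so the induction hypothesis bounds their number. *)
pose rep (X : V) : V := odflt X [pick Y in XB | X - Y \in S].
have repP X : X \in XB -> rep X \in XB /\ X - rep X \in S.
  move=> XX0; rewrite /rep; case: pickP => [Y /andP[//]|/(_ X)].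
  by rewrite XX0 subrr mem0v.
have rep_eq X Y : X \in XB -> Y \in XB -> X - Y \in S -> rep X = rep Y.
  move=> hX hY XY; have e1 : [pick Z in XB | X - Z \in S] = [pick Z in XB | Y - Z \in S].
    apply: eq_pick => Z /=; congr (_ && _).
    have -> : X - Z = (X - Y) + (Y - Z) by rewrite addrA subrK.
    by rewrite rpredDl.
  rewrite /rep e1; case: pickP => //= /(_ Y).
  by rewrite hY subrr mem0v.
pose X1 := rep @: XB; pose XD := XB :\: X1.
have X1B X : X \in X1 -> X \in XB by case/imsetP => Y /repP[? _] ->.
have X1rep X : X \in X1 -> rep X = X.
  case/imsetP => Y YB ->; have [rB rS] := repP Y YB.
  by apply/esym/rep_eq.
have X1_inj : {in X1 &, forall X Y, X - Y \in S -> X = Y}.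
  by move=> X Y hX hY h; rewrite -(X1rep X) // -(X1rep Y) //; apply: rep_eq; rewrite ?X1B.
have cA : (#|XA| <= #|F| ^ 2)%N.
  by apply: (@card_sub_vspace XA S) => // X; rewrite inE => /andP[].
have c1 : (#|X1| <= starC * n)%N.
  have pinj : {in X1 &, injective p}.
    move=> X Y hX hY /eqP; rewrite -subr_eq0 -linearB pa0 => h.
    by apply: X1_inj => //; apply: subvP h; apply: addvSr.
  rewrite -(card_in_imset pinj).
  apply: (IH (fun x => p (v x)) (fun x => p' (v' x)) (p @: X1)) => //.
  - rewrite pa0; apply/negP => /vlineP[k ek]; case/negP: (Xe a0 a0X).
    apply/vlineP; exists k^-1; rewrite ek scalerK //.
    by apply: contraNneq e0 => k0'; rewrite ek k0' scale0r.
  - move=> _ /imsetP[X hX ->]; have [/XE[h1 h2] _] := XBP X (X1B X hX).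
    by split; first exact: elt_map; rewrite -linearD; apply: elt_map.
  - move=> _ /imsetP[X hX ->]; have [_] := XBP X (X1B X hX).
    apply: contraNN => /vlineP[k /eqP]; rewrite -linearZ -subr_eq0 -linearB pa0 => h.
    by rewrite -(subrK (k *: v e) X) addrC memv_add ?memvZ ?memv_line.
  - move=> _ _ /imsetP[X hX ->] /imsetP[Y hY ->] /vlineP[k /eqP].
    rewrite -linearB -linearZ -subr_eq0 -linearB pa0 => h; congr (p _).
    apply: X1_inj => //.
    by rewrite -(subrK (k *: v e) (X - Y)) addrC memv_add ?memvZ ?memv_line.
  set U := (<[v e]> + <<enum XX>>)%VS in dX.
  have a0U : (<[a0]> <= U)%VS.
    by apply: subv_trans (addvSr _ _); rewrite -memvE memv_span ?mem_enum.
  have a00 : a0 != 0 by apply: contraNneq (Xe a0 a0X) => ->; rewrite mem0v.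
  have := limg_ker_dim p U; rewrite kp (capv_idPr a0U) dim_vline a00 => hU.
  have : (\dim (p @: U) <= n.+1)%N by rewrite -(leq_add2l 1) hU.
  apply: leq_trans; apply: dimvS; rewrite subv_add; apply/andP; split.
    by rewrite -memvE memv_img // (subvP (addvSl _ _)) ?memv_line.
  apply/span_subvP => y; rewrite mem_enum => /imsetP[X hX ->].
  apply: memv_img; apply: (subvP (addvSr _ _)); apply: memv_span.
  by rewrite mem_enum; have [] := XBP X (X1B X hX).
(* Two vectors with the same difference to their representatives form two pairs of equal sum in
   characteristic 2. This is a collision unless one of them lies in the span of [S] and the other, a
   space of dimension at most 3. *)
pose tl X := odflt (0, 0) [pick ct : F * F | X - rep X == ct.1 *: a0 + ct.2 *: v e].
have tlP X : X \in XB -> X - rep X = (tl X).1 *: a0 + (tl X).2 *: v e.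
  move=> /repP[_ /memv_addP[_ /vlineP[t ->] [_ /vlineP[c ->] h]]].
  rewrite /tl; case: pickP => [ct /eqP //|/(_ (c, t)) /=].
  by rewrite h addrC eqxx.
have cD : (#|XD| <= #|F| ^ 2 * #|F| ^ 3)%N.
  have -> : #|XD| = (\sum_(ct : F * F) #|[set X in XD | tl X == ct]|)%N.
    rewrite -sum1_card (partition_big tl predT) //=; apply: eq_bigr => ct _.
    by rewrite -sum1_card; apply: eq_bigl => X; rewrite !inE.
  apply: leq_trans (_ : \sum_(ct : F * F) #|F| ^ 3 <= _)%N; last first.
    by rewrite sum_nat_const card_prod.
  apply: leq_sum => ct _.
  have [->|[Y]] := set_0Vmem [set X in XD | tl X == ct]; first by rewrite cards0.
  rewrite inE => /andP[YD /eqP tY].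
  pose W := (<[Y]> + S)%VS.
  have dW : (\dim W <= 3)%N.
    apply: leq_trans (dimv_add_leqif _ _) _; rewrite dim_vline.
    by apply: leq_trans (leq_add (leq_b1 _) dS) _.
  apply: (card_sub_vspace (U := W)) => // X; rewrite inE => /andP[XD0 /eqP tX].
  apply: contraT => XW; exfalso.
  have [XB0 XnX1] : X \in XB /\ X \notin X1 by move: XD0; rewrite !inE => /andP[-> ->].
  have [YB0 YnX1] : Y \in XB /\ Y \notin X1 by move: YD; rewrite !inE => /andP[-> ->].
  have [rX _] := repP X XB0; have [rY _] := repP Y YB0.
  have [XX0 XS] := XBP X XB0; have [YX0 YS] := XBP Y YB0.
  have [rXX0 _] := XBP _ rX; have [rYX0 _] := XBP _ rY.
  have hX := tlP X XB0; have hY := tlP Y YB0; rewrite tX in hX; rewrite tY in hY.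
  have ct0 : ct.1 != 0.
    apply: contraNneq XnX1 => ct0; have -> : X = rep X; last by apply: imset_f.
    by apply: XX_inj => //; rewrite hX ct0 scale0r add0r memvZ ?memv_line.
  have add0 (u : V) : u + u = 0.
    by rewrite -mulr2n -scaler_nat (pcharf0 c2) scale0r.
  have oppE (u : V) : - u = u by apply/eqP; rewrite eq_sym -addr_eq0 add0.
  have eXY : X + rep X = Y + rep Y.
    by rewrite -[in LHS](oppE (rep X)) -[in RHS](oppE (rep Y)) hX hY.
  have [h1 h2] := XE _ XX0; have [h3 h4] := XE _ YX0.
  have [h5 h6] := XE _ rXX0; have [h7 h8] := XE _ rYX0.
  apply: (collision_elt_absurd tw n2 c2 _ eXY h1 h5 h3 h7 h2 h6 h4 h8).
  have rXE : rep X = X + ct.1 *: a0 + ct.2 *: v e.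
    by rewrite -addrA -hX addrA add0 add0r oppE.
  have a0e : forall x y, x *: a0 + y *: v e = 0 -> x = 0 /\ y = 0.
    move=> x y h; have x00 : x = 0.
      apply/eqP; apply: contraNT (Xe a0 a0X) => x00; apply/vlineP.
      exists (- y / x); apply: (scalerI x00).
      rewrite scalerA mulrCA mulfV // mulr1 scaleNr.
      by apply/eqP; rewrite -addr_eq0 h.
    split=> //; move: h; rewrite x00 scale0r add0r => /eqP.
    by rewrite scaler_eq0 (negbTE e0) orbF => /eqP.
  apply/free4P => x y z w h.
  have h' : (x + y) *: X + z *: Y + ((y * ct.1) *: a0 + (y * ct.2 + w) *: v e) = 0.
    rewrite -h rXE !scalerDl !scalerDr !scalerA.
    by rewrite (AC (2*1*(1*2)) (1*(2*4*5)*3*6))/=.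
  have xy0 : x + y = 0.
    apply/eqP; apply: contraNT XW => xy0.
    rewrite -(scalerK xy0 X) memvZ //.
    have -> : (x + y) *: X = - (z *: Y) - ((y * ct.1) *: a0 + (y * ct.2 + w) *: v e).
      by apply/eqP; rewrite -opprD -addr_eq0 addrA h'.
    apply: memvB.
      by rewrite memvN; apply: memvZ; apply: (subvP (addvSl _ _)); apply: memv_line.
    apply: (subvP (addvSr _ _)); rewrite addrC.
    by rewrite memv_add ?memvZ ?memv_line.
  have z0 : z = 0.
    apply/eqP; apply: contraNT YS => z0; rewrite -(scalerK z0 Y) memvZ //.
    move: h'; rewrite xy0 scale0r add0r => /eqP; rewrite addr_eq0 => /eqP ->.
    by rewrite memvN addrC memv_add ?memvZ ?memv_line.
  move: h'; rewrite xy0 z0 !scale0r !add0r => /a0e[/eqP].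
  rewrite mulf_eq0 (negbTE ct0) orbF => /eqP y0; rewrite y0 mul0r add0r => ->.
  by move: xy0; rewrite y0 addr0.
have cXB : (#|XB| <= #|X1| + #|XD|)%N.
  by rewrite -(cardsID X1 XB) leq_add2r subset_leq_card ?subsetIr.
have cXX : (#|XX| <= #|XA| + #|XB|)%N.
  by rewrite -(cardsID XA XX) leq_add2r subset_leq_card ?subsetIr.
rewrite mulnS; move: cXX cXB cA c1 cD; rewrite /starC.
move: (#|F| ^ 2)%N (#|F| ^ 3)%N => a b.
move: ((a + a * b) * n)%N (a * b)%N; lia.
Qed.
End Star.

(** * From many stars to a clique *)

Lemma pigeonhole (I T : finType) (f : I -> T) (A : {set I}) m :
  (m * #|T| < #|A|)%N -> exists t, (m < #|[set i in A | f i == t]|)%N.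
Proof.
move=> h; apply/existsP; apply: contraLR h => /existsPn H; rewrite -leqNgt.
rewrite -sum1_card (partition_big f predT) //= mulnC -sum_nat_const.
apply: leq_sum => t _; rewrite sum1dep_card leqNgt.
have := H t; congr (~~ (_ < _)%N); apply: eq_card => i; by rewrite !inE.
Qed.

Section Extract.
Variables (F : fieldType) (V : vectType F).
Implicit Types (U K : {vspace V}) (l : seq V).

Lemma dim_add_line U (y : V) :
  \dim (<[y]> + U) = (\dim U + (y \notin U))%N.
Proof.
case: (boolP (y \in U)) => yU.
  by rewrite (addv_idPr _) ?addn0 // -memvE.
have y0 : y != 0 by apply: contraNneq yU => ->; rewrite mem0v.
rewrite dimv_disjoint_sum ?dim_vline ?y0 ?addn1 //.
apply/eqP; rewrite -subv0; apply/subvP => u /memv_capP[/vlineP[k ->] kU].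
case: (eqVneq k 0) => [->|k0]; first by rewrite scale0r mem0v.
by case/negP: yU; rewrite -(scalerK k0 y) memvZ.
Qed.

Lemma basis_extract l U : exists l', [/\ {subset l' <= l},
  (<<l'>> + U = <<l>> + U)%VS & \dim (<<l'>> + U) = (size l' + \dim U)%N].
Proof.
elim: l => [|x l [l' [sl el dl]]]; first by exists [::]; rewrite span_nil add0v.
case: (boolP (x \in <<l'>> + U)%VS) => xl.
  exists l'; split=> //; first by move=> y /sl yl; rewrite inE yl orbT.
  by rewrite span_cons -addvA -el; apply/esym/addv_idPr; rewrite -memvE.
exists (x :: l'); split.
- by move=> y; rewrite !inE => /orP[->//|/sl ->]; rewrite orbT.
- by rewrite !span_cons -!addvA el.
by rewrite span_cons -addvA dim_add_line xl dl /= addn1.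
Qed.

Lemma indep_mod_cat l1 l2 U :
  \dim (<<l1 ++ l2>> + U) = (size (l1 ++ l2) + \dim U)%N ->
  \dim (<<l1>> + U) = (size l1 + \dim U)%N.
Proof.
rewrite span_cat size_cat => h; apply/eqP; rewrite eqn_leq; apply/andP; split.
  by apply: leq_trans (dimv_add_leqif _ _) _; rewrite leq_add2r dim_span.
rewrite -(leq_add2l (size l2)) addnA (addnC (size l2)) -h.
rewrite (addvC <<l1>>%VS) -addvA.
by apply: leq_trans (dimv_add_leqif _ _) _; rewrite leq_add2r dim_span.
Qed.

Lemma indep_mod_map (p : 'End(V)) l U : lker p = U ->
  \dim (<<l>> + U) = (size l + \dim U)%N -> free (map p l).
Proof.
move=> kp h; rewrite /free size_map -limg_span; apply/eqP.
by apply: (@addIn (\dim (lker p))); rewrite dim_limg_addker kp.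
Qed.
End Extract.

(** * Aligning the spans of many stars *)

Section Stars.
Variables (F : finFieldType) (V : vectType F) (El : V -> Prop) (s : nat).
Variables (e : 'I_s -> V) (XX : 'I_s -> seq V).
Hypotheses (elX : forall i X, X \in XX i -> El X /\ El (X + e i))
  (elE : forall i, El (e i)).

Let E := <<[seq e i | i : 'I_s]>>%VS.
Let gain i K := (\dim (<<XX i>> + (E + K)) - \dim (E + K))%N.

(** Here [gain i K] is the rank left to star [i] once the centres and [K] are contracted.
    Contracting a vector costs 1 to each star whose span contains it, so a vector in fewer than [h]
    spans costs less than [h] in total. This happens at most [\dim H] times, and afterwards every
    surviving vector is shared by at least [h] spans. *)
Lemma stars_contract (H : {vspace V}) h : (E <= H)%VS ->
  (forall i X, X \in XX i -> X \in H) ->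
  exists Z : seq V, [/\ forall z, z \in Z -> El z /\ z \in H,
    \dim (E + <<Z>>) = (\dim E + \dim <<Z>>)%N,
    (\sum_i gain i 0 <= \sum_i gain i <<Z>> + h * \dim H)%N
  & forall j y, y \in XX j -> y \notin (E + <<Z>>)%VS ->
      (h <= #|[set i | y \in (<<XX i>> + (E + <<Z>>))%VS]|)%N].
Proof.
move=> EH XH.
suff: forall k (Z : seq V), (\dim H - \dim <<Z>> <= k)%N ->
    (forall z, z \in Z -> El z /\ z \in H) ->
    \dim (E + <<Z>>) = (\dim E + \dim <<Z>>)%N ->
    (\sum_i gain i 0 <= \sum_i gain i <<Z>> + h * \dim <<Z>>)%N ->
  exists Z : seq V, [/\ forall z, z \in Z -> El z /\ z \in H,
    \dim (E + <<Z>>) = (\dim E + \dim <<Z>>)%N,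
    (\sum_i gain i 0 <= \sum_i gain i <<Z>> + h * \dim H)%N
  & forall j y, y \in XX j -> y \notin (E + <<Z>>)%VS ->
      (h <= #|[set i | y \in (<<XX i>> + (E + <<Z>>))%VS]|)%N].
  move/(_ _ [::] (leqnn _)); apply=> //; rewrite span_nil ?addv0 ?dimv0 ?addn0 //.
  by rewrite muln0 addn0.
elim=> [|k IH] Z dZ Zel Zd Zs;
  have ZH : (<<Z>> <= H)%VS by [apply/span_subvP => z /Zel[]];
  case: (pickP (fun jy : {j : 'I_s & seq_sub (XX j)} =>
    (val (tagged jy) \notin (E + <<Z>>)%VS) &&
    (#|[set i | val (tagged jy) \in (<<XX i>> + (E + <<Z>>))%VS]| < h)%N)) => [[j y] /= /andP[yn yh]|none];
  try (exists Z; split=> //;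
    [ by apply: leq_trans Zs _; rewrite leq_add2l leq_mul2l dimvS ?orbT
    | by move=> j y yj yn; rewrite leqNgt; apply/negP => yh;
      have := none (Tagged (fun j => seq_sub (XX j)) (SeqSub yj)); rewrite /= yn yh]).
  have yH := XH _ _ (valP y).
  have : (<[val y]> + <<Z>> <= H)%VS by rewrite subv_add -memvE yH.
  move/dimvS; rewrite dim_add_line.
  have -> : val y \notin <<Z>>%VS by apply: contra yn; apply/subvP/addvSr.
  lia.
have yH := XH _ _ (valP y).
have ynZ : val y \notin <<Z>>%VS by apply: contra yn; apply/subvP/addvSr.
have eK : (E + <<val y :: Z>> = <[val y]> + (E + <<Z>>))%VS.
  by rewrite span_cons !addvA (addvC E).
have dy : \dim <<val y :: Z>> = (\dim <<Z>>).+1.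
  by rewrite span_cons dim_add_line ynZ addn1.
apply: (IH (val y :: Z)).
- rewrite dy; lia.
- by move=> z; rewrite inE => /orP[/eqP->|/Zel //]; have [] := elX (valP y).
- by rewrite eK dim_add_line yn dy Zd addn1 addnS.
apply: leq_trans Zs _; rewrite dy mulnS addnA leq_add2r.
apply: leq_trans (_ : \sum_i (gain i <<val y :: Z>>%VS +
   (val y \in (<<XX i>> + (E + <<Z>>))%VS)) <= _)%N; last first.
  rewrite big_split /= leq_add2l; apply: leq_trans (ltnW yh).
  by rewrite -sum1_card [leqRHS]big_mkcond /=; apply: leq_sum => i _; rewrite inE; case: (_ \in _).
apply: leq_sum => i _; rewrite /gain eK.
have -> : (<<XX i>> + (<[val y]> + (E + <<Z>>)) =
           <[val y]> + (<<XX i>> + (E + <<Z>>)))%VS.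
  by rewrite addvA (addvC <<XX i>>%VS) -addvA.
rewrite !dim_add_line yn.
by case: (val y \in _) => /=; lia.
Qed.

(** Some star keeps [N0] independent vectors, each in at least [h] spans. By double counting many
    spans contain [L] of them, and by pigeonhole more than [m] spans contain the same subset.
    Vectors of these stars that stick out of the common part are contracted until the spans
    agree. *)
Lemma stars_align (H : {vspace V}) N0 L h m : (E <= H)%VS ->
  (forall i X, X \in XX i -> X \in H) ->
  (s * N0 + h * \dim H < \sum_i gain i 0 + s)%N ->
  (s * L + N0 * m * 2 ^ N0 < N0 * h)%N ->
  exists (Z : seq V) (I : {set 'I_s}) (G : {vspace V}),
  [/\ forall z, z \in Z -> El z,
      \dim (E + <<Z>>) = (\dim E + \dim <<Z>>)%N,
      (m < #|I|)%N,
      forall i, i \in I -> (<<XX i>> + (E + <<Z>>) = G)%VS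
    & (L + \dim (E + <<Z>>) <= \dim G <= N0 + \dim (E + <<Z>>))%N].
Proof.
move=> EH XH hN hm.
have [Z [Zel Zd Zs Zh]] := stars_contract h EH XH.
set K := (E + <<Z>>)%VS in Zs Zh *.
have [i0 gi0] : exists i, (N0 <= gain i <<Z>>)%N.
  apply/existsP; apply: contraLR hN => /existsPn hg; rewrite -leqNgt.
  rewrite -(leq_add2r s) in Zs; apply: leq_trans Zs _.
  rewrite addnAC leq_add2r.
  have -> : (s * N0 = \sum_(i < s) N0)%N by rewrite sum_nat_const card_ord.
  have -> : (\sum_i gain i <<Z>> + s = \sum_(i < s) (gain i <<Z>>).+1)%N.
    rewrite [RHS](eq_bigr (fun i => gain i <<Z>> + 1)%N) => [|i _]; last by rewrite addn1.
    by rewrite big_split /= sum1_card card_ord.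
  by apply: leq_sum => i _; rewrite ltnNge hg.
have [l0 [l0X el0 dl0]] := basis_extract (XX i0) K.
have sl0 : (N0 <= size l0)%N.
  by move: gi0; rewrite /gain -/K -el0 dl0 addnK.
pose y (k : 'I_N0) := l0`_k.
have yX k : y k \in XX i0 by apply/l0X/mem_nth/(leq_trans (ltn_ord k)).
have dY : \dim (<<take N0 l0>> + K) = (N0 + \dim K)%N.
  have := @indep_mod_cat _ _ (take N0 l0) (drop N0 l0) K.
  by rewrite cat_take_drop size_takel // => ->.
have ytake k : y k \in take N0 l0.
  by rewrite /y -(nth_take 0 (ltn_ord k)) mem_nth // size_takel.
have ey (S : {set 'I_N0}) : \dim (<<[seq y k | k in S]>> + K) = (#|S| + \dim K)%N.
  have := @indep_mod_cat _ _ [seq y k | k in S] [seq y k | k in ~: S] K.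
  rewrite size_image; apply; rewrite size_cat !size_image cardsC card_ord -dY.
  congr (\dim (_ + _)); apply: eq_span => u; rewrite mem_cat.
  apply/orP/idP => [[] /imageP[k _ ->]|ut].
  - exact: ytake.
  - exact: ytake.
  have := ut; rewrite -index_mem size_takel // => ku.
  have eu : u = y (Ordinal ku) by rewrite /y /= -(nth_take _ ku) nth_index.
  by case: (boolP (Ordinal ku \in S)) => kS; [left|right];
     rewrite eu; apply: image_f; rewrite // inE.
have ynK k : y k \notin K.
  have := ey [set k]; rewrite cards1.
  have -> : <<[seq y i | i in [set k]]>>%VS = <[y k]>%VS.
    rewrite -span_seq1; apply: eq_span => u; rewrite inE.
    apply/imageP/eqP => [[j]|->]; first by rewrite inE => /eqP -> ->.
    by exists k; rewrite ?inE.
  by rewrite dim_add_line addnC => /addIn; case: (_ \notin _).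
pose f i := [set k | y k \in (<<XX i>> + K)%VS].
pose A := [set i | (L <= #|f i|)%N].
have cA : (m * #|{set 'I_N0}| < #|A|)%N.
  have dbl : (N0 * h <= \sum_i #|f i|)%N.
    have -> : (\sum_i #|f i| = \sum_(k < N0) #|[set i | y k \in (<<XX i>> + K)%VS]|)%N.
      under eq_bigr do rewrite -sum1_card big_mkcond /=.
      rewrite exchange_big /=; apply: eq_bigr => k _.
      rewrite -sum1_card [RHS]big_mkcond /=; apply: eq_bigr => i _.
      by rewrite !inE.
    have -> : (N0 * h = \sum_(k < N0) h)%N by rewrite sum_nat_const card_ord.
    apply: leq_sum => k _.
    by apply: Zh (yX k) (ynK k).
  have up : (\sum_i #|f i| <= s * L + N0 * #|A|)%N.
    rewrite (bigID (mem A)) /= addnC leq_add //.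
      have -> : (s * L = \sum_(i < s) L)%N by rewrite sum_nat_const card_ord.
      rewrite big_mkcond /=.
      by apply: leq_sum => i _; rewrite inE -ltnNge; case: ltnP => // /ltnW.
    rewrite mulnC -sum_nat_const; apply: leq_sum => i _.
    by have := max_card (mem (f i)); rewrite card_ord.
  have N00 : (0 < N0)%N.
    by move: hm; case: (N0) => //; rewrite !mul0n ltn0.
  rewrite -cardsT -powersetT card_powerset cardsT card_ord.
  rewrite -(ltn_pmul2l N00) mulnA.
  have h1 := leq_trans dbl up; have := leq_trans hm h1; by rewrite ltn_add2l.
have [S0 hS0] := pigeonhole f cA.
set I := [set i in A | f i == S0] in hS0.
have IS i : i \in I -> f i = S0 by rewrite inE => /andP[_ /eqP].
have [i1 i1I] : exists i, i \in I by apply/card_gt0P; apply: leq_ltn_trans hS0.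
have LS : (L <= #|S0|)%N by move: i1I; rewrite inE => /andP[+ /eqP <-]; rewrite inE.
pose Y1 := <<[seq y k | k in S0]>>%VS.
have dY1 : \dim (Y1 + K) = (#|S0| + \dim K)%N := ey S0.
have Y1X i (i_I : i \in I) : (Y1 <= <<XX i>> + K)%VS.
  apply/span_subvP => _ /imageP[k kS ->]; move: kS; rewrite -(IS i i_I).
  by rewrite inE.
(* The invariant keeps the shared vectors and the centres independent of what is contracted, so the
   rank of the common span stays between [L] and [N0]. *)
suff: forall k (Z2 : seq V), (\dim {:V} - \dim <<Z2>> <= k)%N ->
    (<<Z>> <= <<Z2>>)%VS -> (forall z, z \in Z2 -> El z) ->
    \dim (Y1 + (E + <<Z2>>)) = (#|S0| + \dim E + \dim <<Z2>>)%N ->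
  exists Z3 : seq V, [/\ (<<Z>> <= <<Z3>>)%VS, forall z, z \in Z3 -> El z,
    \dim (Y1 + (E + <<Z3>>)) = (#|S0| + \dim E + \dim <<Z3>>)%N
  & forall i X, i \in I -> X \in XX i -> X \in (Y1 + (E + <<Z3>>))%VS].
  move/(_ _ Z (leqnn _) (subvv _) (fun z h => (Zel z h).1)).
  case=> [|Z3 [ZZ3 Z3el Z3d Z3X]]; first by rewrite -/K dY1 -addnA -Zd.
  have Z3E : \dim (E + <<Z3>>) = (\dim E + \dim <<Z3>>)%N.
    apply/eqP; rewrite eqn_leq (dimv_add_leqif _ _) /=.
    rewrite -(leq_add2l #|S0|) addnA -Z3d.
    apply: leq_trans (dimv_add_leqif _ _) _; rewrite leq_add2r.
    by apply: leq_trans (dim_span _) _; rewrite size_image.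
  exists Z3, I, (Y1 + (E + <<Z3>>))%VS; split=> //.
    move=> i iI; apply/eqP; rewrite eqEsubv; apply/andP; split.
      rewrite subv_add addvSr andbT; apply/span_subvP => X; exact: Z3X.
    rewrite subv_add addvSr andbT; apply: subv_trans (Y1X i iI) _.
    by rewrite addvS // addvS.
  rewrite Z3d Z3E -addnA !leq_add2r LS /=.
  by have := max_card (mem S0); rewrite card_ord.
elim=> [|k IH] Z2 dZ2 ZZ2 Z2el Z2d.
  exists Z2; split=> // i X _ _; suff -> : <<Z2>>%VS = fullv.
    by rewrite !addvf memvf.
  by apply/eqP; rewrite eqEdim subvf -subn_eq0 -leqn0.
case: (pickP (fun jy : {j : 'I_s & seq_sub (XX j)} =>
    (tag jy \in I) && (val (tagged jy) \notin (Y1 + (E + <<Z2>>))%VS))) =>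
    [[j x] /= /andP[jI xn]|none]; last first.
  exists Z2; split=> // i X iI Xi; apply: contraT => Xn.
  by have := none (Tagged (fun j => seq_sub (XX j)) (SeqSub Xi)); rewrite /= iI Xn.
have xn2 : val x \notin <<Z2>>%VS.
  by apply: contra xn => hx; do 2!apply: (subvP (addvSr _ _)).
apply: (IH (val x :: Z2)).
- rewrite span_cons dim_add_line xn2; move: dZ2; clear; lia.
- by rewrite span_cons; apply: subv_trans ZZ2 (addvSr _ _).
- by move=> z; rewrite inE => /orP[/eqP->|/Z2el //]; have [] := elX (valP x).
have -> : (Y1 + (E + <<val x :: Z2>>) = <[val x]> + (Y1 + (E + <<Z2>>)))%VS.
  by rewrite span_cons (addvA E) (addvC E) -addvA addvA (addvC Y1) -addvA.
by rewrite dim_add_line xn Z2d span_cons dim_add_line xn2 addnA.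
Qed.
End Stars.

Lemma span_ordP (F : fieldType) (V : vectType F) s (e : 'I_s -> V) u :
  u \in <<[seq e i | i : 'I_s]>>%VS -> exists c : {ffun 'I_s -> F}, u = \sum_i c i *: e i.
Proof.
rewrite -[[seq e i | i : 'I_s]]/(tval (map_tuple e (ord_tuple s))) => /coord_span h.
exists [ffun i => coord (map_tuple e (ord_tuple s)) i u]; rewrite {1}h.
apply: eq_bigr => i _; rewrite ffunE; congr (_ *: _).
by rewrite (nth_map i) ?size_enum_ord // nth_ord_enum.
Qed.

(** * A clique inside aligned stars *)

Section Core.
Variables (F : finFieldType) (V : vectType F) (n D : nat).
Variables (e : 'I_n.+1 -> V) (b : 'I_n.+1 -> 'I_D -> V).
Hypotheses (fe : free [seq e a | a : 'I_n.+1])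
  (be : forall a k, b a k - b ord0 k \in <<[seq e a | a : 'I_n.+1]>>%VS)
  (b0 : forall d : 'I_D -> F, \sum_k d k *: b ord0 k \in <<[seq e a | a : 'I_n.+1]>>%VS ->
     forall k, d k = 0)
  (hD : (n.+1 * #|F| ^ (n.+1 * n.+1) < D)%N).

(** By pigeonhole [n.+1] indices have the same offsets between the stars, so [el i (kk m)] splits
    into a vector depending on [m] and a vector w_i. Contracting the matching [el m (kk m)]
    identifies the former with - w_m and turns [el i (kk j)] into w_i - w_j, an edge of a clique.
    The offsets alone might coincide; [al] and [ep] make the w_i affinely independent, since the two
    choices of [ep] at [a] differ by [e a]. *)
Lemma clique_core : exists (al : 'I_n.+1 -> 'I_n.+1) (ep : 'I_n.+1 -> bool)
    (kk : 'I_n.+1 -> 'I_D),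
  let el i k := b (al i) k + (ep i)%:R *: e (al i) in
  (forall i j m m', el i (kk m) - el j (kk m) = el i (kk m') - el j (kk m')) /\
  (forall c : 'I_n.+1 -> F, \sum_i c i = 0 ->
     \sum_i c i *: (el i (kk ord0) - el ord0 (kk ord0)) \in
        <<[seq el m (kk m) | m : 'I_n.+1]>>%VS -> forall i, c i = 0).
Proof.
pose E := <<[seq e a | a : 'I_n.+1]>>%VS.
have /fin_all_exists[c0 c0P] : forall ak : 'I_n.+1 * 'I_D, exists c : {ffun 'I_n.+1 -> F},
    b ak.1 ak.2 - b ord0 ak.2 = \sum_i c i *: e i by move=> ak; apply/span_ordP/be.
pose pat k : {ffun 'I_n.+1 * 'I_n.+1 -> F} := [ffun x => c0 (x.1, k) x.2].
have [P hP] : exists P, (n.+1 < #|[set k in [set: 'I_D] | pat k == P]|)%N.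
  by apply: pigeonhole; rewrite card_ffun card_prod !card_ord cardsT card_ord.
set TT := [set k in [set: 'I_D] | pat k == P] in hP.
have /card_gt0P[k0 k0T] : (0 < #|TT|)%N by apply: leq_ltn_trans hP.
pose kk (m : 'I_n.+1) : 'I_D := nth k0 (enum TT) m.
have sT : (n.+1 <= size (enum TT))%N by rewrite -cardE ltnW.
have kkT m : pat (kk m) = P.
  have : kk m \in TT by rewrite -mem_enum mem_nth // (leq_trans (ltn_ord m)).
  by rewrite !inE => /eqP.
have kk_inj : injective kk.
  move=> m m' /eqP; rewrite nth_uniq ?enum_uniq ?(leq_trans (ltn_ord _)) //.
  by move/eqP/val_inj.
pose u a := \sum_i P (a, i) *: e i.
have bu a m : b a (kk m) = b ord0 (kk m) + u a.
  apply/eqP; rewrite addrC -subr_eq (c0P (a, kk m)) /u; apply/eqP.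
  by apply: eq_bigr => i _; rewrite -(kkT m) ffunE.
have uE a : u a \in E.
  by apply: memv_suml => i _; apply/memvZ/memv_span/image_f.
have eE a : e a \in E by apply/memv_span/image_f.
pose w (x : 'I_n.+1 * bool) := u x.1 + x.2%:R *: e x.1.
pose x0 : 'I_n.+1 * bool := (ord0, false).
have [l [lw el dl]] := basis_extract [seq w x - w x0 | x : ('I_n.+1 * bool)%type] 0.
rewrite !addv0 dimv0 addn0 in el dl.
have fl : free l by rewrite /free dl.
have sl : (n < size l)%N.
  have dE : \dim E = n.+1 by rewrite /E (eqP fe) size_image card_ord.
  have : (\dim E <= size l)%N; last by rewrite dE.
  rewrite -dl el; apply/dimvS/span_subvP => _ /imageP[a _ ->].
  have -> : e a = (w (a, true) - w x0) - (w (a, false) - w x0).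
    by rewrite opprB addrA subrK /w /= scale1r scale0r addr0 addrAC subrr add0r.
  by rewrite memvB //; apply/memv_span/image_f.
have /fin_all_exists[pr prP] : forall i : 'I_n.+1, exists x : 'I_n.+1 * bool,
    w x - w x0 = if i == ord0 then 0 else l`_i.-1.
  move=> i; case: eqVneq => [_|i0]; first by exists x0; rewrite subrr.
  have : l`_i.-1 \in l.
    by apply: mem_nth; apply: leq_ltn_trans (leq_pred _) _; apply: leq_trans (ltn_ord i) _.
  by move/lw/imageP=> [x _ h]; exists x.
exists (fun i => (pr i).1), (fun i => (pr i).2), kk => el0.
have elE i m : el0 i (kk m) = b ord0 (kk m) + w (pr i).
  by rewrite /el0 bu addrA.
have subK (x y z : V) : (x + y) - (x + z) = y - z.
  by rewrite opprD addrACA subrr add0r.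
split=> [i j m m'|c c1].
  by rewrite !elE !subK.
have -> : \sum_i c i *: (el0 i (kk ord0) - el0 ord0 (kk ord0)) =
          \sum_(i < n) c (lift ord0 i) *: l`_i.
  rewrite big_ord_recl /= subrr scaler0 add0r; apply: eq_bigr => i _.
  rewrite !elE subK; congr (_ *: _).
  have -> : w (pr (lift ord0 i)) - w (pr ord0) =
    (w (pr (lift ord0 i)) - w x0) - (w (pr ord0) - w x0) by rewrite opprB addrA subrK.
  have -> : w (pr (lift ord0 i)) - w x0 = l`_i by rewrite prP.
  by rewrite prP eqxx subr0.
move/span_ordP => [d hd].
have d0 m : d m = 0.
  pose d' k := \sum_(m | kk m == k) d m.
  have : \sum_k d' k *: b ord0 k \in E.
    have -> : \sum_k d' k *: b ord0 k = \sum_m d m *: b ord0 (kk m).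
      rewrite [RHS](partition_big kk predT) //=; apply: eq_bigr => k _.
      by rewrite /d' scaler_suml; apply: eq_bigr => m' /eqP ->.
    have -> : \sum_m d m *: b ord0 (kk m) =
       \sum_(i < n) c (lift ord0 i) *: l`_i - \sum_m d m *: w (pr m).
      rewrite hd -sumrB; apply: eq_bigr => m' _.
      by rewrite elE scalerDr addrK.
    have wE x : w x \in E by rewrite memvD ?memvZ.
    apply: memvB; apply: memv_suml => i _; apply: memvZ => //.
    have : l`_i \in l by apply: mem_nth; apply: ltn_trans sl.
    by move/lw/imageP => [x _ ->]; rewrite memvB.
  move/b0/(_ (kk m)); rewrite /d' (big_pred1 m) // => m'.
  by apply/eqP/eqP => [/kk_inj|->].
have {}hd : \sum_(i < n) c (lift ord0 i) *: l`_i = 0.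
  by rewrite hd big1 // => m _; rewrite d0 scale0r.
have c2 i : c (lift ord0 i) = 0.
  pose g k := if insub k is Some i then c (lift ord0 i) else 0.
  have /freeP/(_ (fun k : 'I_(size l) => g k)) : free (in_tuple l) by [].
  have ->: \sum_(i0 < size l) g i0 *: (in_tuple l)`_i0 = \sum_(0 <= i0 < size l) g i0 *: l`_i0.
    by rewrite big_mkord.
  rewrite (@big_cat_nat _ _ _ n) ?(ltnW sl) //= big_mkord [X in _ + X]big_nat_cond.
  rewrite [X in _ + X]big1 ?addr0; last first.
    move=> k /andP[/andP[nk _] _]; rewrite /g insubF ?scale0r //.
    by apply/negbTE; rewrite -leqNgt.
  rewrite (eq_bigr (fun i : 'I_n => c (lift ord0 i) *: l`_i)); last first.
    by move=> k _; rewrite /g valK.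
  move/(_ hd (Ordinal (ltn_trans (ltn_ord i) sl))); rewrite /g /=.
  by rewrite valK.
move=> i; case: (unliftP ord0 i) => [j ->//|->].
by move: c1; rewrite big_ord_recl big1 ?addr0 // => j _; rewrite c2.
Qed.
End Core.

(** * Cliques as minors *)

(** A path is extended at its head by a neighbour other than its second vertex. If that neighbour is
    on the path it closes a cycle, and a path cannot outgrow [#|T|]. *)
Lemma graph_cycle (T : finType) (e : rel T) (x y : T) :
  symmetric e -> irreflexive e -> e x y ->
  (forall i j, e i j -> exists2 k, k != i & e j k) ->
  exists c : seq T, [/\ (2 < size c)%N, uniq c & cycle e c].
Proof.
move=> es ei exy deg.
suff: forall m x y p, (#|T| - size (x :: y :: p) <= m)%N ->
    path e x (y :: p) -> uniq (x :: y :: p) ->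
    exists c : seq T, [/\ (2 < size c)%N, uniq c & cycle e c].
  move/(_ _ x y [::] (leqnn _)); apply=> /=; rewrite ?exy // inE andbT.
  by apply: contraTneq exy => ->; rewrite ei.
move=> m; clear x y exy; elim: m => [|m IH] x y p hm pp up.
- have [k ky exk] : exists2 k, k != y & e x k.
    by apply: deg; move: pp => /= /andP[+ _]; rewrite es.
  have kx : k != x by apply: contraTneq exk => ->; rewrite ei.
  case: (boolP (k \in p)) => kp; last first.
    have : uniq (k :: x :: y :: p) by rewrite cons_uniq up !inE !negb_or kx ky kp.
    by move/card_uniqP => h; have := max_card (mem (k :: x :: y :: p)); rewrite h /=; move: hm; rewrite /=; lia.
  case/splitPr: kp up pp => p1 p2 up pp.
  exists (x :: y :: rcons p1 k); split=> //; first by rewrite /= size_rcons.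
    by move: up; rewrite -cat_rcons -2!cat_cons cat_uniq => /andP[].
  rewrite /= rcons_path last_rcons (es k) exk andbT.
  move: pp; rewrite -cat_rcons /= => /andP[-> /=].
  by rewrite cat_path => /andP[].
have [k ky exk] : exists2 k, k != y & e x k.
  by apply: deg; move: pp => /= /andP[+ _]; rewrite es.
have kx : k != x by apply: contraTneq exk => ->; rewrite ei.
case: (boolP (k \in p)) => kp; last first.
  apply: (IH k x (y :: p)).
  - by move: hm; rewrite /=; lia.
  - by rewrite /= es exk.
  by rewrite cons_uniq up !inE !negb_or kx ky kp.
case/splitPr: kp up pp => p1 p2 up pp.
exists (x :: y :: rcons p1 k); split=> //; first by rewrite /= size_rcons.
  by move: up; rewrite -cat_rcons -2!cat_cons cat_uniq => /andP[].
rewrite /= rcons_path last_rcons (es k) exk andbT.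
move: pp; rewrite -cat_rcons /= => /andP[-> /=].
by rewrite cat_path => /andP[].
Qed.


Lemma free_setP (F : fieldType) (V : vectType F) (T : finType) (w : T -> V)
    (S : {set T}) :
  (forall k : T -> F, \sum_(x in S) k x *: w x = 0 -> forall x, x \in S -> k x = 0) ->
  free (map w (enum S)).
Proof.
move=> H; rewrite -[map w _]/(tval (map_tuple w (enum_tuple S))).
apply/freeP => k hk i.
pose kA x := \sum_(j < #|S| | enum_val j == x) k j.
have kAE j : kA (enum_val j) = k j.
  by rewrite /kA (big_pred1 j) // => j'; apply/eqP/eqP => [/enum_val_inj|->].
rewrite -kAE; apply: H (enum_valP i).
rewrite big_enum_val -[RHS]hk; apply: eq_bigr => j _; rewrite kAE; congr (_ *: _).
by rewrite (nth_map (enum_default j)) ?size_tuple //; rewrite -cardE.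
Qed.

Lemma not_free_mem (F : fieldType) (V : vectType F) (T : finType) (w : T -> V)
    (S : {set T}) x : x \in S -> w x \in <<map w (enum (S :\ x))>>%VS ->
  ~~ free (map w (enum S)).
Proof.
move=> xS h; have pe : perm_eq (enum S) (x :: enum (S :\ x)).
  apply: uniq_perm; rewrite ?enum_uniq //= ?enum_uniq ?andbT ?mem_enum ?inE ?eqxx //.
  by move=> y; rewrite inE !mem_enum !inE; case: eqVneq => [->|].
by rewrite (perm_free (perm_map w pe)) /= free_cons h.
Qed.

Section Forest.
Variables (F : fieldType) (V : vectType F) (n : nat) (t : 'I_n -> V).
Hypothesis taff : forall c : 'I_n -> F, \sum_i c i = 0 ->
  \sum_i c i *: t i = 0 -> forall i, c i = 0.
Variables (S : {set {set 'I_n}}) (w : {set 'I_n} -> V).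
Hypothesis wS : forall A, A \in S -> exists i j c,
  [/\ i != j, A = [set i; j], c != 0 & w A = c *: (t i - t j)].

(** The edges with nonzero coefficient in a dependency form a graph without vertices of degree 1: a
    lone edge would leave its coefficient uncancelled in an affine dependency of the [t i]. Such a
    graph contains a cycle. *)
Lemma forest_free : forest S -> free (map w (enum S)).
Proof.
move=> fS; apply: free_setP => k hk A AS; apply/eqP; apply: contraT => kA.
pose e : rel 'I_n := [rel i j | ([set i; j] \in S) && (k [set i; j] != 0)].
have es : symmetric e by move=> i j; rewrite /e /= setUC.
have ei : irreflexive e.
  move=> i /=; apply/negP => /andP[/wS[a [b [c [ab E _ _]]]] _].
  have := cards1 i; have := cards2 a b; rewrite -E setUid ab => -> //.
have [x [y [c0 [xy EA c00 wA]]]] := wS AS.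
have exy : e x y by rewrite /e /= -EA AS kA.
have deg i j : e i j -> exists2 m, m != i & e j m.
  move=> eij; apply/exists_inP; apply: contraT; rewrite negb_exists_in => /forall_inP nj.
  have /fin_all_exists[g gP] : forall B : {set 'I_n}, exists d : 'I_n * 'I_n * F,
      B \in S -> [/\ d.1.1 != d.1.2, B = [set d.1.1; d.1.2], d.2 != 0
        & w B = d.2 *: (t d.1.1 - t d.1.2)].
    move=> B; case: (boolP (B \in S)) => [/wS[a [b [c h]]]|_].
      by exists (a, b, c).
    by exists (i, j, 0).
  pose cf m := \sum_(B in S) k B * (g B).2 * ((m == (g B).1.1)%:R - (m == (g B).1.2)%:R).
  have delta (a : 'I_n) : \sum_m (m == a)%:R *: t m = t a.
    rewrite (bigD1 a) //= eqxx scale1r big1 ?addr0 // => m /negbTE ->.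
    by rewrite scale0r.
  have delta1 (a : 'I_n) : \sum_m (m == a)%:R = 1 :> F.
    rewrite (bigD1 a) //= eqxx big1 ?addr0 // => m /negbTE -> //.
  have s1 : \sum_m cf m = 0.
    rewrite exchange_big big1 //= => B _; rewrite -mulr_sumr sumrB !delta1.
    by rewrite subrr mulr0.
  have s2 : \sum_m cf m *: t m = 0.
    rewrite -[RHS]hk; under eq_bigr do rewrite scaler_suml.
    rewrite exchange_big; apply: eq_bigr => B BS /=.
    have [_ _ _ ->] := gP B BS; rewrite scalerA.
    under eq_bigr do rewrite -scalerA scalerBl.
    by rewrite -scaler_sumr sumrB !delta.
  have := taff s1 s2 j; rewrite /cf.
  have eijS : [set i; j] \in S by case/andP: eij.
  rewrite (bigD1 [set i; j]) //= big1 ?addr0 => [/eqP|B /andP[BS Bij]]; last first.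
    have [d12 EB d0 _] := gP B BS.
    have mB := congr1 (fun A : {set 'I_n} => j \in A) EB; rewrite /= !inE in mB.
    case: (boolP (j \in B)) => jB; last first.
      have h1 : j == (g B).1.1 = false by apply: contraNF jB => h; rewrite mB h.
      have h2 : j == (g B).1.2 = false by apply: contraNF jB => h; rewrite mB h orbT.
      by rewrite h1 h2 subrr mulr0.
    have [m EBm mj] : exists2 m, B = [set j; m] & m != j.
      move: jB; rewrite mB => /orP[/eqP jE|/eqP jE].
        by exists (g B).1.2; [rewrite jE -EB | rewrite jE eq_sym].
      by exists (g B).1.1; [rewrite jE setUC -EB | rewrite jE].
    have -> : k B = 0; last by rewrite !mul0r.
    apply/eqP; apply: contraT => kB.
    have mi : m != i by apply: contraNneq Bij => <-; rewrite EBm setUC.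
    by have := nj m mi; rewrite /e /= -EBm BS kB.
  have [d12 EB d0 _] := gP _ eijS.
  have kij : k [set i; j] != 0 by case/andP: eij.
  rewrite !mulf_eq0 (negbTE kij) (negbTE d0) /=.
  have mB := congr1 (fun A : {set 'I_n} => j \in A) EB; rewrite /= !inE eqxx orbT in mB.
  move: d12 mB; case: (g [set i; j]).1 => a b /= ab /esym/orP[/eqP ja|/eqP jb].
    by rewrite -ja in ab *; rewrite eqxx (negbTE ab) subr0 oner_eq0.
  by rewrite -jb in ab *; rewrite eqxx (eq_sym j a) (negbTE ab) sub0r oppr_eq0 oner_eq0.
have [c [c2 uc cc]] := graph_cycle es ei exy deg.
have := fS c c2 uc; apply: contraNT => _.
by apply: sub_cycle cc => i j /andP[].
Qed.

(** Along a cycle the differences telescope, so the closing edge lies in the span of the others. *)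
Lemma free_forest : free (map w (enum S)) -> forest S.
Proof.
move=> fS [|x p] //= c2 /andP[xp up]; apply/negP; rewrite rcons_path => /andP[pp exl].
set A0 := [set last x p; x] in exl.
have [p0 [y py]] : exists p0 y, p = rcons p0 y.
  by case/lastP: p c2 {xp up pp exl A0} => // p0 y _; exists p0, y.
suff h : t x - t (last x p) \in <<map w (enum (S :\ A0))>>%VS.
  have nf := @not_free_mem _ _ _ w S A0 exl.
  suff /nf : w A0 \in <<map w (enum (S :\ A0))>>%VS by rewrite fS.
  have [i [j [c [ij EA c0 ->]]]] := wS exl; apply: memvZ.
  have xl : x != last x p.
    by apply: contraNneq xp => {1}->; rewrite py last_rcons mem_rcons inE eqxx.
  have : last x p \in [set i; j] by rewrite -EA !inE eqxx.
  have : x \in [set i; j] by rewrite -EA !inE eqxx orbT.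
  rewrite !inE => /orP[/eqP ex|/eqP ex] /orP[/eqP el|/eqP el].
  - by rewrite el ex eqxx in xl.
  - by rewrite -ex -el.
  - by rewrite -ex -el -memvN opprB.
  by rewrite el ex eqxx in xl.
have edge a b : [set a; b] \in S -> [set a; b] != A0 ->
    t a - t b \in <<map w (enum (S :\ A0))>>%VS.
  move=> abS abA; have [i [j [c [ij EA c0 wA]]]] := wS abS.
  have wm : t i - t j \in <<map w (enum (S :\ A0))>>%VS.
    rewrite -(scalerK c0 (t i - t j)) -wA; apply/memvZ/memv_span/map_f.
    by rewrite mem_enum !inE abA.
  have : a \in [set i; j] by rewrite -EA !inE eqxx.
  have : b \in [set i; j] by rewrite -EA !inE eqxx orbT.
  rewrite !inE => /orP[/eqP ->|/eqP ->] /orP[/eqP ->|/eqP ->]; rewrite ?subrr ?mem0v //.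
  by rewrite -memvN opprB.
(* The side conditions say that [x] can only occur as the head, and that a path from [x] to the last
   vertex has at least two edges; hence the closing edge is never traversed. *)
suff: forall q z, path [rel i j | [set i; j] \in S] z q -> uniq (z :: q) ->
   (z = x /\ last z q = last x p -> (1 < size q)%N) ->
   last z q = last x p -> (x \in z :: q -> z = x) ->
   t z - t (last z q) \in <<map w (enum (S :\ A0))>>%VS.
  by apply=> //=; rewrite ?xp.
elim=> [|b q IH] z /=; first by rewrite subrr mem0v.
move=> /andP[zb pq] /and3P[zbq bq uq] sq lq xz.
have -> : t z - t (last b q) = (t z - t b) + (t b - t (last b q)).
  by rewrite addrA subrK.
have bx : b != x.
  apply: contraNneq zbq => bx; rewrite (xz _) ?bx ?inE ?eqxx ?orbT //.
apply: memvD; last first.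
  apply: IH => //=; first by rewrite bq.
    by move=> [/eqP]; rewrite (negbTE bx).
  rewrite inE eq_sym (negbTE bx) /= => xq; have zx : z = x by apply: xz; rewrite !inE xq !orbT.
  by move: zbq; rewrite zx inE xq orbT.
apply: edge => //; apply/eqP => E.
have : x \in [set z; b] by rewrite E !inE eqxx orbT.
rewrite !inE (eq_sym x b) (negbTE bx) orbF => /eqP xz'.
have : last x p \in [set z; b] by rewrite E !inE eqxx.
rewrite !inE => /orP[/eqP h|/eqP h].
  by move: zbq; rewrite -h -lq mem_last.
have := sq (conj (esym xz') lq); case: q {IH sq uq pq} lq bq zbq xz => // b' q lq bq _ _ _.
by move: bq; rewrite -h -lq /= mem_last.
Qed.
End Forest.

(** All elements that vanish modulo [Z] are contracted and one element is kept for each pair. Affine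
    independence of the [t i] makes these elements distinct and identifies independent sets with
    forests. *)
Lemma MK_minor (F : fieldType) (V : vectType F) (M : matroid) (v : M -> V)
    (n : nat) (p : 'End(V)) (Z0 : seq M) (Z : seq V) (t : 'I_n -> V) :
  vrep v -> lker p = <<map v Z0>>%VS ->
  (forall z, z \in Z -> elt (fun x => p (v x)) z) ->
  (forall i j, i != j -> exists z, elt (fun x => p (v x)) z /\
      t i - t j - z \in <<Z>>%VS) ->
  (forall c : 'I_n -> F, \sum_i c i = 0 -> \sum_i c i *: t i \in <<Z>>%VS ->
     forall i, c i = 0) ->
  has_minor M (is_MK n).
Proof.
move=> rv kp Zel Zt taff.
pose C := [set x | p (v x) \in <<Z>>%VS].
have [p2 kp2] := exists_ker <<Z>>.
have kC : lker (p2 \o p)%VF = <<[seq v x | x in C]>>%VS.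
  apply/eqP; rewrite eqEsubv; apply/andP; split; last first.
    by apply/span_subvP => _ /imageP[x + ->]; rewrite inE memv_ker comp_lfunE -memv_ker kp2.
  have ZC : (<<Z>> <= p @: <<[seq v x | x in C]>>)%VS.
    apply/span_subvP => z zZ; have [x [c [c0 ez]]] := Zel z zZ.
    rewrite ez -linearZ; apply/memv_img/memvZ/memv_span/image_f.
    by rewrite inE -(scalerK c0 (p (v x))) -ez memvZ // memv_span.
  apply/subvP => u; rewrite memv_ker comp_lfunE -memv_ker kp2 => /(subvP ZC).
  case/memv_imgP => y yC pu; rewrite -(subrK y u) memvD //.
  have : u - y \in lker p by rewrite memv_ker linearB /= pu subrr.
  rewrite kp; apply: subvP; apply/span_subvP => _ /mapP[x xZ ->].
  apply/memv_span/image_f; rewrite inE; have : v x \in lker p.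
    by rewrite kp; apply/memv_span/map_f.
  by rewrite memv_ker => /eqP ->; rewrite mem0v.
have rc := vrep_contract rv kC.
pose t' i := p2 (t i).
have taff' (c : 'I_n -> F) : \sum_i c i = 0 -> \sum_i c i *: t' i = 0 -> forall i, c i = 0.
  move=> c1 c2; apply: taff c1 _; rewrite -kp2 memv_ker linear_sum -[X in _ == X]c2.
  by apply/eqP; apply: eq_bigr => i _; rewrite linearZ.
have tdist i j k l (c d : F) : i != j -> k != l -> c != 0 -> d != 0 ->
    c *: (t' i - t' j) = d *: (t' k - t' l) -> [set i; j] = [set k; l].
  move=> ij kl c0 d0 h.
  pose cf m : F := c * ((m == i)%:R - (m == j)%:R) - d * ((m == k)%:R - (m == l)%:R).
  have delta (a : 'I_n) : \sum_m (m == a)%:R *: t' m = t' a.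
    by rewrite (bigD1 a) //= eqxx scale1r big1 ?addr0 // => m /negbTE ->; rewrite scale0r.
  have delta1 (a : 'I_n) : \sum_m (m == a)%:R = 1 :> F.
    by rewrite (bigD1 a) //= eqxx big1 ?addr0 // => m /negbTE ->.
  have cf0 : forall m, cf m = 0.
    apply: taff'.
      by rewrite sumrB -!mulr_sumr !sumrB !delta1 !subrr !mulr0 subrr.
    under eq_bigr do rewrite scalerBl -!scalerA !scalerBl.
    by rewrite sumrB -!scaler_sumr !sumrB !delta h subrr.
  have hk m : (m \in [set k; l]) = (m \in [set i; j]).
    have := cf0 m; rewrite /cf !inE.
    have [mi|mi] := eqVneq m i; have [mj|mj] := eqVneq m j;
    have [mk|mk] := eqVneq m k; have [ml|ml] := eqVneq m l => //=;
      do ?[by move: ij; rewrite -mi -mj eqxx | by move: kl; rewrite -mk -ml eqxx];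
      move/eqP; rewrite ?subrr ?subr0 ?sub0r ?mulr0 ?mulrN ?mulr1 ?subr0 ?sub0r ?opprK ?oppr_eq0
        ?(negbTE c0) ?(negbTE d0) //.
  by apply/setP => m; rewrite hk.
pose P := {A : {set 'I_n} | #|A| == 2}.
have /fin_all_exists[yy yyP] : forall A : P, exists y : contract C, exists i j c,
    [/\ i != j, val A = [set i; j], c != 0
      & (p2 \o p)%VF (v (val y)) = c *: (t' i - t' j)].
  move=> [A A2]; have /cards2P[i [j [ij EA]]] := A2.
  have [z [[x [c [c0 ez]]] hz]] := Zt i j ij.
  have e1 : c *: p2 (p (v x)) = t' i - t' j.
    apply/eqP; rewrite eq_sym -subr_eq0 -linearZ -ez /t' -!linearB -memv_ker kp2.
    by [].
  have xC : x \in ~: C.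
    rewrite !inE -kp2 memv_ker; apply/negP => /eqP x0.
    have h1 : 1 *: (t' i - t' j) = 0 by rewrite scale1r -e1 x0 scaler0.
    pose cf m : F := (m == i)%:R - (m == j)%:R.
    have : cf i = 0.
      apply: taff'; rewrite /cf.
        rewrite sumrB (bigD1 i) //= eqxx big1 => [|m /negbTE -> //].
        rewrite (bigD1 j) //= eqxx big1 => [|m /negbTE -> //].
        by rewrite subrr.
      under eq_bigr do rewrite scalerBl.
      rewrite sumrB (bigD1 i) //= eqxx big1 => [|m /negbTE ->]; last by rewrite scale0r.
      rewrite (bigD1 j) //= eqxx big1 => [|m /negbTE ->]; last by rewrite scale0r.
      by rewrite !addr0 !scale1r -[RHS]h1 scale1r.
    by rewrite /cf eqxx (negbTE ij) subr0 => /eqP; rewrite oner_eq0.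
  exists (Sub x xC), i, j, c^-1; rewrite comp_lfunE SubK -e1 scalerK //.
  by rewrite invr_eq0 /= EA.
have yy_inj : injective yy.
  move=> A B eAB; have [i [j [c [ij EA c0 h1]]]] := yyP A.
  have [k [l [d [kl EB d0 h2]]]] := yyP B; apply: val_inj; rewrite EA EB.
  by apply: (tdist _ _ _ _ c d) => //; rewrite -h1 -h2 eAB.
pose D : {set contract C} := ~: (yy @: setT).
exists C, D.
have /fin_all_exists[g gP] : forall x : delete D, exists A : P, yy A = val x.
  move=> x; have : val x \in yy @: setT; last by move=> /imsetP[A _ ->]; exists A.
  apply: contraT => nx; have xD : val x \in D by rewrite inE nx.
  by have := valP x; rewrite inE xD.
have rd := @vrep_delete _ _ _ _ D rc.
have g_inj : injective g by move=> x y h; apply: val_inj; rewrite -!gP h.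
have gs A : exists x, g x = A.
  have hA : yy A \in ~: D by rewrite /D setCK imset_f.
  exists (Sub (yy A) hA); apply: yy_inj; rewrite gP SubK //.
exists (fun x => val (g x)); split.
- by move=> x y /val_inj/g_inj.
- apply/setP => A; rewrite inE; apply/imsetP/idP => [[x _ ->]|A2]; first exact: (valP (g x)).
  by have [x ex] := gs (Sub A A2 : P); exists x; rewrite ?ex ?SubK.
move=> X; rewrite /indep rd.
pose S := [set val (g x) | x in X].
pose w (A : {set 'I_n}) : V := if insub A is Some A' then (p2 \o p)%VF (v (val (yy A'))) else 0.
have wg x : w (val (g x)) = (p2 \o p)%VF (v (val (val x))).
  by rewrite /w valK gP.
have wS A : A \in S -> exists i j c, [/\ i != j, A = [set i; j], c != 0
    & w A = c *: (t' i - t' j)].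
  case/imsetP => x _ ->; have [i [j [c [ij EA c0 h1]]]] := yyP (g x).
  by exists i, j, c; split=> //; rewrite /w valK h1.
have cS : #|S| = #|X| by rewrite card_imset // => x y /val_inj/g_inj.
have -> : (\dim <<[seq (p2 \o p)%VF (v (val (val x))) | x in X]>> == #|X|) =
          free (map w (enum S)).
  rewrite /free size_map -cardE cS; congr (\dim _ == _); apply: eq_span => u.
  apply/imageP/mapP => [[x xX ->]|[A]].
    by exists (val (g x)); rewrite ?wg // mem_enum; apply/imsetP; exists x.
  by rewrite mem_enum => /imsetP[x xX ->] ->; exists x; rewrite ?wg.
by split=> [/(free_forest wS)|/(forest_free taff' wS)].
Qed.

Lemma stars_clique (F : finFieldType) (kap n : nat) : (0 < kap)%N ->
  exists s rho0 : nat, forall (V : vectType F) (El : V -> Prop) (e : 'I_s -> V)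
    (XX : 'I_s -> seq V) (H : {vspace V}),
  (forall i X, X \in XX i -> El X /\ El (X + e i)) -> (forall i, El (e i)) ->
  free [seq e i | i : 'I_s] -> (<<[seq e i | i : 'I_s]>> <= H)%VS ->
  (forall i X, X \in XX i -> X \in H) ->
  (forall i, \dim H <= kap * \dim <<XX i>>)%N -> (rho0 <= \dim H)%N ->
  exists (Z : seq V) (t : 'I_n.+1 -> V),
  [/\ forall z, z \in Z -> El z,
      forall i j, i != j -> exists z, El z /\ t i - t j - z \in <<Z>>%VS
    & forall c : 'I_n.+1 -> F, \sum_i c i = 0 -> \sum_i c i *: t i \in <<Z>>%VS ->
      forall i, c i = 0].
Proof.
move=> kap0.
have q0 : (0 < #|F|)%N by apply/card_gt0P; exists 0.
(* [L] is what [clique_core] requires, and [m] is [n.+1] times the number of coordinate matrices of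
   size at most [N0]. With [s = 2 * kap * h] the star ranks add up to at least [2 * h * \dim H]. The
   choice of [N0] makes [s * L] half of [N0 * h], and [h] exceeds [2 * m * 2 ^ N0] to cover the
   other half. *)
pose L := (n.+1 * #|F| ^ (n.+1 * n.+1)).+1.
pose N0 := (4 * kap * L)%N.
pose m := (n.+1 * #|F| ^ (N0 * N0))%N.
pose h := (2 * m * 2 ^ N0).+1.
pose s := (2 * kap * h)%N.
exists s, (s * N0 + s * s).+1 => V El e XX H elX elE fe EH XH dXX dH.
set E := <<[seq e i | i : 'I_s]>>%VS in EH.
have dE : \dim E = s by rewrite /E (eqP fe) size_image card_ord.
have c1 : (s * N0 + h * \dim H < \sum_i (\dim (<<XX i>> + (E + 0)) - \dim (E + 0)) + s)%N.
  have g1 i : (\dim <<XX i>> <= \dim (<<XX i>> + (E + 0)) - \dim (E + 0) + s)%N.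
    have := dimvS (addvSl <<XX i>>%VS (E + 0)%VS); rewrite addv0 dE; lia.
  have g2 : (\sum_i \dim <<XX i>> <=
      \sum_i (\dim (<<XX i>> + (E + 0)) - \dim (E + 0)) + s * s)%N.
    apply: (@leq_trans (\sum_(i < s) (\dim (<<XX i>> + (E + 0)) - \dim (E + 0) + s)%N)).
      by apply: leq_sum => i _; apply: g1.
    by rewrite big_split /= sum_nat_const card_ord.
  have g3 : (kap * (2 * h * \dim H) <= kap * \sum_i \dim <<XX i>>)%N.
    rewrite big_distrr /=; apply: leq_trans (_ : \sum_(i < s) \dim H <= _)%N.
      by rewrite sum_nat_const card_ord /s mulnA; apply: eq_leq; congr (_ * _)%N; lia.
    exact: leq_sum.
  rewrite leq_pmul2l // in g3; move: g2 g3 dH; rewrite -/L -/N0.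
  have : (\dim H <= h * \dim H)%N by rewrite leq_pmull.
  move: (\sum_i \dim _)%N (\sum_i (_ - _))%N (h * \dim H)%N (\dim H) (s * N0)%N (s * s)%N.
  by move=> a b c d x y; rewrite -mulnA; lia.
have c2 : (s * L + N0 * m * 2 ^ N0 < N0 * h)%N.
  have -> : (s * L = 2 * kap * L * h)%N by rewrite /s; lia.
  have -> : (N0 * m * 2 ^ N0 = 2 * kap * L * (2 * m * 2 ^ N0))%N by rewrite {1}/N0; lia.
  have -> : (N0 * h = 2 * kap * L * h + 2 * kap * L * h)%N by rewrite {1}/N0; lia.
  rewrite ltn_add2l ltn_pmul2l; first exact: ltnSn.
  by rewrite !muln_gt0 kap0.
have [Z [I [G [Zel Zd Im IG /andP[GL GN]]]]] := stars_align elX EH XH c1 c2.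
set K := (E + <<Z>>)%VS in Zd IG GL GN.
have [q kq] := exists_ker K.
have /fin_all_exists[l lP] : forall i : 'I_s, exists l : seq V,
    i \in I -> [/\ {subset l <= XX i}, (<<l>> + K = G)%VS & \dim G = (size l + \dim K)%N].
  move=> i; have [l [l1 l2 l3]] := basis_extract (XX i) K.
  by exists l => iI; rewrite -(IG i iI) -/K -l2.
pose G' := (q @: G)%VS; set D := \dim G'.
have i1I : exists i, i \in I by apply/card_gt0P; apply: leq_ltn_trans Im.
have KG : (K <= G)%VS by case: i1I => i iI; rewrite -(IG i iI) addvSr.
have dG : (D + \dim K = \dim G)%N.
  by rewrite /D /G' -kq dim_limg_addker kq (addv_idPl KG).
have sl i : i \in I -> size (l i) = D.
  by move/lP => [_ _]; rewrite -dG => /addIn ->.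
have DL : (L <= D)%N by move: GL; rewrite -dG leq_add2r.
have DN : (D <= N0)%N by move: GN; rewrite -dG leq_add2r.
(* Stars with equal coordinate matrices have bases that agree modulo [K], index by index, as
   [clique_core] requires. *)
pose ph (i : 'I_s) : {ffun 'I_D * 'I_D -> F} :=
  [ffun x : 'I_D * 'I_D => coord (vbasis G') x.2 (q (l i)`_(x.1 : 'I_D))].
have [ph0 hph] : exists ph0, (n.+1 < #|[set i in I | ph i == ph0]|)%N.
  apply: pigeonhole; apply: leq_ltn_trans Im; rewrite leq_mul2l /=.
  by rewrite card_ffun card_prod card_ord leq_pexp2l // leq_mul.
set J0 := [set i in I | _] in hph.
have [i0 i0J] : exists i, i \in J0 by apply/card_gt0P; apply: leq_ltn_trans hph.
pose j (a : 'I_n.+1) : 'I_s := nth i0 (enum J0) a.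
have sJ : (n.+1 <= size (enum J0))%N by rewrite -cardE ltnW.
have jJ a : j a \in J0 by rewrite -mem_enum mem_nth // (leq_trans (ltn_ord a)).
have jI a : j a \in I by have := jJ a; rewrite inE => /andP[].
have j_inj : injective j.
  move=> a b /eqP; rewrite nth_uniq ?enum_uniq ?(leq_trans (ltn_ord _)) //.
  by move/eqP/val_inj.
have lG i k : i \in I -> (k < D)%N -> (l i)`_k \in G.
  move=> iI kD; have [_ <- _] := lP i iI; apply: (subvP (addvSl _ _)).
  by apply/memv_span/mem_nth; rewrite sl.
have qj a (k : 'I_D) : q (l (j a))`_k = q (l (j ord0))`_k.
  have mG b : q (l (j b))`_k \in G' by apply/memv_img/lG.
  rewrite (coord_vbasis (mG a)) (coord_vbasis (mG ord0)).
  apply: eq_bigr => x _; congr (_ *: _).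
  have e1 b : coord (vbasis G') x (q (l (j b))`_k) = ph0 (k, x).
    by have := jJ b; rewrite inE => /andP[_ /eqP <-]; rewrite ffunE.
  by rewrite !e1.
pose Sc := [seq e i | i in ~: (j @: setT)].
pose ES := [seq e (j a) | a : 'I_n.+1].
have [p kp] := exists_ker <<Z ++ Sc>>.
have ESc : (<<ES>> + <<Sc>> = E)%VS.
  apply/eqP; rewrite eqEsubv subv_add; apply/andP; split; first apply/andP; first split;
    try by apply/span_subvP => _ /imageP[a _ ->]; apply/memv_span/image_f.
  apply/span_subvP => _ /imageP[i _ ->]; case: (boolP (i \in j @: setT)) => ij.
    apply: (subvP (addvSl _ _)); case/imsetP: ij => a _ ->.
    by apply/memv_span/image_f.
  by apply: (subvP (addvSr _ _)); apply/memv_span/image_f; rewrite inE.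
have ESK : (<<ES>> + lker p = K)%VS.
  by rewrite kp span_cat (addvC <<Z>>%VS) addvA ESc.
have fe' : free [seq p (e (j a)) | a : 'I_n.+1].
  rewrite /free size_image card_ord eqn_leq; apply/andP; split.
    by apply: leq_trans (dim_span _) _; rewrite size_image card_ord.
  have := dim_map_ker (fun a => e (j a)) p (enum 'I_n.+1).
  rewrite -/ES ESK Zd dE kp => hd.
  have : (\dim <<Z ++ Sc>> <= \dim <<Z>> + (s - n.+1))%N.
    rewrite span_cat; apply: leq_trans (dimv_add_leqif _ _) _; rewrite leq_add2l.
    apply: leq_trans (dim_span _) _; rewrite size_image.
    have := cardsC (j @: setT); rewrite card_imset // cardsT !card_ord; lia.
  have : (n.+1 <= s)%N.
    by have := max_card (mem (j @: setT)); rewrite card_imset // cardsT !card_ord.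
  move: hd; rewrite /image_mem; move: (\dim <<[seq p (e (j x)) | x <- enum 'I_n.+1]>>) => x.
  lia.
pose b a (k : 'I_D) := p (l (j a))`_k.
have be a k : b a k - b ord0 k \in <<[seq p (e (j a)) | a : 'I_n.+1]>>%VS.
  have : (l (j a))`_k - (l (j ord0))`_k \in K.
    by rewrite -kq memv_ker linearB /= qj subrr.
  rewrite -ESK => /memv_addP[x xE [y yk e1]].
  have -> : b a k - b ord0 k = p x.
    by rewrite -linearB e1 linearD /=; move: yk; rewrite memv_ker => /eqP ->; rewrite addr0.
  by have := memv_img p xE; rewrite limg_span -map_comp.
have b0 (d : 'I_D -> F) : \sum_k d k *: b ord0 k \in <<[seq p (e (j a)) | a : 'I_n.+1]>>%VS ->
    forall k, d k = 0.
  move=> hd; have fl : free (map q (l (j ord0))).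
    have [_ e1 e2] := lP _ (jI ord0).
    by apply: (indep_mod_map kq); rewrite e1 e2.
  have : \sum_k d k *: (l (j ord0))`_k \in K.
    rewrite -ESK; have : p (\sum_k d k *: (l (j ord0))`_k) \in (p @: <<ES>>)%VS.
      rewrite linear_sum limg_span -map_comp; under eq_bigr do rewrite linearZ /=.
      exact: hd.
    case/memv_imgP => x xE e1; rewrite -(subrK x (\sum_k _)) addrC memv_add //.
    by rewrite memv_ker linearB /= e1 subrr.
  rewrite -kq memv_ker linear_sum => /eqP hs k.
  have slq : size (map q (l (j ord0))) = D by rewrite size_map sl.
  have tq : size (map q (l (j ord0))) == D by rewrite slq.
  have /freeP/(_ d) : free (Tuple tq) by [].
  apply; rewrite -[RHS]hs; apply: eq_bigr => x _; rewrite linearZ /=.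
  by rewrite (nth_map 0) // sl.
have [al [ep [kk [core1 core2]]]] := clique_core fe' be b0 DL.
pose EL i k := (l (j (al i)))`_(k : 'I_D) + (ep i)%:R *: e (j (al i)).
have pEL i k : p (EL i k) = b (al i) k + (ep i)%:R *: p (e (j (al i))).
  by rewrite /EL linearD linearZ.
have elEL i k : El (EL i k).
  have [sX _ _] := lP _ (jI (al i)).
  have kl : (k < size (l (j (al i))))%N by rewrite sl.
  have [h1 h2] := elX _ _ (sX _ (mem_nth 0 kl)).
  by rewrite /EL; case: (ep i); rewrite ?scale1r ?scale0r ?addr0.
pose Zf := (Z ++ Sc) ++ [seq EL i (kk i) | i : 'I_n.+1].
have ZfP u : p u \in <<[seq p (EL i (kk i)) | i : 'I_n.+1]>>%VS -> u \in <<Zf>>%VS.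
  rewrite /image_mem (map_comp p (fun i => EL i (kk i))) -limg_span => /memv_imgP[x xE e1].
  rewrite /Zf span_cat -kp -(subrK x u) memv_add //.
  by rewrite memv_ker linearB /= e1 subrr.
have ZfP' u : u \in <<Zf>>%VS -> p u \in <<[seq p (EL i (kk i)) | i : 'I_n.+1]>>%VS.
  rewrite /Zf span_cat -kp => /memv_addP[x xk [y yE ->]]; rewrite linearD /=.
  move: xk; rewrite memv_ker => /eqP ->; rewrite add0r.
  by have := memv_img p yE; rewrite limg_span -map_comp.
exists Zf, (fun i => EL i (kk ord0) - EL ord0 (kk ord0)); split.
- move=> z; rewrite !mem_cat => /orP[/orP[/Zel //|/imageP[i _ -> //]]|/imageP[i _ ->]].
  exact: elEL.
- move=> i j' _; exists (EL i (kk j')); split; first exact: elEL.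
  apply: ZfP; set X := <<_>>%VS.
  have -> : p (EL i (kk ord0) - EL ord0 (kk ord0) - (EL j' (kk ord0) - EL ord0 (kk ord0))
     - EL i (kk j')) = - p (EL j' (kk j')).
    rewrite opprB addrA subrK linearB linearB /= !pEL.
    by rewrite (core1 i j' ord0 j') addrAC subrr sub0r.
  by rewrite memvN; apply/memv_span/image_f.
move=> c cs /ZfP' hc; apply: core2 cs _; move: hc.
rewrite linear_sum; under eq_bigr do rewrite linearZ linearB /= !pEL.
by rewrite (eq_image (fun=> erefl) (fun i => pEL i (kk i))).
Qed.

(** * A dense matroid has a clique minor *)

Definition psimple (F : fieldType) (V : vectType F) (T : finType) (w : T -> V)
    (Y : {set T}) :=
  forall x y, x \in Y -> y \in Y -> w x != 0 /\ (w y \in <[w x]>%VS -> x = y).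

Section DenseStar.
Variables (F : finFieldType) (F' : fieldType) (d : nat) (V' : vectType F').
Local Notation V := 'rV[F]_d.
Hypotheses (n2 : 2 \notin [pchar F']) (c2 : 2 \in [pchar F]).
Variables (T : finType) (w : T -> V) (w' : T -> V').
Hypothesis tw : twin w w'.

(** Contracting [e] lowers the threshold by about [rho / 2], and the parallel classes number at most
    the new threshold, so about [rho / 2] elements are lost. A long line accounts for at most
    [#|F| ^ 2] of them; hence the long lines through [e] are linearly many, and [star_card] turns
    their number into a rank. *)
Lemma dense_star (Y : {set T}) (e : T) (K rho : nat) :
  psimple w Y -> e \in Y ->
  (forall (p1 : 'End(V)) (Y1 : {set T}), lker p1 = <[w e]>%VS ->
     psimple (fun x => p1 (w x)) Y1 -> (4 * #|Y1| <= 4 * K + (rho.-1) ^ 2)%N) ->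
  (4 * K + rho ^ 2 < 4 * #|Y|)%N -> (4 <= rho)%N ->
  exists XX : seq V, (forall X, X \in XX -> elt w X /\ elt w (X + w e)) /\
    (rho <= 4 * #|F| ^ 2 * starC F * \dim <<XX>>)%N.
Proof.
move=> sY eY minY dY rho4.
have e0 : w e != 0 by have [] := sY e e eY eY.
pose D := Y :\ e; pose cls (x : T) : {vspace V} := (<[w e]> + <[w x]>)%VS.
have DY x : x \in D -> x \in Y by case/setD1P.
have De x : x \in D -> w x \notin <[w e]>%VS.
  by case/setD1P=> xe xY; apply: contra xe => /(sY e x eY xY).2 ->.
pose rep (x : T) : T := odflt x [pick y in D | cls y == cls x].
have repD x : x \in D -> rep x \in D /\ cls (rep x) = cls x.
  move=> xD; rewrite /rep; case: pickP => [y /andP[yD /eqP ey]|/(_ x)] //=.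
have repE x y : x \in D -> cls x = cls y -> rep x = rep y.
  move=> xD exy; rewrite /rep exy; case: pickP => //= /(_ x).
  by rewrite !inE in xD *; rewrite xD exy eqxx.
have clsP x y : x \in D -> y \in D -> w y \in cls x -> cls x = cls y.
  move=> xD yD yx; apply/esym/eqP; rewrite eqEdim /cls; apply/andP; split.
    by apply/subvP => u; apply/subvP; rewrite subv_add addvSl -memvE.
  have dl z : z \in D -> \dim (<[w e]> + <[w z]>) = 2.
    by move=> zD; rewrite addvC dim_add_line (De _ zD) dim_vline e0.
  by rewrite !dl.
(* [R] has one element on each line through [e]; [RL] keeps those whose line carries a further
   element, that is the long lines. *)
pose R := rep @: D; pose RL := rep @: (D :\: R).
have RD x : x \in R -> x \in D /\ rep x = x.
  case/imsetP => y yD ->; have [ryD cy] := repD y yD.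
  by split=> //; apply: repE.
have sR : (4 * #|R| <= 4 * K + (rho.-1) ^ 2)%N.
  have [p1 kp1] := exists_ker <[w e]>%VS.
  apply: (minY p1 R kp1) => x y xR yR; have [xD rx] := RD _ xR; have [yD ry] := RD _ yR.
  split; first by rewrite -memv_ker kp1 De.
  case/vlineP=> c ec; rewrite -rx -ry; apply: repE => //; apply: clsP => //.
  have : w y - c *: w x \in lker p1 by rewrite memv_ker linearB linearZ /= ec subrr.
  rewrite kp1 => h; rewrite -(subrK (c *: w x) (w y)) /cls memv_add // memvZ ?memv_line //.
have cY : #|Y| = #|D|.+1 by rewrite (cardsD1 e) eY.
have cDR : (#|D :\: R| + #|R| = #|D|)%N.
  rewrite cardsD (setIidPr _) ?subnK //; first by apply: leq_imset_card.
  by apply/subsetP => x /RD[].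
have inj x y : x \in Y -> y \in Y -> w x = w y -> x = y.
  by move=> xY yY exy; apply: (sY x y xY yY).2; rewrite exy memv_line.
have cRL : (#|D :\: R| <= #|F| ^ 2 * #|RL|)%N.
  rewrite leqNgt; apply/negP => lt.
  have : (#|F| ^ 2 * #|[set: {x | x \in RL}]| < #|D :\: R|)%N.
    by rewrite cardsT card_sig; move: lt; congr (_ < _)%N; congr (_ * _)%N; apply: eq_card.
  rewrite cardsT => lt'.
  have rRL x : x \in D :\: R -> rep x \in RL by move=> xDR; apply: imset_f.
  have [x0 x0D] : exists x0, x0 \in D :\: R.
    by apply/card_gt0P; apply: leq_ltn_trans lt'.
  have [t] := pigeonhole (fun x => insubd (Sub (rep x0) (rRL _ x0D) : {x | x \in RL}) (rep x)) lt'.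
  set S := [set _ in _ | _]; rewrite ltnNge => /negP; apply.
  have SP x : x \in S -> [/\ x \in D & rep x = val t].
    rewrite !inE => /andP[/andP[xR xD] /eqP <-]; rewrite insubdK //.
    by apply: (rRL x); rewrite !inE xR xD.
  rewrite -(card_in_imset (f := w) (D := S)); last first.
    by move=> x y /SP[/DY xY _] /SP[/DY yY _]; apply: inj.
  apply: (@card_sub_vspace F d _ (cls (val t))).
    move=> _ /imsetP[x /SP[xD rx] ->]; rewrite -rx (repD x xD).2 /cls.
    by rewrite (subvP (addvSr _ _)) ?memv_line.
  by rewrite /cls addvC dim_add_line dim_vline e0; case: (_ \notin _).
have exX z : z \in RL -> exists X, [/\ exists2 c, c != 0 & X = c *: w z,
    elt w X & elt w (X + w e)].
  case/imsetP => x /setDP[xD xR] ez; have [zD cz] := repD x xD; rewrite -ez in zD cz.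
  have xz : x != z by apply: contraNneq xR => ->; rewrite ez; apply: imset_f.
  have : w x \in cls z by rewrite cz /cls (subvP (addvSr _ _)) ?memv_line.
  case/memv_addP => _ /vlineP[b ->] [_ /vlineP[a ->] ex].
  have a0 : a != 0.
    by apply: contraNneq (De _ xD) => a0; rewrite ex a0 scale0r addr0 memvZ ?memv_line.
  have b0 : b != 0.
    apply: contraNneq xz => b0; apply/eqP/esym/(sY z x (DY _ zD) (DY _ xD)).2.
    by rewrite ex b0 scale0r add0r memvZ ?memv_line.
  exists ((a / b) *: w z); have ab0 : a / b != 0 by rewrite mulf_neq0 ?invr_eq0.
  split; [by exists (a / b) | by exists z, (a / b) | exists x, b^-1].
  by rewrite invr_eq0 ex scalerDr !scalerA mulVf // scale1r addrC (mulrC a).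
pose good z (X : V) := [/\ exists2 c, c != 0 & X = c *: w z, elt w X & elt w (X + w e)].
have [Xf XfP] : exists Xf : T -> V, forall z, z \in RL -> good z (Xf z).
  have h z : exists X, z \in RL -> good z X.
    case zRL : (z \in RL); last by exists 0.
    by have [X gX] := exX z zRL; exists X.
  exists (fun z => projT1 (boolp.cid (h z))) => z.
  by case: (boolp.cid _).
pose XX := Xf @: RL.
have XXP X : X \in XX -> exists2 z, z \in RL & X = Xf z /\ good z X.
  by case/imsetP => z zR ->; exists z => //; split=> //; apply: XfP.
have RLD z : z \in RL -> z \in D /\ rep z = z.
  case/imsetP => x /setDP[xD _] ->; have [rxD cx] := repD x xD.
  by split=> //; apply: repE.
have injX : {in RL &, forall y z, Xf y - Xf z \in <[w e]>%VS -> y = z}.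
  move=> y z yR zR; have [[c c0 ->] _ _] := XfP y yR; have [[c' c'0 ->] _ _] := XfP z zR.
  case/vlineP => k ek; have [yD ry] := RLD y yR; have [zD rz] := RLD z zR.
  rewrite -ry -rz; apply/esym/repE => //; apply: clsP => //.
  have -> : w y = (k / c) *: w e + (c' / c) *: w z.
    apply: (scalerI c0); rewrite scalerDr !scalerA (mulrCA _ k) (mulrCA _ c') mulfV // !mulr1.
    by rewrite -ek subrK.
  by rewrite /cls memv_add // memvZ ?memv_line.
exists (enum XX); split=> [X|].
  by rewrite mem_enum => /XXP[z _ [_ []]].
have cXX : #|XX| = #|RL|.
  apply: card_in_imset => y z yR zR eyz; apply: injX => //.
  by rewrite eyz subrr mem0v.
have sc : (#|XX| <= starC F * \dim <<enum XX>>)%N.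
  apply: (star_card n2 c2 (e := e) tw e0).
  - by move=> X /XXP[z _ [_ []]].
  - move=> X /XXP[z zR [_ [[c c0 ->] _ _]]].
    apply: contra (De _ (RLD z zR).1) => h.
    by have := memvZ c^-1 h; rewrite scalerA mulVf // scale1r.
  - move=> X Z /imsetP[y yR ->] /imsetP[z zR ->] h.
    by rewrite (injX _ _ yR zR h).
  rewrite dim_add_line -[leqRHS]addn1 leq_add2l; exact: leq_b1.
rewrite cXX in sc.
have : (#|D :\: R| <= #|F| ^ 2 * (starC F * \dim <<enum XX>>))%N.
  by apply: leq_trans cRL _; rewrite leq_mul2l sc orbT.
set q := (#|F| ^ 2)%N; set S := starC F; set m := \dim _ => h.
suff : (rho <= 4 * (q * (S * m)))%N by rewrite !mulnA.
have : (rho ^ 2 = (rho.-1) ^ 2 + 2 * rho - 1)%N by case: (rho) rho4 => // k _ /=; nia.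
by clearbody q S m; move: h cDR cY sR dY; lia.
Qed.
End DenseStar.

(** The induction asks for more than [K + N ^ 2 / 4] elements in rank [N], which the hypothesis
    exceeds by a factor for large rank. While some contraction preserves this, the rank drops; when
    none does, every element is the centre of a star of rank proportional to [N], and [stars_clique]
    applies. *)
Theorem clique_minor (F : finFieldType) (n : nat) : 2 \in [pchar F] ->
  exists r0, forall (F' : fieldType) (M : matroid), 2 \notin [pchar F'] ->
    simple M -> representable F M -> representable F' M ->
    (r0 <= rank M)%N -> (rank M ^ 2 <= 2 * #|M|)%N -> has_minor M (is_MK n.+1).
Proof.
move=> c2.
have q1 : (1 < #|F|)%N by apply: finRing_gt1.
have q0 : (0 < #|F|)%N by apply: ltnW.
have kap0 : (0 < 4 * #|F| ^ 2 * starC F)%N.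
  by rewrite !muln_gt0 /starC addn_gt0 expn_gt0 q0.
have [s [rho0 SC]] := @stars_clique F (4 * #|F| ^ 2 * starC F) n kap0.
(* A space of dimension [s + rho0 + 4] has [K] vectors, so a dense simple set has larger rank:
   enough for [s] independent centres and for the threshold [rho0]. *)
pose K := (#|F| ^ (s + rho0 + 4))%N.
exists (2 * K + 1)%N => F' M n2 sM rF rF' rK dM.
have [U0 [u0 ru0]] := (representableP F M).1 rF.
have [V' [v' rv']] := (representableP F' M).1 rF'.
have [d [v rv]] : exists d (v : M -> 'rV[F]_d), vrep v.
  pose g (u : U0) : 'rV[F]_(\dim {:U0}) := \row_i coord (vbasis {:U0}) i u.
  have lg : linear g by move=> a x y; apply/rowP => i; rewrite !mxE linearP.
  pose gL := GRing.isLinear.Build _ _ _ _ g lg.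
  pose G : {linear U0 -> 'rV[F]_(\dim {:U0})} := HB.pack g gL.
  exists _, (fun x => linfun G (u0 x)) => X.
  rewrite ru0 !span_image dim_map_inj // => x y; rewrite !lfunE /= => /rowP e.
  rewrite (coord_vbasis (memvf x)) (coord_vbasis (memvf y)).
  by apply: eq_bigr => i _; have := e i; rewrite !mxE => ->.
pose rho (p : 'End('rV[F]_d)) := \dim <<map (fun x => p (v x)) (enum M)>>.
have main : forall N p (Z0 : seq M) (Y : {set M}), lker p = <<map v Z0>>%VS ->
    psimple (fun x => p (v x)) Y -> rho p = N -> (4 * K + N ^ 2 < 4 * #|Y|)%N ->
    has_minor M (is_MK n.+1).
  elim/ltn_ind => N IH p Z0 Y kp sY eN dY.
  case: (boolp.EM (exists e (p1 : 'End('rV[F]_d)) (Y1 : {set M}), [/\ e \in Y, lker p1 = <[p (v e)]>%VS,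
      psimple (fun x => p1 (p (v x))) Y1 & (4 * K + (N.-1) ^ 2 < 4 * #|Y1|)%N])).
    case=> e [p1 [Y1 [eY kp1 sY1 dY1]]].
    have e0 : p (v e) != 0 by have [] := sY e e eY eY.
    have eH : p (v e) \in <<map (fun x => p (v x)) (enum M)>>%VS.
      by apply/memv_span/mapP; exists e; rewrite ?mem_enum.
    have N0 : (0 < N)%N.
      rewrite -eN /rho lt0n dimv_eq0; apply: contraNneq e0 => h.
      by rewrite h memv0 in eH.
    apply: (IH N.-1 _ (p1 \o p)%VF (e :: Z0) Y1) => //.
    - by rewrite ltn_predL.
    - apply/vspaceP => x; rewrite memv_ker comp_lfunE -memv_ker kp1 /= span_cons.
      rewrite -kp; apply/vlineP/memv_addP => [[c ec]|[_ /vlineP[c ->] [y yk ->]]].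
        exists (c *: v e); first by rewrite memvZ ?memv_line.
        exists (x - c *: v e); last by rewrite addrC subrK.
        by rewrite memv_ker linearB linearZ /= ec subrr.
      by exists c; move: yk; rewrite memv_ker linearD linearZ /= => /eqP ->; rewrite addr0.
    - move=> x y xY yY; rewrite !comp_lfunE; exact: sY1.
    have := dim_map_ker (fun x => p (v x)) p1 (enum M).
    rewrite kp1 addvC (addv_idPr _) -?memvE // dim_vline e0.
    rewrite -/(rho p) eN addn1 => <- /=; rewrite /rho; congr (\dim <<_>>).
    by apply: eq_map => x; rewrite comp_lfunE.
  move=> nex; pose w x := p (v x).
  have [p' kp'] := exists_ker <<map v' Z0>>%VS.
  have tw : twin w (fun x => p' (v' x)) := twin_contract (vrep_twin rv rv') kp kp'.
  pose H := <<map w (enum M)>>%VS.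
  have wH x : w x \in H by apply/memv_span/mapP; exists x; rewrite ?mem_enum.
  have dHN : \dim H = N by [].
  have dwY : (s + rho0 + 4 < \dim <<map w (enum Y)>>)%N.
    rewrite ltnNge; apply/negP => le.
    have := @card_sub_vspace F d (w @: Y) _ _ _ le.
    rewrite card_in_imset => [|x y xY yY exy]; last first.
      by apply: (sY x y xY yY).2; rewrite -/(w x) exy memv_line.
    rewrite -/K => h.
    have : (#|Y| <= K)%N.
      by apply: h => _ /imsetP[x xY ->]; apply/memv_span/mapP; exists x; rewrite ?mem_enum.
    by move: dY; clear; nia.
  have dwN : (s + rho0 + 4 < N)%N.
    apply: leq_trans dwY _; rewrite -dHN; apply/dimvS/span_subvP => _ /mapP[x _ ->].
    exact: wH.
  have [l [lw el dl]] := basis_extract (map w (enum Y)) 0.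
  have sl : (s <= size l)%N.
    by move: dwY; rewrite !addv0 in el dl; rewrite -el dl dimv0 addn0; clear; lia.
  have fl : free l by rewrite /free; rewrite addv0 dimv0 addn0 in dl; rewrite dl.
  have lY i : (i < s)%N -> exists2 x, x \in Y & l`_i = w x.
    move=> lti; have /lw/mapP[x xY ->] := mem_nth 0 (leq_trans lti sl).
    by exists x => //; rewrite -mem_enum.
  have [xf xfP] : exists xf : 'I_s -> M, forall i, xf i \in Y /\ l`_i = w (xf i).
    have h (i : 'I_s) : exists x, x \in Y /\ l`_i = w x.
      by have [x xY ex] := lY i (ltn_ord i); exists x.
    exists (fun i => projT1 (boolp.cid (h i))) => i.
    by case: (boolp.cid _).
  have stars i : exists XX : seq 'rV[F]_d,
      (forall X, X \in XX -> elt w X /\ elt w (X + w (xf i))) /\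
      (N <= 4 * #|F| ^ 2 * starC F * \dim <<XX>>)%N.
    have [xY _] := xfP i.
    apply: (dense_star n2 c2 tw sY xY _ dY); last by move: dwN; clear; lia.
    move=> p1 Y1 kp1 sY1; rewrite leqNgt; apply/negP => lt; apply: nex.
    by exists (xf i), p1, Y1.
  pose XX i := projT1 (boolp.cid (stars i)).
  have XXP i : (forall X, X \in XX i -> elt w X /\ elt w (X + w (xf i))) /\
      (N <= 4 * #|F| ^ 2 * starC F * \dim <<XX i>>)%N.
    by rewrite /XX; case: (boolp.cid _).
  have [|||||||Z [t [Zel Zt taff]]] := SC _ (elt w) (fun i => w (xf i)) XX H.
  - by move=> i X /(XXP i).1.
  - by move=> i; exists (xf i), 1; rewrite oner_neq0 scale1r.
  - have -> : [seq w (xf i) | i : 'I_s] = take s l.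
      apply: (@eq_from_nth _ 0) => [|i].
        by rewrite size_image card_ord size_take; case: ltngtP sl.
      rewrite size_image card_ord => lti.
      have -> : i = Ordinal lti :> nat by [].
      rewrite /image_mem (nth_map (Ordinal lti)) ?size_enum_ord // nth_ord_enum.
      by rewrite nth_take // (xfP _).2.
    by move: fl; rewrite -{1}(cat_take_drop s l) => /catl_free.
  - by apply/span_subvP => _ /imageP[i _ ->]; apply: wH.
  - by move=> i X /(XXP i).1[[x [c [_ ->]]] _]; apply: memvZ.
  - by move=> i; rewrite dHN; apply: (XXP i).2.
  - by rewrite dHN; move: dwN; clear; lia.
  by exact: (MK_minor rv kp Zel Zt taff).
have simp : psimple (fun x => (\1%VF : 'End('rV[F]_d)) (v x)) [set: M].
  move=> x y _ _; rewrite !lfunE /=; split.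
    have := sM [set x]; rewrite cards1 /indep cards1 => /(_ isT).
    have := vrep_seq [:: x] rv; rewrite /= span_seq1 dim_vline.
    have -> : [set z in [:: x]] = [set x] by apply/setP => z; rewrite !inE.
    by move=> <-; case: (v x == 0).
  move=> xy; apply/eqP; apply: contraT => nxy.
  have := sM [set x; y]; rewrite cards2 nxy /indep cards2 nxy => /(_ isT)/eqP.
  have := vrep_seq [:: y; x] rv.
  have -> : [set z in [:: y; x]] = [set x; y] by apply/setP => z; rewrite !inE orbC.
  move=> <- /eqP; rewrite /= span_cons span_seq1 dim_add_line xy addn0 dim_vline.
  by case: (v x != 0).
apply: (main (rank M) \1%VF [::] [set: M]) => //.
- apply/vspaceP => x; rewrite memv_ker lfunE /= span_nil memv0 //.
- rewrite /rho /rank rv span_image; congr (\dim _).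
  under eq_map => x do rewrite lfunE /=.
  by apply: eq_span_map => x; rewrite mem_enum mem_enum !inE.
rewrite cardsT; move: rK dM; clear; nia.
Qed.

(** * Reduction to highly connected matroids *)

Section SplitArith.
Variables (S : nat -> nat -> Prop) (k R1 : nat).
Hypotheses (k0 : (0 < k)%N) (kR : (k <= R1)%N)
  (S4 : forall r m, S r m -> (m <= 4 ^ r)%N)
  (Ssplit : forall r m, S r m -> (R1 <= r)%N -> (2 * m + 4 <= r * r + 5 * r)%N \/
     exists a b m1 m2, [/\ (a < r)%N, (b <= a)%N, (a + b < r + k)%N, S a m1 & S b m2 /\
       (m = m1 + m2)%N]).

Let H := (4 ^ R1)%N.
Let A := (2 * H + k * k + 5 * k + 4)%N.

Lemma split_small r m : (r <= R1)%N -> S r m -> (m <= H)%N.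
Proof. by move=> rR /S4 h; apply: leq_trans h _; rewrite leq_exp2l. Qed.

(** With ranks written [k + x], [k + y] for the parts and [k + z] for the whole, a separation gives
    [x + y < z]. So the linear error splits as A(2x + 1) + A(2y + 1) + A, and the last summand
    absorbs the terms in [k]. *)
Lemma split_bound_linear z m : S (k + z) m ->
  (2 * m + 4 <= (k + z) * (k + z) + 5 * (k + z) + 2 * (A * (2 * z + 1)))%N.
Proof.
elim/ltn_ind: z m => z IH m Sm.
have [lt|ge] := ltnP (k + z) R1.
  have : (A <= A * (2 * z + 1))%N by rewrite mulnDr muln1 leq_addl.
  have : (H + 4 <= A)%N by rewrite /A; lia.
  have := split_small (ltnW lt) Sm; clear; lia.
have [h|[a [b [m1 [m2 [ar ba ab Sa [Sb em]]]]]]] := Ssplit Sm ge.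
  by apply: leq_trans h _; apply: leq_addr.
have [bk|kb] := ltnP b k.
  have m2H : (m2 <= H)%N by apply: split_small Sb; apply: leq_trans (ltnW bk) kR.
  have [ak|ka] := ltnP a k.
    have m1H : (m1 <= H)%N by apply: split_small Sa; apply: leq_trans (ltnW ak) kR.
    have : (A <= A * (2 * z + 1))%N by rewrite mulnDr muln1 leq_addl.
    have : (2 * H + 4 <= A)%N by rewrite /A; lia.
    rewrite em; clear - m1H m2H; lia.
  have ea : a = (k + (a - k))%N by rewrite subnKC.
  set x := (a - k)%N in ea; rewrite ea in Sa ar.
  have xz : (x < z)%N by move: ar; rewrite ltn_add2l.
  have := IH x xz m1 Sa; rewrite em.
  have : (A * (2 * x + 1) + 2 * A <= A * (2 * z + 1))%N.
    by rewrite (mulnC 2%N A) -mulnDr leq_mul2l; apply/orP; right; lia.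
  have : ((k + x) * (k + x) <= (k + z) * (k + z))%N by apply: leq_mul; lia.
  have : (H <= A)%N by rewrite /A; lia.
  clear - xz m2H; lia.
have ka : (k <= a)%N by apply: leq_trans kb ba.
have ea : a = (k + (a - k))%N by rewrite subnKC.
have eb : b = (k + (b - k))%N by rewrite subnKC.
set x := (a - k)%N in ea; set y := (b - k)%N in eb.
rewrite ea in Sa ar ab; rewrite eb in Sb ab.
have xz : (x + y < z)%N by lia.
have xz1 : (x < z)%N by lia.
have yz1 : (y < z)%N by lia.
have := IH x xz1 m1 Sa; have := IH y yz1 m2 Sb; rewrite em.
have : (A * (2 * x + 1) + A * (2 * y + 1) + A <= A * (2 * z + 1))%N.
  by rewrite -mulnDr -[X in (_ + X <= _)%N]muln1 -mulnDr leq_mul2l; apply/orP; right; lia.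
have : ((k + x) * (k + x) + (k + y) * (k + y) <= (k + z) * (k + z) + k * k)%N.
  have : ((k + (x + y)) * (k + (x + y)) <= (k + z) * (k + z))%N by apply: leq_mul; lia.
  by rewrite !mulnDl !mulnDr; lia.
have : (k * k + 5 * k <= A)%N by rewrite /A; lia.
clear - xz; lia.
Qed.

Let C2 := (2 * H + k * k + 10 * k + 40 + 2 * A * (2 * k + 1))%N.
Let R3 := (R1 + 2 * k + C2 + H)%N.

(* Splitting off a part of smaller rank [b] loses at least [r / 2] elements up
   to a constant. *)
Lemma split_gain r a b m2 : (R3 <= r)%N -> (a < r)%N -> (b <= a)%N -> (a + b < r + k)%N ->
  S b m2 -> (a * a + 5 * a + 2 * m2 + r <= r * r + 5 * r + C2)%N.
Proof.
move=> rR ar ba ab Sb; have [bk|kb] := ltnP b k.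
  have m2H : (m2 <= H)%N by apply: split_small Sb; apply: leq_trans (ltnW bk) kR.
  have : ((a + 1) * (a + 1) <= r * r)%N by apply: leq_mul; lia.
  rewrite /C2 !mulnDl !mulnDr; lia.
have eb : b = (k + (b - k))%N by rewrite subnKC.
set s := (b - k)%N in eb; rewrite eb in Sb ba ab.
have := split_bound_linear Sb.
have le2 : (2 * A * (2 * k + 1) + k <= r)%N by move: rR; rewrite /R3 /C2; lia.
have eC : (2 * A * (2 * k + 1) + k * k + 10 * k <= C2)%N by rewrite /C2; lia.
set m := (2 * A * (2 * k + 1))%N in le2 eC *.
have le1 : (2 * (A * (2 * s + 1)) <= m * s.+1)%N.
  by rewrite /m -!mulnA !leq_mul2l /=; apply/orP; right; clear - k0; nia.
have le3 : (m * s.+1 + k * s.+1 + r <= r * s.+1 + m + k)%N.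
  have : ((m + k) * s <= r * s)%N by rewrite leq_mul2r le2 orbT.
  by rewrite !mulnS mulnDl; clear; lia.
have le4 : (a * a + (k + s) * (k + s) + r * s.+1 <= r * r + k * k + k * s.+1)%N.
  have [t et] : exists t, r = (a + s.+1 + t)%N by exists (r - (a + s.+1))%N; lia.
  have : ((k + s) * s.+1 <= a * s.+1)%N by rewrite leq_mul2r ba orbT.
  by rewrite et !mulnDl !mulnDr !mulnS !mulSn; clear; lia.
move: (C2) eC le1 le3 le4 ab k0; clear; lia.
Qed.

Let G := (A * (2 * R3 + 1))%N.

(** Descending along the larger part, the loss provided by [split_gain] pays for its own constant,
    so the error does not accumulate. *)
Lemma split_bound_const r m : (k <= r)%N -> S r m -> (2 * m + 4 <= r * r + 5 * r + 2 * G)%N.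
Proof.
elim/ltn_ind: r m => r IH m kr Sm.
have er : r = (k + (r - k))%N by rewrite subnKC.
have [lt|ge] := ltnP r R3.
  move: Sm; rewrite {1}er => /split_bound_linear; rewrite -er.
  have : (A * (2 * (r - k) + 1) <= G)%N.
    by rewrite /G leq_mul2l; apply/orP; right; lia.
  lia.
have R1r : (R1 <= r)%N by apply: leq_trans ge; rewrite /R3; lia.
have [h|[a [b [m1 [m2 [ar ba ab Sa [Sb em]]]]]]] := Ssplit Sm R1r.
  by apply: leq_trans h _; apply: leq_addr.
have := split_gain ge ar ba ab Sb.
have C2r : (C2 + 2 * H <= r + r)%N by move: ge; rewrite /R3; lia.
have [ka|ak] := leqP k a.
  have := IH a ar m1 ka Sa; rewrite em; move: ge; rewrite /R3; lia.
have m1H : (m1 <= H)%N by apply: split_small Sa; apply: leq_trans (ltnW ak) kR.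
have HG : (H + 2 <= G)%N.
  have : (A <= G)%N by rewrite /G mulnDr muln1 leq_addl.
  rewrite /A; lia.
rewrite em; move: ge; rewrite /R3; lia.
Qed.

(** Once the rank exceeds the constant error, a single separation already loses more than that
    error. *)
Lemma split_arith : exists R, forall r m, (R <= r)%N -> S r m ->
  (2 * m + 4 <= r * r + 5 * r)%N.
Proof.
exists (R3 + C2 + 2 * G + 2 * H + 4)%N => r m rR Sm.
have rR3 : (R3 <= r)%N by lia.
have R1r : (R1 <= r)%N by apply: leq_trans rR3; rewrite /R3; lia.
have [//|[a [b [m1 [m2 [ar ba ab Sa [Sb em]]]]]]] := Ssplit Sm R1r.
have := split_gain rR3 ar ba ab Sb.
have [ka|ak] := leqP k a.
  have := split_bound_const ka Sa; rewrite em; lia.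
have m1H : (m1 <= H)%N by apply: split_small Sa; apply: leq_trans (ltnW ak) kR.
rewrite em; lia.
Qed.
End SplitArith.

Lemma delete_simple (M : matroid) (D : {set M}) : simple M -> simple (delete D).
Proof.
move=> sM X X2; rewrite /indep /= /delete_rk.
have := sM (val @: X); rewrite /indep card_imset; last exact: val_inj.
by move=> /(_ X2).
Qed.

Lemma rank_delete (M : matroid) (X : {set M}) : rank (delete X) = rk (~: X).
Proof.
rewrite /rank /= /delete_rk; congr rk; apply/setP => x.
apply/imsetP/idP => [[y _ ->]|xX]; first exact: (valP y).
by exists (Sub x xX).
Qed.

Lemma card_delete (M : matroid) (X : {set M}) : #|delete X| = #|~: X|.
Proof. by rewrite /= card_sig; apply: eq_card. Qed.

(** If vertical connectivity fails, some [X] and its complement are both nonspanning with ranks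
    adding up to less than [rank M + k]. Their restrictions are smaller members of the class, which
    is the second alternative in the arithmetic above. *)
Lemma bound_of_connected_bound (P : matroid -> Prop) (k R1 : nat) : (0 < k)%N ->
  (forall (M : matroid) (D : {set M}), P M -> P (delete D)) ->
  (forall M, P M -> simple M -> #|M| <= 4 ^ rank M)%N ->
  (forall M, P M -> simple M -> vertically_connected k M -> (R1 <= rank M)%N ->
     (2 * #|M| + 4 <= rank M * rank M + 5 * rank M)%N) ->
  exists R, forall M, P M -> simple M -> (R <= rank M)%N ->
     (2 * #|M| + 4 <= rank M * rank M + 5 * rank M)%N.
Proof.
move=> k0 Pd P4 Pc.
pose S r m := exists M, [/\ P M, simple M, rank M = r & #|M| = m].
have S4 r m : S r m -> (m <= 4 ^ r)%N by case=> M [PM sM <- <-]; apply: P4.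
have [||R RP] := @split_arith S k (maxn k R1) k0 _ S4; last first.
- by exists R => M PM sM /RP; apply; exists M.
- move=> r m [M [PM sM er em]]; rewrite geq_max => /andP[kr R1r].
  case: (boolp.EM (vertically_connected k M)) => [vc|nvc].
    by left; rewrite -er -em; apply: Pc; rewrite ?er.
  right; have [X] : exists X : {set M}, (rk X + rk (~: X) - rank M < k)%N /\
      ~ (spanning X \/ spanning (~: X)).
    apply: boolp.contrapT => h; apply: nvc => X hX.
    by apply: boolp.contrapT => h'; apply: h; exists X.
  wlog le : X / (rk (~: X) <= rk X)%N => [wl|].
    case: (leqP (rk (~: X)) (rk X)) => [/wl //|/ltnW lt [h1 h2]].
    apply: (wl (~: X)); rewrite setCK // addnC; split=> //.
    by move=> h; apply: h2; case: h; [right|left].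
  case=> hX nsp.
  have rX (Z : {set M}) : (rk Z <= r)%N by rewrite -er; apply/rk_mono/subsetT.
  exists (rk X), (rk (~: X)), #|X|, #|~: X|; split=> //.
  - rewrite ltn_neqAle rX andbT; apply/negP => /eqP e; apply: nsp; left.
    by rewrite /spanning e er.
  - by move: hX; rewrite er; have := rX X; lia.
  - exists (delete (~: X)); rewrite rank_delete card_delete setCK.
    by split=> //; [apply: Pd | apply: delete_simple].
  split; last by rewrite cardsC.
  exists (delete X); rewrite rank_delete card_delete.
  by split=> //; [apply: Pd | apply: delete_simple].
exact: leq_maxl.
Qed.

(** * Configurations without a twin in characteristic 3 *)

(** Linear functionals separate vectors. Hence [vlin] reduces an identity between vectors to one
    between scalars, where [ring] applies. *)
Lemma vec_ext (F : fieldType) (U : vectType F) (u v : U) :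
  (forall f : U -> F, (forall x y, f (x + y) = f x + f y) ->
     (forall a x, f (a *: x) = a * f x) -> (forall x, f (- x) = - f x) ->
     f 0 = 0 -> f u = f v) -> u = v.
Proof.
move=> h; rewrite (coord_vbasis (memvf u)) (coord_vbasis (memvf v)).
apply: eq_bigr => i _; congr (_ *: _); apply: (h (coord (vbasis fullv) i)).
- by move=> x y; rewrite linearD.
- by move=> a x; rewrite linearZ.
- by move=> x; rewrite linearN.
by rewrite linear0.
Qed.

Ltac vlin := apply: vec_ext; let f := fresh "f" in let fD := fresh "fD" in
  let fZ := fresh "fZ" in let fN := fresh "fN" in let f0 := fresh "f0" in
  intros f fD fZ fN f0; rewrite ?(fD, fZ, fN, f0); apply: subr0_eq.

Lemma free2_eq (F : fieldType) (U : vectType F) (x y : U) a b c d :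
  free [:: x; y] -> a *: x + b *: y = c *: x + d *: y -> a = c /\ b = d.
Proof.
move=> /free2P h e; have [] := h (a - c) (b - d).
  rewrite !scalerBl addrACA -opprD; apply/eqP; rewrite subr_eq0; exact/eqP.
by move=> /subr0_eq -> /subr0_eq ->.
Qed.

Lemma free3_eq (F : fieldType) (U : vectType F) (x y z : U) a b c a' b' c' :
  free [:: x; y; z] -> a *: x + b *: y + c *: z = a' *: x + b' *: y + c' *: z ->
  [/\ a = a', b = b' & c = c'].
Proof.
move=> /free3P h e; have [] := h (a - a') (b - b') (c - c').
  rewrite !scalerBl (addrACA (a *: x)) -opprD addrACA -opprD.
  by apply/eqP; rewrite subr_eq0; apply/eqP.
by move=> /subr0_eq -> /subr0_eq -> /subr0_eq ->.
Qed.

(** * The field with four elements, and characteristic 3 *)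

Section FieldFour.
Variable F : finFieldType.
Hypothesis cF : #|F| = 4%N.

Lemma pchar_card4 : 2 \in [pchar F].
Proof. exact: (card_finPcharP (n := 2)). Qed.

Lemma two_card4 : 2 = 0 :> F.
Proof. by have /andP[_ /eqP] := pchar_card4. Qed.

Lemma four_card4 : 4 = 0 :> F.
Proof. by rewrite -[4%N]/(2 + 2)%N natrD two_card4 addr0. Qed.

Lemma six_card4 : 6 = 0 :> F.
Proof. by rewrite -[6%N]/(4 + 2)%N natrD four_card4 two_card4 addr0. Qed.

Lemma eight_card4 : 8 = 0 :> F.
Proof. by rewrite -[8%N]/(4 + 4)%N natrD four_card4 addr0. Qed.

Lemma ten_card4 : 10 = 0 :> F.
Proof. by rewrite -[10%N]/(6 + 4)%N natrD six_card4 four_card4 addr0. Qed.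

Lemma oppr_card4 (x : F) : - x = x.
Proof. exact: oppr_pchar2 pchar_card4 x. Qed.

Lemma cube_card4 (x : F) : x != 0 -> x ^+ 3 = 1.
Proof.
by move=> x0; apply: (mulfI x0); rewrite mulr1 -exprS -[in RHS](expf_card x) cF.
Qed.

Lemma square_card4 (w : F) : w != 0 -> w != 1 -> w ^+ 2 = w + 1.
Proof.
move=> w0 w1; have := cube_card4 w0 => /eqP; rewrite -subr_eq0.
have -> : w ^+ 3 - 1 = (w - 1) * (w ^+ 2 + w + 1) by ring.
rewrite mulf_eq0 subr_eq0 (negbTE w1) /= -addrA addr_eq0 => /eqP ->.
exact: oppr_card4.
Qed.

Lemma mem_card4 (w x : F) : w != 0 -> w != 1 ->
  [\/ x = 0, x = 1, x = w | x = w + 1].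
Proof.
move=> w0 w1.
have u : uniq [:: 0; 1; w; w + 1].
  rewrite /= !inE !negb_or (eq_sym 0 1) oner_eq0 (eq_sym 0 w) w0 (eq_sym 1 w) w1 /=.
  rewrite eq_sym addr_eq0 oppr_card4 w1 /= -[X in X == w + 1]add0r (inj_eq (addIr _)).
  by rewrite eq_sym w0 -[X in X == w + 1]addr0 (inj_eq (addrI _)) eq_sym oner_eq0.
have : x \in [:: 0; 1; w; w + 1].
  have sub : {subset [:: 0; 1; w; w + 1] <= enum F} by move=> y _; rewrite mem_enum.
  have /(uniq_min_size u sub)[_ ->] : (size (enum F) <= 4)%N by rewrite -cardE cF.
  by rewrite mem_enum.
by rewrite !inE => /or4P[]/eqP ->; constructor.
Qed.

Lemma exists_card4 : exists w : F, w != 0 /\ w != 1.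
Proof.
have : (0 < #|[set: F] :\: [set 0%R; 1%R]|)%N.
  rewrite cardsD cardsT cF setTI subn_gt0.
  by rewrite cards2; case: eqP.
by case/card_gt0P => w; rewrite !inE negb_or andbT => /andP[]; exists w.
Qed.

Lemma oppv_card4 (U : lmodType F) (u : U) : - u = u.
Proof. by rewrite -scaleN1r oppr_card4 scale1r. Qed.
End FieldFour.

(* [ring] modulo [2 = 0] only replaces coefficients equal to 2, so that signs are
   removed first. *)
Tactic Notation "ring4" constr(cF) := rewrite ?(oppr_card4 cF);
  ring: (ten_card4 cF) (eight_card4 cF) (six_card4 cF) (four_card4 cF) (two_card4 cF).
Tactic Notation "ring4w" constr(cF) constr(h) := rewrite ?(oppr_card4 cF);
  ring: h (ten_card4 cF) (eight_card4 cF) (six_card4 cF) (four_card4 cF) (two_card4 cF).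

Section Char3.
Variable F' : fieldType.
Hypothesis c3 : 3 \in [pchar F'].

Lemma three_char3 : 3 = 0 :> F'.
Proof. by have /andP[_ /eqP] := c3. Qed.

Lemma two_char3 : 2 != 0 :> F'.
Proof.
apply/eqP => h; have := three_char3; rewrite -[3%N]/(2 + 1)%N natrD h add0r.
by apply/eqP/oner_neq0.
Qed.

Lemma pchar2_char3 : 2 \notin [pchar F'].
Proof. by rewrite inE /= two_char3. Qed.

Lemma cube1_char3 (x : F') : x ^+ 3 = 1 -> x = 1.
Proof.
move=> h; suff : (x - 1) ^+ 3 == 0 by rewrite expf_eq0 subr_eq0 => /eqP.
have -> : (x - 1) ^+ 3 = x ^+ 3 - 1 - 3 * (x ^+ 2 - x) by ring.
by rewrite h subrr three_char3 mul0r subr0 eqxx.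
Qed.
End Char3.

(** Only the differences are compared, because they are what the contractions of a frame
    configuration expose; a translation of the points is immaterial. *)
Definition dtwin (F F' : fieldType) (U : vectType F) (U' : vectType F')
    (I : Type) (s : I -> U) (t : I -> U') :=
  twin (fun x : I * I => s x.1 - s x.2) (fun x => t x.1 - t x.2).

Section DiffTwin.
Variables (F F' : fieldType) (U : vectType F) (U' : vectType F').

Lemma dtwin_comp (I J : Type) (h : J -> I) (s : I -> U) (t : I -> U') :
  dtwin s t -> dtwin (fun j => s (h j)) (fun j => t (h j)).
Proof. exact: (twin_comp (fun x : J * J => (h x.1, h x.2))). Qed.

Lemma dtwin_contract (I : Type) (s : I -> U) (t : I -> U') (Z : seq (I * I)) :
  dtwin s t -> exists (p : 'End(U)) (p' : 'End(U')),
  lker p = <<map (fun x => s x.1 - s x.2) Z>>%VS /\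
  dtwin (fun i => p (s i)) (fun i => p' (t i)).
Proof.
move=> tw; have [p [p' [kp kp' tw']]] := twin_contract_ex Z tw.
by exists p, p'; split=> //; apply: eq_twin tw' => x; rewrite linearB.
Qed.

Variables (I : Type) (s : I -> U) (t : I -> U').
Hypothesis tw : dtwin s t.

Lemma dtwin_mem1 i j k l :
  (t i - t j \in <[t k - t l]>%VS) = (s i - s j \in <[s k - s l]>%VS).
Proof. by rewrite -!span_seq1; symmetry; exact: (twin_mem (i, j) [:: (k, l)] tw). Qed.

Lemma dtwin_mem2 i j k l m n :
  (t i - t j \in <<[:: t k - t l; t m - t n]>>%VS) =
  (s i - s j \in <<[:: s k - s l; s m - s n]>>%VS).
Proof. symmetry; exact: (twin_mem (i, j) [:: (k, l); (m, n)] tw). Qed.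

Lemma dtwin_line i j k l a : s i - s j = a *: (s k - s l) ->
  exists a', t i - t j = a' *: (t k - t l).
Proof.
move=> e; apply/vlineP; rewrite dtwin_mem1; apply/vlineP; by exists a.
Qed.

Lemma dtwin_plane i j k l m n a b : s i - s j = a *: (s k - s l) + b *: (s m - s n) ->
  exists a' b', t i - t j = a' *: (t k - t l) + b' *: (t m - t n).
Proof.
move=> e; apply/span2P; rewrite dtwin_mem2; apply/span2P; by exists a, b.
Qed.

Lemma dtwin_free2 i j k l :
  free [:: t i - t j; t k - t l] = free [:: s i - s j; s k - s l].
Proof. symmetry; exact: (twin_free [:: (i, j); (k, l)] tw). Qed.

Lemma dtwin_free3 i j k l m n :
  free [:: t i - t j; t k - t l; t m - t n] = free [:: s i - s j; s k - s l; s m - s n].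
Proof. symmetry; exact: (twin_free [:: (i, j); (k, l); (m, n)] tw). Qed.

Lemma dtwin_eq i j : (t i == t j) = (s i == s j).
Proof.
have := tw [:: (i, j)]; rewrite /= !span_seq1 !dim_vline !subr_eq0.
by case: eqP; case: eqP.
Qed.
End DiffTwin.

Definition parallel (F : fieldType) (U : vectType F) (u v : U) :=
  exists2 k : F, k != 0 & u = k *: v.

Section Configurations.
Variables (F : finFieldType) (F' : fieldType) (U : vectType F) (U' : vectType F').
Hypotheses (cF : #|F| = 4%N) (c3 : 3 \in [pchar F']).

(* The three pairs of opposite sides of a parallelogram over GF(4) are parallel,
   which forces 2 = 0. *)
Lemma parallelogram_absurd (I : Type) (s : I -> U) (t : I -> U') a b c d (x y : U) :
  dtwin s t -> free [:: x; y] ->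
  s b = s a + x -> s c = s a + y -> s d = s a + x + y -> False.
Proof.
move=> tw fxy eb ec ed; have e2 := two_card4 cF.
have ebx : s b - s a = x by rewrite eb; vlin; ring.
have ecy : s c - s a = y by rewrite ec; vlin; ring.
have fX : free [:: t b - t a; t c - t a] by rewrite (dtwin_free2 tw) ebx ecy.
have [l el] : exists l, t d - t c = l *: (t b - t a).
  by apply: (dtwin_line tw (a := 1)); rewrite ed eb ec; vlin; ring.
have [m em] : exists m, t d - t b = m *: (t c - t a).
  by apply: (dtwin_line tw (a := 1)); rewrite ed eb ec; vlin; ring.
have [n en] : exists n, t d - t a = n *: (t b - t c).
  by apply: (dtwin_line tw (a := 1)); rewrite ed eb ec; vlin; ring4 cF.
set X := t b - t a in fX el; set Y := t c - t a in fX em.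
have E1 : t d - t a = l *: X + 1 *: Y by rewrite -el /Y; vlin; ring.
have E2 : t d - t a = 1 *: X + m *: Y by rewrite -em /X; vlin; ring.
have E3 : t d - t a = n *: X + (- n) *: Y by rewrite en /X /Y; vlin; ring.
have [l1 _] := free2_eq fX (etrans (esym E1) E2).
have [ln nn] := free2_eq fX (etrans (esym E1) E3).
have /eqP := two_char3 c3; apply; rewrite -[2%N]/(1 + 1)%N natrD {2}nn -ln l1.
by rewrite subrr.
Qed.

(** The common ratio [w] of the two triples becomes some u in the twin with u^2 - u + 1 = 0, which
    in characteristic 3 reads (u + 1)^2 = 0. The value u = -1 then produces a dependency that [s]
    does not have. *)
Lemma grid_absurd (I : Type) (s : I -> U) (t : I -> U') a0 a1 a2 b0 b1 b2
    (w : F) (x y d : U) :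
  dtwin s t -> w != 0 -> w != 1 -> free [:: x; y; d] ->
  s a1 = s a0 + x -> s a2 = s a0 + w *: x ->
  s b0 = s a0 + d -> s b1 = s a0 + d + y -> s b2 = s a0 + d + w *: y -> False.
Proof.
move=> tw w0 w1 fr ea1 ea2 eb0 eb1 eb2.
have e2 := two_card4 cF; have ew := square_card4 cF w0 w1.
have fX : free [:: t a1 - t a0; t b1 - t b0; t b0 - t a0].
  rewrite (dtwin_free3 tw).
  have -> : s a1 - s a0 = x by rewrite ea1; vlin; ring.
  have -> : s b1 - s b0 = y by rewrite eb1 eb0; vlin; ring.
  by have -> : s b0 - s a0 = d by rewrite eb0; vlin; ring.
set X := t a1 - t a0 in fX; set Y := t b1 - t b0 in fX; set D := t b0 - t a0 in fX.
have [u eu] : exists u, t a2 - t a0 = u *: X.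
  by apply: (dtwin_line tw (a := w)); rewrite ea1 ea2; vlin; ring.
have [v ev] : exists v, t b2 - t b0 = v *: Y.
  by apply: (dtwin_line tw (a := w)); rewrite eb1 eb2 eb0; vlin; ring.
have [k [l e1]] : exists k l, t b2 - t a2 = k *: (t b0 - t a0) + l *: (t b1 - t a1).
  apply: (dtwin_plane tw (a := 1 - w) (b := w)).
  by rewrite eb2 ea2 eb0 eb1 ea1; vlin; ring.
have [k' [l' e3]] : exists k l, t b0 - t a2 = k *: (t b1 - t a0) + l *: (t b2 - t a1).
  apply: (dtwin_plane tw (a := 1 - w) (b := w)).
  by rewrite eb2 ea2 eb0 eb1 ea1; vlin; ring4w cF ew.
have [E1 E2 E3] : [/\ - u = - l, v = l & 1 = k + l].
  apply: (free3_eq fX); transitivity (t b2 - t a2); last rewrite e1.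
    have -> : t b2 - t a2 = (t b2 - t b0) - (t a2 - t a0) + D by rewrite /D; vlin; ring.
    by rewrite ev eu; vlin; ring.
  by rewrite /X /Y /D; vlin; ring.
have [E4 E5 E6] : [/\ - u = - l', 0 = k' + l' * v & 1 = k' + l'].
  apply: (free3_eq fX); transitivity (t b0 - t a2); last rewrite e3.
    have -> : t b0 - t a2 = D - (t a2 - t a0) by rewrite /D; vlin; ring.
    by rewrite eu; vlin; ring.
  have -> : t b2 - t a1 = (t b2 - t b0) + D - X by rewrite /D /X; vlin; ring.
  by rewrite ev /X /Y /D; vlin; ring.
have lu : l' = u by apply: oppr_inj.
have vu : v = u by rewrite E2; apply: oppr_inj.
have ek : k' = 1 - u by rewrite E6 lu addrK.
have u1 : u = -1.
  have h3 := three_char3 c3.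
  suff : (u + 1) ^+ 2 == 0 by rewrite expf_eq0 addr_eq0 => /eqP.
  have -> : (u + 1) ^+ 2 = (k' + l' * v) + 3 * u by rewrite ek lu vu; ring.
  by rewrite -E5 h3 mul0r addr0 eqxx.
have [k2 [l2]] : exists k l, s b2 - s a2 = k *: (s b1 - s a0) + l *: (s b0 - s a1).
  apply/span2P; rewrite -(dtwin_mem2 tw); apply/span2P; exists (-1), (-1).
  have -> : t b2 - t a2 = (t b2 - t b0) - (t a2 - t a0) + D by rewrite /D; vlin; ring.
  have h3 := three_char3 c3.
  have -> : t b1 - t a0 = Y + D by rewrite /Y /D; vlin; ring.
  have -> : t b0 - t a1 = D - X by rewrite /X /D; vlin; ring.
  by rewrite ev eu vu u1; clearbody X Y D; vlin; ring: h3.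
rewrite eb2 ea2 eb1 eb0 ea1 => e4.
have [F1 F2 F3] : [/\ - w = - l2, w = k2 & 1 = k2 + l2].
  apply: (free3_eq fr); transitivity (s a0 + d + w *: y - (s a0 + w *: x)).
    by vlin; ring.
  by rewrite e4; vlin; ring.
have /eqP := oner_neq0 F; apply; rewrite F3 -F2 -(oppr_inj F1) -(oppr_card4 cF w).
by rewrite {1}(oppr_card4 cF) subrr.
Qed.

(* The nine points [e_i + g e_j] make a homomorphism from the cubic roots of
   unity of GF(4) into the field of characteristic 3, where 1 is the only one. *)
Lemma dowling_absurd (T : Type) (v : T -> U) (v' : T -> U') (w : F)
    (a b c ab1 abw abw2 bc1 bcw ac1 acw acw2 : T) :
  twin v v' -> w != 0 -> w != 1 ->
  free [:: v a; v b; v c] ->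
  parallel (v ab1) (v a + v b) -> parallel (v abw) (v a + w *: v b) ->
  parallel (v abw2) (v a + (w + 1) *: v b) ->
  parallel (v bc1) (v b + v c) -> parallel (v bcw) (v b + w *: v c) ->
  parallel (v ac1) (v a + v c) -> parallel (v acw) (v a + w *: v c) ->
  parallel (v acw2) (v a + (w + 1) *: v c) -> False.
Proof.
move=> tw w0 w1 fr eab1 eabw eabw2 ebc1 ebcw eac1 eacw eacw2.
have e2 := two_card4 cF; have ew := square_card4 cF w0 w1.
have w20 : w + 1 != 0 by rewrite addr_eq0 oppr_card4.
have fr' : free [:: v' a; v' b; v' c].
  by have := twin_free [:: a; b; c] tw; rewrite /= fr.
have fab : free [:: v a; v b] by move: fr; rewrite -[[:: _; _; _]]/([:: v a; v b] ++ [:: v c]) => /catl_free.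
have fbc : free [:: v b; v c] by move: fr; rewrite -[[:: _; _; _]]/([:: v a] ++ [:: v b; v c]) => /catr_free.
have fac : free [:: v a; v c].
  apply/free2P => p q e; have /free3P := fr => /(_ p 0 q).
  by rewrite scale0r addr0 => /(_ e) [].
have line p q r (g : F) : g != 0 -> free [:: v p; v q] -> parallel (v r) (v p + g *: v q) ->
    exists x A, [/\ x != 0, A != 0 & v' r = x *: (v' p + A *: v' q)].
  move=> g0 fpq [k k0 er].
  have [x [y [x0 y0 e]]] := twin_line tw fpq k0 (mulf_neq0 k0 g0)
    (etrans er (etrans (scalerDr _ _ _) (congr1 (fun z => _ + z) (scalerA _ _ _)))).
  exists x, (y / x); split; rewrite ?mulf_neq0 ?invr_eq0 //.
  by rewrite scalerDr scalerA mulrCA mulfV // mulr1.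
have o0 := oner_neq0 F.
rewrite -[v b]scale1r in eab1; rewrite -[v c]scale1r in ebc1 eac1.
have [x1 [A1 [x10 A10 e1]]] := line _ _ _ _ o0 fab eab1.
have [x2 [Aw [x20 Aw0 e3]]] := line _ _ _ _ w0 fab eabw.
have [x3 [Aq [x30 Aq0 e4]]] := line _ _ _ _ w20 fab eabw2.
have [x4 [B1 [x40 B10 e5]]] := line _ _ _ _ o0 fbc ebc1.
have [x5 [Bw [x50 Bw0 e6]]] := line _ _ _ _ w0 fbc ebcw.
have [x6 [C1 [x60 C10 e7]]] := line _ _ _ _ o0 fac eac1.
have [x7 [Cw [x70 Cw0 e8]]] := line _ _ _ _ w0 fac eacw.
have [x8 [Cq [x80 Cq0 e9]]] := line _ _ _ _ w20 fac eacw2.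
have tri r p q (A B C : F') x y z (g h i : F) :
    parallel (v r) (v a + i *: v c) -> parallel (v p) (v a + g *: v b) ->
    parallel (v q) (v b + h *: v c) -> i = g * h -> x != 0 -> y != 0 -> z != 0 ->
    v' r = x *: (v' a + C *: v' c) -> v' p = y *: (v' a + A *: v' b) ->
    v' q = z *: (v' b + B *: v' c) -> C = - A * B.
  move=> [kr _ er] [kp kp0 ep] [kq kq0 eq] ei x0 y0 z0 er' ep' eq'.
  have : v r \in <<map v [:: p; q]>>%VS.
    apply/span2P; exists (kr / kp), (kr * g / kq).
    rewrite er ep eq ei !scalerA -!mulrA !mulVf // !mulr1.
    by vlin; ring4 cF.
  rewrite (twin_mem _ _ tw) => /span2P[m [n e]].
  have [E1 E2 E3] : [/\ x = m * y, 0 = m * y * A + n * z & x * C = n * z * B].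
    apply: (free3_eq fr'); transitivity (v' r); first by rewrite er'; vlin; ring.
    by rewrite e ep' eq'; vlin; ring.
  apply: (mulfI x0); rewrite E3 E1.
  have -> : n * z = - (m * y * A) by apply/eqP; rewrite -addr_eq0 addrC -E2.
  by ring.
have R1 : C1 = - A1 * B1 by apply: tri eac1 eab1 ebc1 _ x60 x10 x40 e7 e1 e5; rewrite mulr1.
have R2 : Cw = - Aw * B1 by apply: tri eacw eabw ebc1 _ x70 x20 x40 e8 e3 e5; rewrite mulr1.
have R3 : Cw = - A1 * Bw by apply: tri eacw eab1 ebcw _ x70 x10 x50 e8 e1 e6; rewrite mul1r.
have R4 : Cq = - Aw * Bw.
  by apply: tri eacw2 eabw ebcw _ x80 x20 x50 e9 e3 e6; rewrite -expr2 ew.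
have R5 : Cq = - Aq * B1 by apply: tri eacw2 eabw2 ebc1 _ x80 x30 x40 e9 e4 e5; rewrite mulr1.
have R6 : C1 = - Aq * Bw.
  by apply: tri eac1 eabw2 ebcw _ x60 x30 x50 e7 e4 e6; apply: subr0_eq; ring4w cF ew.
have : (Aw / A1) ^+ 3 = 1.
  have S1 : Bw = Aw * B1 / A1.
    by apply: (mulfI A10); rewrite mulrCA mulfV // mulr1; apply: oppr_inj; rewrite -!mulNr -R3 R2.
  have S2 : Aq = Aw ^+ 2 / A1.
    apply: (mulIf B10); apply: oppr_inj; rewrite -!mulNr -R5 R4 S1; by field.
  have : Aq * Bw = A1 * B1 by apply: oppr_inj; rewrite -!mulNr -R6 R1.
  rewrite S1 S2 => h.
  apply: (mulIf A10); apply: (mulIf B10); rewrite mul1r -h; by field.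
move=> /(cube1_char3 c3) /divr1_eq AA.
have : v' abw \in <<map v' [:: ab1]>>%VS.
  rewrite /= span_seq1 e3 e1 AA; apply/vlineP; exists (x2 / x1).
  by rewrite scalerA -mulrA mulVf // mulr1.
rewrite -(twin_mem _ _ tw) /= span_seq1 => /vlineP[m].
have [k k0 ek] := eabw; have [k1 _ ek1] := eab1.
rewrite ek ek1 scale1r => e.
have [E1 E2] : k = m * k1 /\ k * w = m * k1.
  apply: (free2_eq fab); transitivity (k *: (v a + w *: v b)); first by vlin; ring.
  by rewrite e; vlin; ring.
have /eqP := w1; apply; apply: (mulfI k0); by rewrite E2 -E1 mulr1.
Qed.
End Configurations.

(** * Point sets without a twin *)

Section PlanarConfigurations.
Variables (F : finFieldType) (F' : fieldType) (U : vectType F) (U' : vectType F').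
Hypotheses (cF : #|F| = 4%N) (c3 : 3 \in [pchar F']).
Variables (I : Type) (s : I -> U) (t : I -> U').
Hypothesis tw : dtwin s t.

(** The homothety of ratio [be] centred at [L 0] sends [e] to [f] and permutes the full line. Since
    be^3 = 1, its ratio n in the twin satisfies n^3 = 1, so n = 1 and [e] would coincide with
    [f]. *)
Lemma full_line_absurd (L : F -> I) (e f : I) (be : F) (x y : U) :
  free [:: x; y] -> be != 0 -> be != 1 -> (forall k, s (L k) = s (L 0) + k *: x) ->
  s e = s (L 0) + y -> s f = s (L 0) + be *: y -> False.
Proof.
move=> fr b0 b1 eL ee ef; pose z := L 0.
have fX : free [:: t (L 1) - t z; t e - t z].
  rewrite (dtwin_free2 tw).
  have -> : s (L 1) - s z = x by rewrite eL /z; vlin; ring.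
  by have -> : s e - s z = y by rewrite ee /z; vlin; ring.
set X := t (L 1) - t z in fX; set Y := t e - t z in fX.
have [n en] : exists n, t f - t z = n *: Y.
  by apply: (dtwin_line tw (a := be)); rewrite ef ee /z; vlin; ring.
have mX k : exists m, t (L k) - t z = m *: X.
  by apply: (dtwin_line tw (a := k)); rewrite (eL k) (eL 1) /z; vlin; ring.
have step k m m' : t (L k) - t z = m *: X -> t (L (be * k)) - t z = m' *: X -> m' = n * m.
  move=> em em'.
  have [r er] : exists r, t f - t (L (be * k)) = r *: (t e - t (L k)).
    by apply: (dtwin_line tw (a := be)); rewrite (eL (be * k)) (eL k) ee ef; vlin; ring.
  have [E1 E2] : - m' = - (r * m) /\ n = r.
    apply: (free2_eq fX); transitivity (t f - t (L (be * k))).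
      have -> : t f - t (L (be * k)) = (t f - t z) - (t (L (be * k)) - t z) by vlin; ring.
      by rewrite en em'; vlin; ring.
    rewrite er; have -> : t e - t (L k) = Y - (t (L k) - t z) by rewrite /Y; vlin; ring.
    by rewrite em; vlin; ring.
  by rewrite (oppr_inj E1) E2.
have [m1 e1] := mX be; have [m2 e2] := mX (be * be).
have h0 : t (L 1) - t z = 1 *: X by rewrite scale1r.
have E1 := step 1 1 m1 h0 _; rewrite mulr1 in E1; have := E1 e1 => {}E1.
have E2 := step be m1 m2 e1 e2.
have b3 : be * (be * be) = 1 by rewrite -[RHS](cube_card4 cF b0) !exprS expr0 mulr1.
have E3 : 1 = n * m2 by apply: (step (be * be)); rewrite ?b3.
have n1 : n = 1 by apply: (cube1_char3 c3); rewrite E3 E2 E1 !exprS expr0 !mulr1.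
have : t f = t e by have := en; rewrite n1 scale1r /Y => /addIr.
move/eqP; rewrite (dtwin_eq tw) ee ef (inj_eq (addrI _)) => /eqP h.
have [] := free2_eq (a := 0) (b := be) (c := 0) (d := 1) fr; first by rewrite h scale1r.
by move=> _ /eqP; rewrite (negbTE b1).
Qed.

(** The lines meet in [o], which need not belong to the configuration. The parallels joining the two
    triples give a ratio [z] with z^3 = 1, hence z = 1, against the identity [m + 1 = z * m]. *)
Lemma two_lines_absurd (w : F) (l1 lw lq n1 nw nq : I) (o x y : U) :
  free [:: x; y] -> w != 0 -> w != 1 ->
  s l1 = o + x -> s lw = o + w *: x -> s lq = o + (w + 1) *: x ->
  s n1 = o + y -> s nw = o + w *: y -> s nq = o + (w + 1) *: y -> False.
Proof.
move=> fr w0 w1 el1 elw elq en1 enw enq.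
have ew := square_card4 cF w0 w1.
have w10 : w - 1 != 0 by rewrite subr_eq0.
have fA : free [:: t lw - t l1; t nw - t n1].
  rewrite (dtwin_free2 tw).
  have -> : s lw - s l1 = (w - 1) *: x by rewrite elw el1; vlin; ring.
  have -> : s nw - s n1 = (w - 1) *: y by rewrite enw en1; vlin; ring.
  have /free2P fr2 := fr; apply/free2P => a b; rewrite !scalerA => /fr2[].
  by move=> /eqP; rewrite mulf_eq0 (negbTE w10) orbF => /eqP -> /eqP;
     rewrite mulf_eq0 (negbTE w10) orbF => /eqP ->.
set A := t lw - t l1 in fA; set B := t nw - t n1 in fA.
have [u eu] : exists u, t lq - t l1 = u *: A.
  apply: (dtwin_line tw (a := w / (w - 1))); rewrite elq elw el1.
  have -> : o + w *: x - (o + x) = (w - 1) *: x by vlin; ring.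
  by rewrite scalerA -mulrA mulVf // mulr1; vlin; ring.
have [v ev] : exists v, t nq - t n1 = v *: B.
  apply: (dtwin_line tw (a := w / (w - 1))); rewrite enq enw en1.
  have -> : o + w *: y - (o + y) = (w - 1) *: y by vlin; ring.
  by rewrite scalerA -mulrA mulVf // mulr1; vlin; ring.
pose D := t l1 - t n1.
have [m [n eD]] : exists m n, D = m *: A + n *: B.
  apply: (dtwin_plane tw (a := (w - 1)^-1) (b := - (w - 1)^-1)).
  have -> : s lw - s l1 = (w - 1) *: x by rewrite elw el1; vlin; ring.
  have -> : s nw - s n1 = (w - 1) *: y by rewrite enw en1; vlin; ring.
  by rewrite !scalerA mulNr mulVf // el1 en1; vlin; ring.
have [al eal] : exists al, t lw - t nw = al *: D.
  by apply: (dtwin_line tw (a := w)); rewrite elw enw el1 en1; vlin; ring.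
have [be ebe] : exists be, t lq - t nq = be *: D.
  by apply: (dtwin_line tw (a := w + 1)); rewrite elq enq el1 en1; vlin; ring.
have [z ez] : exists z, t lw - t nq = z *: (t l1 - t nw).
  by apply: (dtwin_line tw (a := w)); rewrite elw enq el1 enw; vlin; ring4w cF ew.
have [z' ez'] : exists z', t lq - t n1 = z' *: (t l1 - t nw).
  by apply: (dtwin_line tw (a := w + 1)); rewrite elq en1 el1 enw; vlin; ring4w cF ew.
have [E1 E2] : m + 1 = al * m /\ n - 1 = al * n.
  apply: (free2_eq fA); transitivity (t lw - t nw).
    have -> : t lw - t nw = A - B + D by rewrite /A /B /D; vlin; ring.
    by rewrite eD; vlin; ring.
  by rewrite eal eD; vlin; ring.
have [E3 E4] : m + u = be * m /\ n - v = be * n.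
  apply: (free2_eq fA); transitivity (t lq - t nq).
    have -> : t lq - t nq = (t lq - t l1) - (t nq - t n1) + D by rewrite /D; vlin; ring.
    by rewrite eu ev eD; vlin; ring.
  by rewrite ebe eD; vlin; ring.
have [E5 E6] : m + 1 = z * m /\ n - v = z * (n - 1).
  apply: (free2_eq fA); transitivity (t lw - t nq).
    have -> : t lw - t nq = A - (t nq - t n1) + D by rewrite /A /D; vlin; ring.
    by rewrite ev eD; vlin; ring.
  rewrite ez; have -> : t l1 - t nw = D - B by rewrite /D /B; vlin; ring.
  by rewrite eD; vlin; ring.
have [E7 E8] : m + u = z' * m /\ n = z' * (n - 1).
  apply: (free2_eq fA); transitivity (t lq - t n1).
    have -> : t lq - t n1 = (t lq - t l1) + D by rewrite /D; vlin; ring.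
    by rewrite eu eD; vlin; ring.
  rewrite ez'; have -> : t l1 - t nw = D - B by rewrite /D /B; vlin; ring.
  by rewrite eD; vlin; ring.
have a1 : (al - 1) * m = 1 by rewrite mulrBl -E1 mul1r addrC addKr.
have a10 : al - 1 != 0 by apply: contraTneq (oner_neq0 F') => h; rewrite -a1 h mul0r eqxx.
have m0 : m != 0 by apply: contraTneq (oner_neq0 F') => h; rewrite -a1 h mulr0 eqxx.
have nm : n = - m.
  by apply: (mulfI a10); rewrite mulrN a1 mulrBl -E2 mul1r addrC addKr.
have z2 : z' = z ^+ 2.
  have mu : m + u = - (n - v) by rewrite E4 E3 nm; ring.
  apply: (mulIf m0); rewrite -E7 mu E6 nm.
  have -> : - (z * (- m - 1)) = z * (m + 1) by ring.
  by rewrite E5; ring.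
have : z ^+ 3 = 1.
  apply: (mulIf m0); rewrite mul1r -[RHS]opprK -nm E8 z2 nm -opprD E5; ring.
move/(cube1_char3 c3) => z1; move: E5; rewrite z1 mul1r => /eqP.
by rewrite -subr_eq0 addrC addKr oner_eq0.
Qed.

(** The parallels give [2 * u = 0] for the ratio [u] of [x2] to [x1] seen from [z], so [x2] would
    coincide with [z]. *)
Lemma quadrilateral_absurd (w : F) (z x1 x2 y1 y2 q : I) (x y : U) :
  free [:: x; y] -> w != 0 -> w != 1 ->
  s x1 = s z + x -> s x2 = s z + w *: x -> s y1 = s z + y -> s y2 = s z + w *: y ->
  s q = s z + (w + 1) *: (x + y) -> False.
Proof.
move=> fr w0 w1 ex1 ex2 ey1 ey2 eq.
have ew := square_card4 cF w0 w1.
have fX : free [:: t x1 - t z; t y1 - t z].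
  rewrite (dtwin_free2 tw).
  have -> : s x1 - s z = x by rewrite ex1; vlin; ring.
  by have -> : s y1 - s z = y by rewrite ey1; vlin; ring.
set X := t x1 - t z in fX; set Y := t y1 - t z in fX.
have [u eu] : exists u, t x2 - t z = u *: X.
  by apply: (dtwin_line tw (a := w)); rewrite ex1 ex2; vlin; ring.
have [v ev] : exists v, t y2 - t z = v *: Y.
  by apply: (dtwin_line tw (a := w)); rewrite ey1 ey2; vlin; ring.
have [k ek] : exists k, t x2 - t y2 = k *: (t x1 - t y1).
  by apply: (dtwin_line tw (a := w)); rewrite ey1 ey2 ex1 ex2; vlin; ring.
have [l el] : exists l, t q - t x1 = l *: (t x1 - t y2).
  by apply: (dtwin_line tw (a := w)); rewrite eq ey2 ex1; vlin; ring4w cF ew.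
have [m em] : exists m, t q - t x2 = m *: (t x2 - t y1).
  by apply: (dtwin_line tw (a := w + 1)); rewrite eq ey1 ex2; vlin; ring4w cF ew.
have [n en] : exists n, t q - t z = n *: (t x1 - t y1).
  by apply: (dtwin_line tw (a := w + 1)); rewrite eq ey1 ex1; vlin; ring4w cF ew.
have XY : t x1 - t y1 = X - Y by rewrite /X /Y; vlin; ring.
have [E1 E2] : u = k /\ - v = - k.
  apply: (free2_eq fX); transitivity (t x2 - t y2).
    have -> : t x2 - t y2 = (t x2 - t z) - (t y2 - t z) by vlin; ring.
    by rewrite eu ev; vlin; ring.
  by rewrite ek XY; vlin; ring.
have vu : v = u by rewrite E1; apply: oppr_inj.
have eQ : t q - t z = n *: X + (- n) *: Y by rewrite en XY; vlin; ring.
have [E3 E4] : n = 1 + l /\ - n = - (l * u).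
  apply: (free2_eq fX); rewrite -eQ.
  have -> : t q - t z = (t q - t x1) + X by rewrite /X; vlin; ring.
  rewrite el; have -> : t x1 - t y2 = X - (t y2 - t z) by rewrite /X; vlin; ring.
  by rewrite ev vu; vlin; ring.
have [E5 E6] : n = u + m * u /\ - n = - m.
  apply: (free2_eq fX); rewrite -eQ.
  have -> : t q - t z = (t q - t x2) + (t x2 - t z) by vlin; ring.
  rewrite em; have -> : t x2 - t y1 = (t x2 - t z) - Y by rewrite /Y; vlin; ring.
  by rewrite eu; vlin; ring.
have : 2 * u == 0.
  have E7 := oppr_inj E4; have E8 := oppr_inj E6.
  have -> : 2 * u = (u + m * u) - (1 + l - 1 - 1) * u - (m - l) * u by ring.
  rewrite -E5 -E3 -E8; have -> : n - (n - 1 - 1) * u - (n - l) * u = n - (n - 1) * u + (1 - (n - l)) * u by ring.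
  have -> : l = n - 1 by rewrite E3 addrC addKr.
  rewrite {1}E7 E3; have -> : l = n - 1 by rewrite E3 addrC addKr.
  by apply/eqP; ring.
rewrite mulf_eq0 (negbTE (two_char3 c3)) /= => /eqP u0.
have : t x2 == t z by rewrite -subr_eq0 eu u0 scale0r.
rewrite (dtwin_eq tw) ex2 -subr_eq0 addrC addKr scaler_eq0 (negbTE w0) /= => /eqP x0.
by have /free2P/(_ 1 0) := fr; rewrite x0 scaler0 scale0r addr0 => /(_ erefl) [/eqP];
  rewrite oner_eq0.
Qed.

(** The six points form a hyperoval of the affine plane of order 4. Its parallel chords give
    [2 * p = 0], so [c] would coincide with [a]. *)
Lemma arc_absurd (w : F) (z a b c d e : I) (x y : U) :
  free [:: x; y] -> w != 0 -> w != 1 ->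
  s a = s z + x -> s b = s z + y -> s c = s z + x + w *: y -> s d = s z + w *: x + y ->
  s e = s z + w *: x + w *: y -> False.
Proof.
move=> fr w0 w1 ea eb ec ed ee.
have ew := square_card4 cF w0 w1.
have fX : free [:: t a - t z; t b - t z].
  rewrite (dtwin_free2 tw).
  have -> : s a - s z = x by rewrite ea; vlin; ring.
  by have -> : s b - s z = y by rewrite eb; vlin; ring.
set X := t a - t z in fX; set Y := t b - t z in fX.
have [p ep] : exists p, t c - t a = p *: Y.
  by apply: (dtwin_line tw (a := w)); rewrite ea eb ec; vlin; ring.
have [q eq] : exists q, t d - t b = q *: X.
  by apply: (dtwin_line tw (a := w)); rewrite ea eb ed; vlin; ring.
have [r er] : exists r, t e - t z = r *: (t a - t b).
  by apply: (dtwin_line tw (a := w)); rewrite ea eb ee; vlin; ring4 cF.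
have [k ek] : exists k, t c - t d = k *: (t a - t b).
  by apply: (dtwin_line tw (a := w + 1)); rewrite ea eb ec ed; vlin; ring4 cF.
have [l el] : exists l, t e - t c = l *: X.
  by apply: (dtwin_line tw (a := w + 1)); rewrite ea ee ec; vlin; ring4 cF.
have [m em] : exists m, t e - t d = m *: Y.
  by apply: (dtwin_line tw (a := w + 1)); rewrite eb ee ed; vlin; ring4 cF.
have XY : t a - t b = X - Y by rewrite /X /Y; vlin; ring.
have [E1 E2] : 1 - q = k /\ p - 1 = - k.
  apply: (free2_eq fX); transitivity (t c - t d); last by rewrite ek XY; vlin; ring.
  have -> : t c - t d = (t c - t a) + X - (t d - t b) - Y by rewrite /X /Y; vlin; ring.
  by rewrite ep eq; vlin; ring.
have eE : t e - t z = r *: X + (- r) *: Y by rewrite er XY; vlin; ring.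
have [E3 E4] : r = 1 + l /\ - r = p.
  apply: (free2_eq fX); rewrite -eE.
  have -> : t e - t z = (t e - t c) + (t c - t a) + X by rewrite /X; vlin; ring.
  by rewrite el ep; vlin; ring.
have [E5 E6] : r = q /\ - r = 1 + m.
  apply: (free2_eq fX); rewrite -eE.
  have -> : t e - t z = (t e - t d) + (t d - t b) + Y by rewrite /Y; vlin; ring.
  by rewrite em eq; vlin; ring.
have : 2 * p == 0.
  have -> : 2 * p = (p - 1) + (1 - q) + (p + q) by ring.
  by rewrite E2 E1 -E4 -E5; apply/eqP; ring.
rewrite mulf_eq0 (negbTE (two_char3 c3)) /= => /eqP p0.
have : t c == t a by rewrite -subr_eq0 ep p0 scale0r.
rewrite (dtwin_eq tw) ec ea -subr_eq0 addrC addKr scaler_eq0 (negbTE w0) /= => /eqP y0.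
by have /free2P/(_ 0 1) := fr; rewrite y0 scaler0 scale0r addr0 => /(_ erefl) [_ /eqP];
  rewrite oner_eq0.
Qed.

(** These are two homothetic triangles. In the basis of differences between corresponding vertices,
    the other differences form the Dowling configuration excluded above. *)
Lemma homothety_absurd (w : F) (i1 i2 i3 i4 i5 i6 : I) :
  w != 0 -> w != 1 -> free [:: s i1 - s i2; s i3 - s i4; s i5 - s i6] ->
  s i1 - s i3 = w *: (s i2 - s i4) -> s i3 - s i5 = w *: (s i4 - s i6) -> False.
Proof.
move=> w0 w1 fr e13 e35.
have ew := square_card4 cF w0 w1; have o0 := oner_neq0 F.
have w20 : w + 1 != 0 by rewrite addr_eq0 oppr_card4.
have h1 : s i1 = s i3 + w *: (s i2 - s i4) by rewrite -e13 addrC subrK.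
have h5 : s i5 = s i3 - w *: (s i4 - s i6) by rewrite -e35; vlin; ring.
apply: (@dowling_absurd F F' _ _ cF c3 _ _ _ w (i1, i2) (i3, i4) (i5, i6)
  (i1, i3) (i2, i3) (i1, i4) (i3, i5) (i4, i5) (i1, i5) (i2, i5) (i1, i6) tw w0 w1 fr) => /=.
- by exists (w + 1) => //; rewrite h1; vlin; ring4w cF ew.
- by exists w => //; rewrite h1; vlin; ring4w cF ew.
- by exists (w + 1) => //; rewrite h1; vlin; ring4w cF ew.
- by exists (w + 1) => //; rewrite h5; vlin; ring4w cF ew.
- by exists w => //; rewrite h5; vlin; ring4w cF ew.
- by exists (w + 1) => //; rewrite h1 h5; vlin; ring4w cF ew.
- by exists w => //; rewrite h1 h5; vlin; ring4w cF ew.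
- by exists (w + 1) => //; rewrite h1 h5; vlin; ring4w cF ew.
Qed.

(** Three parallel segments whose lengths 1, [l], [m] add up to 0 have differences containing a Fano
    plane. *)
Lemma segments_absurd (l m : F) (i1 i2 i3 i4 i5 i6 : I) (p x y : U) :
  free [:: p; x; y] -> 1 + l + m = 0 ->
  s i2 = s i1 + p -> s i3 = s i1 + x -> s i4 = s i1 + x + l *: p ->
  s i5 = s i1 + x + y -> s i6 = s i1 + x + y + m *: p -> False.
Proof.
move=> fr lm e2 e3 e4 e5 e6.
have el : l = 1 + m by apply: subr0_eq; rewrite oppr_card4 // -lm; ring.
have d12 : s i1 - s i2 = p by rewrite e2; vlin; ring4 cF.
have d13 : s i1 - s i3 = x by rewrite e3; vlin; ring4 cF.
have d35 : s i3 - s i5 = y by rewrite e3 e5; vlin; ring4 cF.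
apply: (@fano_absurd F F' _ _ _ _ _ (i1, i2) (i1, i3) (i3, i5) (i2, i3) (i1, i5) (i4, i6)
  (i2, i5) tw (pchar2_char3 c3) (pchar_card4 cF)) => /=.
- by rewrite d12 d13 d35.
- by rewrite e2 e3; vlin; ring4 cF.
- by rewrite e3 e5; vlin; ring4 cF.
- by rewrite d12 d35 e4 e6 el; vlin; ring4 cF.
by rewrite e2 e3 e5; vlin; ring4 cF.
Qed.
End PlanarConfigurations.

(** * Six points in an affine plane of order 4 *)

Section SixPoints.
Variables (F : finFieldType) (F' : fieldType) (U : vectType F) (U' : vectType F').
Hypotheses (cF : #|F| = 4%N) (c3 : 3 \in [pchar F']).
Variables (I : finType) (s : I -> U) (t : I -> U').
Hypotheses (tw : dtwin s t) (si : injective s).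

Let coef (x u : U) : F := odflt 0 [pick k | u == k *: x].

Lemma line_coefE x u : u \in <[x]>%VS -> u = coef x u *: x.
Proof.
case/vlineP => k ->; rewrite /coef; case: pickP => [j /eqP //|/(_ k)].
by rewrite eqxx.
Qed.

Definition line_set a b := [set i | s i - s a \in <[s b - s a]>%VS].

Lemma card_line_set a b : (#|line_set a b| <= 4)%N.
Proof.
rewrite -cF -(card_in_imset (f := fun i => coef (s b - s a) (s i - s a)) (D := line_set a b)).
  exact: max_card.
move=> i j; rewrite !inE => iA jA e; apply: si; apply: (addIr (- s a)).
by rewrite (line_coefE iA) (line_coefE jA) e.
Qed.

Lemma full_line_set a b : a != b -> (4 <= #|line_set a b|)%N ->
  exists L : F -> I, forall k, s (L k) = s a + k *: (s b - s a).
Proof.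
move=> ab le.
pose f i := coef (s b - s a) (s i - s a).
have fi : {in line_set a b &, injective f}.
  move=> i j; rewrite !inE => iA jA e; apply: si; apply: (addIr (- s a)).
  by rewrite (line_coefE iA) (line_coefE jA) -/(f i) e.
have fT : f @: line_set a b = setT.
  by apply/eqP; rewrite eqEcard subsetT cardsT cF card_in_imset.
have h k : exists i, s i = s a + k *: (s b - s a).
  have : k \in f @: line_set a b by rewrite fT inE.
  by case/imsetP => i; rewrite inE => iA ->; exists i; rewrite -line_coefE // addrC subrK.
by exists (fun k => projT1 (boolp.cid (h k))) => k; case: (boolp.cid _).
Qed.

Hypotheses (I6 : (5 < #|I|)%N)
  (pl : forall a b c i, free [:: s b - s a; s c - s a] ->
     s i - s a \in <<[:: s b - s a; s c - s a]>>%VS).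

Lemma free_off_line a b c : a != b -> c \notin line_set a b -> free [:: s b - s a; s c - s a].
Proof.
move=> ab; rewrite inE => ca; apply/free2P => x y e.
have y0 : y = 0.
  apply/eqP; apply: contraNT ca => y0; apply/vlineP; exists (- x / y).
  apply: (scalerI y0); rewrite scalerA mulrCA mulfV // mulr1 scaleNr.
  by apply/eqP; rewrite -addr_eq0 addrC e.
split=> //; move: e; rewrite y0 scale0r addr0 => /eqP.
by rewrite scaler_eq0 subr_eq0 (inj_eq si) (eq_sym b) (negbTE ab) orbF => /eqP.
Qed.

Lemma plane_coord a b c i : a != b -> c \notin line_set a b ->
  exists al be, s i = s a + al *: (s b - s a) + be *: (s c - s a).
Proof.
move=> ab ca; have := pl i (free_off_line ab ca); case/span2P => al [be e].
by exists al, be; rewrite -addrA -e addrC subrK.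
Qed.

(** Two points [e], [f] lie off a full line. Their line is either parallel to it, which gives a
    parallelogram, or meets it in a point from which [full_line_absurd] applies. *)
Lemma card_line_set3 a b : a != b -> (#|line_set a b| <= 3)%N.
Proof.
move=> ab; rewrite leqNgt; apply/negP => ge.
have [L eL] := full_line_set ab ge.
have [e [f [eA fA ef]]] : exists e f, [/\ e \notin line_set a b, f \notin line_set a b & e != f].
  have : (1 < #|~: line_set a b|)%N.
    by have := cardsC (line_set a b); have := card_line_set a b; move: I6; lia.
  by case/card_gt1P => e [f []]; rewrite !in_setC => ? ? ?; exists e, f.
set x := s b - s a in eL; pose y := s e - s a.
have fr : free [:: x; y] := free_off_line ab eA.
have [al [be]] := plane_coord f ab eA; rewrite -/x -/y => ef'.
have ee : s e = s a + y by rewrite /y addrC subrK.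
have be0 : be != 0.
  apply: contraNneq fA => b0; rewrite inE; apply/vlineP; exists al.
  by rewrite ef' b0 -/x; vlin; ring.
have [b1|b1] := eqVneq be 1.
  have al0 : al != 0.
    apply: contraNneq ef => a0; apply/eqP/si; rewrite ef' ee a0 b1; vlin; ring.
  apply: (parallelogram_absurd cF c3 (a := a) (b := L al) (c := e) (d := f) (x := al *: x)
    (y := y) tw); rewrite ?eL ?ee ?ef' ?b1 ?scale1r //.
  apply/free2P => p q; rewrite scalerA => /((free2P _ _) fr)[].
  by move=> /eqP; rewrite mulf_eq0 (negbTE al0) orbF => /eqP -> ->.
have b10 : 1 - be != 0 by rewrite subr_eq0 eq_sym.
(* The parameter of the point where the line through [e] and [f] meets the full line. *)
pose ze := al / (1 - be); pose M k := L (ze + k).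
have M0 : s (M 0) = s a + ze *: x by rewrite /M addr0 eL.
have eM k : s (M k) = s (M 0) + k *: x by rewrite M0 /M eL; vlin; ring.
apply: (@full_line_absurd _ _ _ _ cF c3 _ _ _ tw M e f be x (y - ze *: x)) => //.
- apply/free2P => p q h; have /free2P/(_ (p - q * ze) q) := fr.
  have -> : (p - q * ze) *: x + q *: y = p *: x + q *: (y - ze *: x) by vlin; ring.
  by case/(_ h) => h1 q0; split=> //; move: h1; rewrite q0 mul0r subr0.
- by rewrite M0 ee; vlin; ring.
rewrite M0 ef'; have -> : al = ze * (1 - be) by rewrite /ze -mulrA mulVf // mulr1.
by vlin; ring.
Qed.

(** Let [d], [e], [f] be points off the line. Two of them on a parallel to it would form a
    parallelogram with two of the collinear points, so their heights are 1, w and w + 1. A further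
    parallelogram forces equal offsets for [e] and [f]; what remains is [two_lines_absurd] or
    [quadrilateral_absurd]. *)
Lemma no_three_collinear a b c : a != b -> c != a -> c != b -> c \notin line_set a b.
Proof.
move=> ab ca cb; apply/negP => cl.
have := cl; rewrite inE => /vlineP[l el]; set x := s b - s a in el.
have x0 : x != 0 by rewrite subr_eq0 (inj_eq si) eq_sym.
have l0 : l != 0.
  by apply: contraNneq ca => l0; rewrite -(inj_eq si) -subr_eq0 el l0 scale0r.
have l1 : l != 1.
  apply: contraNneq cb => l1; rewrite -(inj_eq si).
  by move: el; rewrite l1 scale1r /x => /addIr ->.
have ew := square_card4 cF l0 l1.
(* The fourth point of the line, taken as origin: [a], [b], [c] become its three nonzero points. *)
pose o := s a + (l + 1) *: x.
have eA : s a = o + (l + 1) *: x by rewrite /o; vlin; ring4 cF.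
have eB : s b = o + l *: x.
  by rewrite /o -[s b](subrK (s a)) -/x; vlin; ring4 cF.
have eC : s c = o + x by rewrite /o -[s c](subrK (s a)) el; vlin; ring4 cF.
have ptx k : k != 0 -> exists i, i \in [:: a; b; c] /\ s i = o + k *: x.
  move=> k0; have [k0'|k1|k2|k3] := mem_card4 cF k l0 l1.
  - by rewrite k0' eqxx in k0.
  - by exists c; rewrite k1 scale1r !inE eqxx !orbT.
  - by exists b; rewrite k2 !inE eqxx !orbT.
  by exists a; rewrite k3 !inE eqxx.
have lA : line_set a b = [set a; b; c].
  apply/eqP; rewrite eq_sym eqEcard; apply/andP; split.
    apply/subsetP => i; rewrite !inE => /orP[/orP[]|] /eqP ->.
    - by rewrite subrr mem0v.
    - by rewrite memv_line.
    by move: cl; rewrite inE.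
  apply: leq_trans (card_line_set3 ab) _.
  by rewrite setUC cardsU1 cards2 !inE negb_or ca cb ab.
have [d [e [f [[dA eA' fA] [de ef fd]]]]] : exists d e f,
    [/\ d \notin line_set a b, e \notin line_set a b & f \notin line_set a b] /\
    [/\ d != e, e != f & f != d].
  have : (2 < #|~: line_set a b|)%N.
    by have := cardsC (line_set a b); have := card_line_set3 ab; move: I6; lia.
  by case/card_gt2P => d [e [f []]]; rewrite !in_setC; exists d, e, f.
pose y := s d - o.
have fr : free [:: x; y].
  apply/free2P => p q h; have /free2P/(_ (p + q * (l + 1)) q) := free_off_line ab dA.
  rewrite -/x; have -> : (p + q * (l + 1)) *: x + q *: (s d - s a) = p *: x + q *: y.
    by rewrite /y eA; vlin; ring.
  by case/(_ h) => h1 q0; split=> //; move: h1; rewrite q0 mul0r addr0.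
have coo i : exists al be, s i = o + al *: x + be *: y.
  have [al [be h]] := plane_coord i ab dA; exists (al + (l + 1) - be * (l + 1)), be.
  by rewrite h -/x /y eA; vlin; ring.
have ed : s d = o + y by rewrite /y addrC subrK.
have offline i al be : i \notin line_set a b -> s i = o + al *: x + be *: y -> be != 0.
  move=> iA h; apply: contraNneq iA => b0; rewrite inE; apply/vlineP.
  by exists (al - (l + 1)); rewrite -/x h b0 eA; vlin; ring.

clearbody y; clearbody o; clearbody x.
have distinct i j al al' be : i != j -> s i = o + al *: x + be *: y -> be != 0 ->
    s j = o + al' *: x + be *: y -> False.
  move=> ij ei be0 ej.
  pose m := al' - al.
  have m0 : m != 0.
    by apply: contraNneq ij => /subr0_eq h; rewrite -(inj_eq si) ei ej h.
  have [i1 [_ e1]] := ptx (m * l) (mulf_neq0 m0 l0).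
  have w20 : l + 1 != 0 by rewrite addr_eq0 oppr_card4.
  have [i2 [_ e2]] := ptx (m * (l + 1)) (mulf_neq0 m0 w20).
  apply: (parallelogram_absurd cF c3 (a := i1) (b := i2) (c := i) (d := j) (x := m *: x)
    (y := al *: x + be *: y - (m * l) *: x) tw).
  - apply/free2P => p q h; have /free2P/(_ (p * m + q * al - q * m * l) (q * be)) := fr.
    have -> : (p * m + q * al - q * m * l) *: x + (q * be) *: y =
       p *: (m *: x) + q *: (al *: x + be *: y - (m * l) *: x) by vlin; ring.
    case/(_ h) => h1 /eqP; rewrite mulf_eq0 (negbTE be0) orbF => /eqP q0.
    move: h1; rewrite q0 !mul0r subr0 addr0 => /eqP.
    by rewrite mulf_eq0 (negbTE m0) orbF => /eqP.
  - by rewrite e1 e2; vlin; ring.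
  - by rewrite e1 ei; vlin; ring.
  by rewrite e1 ej /m; vlin; ring4 cF.
have [mu [w ee]] := coo e; have [nu [w' ef']] := coo f.
have w0 := offline _ _ _ eA' ee; have w'0 := offline _ _ _ fA ef'.
have ed' : s d = o + 0 *: x + 1 *: y by rewrite ed; vlin; ring.
have w1 : w != 1.
  apply/eqP => h; rewrite h in ee; exact: (distinct d e _ _ _ de ed' (oner_neq0 _) ee).
have w'1 : w' != 1.
  apply/eqP => h; rewrite h in ef'; exact: (distinct f d _ _ _ fd ef' (oner_neq0 _) ed').
have w'w : w' != w.
  apply/eqP => h; rewrite h in ef'; exact: (distinct e f _ _ _ ef ee w0 ef').
have ew' := square_card4 cF w0 w1.
have {w'0 w'1 w'w} ww' : w' = w + 1.
  by case: (mem_card4 cF w' w0 w1) => // h; rewrite h eqxx in w'0 w'1 w'w.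
have w20 : w + 1 != 0 by rewrite addr_eq0 oppr_card4.
have mn : mu = nu.
  apply/eqP; rewrite -subr_eq0; apply: contraT => mn0.
  have [i [iabc ei]] := ptx _ mn0.
  have es : s i - s d = (s e - s d) + (s f - s d).
    by rewrite ei ee ef' ed ww'; vlin; ring4 cF.
  have [fl|fl] := boolP (f \in line_set d e).
    have il : i \in line_set d e by move: fl; rewrite !inE es => fl; rewrite memvD ?memv_line.
    have iN j : j \notin line_set a b -> i != j.
      by rewrite lA => jN; apply: contraNneq jN => <-; move: iabc; rewrite !inE -orbA.
    have : (#|[set i; d; e; f]| <= 3)%N.
      apply: leq_trans (card_line_set3 de); apply/subset_leq_card/subsetP => j.
      rewrite !inE -!orbA => /or4P[]/eqP -> //; move: il fl; rewrite !inE //.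
        by rewrite subrr mem0v.
      by rewrite memv_line.
    by rewrite -!setUA !cardsU1 cards1 !inE !negb_or !iN // de ef (eq_sym d f) fd.
  exfalso; apply: (parallelogram_absurd cF c3 (a := d) (b := e) (c := f) (d := i) tw
    (free_off_line de fl)).
  - by vlin; ring.
  - by vlin; ring.
  by rewrite -addrA -es addrC subrK.
rewrite -{nu}mn ww' in ef'.
have [mu0|mu0] := eqVneq mu 0.
  have [i1 [_ e1]] := ptx 1 (oner_neq0 _); have [i2 [_ e2]] := ptx w w0.
  have [i3 [_ e3]] := ptx _ w20.
  apply: (@two_lines_absurd _ _ _ _ cF c3 _ _ _ tw w i1 i2 i3 d e f o x y) => //.
  - by rewrite e1 scale1r.
  - by rewrite ee mu0 scale0r addr0.
  by rewrite ef' mu0 scale0r addr0.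
have [z [_ ez]] := ptx mu mu0; have wm0 : w * mu + mu != 0 by rewrite -{2}[mu]mul1r -mulrDl mulf_neq0.
have [i1 [_ e1]] := ptx _ wm0.
have [i2 [_ e2]] := ptx (w * mu) (mulf_neq0 w0 mu0).
apply: (@quadrilateral_absurd _ _ _ _ cF c3 _ _ _ tw w z i1 i2 e f d (w *: (mu *: x)) (w *: y)).
- apply/free2P => p q; rewrite !scalerA => h; have /free2P/(_ _ _ h)[] := fr.
  move=> /eqP; rewrite !mulf_eq0 (negbTE w0) (negbTE mu0) !orbF => /eqP -> /eqP.
  by rewrite mulf_eq0 (negbTE w0) orbF => /eqP ->.
- exact: w0.
- exact: w1.
- by rewrite e1 ez; vlin; ring4w cF ew'.
- by rewrite e2 ez; vlin; ring4w cF ew'.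
- by rewrite ee ez; vlin; ring4w cF ew'.
- by rewrite ef' ez; vlin; ring4w cF ew'.
by rewrite ed ez; vlin; ring4w cF ew'.
Qed.

(** Seen from [z], with [a] and [b] on the axes, the other three points have the three nonzero
    slopes. Excluding parallelograms and collinear triples leaves only the hyperoval of
    [arc_absurd]. *)
Lemma six_points_absurd : False.
Proof.
have [z [a [b [_ [za ab bz]]]]] : exists z a b, [/\ z \in I, a \in I & b \in I] /\
    [/\ z != a, a != b & b != z] by apply/card_gt2P; apply: leq_ltn_trans I6.
have bl : b \notin line_set z a by apply: no_three_collinear => //; rewrite eq_sym.
set x := s a - s z; set y := s b - s z.
have fr : free [:: x; y] := free_off_line za bl.
have [c [d [e [[cN dN eN] [cd de ec]]]]] : exists c d e,
    [/\ c \notin [set z; a; b], d \notin [set z; a; b] & e \notin [set z; a; b]] /\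
    [/\ c != d, d != e & e != c].
  have : (2 < #|~: [set z; a; b]|)%N.
    have := cardsC [set z; a; b]; rewrite setUC cardsU1 cards2 !inE negb_or bz za eq_sym ab.
    by move: I6; lia.
  by case/card_gt2P => c [d [e []]]; rewrite !in_setC; exists c, d, e.
have ea : s a = s z + x by rewrite /x addrC subrK.
have eb : s b = s z + y by rewrite /y addrC subrK.
have nN i : i \notin [set z; a; b] -> [/\ i != z, i != a & i != b].
  by rewrite !inE !negb_or -andbA => /and3P[].
have n3 i j k (c' : F) : i != j -> k != i -> k != j ->
    s k - s i = c' *: (s j - s i) -> False.
  move=> ij ki kj h; have /negP := no_three_collinear ij ki kj; apply.
  by rewrite inE; apply/vlineP; exists c'.
have coo i : i \notin [set z; a; b] -> exists al r, [/\ al != 0, r != 0, al + al * r != 1,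
    ~~ ((al == 1) && (r == 1)) & s i = s z + al *: x + (al * r) *: y].
  move=> iN; have [iz ia ib] := nN i iN.
  have [al [be ei]] := plane_coord i za bl; rewrite -/x -/y in ei.
  have al0 : al != 0.
    apply/eqP => h; apply: (n3 z b i be) => //; first by rewrite eq_sym.
    by rewrite ei h -/y; vlin; ring.
  have be0 : be != 0.
    apply/eqP => h; apply: (n3 z a i al) => //.
    by rewrite ei h -/x; vlin; ring.
  exists al, (be / al); have -> : al * (be / al) = be by rewrite mulrCA mulfV // mulr1.
  split=> //; first by rewrite mulf_neq0 ?invr_eq0.
    apply/eqP => h; apply: (n3 a b i be) => //.
    by rewrite ei ea eb -[al](addrK be) h; vlin; ring.
  apply/negP => /andP[/eqP h1]; rewrite h1 divr1 => /eqP h2.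
  apply: (parallelogram_absurd cF c3 (a := z) (b := a) (c := b) (d := i) tw fr) => //.
  by rewrite ei h1 h2 !scale1r.
clearbody x y.
have rat i j al al' r : i \notin [set z; a; b] -> j \notin [set z; a; b] -> i != j -> al != 0 ->
    s i = s z + al *: x + (al * r) *: y -> s j = s z + al' *: x + (al' * r) *: y -> False.
  move=> /nN[iz _ _] /nN[jz _ _] ij al0 ei ej.
  apply: (n3 z i j (al' / al)) => //; [by rewrite eq_sym | by rewrite eq_sym |].
  have -> : s i - s z = al *: (x + r *: y) by rewrite ei; vlin; ring.
  by rewrite scalerA -mulrA mulVf // mulr1 ej; vlin; ring.
have [w [w0 w1]] : exists w : F, w != 0 /\ w != 1 := exists_card4 cF.
have w20 : w + 1 != 0 by rewrite addr_eq0 oppr_card4.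
have [al1 [r1 [a10 r10 s1 u1 e1]]] := coo c cN.
have [al2 [r2 [a20 r20 s2 u2 e2]]] := coo d dN.
have [al3 [r3 [a30 r30 s3 u3 e3]]] := coo e eN.
have r12 : r1 != r2.
  by apply/eqP => h; rewrite h in e1; apply: (rat c d) cd a10 e1 e2.
have r23 : r2 != r3.
  by apply/eqP => h; rewrite h in e2; apply: (rat d e) de a20 e2 e3.
have r31 : r3 != r1.
  by apply/eqP => h; rewrite h in e3; apply: (rat e c) ec a30 e3 e1.
(* sorting the three remaining points by slope *)
have core i j k al be ga (v : F) : v != 0 -> v != 1 ->
    i \notin [set z; a; b] -> j \notin [set z; a; b] -> k \notin [set z; a; b] ->
    i != j -> j != k -> k != i -> al != 0 -> be != 0 -> ga != 0 ->
    al != 1 -> be + be * v != 1 -> ga + ga * (v + 1) != 1 -> 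
    s i = s z + al *: x + (al * 1) *: y -> s j = s z + be *: x + (be * v) *: y ->
    s k = s z + ga *: x + (ga * (v + 1)) *: y -> al = v -> False.
  move=> v0 v1 iN jN kN ij jk ki al0 be0 ga0 al1' hb hg ei ej ek av.
  have ev := square_card4 cF v0 v1.
  have [iz ia ib] := nN i iN; have [jz ja jb] := nN j jN; have [kz ka kb] := nN k kN.
  have b1 : be = 1.
    case: (mem_card4 cF be v0 v1) => // h.
    - by rewrite h eqxx in be0.
    - by exfalso; move/eqP: hb; apply; rewrite h; apply: subr0_eq; ring4w cF ev.
    exfalso; apply: (n3 a i j (v + 1)) => //; [by rewrite eq_sym | by rewrite eq_sym |].
    by rewrite ej ei ea av h; vlin; ring4w cF ev.
  have g1 : ga = v.
    case: (mem_card4 cF ga v0 v1) => // h.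
    - by rewrite h eqxx in ga0.
    - exfalso; apply: (n3 b i k (v + 1)) => //; [by rewrite eq_sym |].
      by rewrite ek ei eb av h; vlin; ring4w cF ev.
    by exfalso; move/eqP: hg; apply; rewrite h; apply: subr0_eq; ring4w cF ev.
  apply: (@arc_absurd _ _ _ _ cF c3 _ _ _ tw v z a b j k i x y) => //.
  - by rewrite ej b1; vlin; ring.
  - by rewrite ek g1; vlin; ring4w cF ev.
  by rewrite ei av; vlin; ring.
have core2 i j k al be ga rj rk : rj != 0 -> rj != 1 -> rk != 0 -> rk != 1 -> rj != rk ->
    i \notin [set z; a; b] -> j \notin [set z; a; b] -> k \notin [set z; a; b] ->
    i != j -> j != k -> k != i -> al != 0 -> be != 0 -> ga != 0 ->
    ~~ ((al == 1) && ((1 : F) == 1)) -> be + be * rj != 1 -> ga + ga * rk != 1 -> 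
    s i = s z + al *: x + (al * 1) *: y -> s j = s z + be *: x + (be * rj) *: y ->
    s k = s z + ga *: x + (ga * rk) *: y -> False.
  move=> rj0 rj1 rk0 rk1 rjk iN jN kN ij jk ki al0 be0 ga0; rewrite eqxx andbT => al1' hb hg ei ej ek.
  have er : rk = rj + 1.
    case: (mem_card4 cF rk rj0 rj1) => // h; move: rk0 rk1 rjk; rewrite h eqxx //.
  have er' : rj = rk + 1 by rewrite er; apply: subr0_eq; ring4 cF.
  case: (mem_card4 cF al rj0 rj1) => h.
  - by rewrite h eqxx in al0.
  - by rewrite h eqxx in al1'.
  - rewrite er in ek hg.
    exact: (core i j k al be ga rj rj0 rj1 iN jN kN ij jk ki al0 be0 ga0 al1' hb hg ei ej ek h).
  rewrite er' in ej hb; rewrite -er in h; rewrite eq_sym in ij; rewrite eq_sym in jk; rewrite eq_sym in ki.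
  exact: (core i k j al ga be rk rk0 rk1 iN kN jN ki jk ij al0 ga0 be0 al1' hg hb ei ek ej h).
have [h1|r11] := eqVneq r1 1.
  rewrite h1 in u1 e1 r12 r31; rewrite eq_sym in r12.
  exact: (core2 c d e al1 al2 al3 r2 r3 r20 r12 r30 r31 r23 cN dN eN cd de ec a10 a20 a30 u1 s2 s3 e1 e2 e3).
have [h2|r21] := eqVneq r2 1.
  rewrite h2 in u2 e2 r12 r23; rewrite eq_sym in r23.
  exact: (core2 d e c al2 al3 al1 r3 r1 r30 r23 r10 r12 r31 dN eN cN de ec cd a20 a30 a10 u2 s3 s1 e2 e3 e1).
have h3 : r3 = 1.
  case: (mem_card4 cF r2 r10 r11) => h; first by rewrite h eqxx in r20.
  - by rewrite h eqxx in r21.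
  - by rewrite h eqxx in r12.
  case: (mem_card4 cF r3 r10 r11) => // h'; first by rewrite h' eqxx in r30.
  - by rewrite h' eqxx in r31.
  by rewrite h h' eqxx in r23.
rewrite h3 in u3 e3 r31 r23.
exact: (core2 e c d al3 al1 al2 r1 r2 r10 r11 r20 r21 r12 eN cN dN ec cd de a30 a10 a20 u3 s1 s2 e3 e1 e2).
Qed.
End SixPoints.

(** * Affine nullity *)

Section SeriesClasses.
Variable M : matroid.
Implicit Types (A B Q : {set M}).

Definition coloopfree A := forall i, i \in A -> rk (A :\ i) = rk A.

Lemma rk_setD1 A i : (rk A <= rk (A :\ i) + 1)%N.
Proof.
have := rk_submod (A :\ i) [set i]; have := rk_card [set i]; rewrite cards1.
have : (rk A <= rk (A :\ i :|: [set i]))%N.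
  by apply: rk_mono; apply/subsetP => j jA; rewrite !inE jA andbT; case: eqP.
lia.
Qed.

Lemma rk_setU1 A B : (rk (A :|: B) <= rk A + #|B|)%N.
Proof. by have := rk_submod A B; have := rk_card B; lia. Qed.

Lemma coloop_sub A B j : B \subset A -> j \in B -> (rk (A :\ j) < rk A)%N ->
  (rk (B :\ j) < rk B)%N.
Proof.
move=> /subsetP BA jB; have := rk_submod (A :\ j) B.
have -> : A :\ j :|: B = A.
  apply/setP => i; rewrite !inE; case: eqP => [->|_] /=; first by rewrite jB BA.
  by apply/orP/idP => [[//|/BA //]|]; left.
have -> : (A :\ j) :&: B = B :\ j.
  by apply/setP => i; rewrite !inE; case iB : (i \in B); rewrite ?andbF ?(BA _ iB) ?andbT.
lia.
Qed.

Lemma rk_coloops A Q : Q \subset A -> (forall j, j \in Q -> (rk (A :\ j) < rk A)%N) ->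
  (rk (A :\: Q) + #|Q| = rk A)%N.
Proof.
move: {2}#|Q| (erefl #|Q|) => n; elim: n A Q => [|n IH] A Q eQ QA hQ.
  by move/eqP: eQ; rewrite cards_eq0 => /eqP ->; rewrite setD0 cards0 addn0.
have [j jQ] : exists j, j \in Q by apply/card_gt0P; rewrite eQ.
have jA := subsetP QA j jQ.
have cj : #|Q :\ j| = n by have := cardsD1 j Q; rewrite jQ eQ => -[].
have rj : rk (A :\ j) = (rk A).-1 by have := hQ j jQ; have := rk_setD1 A j; lia.
have sub : Q :\ j \subset A :\ j by apply: setSD.
have := IH (A :\ j) (Q :\ j) cj sub _.
have -> : A :\ j :\: (Q :\ j) = A :\: Q.
  by apply/setP => i; rewrite !inE; case: eqP => [->|]; rewrite ?jQ ?andbF ?andbT //=.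
rewrite eQ cj rj => h; have := hQ j jQ => lt; suff : (rk (A :\: Q) + n = (rk A).-1)%N by lia.
apply: h => i iQ; rewrite -rj; apply: (coloop_sub (A := A)).
- exact: subsetDl.
- by apply: (subsetP sub).
by apply: hQ; move: iQ; rewrite !inE => /andP[].
Qed.

(** When [A] has no coloops, this is the series class of [i] in the restriction to [A]: the elements
    forming a cocircuit of size 2 with [i], and [i] itself. *)
Definition ser A i := i |: [set j in A | (rk (A :\: [set i; j]) < rk A)%N].

Lemma ser_id A i : i \in ser A i. Proof. by rewrite !inE eqxx. Qed.

Lemma ser_sub A i : i \in A -> ser A i \subset A.
Proof. by move=> iA; apply/subsetP => j; rewrite !inE => /orP[/eqP ->|/andP[]]. Qed.

Variable A : {set M}.
Hypothesis cA : coloopfree A.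

Lemma ser_coloop i j : i \in A -> j \in ser A i -> j != i ->
  (rk (A :\ i :\ j) < rk (A :\ i))%N.
Proof.
move=> iA; rewrite !inE => /orP[->//|/andP[jA lt]] _.
by rewrite (cA iA) setDDl.
Qed.

(** Deleting [i] keeps the rank and turns the rest of its class into coloops, each of which then
    lowers the rank by 1. So the nullity drops by exactly 1. *)
Lemma rk_ser i : i \in A -> (rk (A :\: ser A i) + #|ser A i| = rk A + 1)%N.
Proof.
move=> iA; have := rk_coloops (A := A :\ i) (Q := ser A i :\ i) _ _.
rewrite setSD ?ser_sub // => /(_ isT) h.
have -> : A :\: ser A i = A :\ i :\: (ser A i :\ i).
  by apply/setP => j; rewrite !inE; case: eqP.
have := cardsD1 i (ser A i); rewrite ser_id => ->.
rewrite -(cA iA) -h; first by rewrite addnCA addnC.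
by move=> j /setD1P[ji js]; apply: ser_coloop.
Qed.

(** A coloop [k] of what remains would already form a cocircuit with [i], and thus belong to the
    deleted class. *)
Lemma coloopfree_ser i : i \in A -> coloopfree (A :\: ser A i).
Proof.
move=> iA k /setDP[kA kP].
have ki : k != i by apply: contraNneq kP => ->; apply: ser_id.
have := rk_setD1 (A :\: ser A i) k.
have : (rk (A :\: ser A i :\ k) <= rk (A :\: ser A i))%N by apply/rk_mono/subsetDl.
case: (ltngtP (rk (A :\: ser A i :\ k)) (rk (A :\: ser A i))) => // lt _ _.
have := rk_ser iA; have cP := cardsD1 i (ser A i); rewrite ser_id in cP.
have : (rk (A :\: [set i; k]) <= rk (A :\: ser A i :\ k) + #|ser A i :\ i|)%N.
  apply: leq_trans (rk_setU1 _ _); apply: rk_mono; apply/subsetP => j /setDP[jA].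
  rewrite !in_set2 => /norP[ji jk]; apply/setUP.
  have [jS|jS] := boolP (j \in ser A i); first by right; rewrite in_setD1 ji jS.
  by left; rewrite in_setD1 jk in_setD jS jA.
have : ~~ (rk (A :\: [set i; k]) < rk A)%N.
  by apply: contra kP => h; rewrite !inE kA h orbT.
rewrite -leqNgt; lia.
Qed.

Lemma ser_sym i j : i \in A -> j \in ser A i -> i \in ser A j.
Proof.
move=> iA; rewrite !inE => /orP[/eqP ->|/andP[jA lt]]; first by rewrite eqxx.
by rewrite iA setUC lt orbT.
Qed.

Lemma ser_trans i j k : i \in A -> j \in ser A i -> k \in ser A j -> k \in ser A i.
Proof.
move=> iA ji kj; have jA : j \in A := subsetP (ser_sub iA) j ji.
have kA : k \in A := subsetP (ser_sub jA) k kj.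
have [->|nki] := eqVneq k i; first exact: ser_id.
have [<- //|nji] := eqVneq j i; have [->//|nkj] := eqVneq k j.
rewrite !inE kA; apply/orP; right.
have l1 : (rk (A :\: [set j; i]) < rk A)%N.
  by move: (ser_sym iA ji); rewrite !inE eq_sym (negbTE nji) /= => /andP[].
have l2 : (rk (A :\: [set j; k]) < rk A)%N.
  by move: kj; rewrite !inE (negbTE nkj) /= => /andP[].
have := rk_submod (A :\: [set j; i]) (A :\: [set j; k]).
have -> : A :\: [set j; i] :|: A :\: [set j; k] = A :\ j.
  apply/setP => x; rewrite !inE !negb_or; case: (x =P j) => //= _.
  case: (x =P i) => [->|_] /=; first by rewrite eq_sym nki.
  by case: (x \in A); rewrite ?andbF.
rewrite (cA jA).
have : (rk (A :\: [set i; k]) <= rk ((A :\: [set j; i]) :&: (A :\: [set j; k])) + #|[set j]|)%N.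
  apply: leq_trans (rk_setU1 _ _); apply: rk_mono; apply/subsetP => x.
  by rewrite !inE !negb_or; case: (x == j); case: (x == i); case: (x == k); case: (_ \in _).
rewrite cards1; lia.
Qed.

Lemma ser_disjoint i j : i \in A -> j \in A -> j \notin ser A i ->
  ser A j \subset A :\: ser A i.
Proof.
move=> iA jA ji; apply/subsetP => k kj; rewrite inE (subsetP (ser_sub jA)) // andbT.
apply: contra ji => ki; apply: ser_trans ki _ => //; exact: ser_sym.
Qed.
End SeriesClasses.

Section AffineRank.
Variables (F : fieldType) (U : vectType F) (I : finType) (s : I -> U).

(** Homogeneous coordinates: linear dependencies of these vectors are affine dependencies of the
    points. *)
Definition hvec (i : I) : U * F^o := (s i, 1).

Definition hrk (A : {set I}) : nat := \dim <<[seq hvec i | i in A]>>.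

Lemma hrk_card A : (hrk A <= #|A|)%N.
Proof. by apply: leq_trans (dim_span _) _; rewrite size_image. Qed.

Lemma sub_hspan (A B : {set I}) : A \subset B ->
  (<<[seq hvec e | e in A]>> <= <<[seq hvec e | e in B]>>)%VS.
Proof.
move=> /subsetP sAB; apply: sub_span => _ /imageP[e eA ->].
by apply: image_f; apply: sAB.
Qed.

Lemma hrk_mono (A B : {set I}) : A \subset B -> (hrk A <= hrk B)%N.
Proof. by move=> sAB; apply/dimvS/sub_hspan. Qed.

Lemma hrk_submod A B : (hrk (A :|: B) + hrk (A :&: B) <= hrk A + hrk B)%N.
Proof.
rewrite /hrk -[leqRHS]dimv_sum_cap leq_add //; apply: dimvS.
  apply/span_subvP => _ /imageP[e + ->]; rewrite inE.
  by case/orP=> eA; [apply: (subvP (addvSl _ _)) | apply: (subvP (addvSr _ _))];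
    apply/memv_span/image_f.
by rewrite subv_cap !sub_hspan ?subsetIl ?subsetIr.
Qed.

Definition affine_matroid : matroid := Matroid hrk_card hrk_mono hrk_submod.

Definition adim (A : {set I}) (a : I) : nat := \dim <<[seq s i - s a | i in A]>>.

Lemma hrk_adim (A : {set I}) a : a \in A -> hrk A = (adim A a).+1.
Proof.
move=> aA.
pose g (u : U) : U * F^o := (u, 0).
have lg : linear g.
  move=> k x y; have -> : k *: g x + g y = (k *: x + y, k *: (0 : F^o) + 0) by [].
  by rewrite scaler0 addr0.
pose G : {linear U -> (U * F^o)%type} := HB.pack g (GRing.isLinear.Build _ _ _ _ g lg).
pose p := linfun G.
have pE u : p u = (u, 0) by rewrite lfunE.
have pi : injective p by move=> x y; rewrite !pE => -[].
have e : <<[seq hvec i | i in A]>>%VS =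
    (<[hvec a]> + <<map (fun i => p (s i - s a)) (enum A)>>)%VS.
  apply/eqP; rewrite eqEsubv; apply/andP; split.
    apply/span_subvP => _ /imageP[i iA ->].
    have -> : hvec i = hvec a + p (s i - s a).
      rewrite pE; have -> : hvec a + (s i - s a, 0) = (s a + (s i - s a), 1 + 0) by [].
      by rewrite addr0 addrC subrK.
    by rewrite memv_add ?memv_line // memv_span //; apply/mapP; exists i; rewrite ?mem_enum.
  rewrite subv_add -memvE memv_span ?image_f //=.
  apply/span_subvP => u /mapP[i iA ->]; rewrite mem_enum in iA.
  have -> : p (s i - s a) = hvec i - hvec a.
    rewrite pE; have -> : hvec i - hvec a = (s i - s a, 1 - 1) by [].
    by rewrite subrr.
  by rewrite memvB ?memv_span ?image_f.
rewrite /hrk e dim_add_line (dim_map_inj (fun i => s i - s a)) // /adim span_image addnC.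
suff -> : hvec a \notin <<map (fun i => p (s i - s a)) (enum A)>>%VS by [].
apply/negP => h.
have : hvec a \in (p @: fullv)%VS.
  apply: subvP h; apply/span_subvP => _ /mapP[i _ ->]; apply: memv_img; exact: memvf.
case/memv_imgP => u _; rewrite pE /hvec => -[_ /eqP]; by rewrite oner_eq0.
Qed.

Lemma hrk_dep (A : {set I}) : (hrk A < #|A|)%N -> exists c : I -> F,
  [/\ forall i, i \notin A -> c i = 0, exists2 i, i \in A & c i != 0,
      \sum_(i in A) c i = 0 & \sum_(i in A) c i *: s i = 0].
Proof.
move=> lt; apply: boolp.contrapT => h.
have fr : free (map hvec (enum A)).
  apply: free_setP => k hk i iA; apply/eqP; apply: contraT => ki; exfalso; apply: h.
  exists (fun j => if j \in A then k j else 0); split.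
  - by move=> j /negbTE ->.
  - by exists i; rewrite ?iA.
  - have := congr1 (fun x : U * F^o => x.2) hk; rewrite (raddf_sum snd) /= => hh.
    rewrite -[RHS]hh; by apply: eq_bigr => j jA; rewrite jA; symmetry; exact: mulr1.
  have := congr1 (fun x : U * F^o => x.1) hk; rewrite (raddf_sum fst) /= => hh.
  by rewrite -[RHS]hh; apply: eq_bigr => j jA; rewrite jA.
move: lt; rewrite /hrk span_image; move: fr; rewrite /free size_map -cardE => /eqP ->.
by rewrite ltnn.
Qed.

Lemma dep_hvec (A : {set I}) (c : I -> F) :
  \sum_(i in A) c i = 0 -> \sum_(i in A) c i *: s i = 0 -> \sum_(i in A) c i *: hvec i = 0.
Proof.
move=> c0 s0; apply/eqP; rewrite -pair_eqE /pair_eq; apply/andP; split; apply/eqP.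
  by rewrite -[RHS]s0 (raddf_sum fst).
rewrite -[RHS]c0 (raddf_sum snd); apply: eq_bigr => i _; exact: mulr1.
Qed.

Lemma dep_coloop (A : {set I}) (c : I -> F) j : j \in A ->
  \sum_(i in A) c i = 0 -> \sum_(i in A) c i *: s i = 0 ->
  (hrk (A :\ j) < hrk A)%N -> c j = 0.
Proof.
move=> jA c0 s0 lt; apply/eqP; apply: contraT => cj; move: lt; rewrite ltnNge => /negP[].
rewrite /hrk; apply/dimvS/span_subvP => _ /imageP[i iA ->].
have [->|ij] := eqVneq i j; last by rewrite memv_span // image_f // !inE ij.
have := dep_hvec c0 s0; rewrite (bigD1 j) //= => /eqP; rewrite addr_eq0 => /eqP h.
have -> : hvec j = (c j)^-1 *: (c j *: hvec j) by rewrite scalerA mulVf // scale1r.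
rewrite h memvZ // memvN; apply: memv_suml => k /andP[kA kj].
by rewrite memvZ // memv_span // image_f // !inE kj.
Qed.

(** A zero coefficient at [i] would leave a dependency inside [A :\ i], although deleting [i] keeps
    the rank at [#|A| - 1]. *)
Lemma circuit_dep (A : {set I}) : @coloopfree affine_matroid A -> #|A| = (hrk A).+1 ->
  exists c : I -> F, [/\ forall i, (c i != 0) = (i \in A),
    \sum_(i in A) c i = 0 & \sum_(i in A) c i *: s i = 0].
Proof.
move=> cf eA; have [|c [cN [i0 i0A ci0] c0 s0]] := @hrk_dep A; first by rewrite eA.
exists c; split=> // i; apply/idP/idP => [|iA]; first by apply: contraNT => /cN ->.
apply/eqP => ci; have lt : (hrk (A :\ i) < #|A :\ i|)%N.
  rewrite ltn_neqAle hrk_card andbT; apply/eqP => h.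
  have i0i : i0 != i by apply: contraNneq ci0 => ->; rewrite ci.
  have c0' : \sum_(j in A :\ i) c j = 0.
    by rewrite -[RHS]c0 [in RHS](bigD1 i) //= ci add0r; apply: eq_bigl => j; rewrite !inE andbC.
  have s0' : \sum_(j in A :\ i) c j *: s j = 0.
    rewrite -[RHS]s0 [in RHS](bigD1 i) //= ci scale0r add0r.
    by apply: eq_bigl => j; rewrite !inE andbC.
  have : c i0 = 0.
    apply: dep_coloop c0' s0' _; first by rewrite !inE i0i.
    apply: leq_ltn_trans (hrk_card _) _.
    by rewrite h [ltnRHS](cardsD1 i0) !inE i0i i0A.
  by move/eqP: ci0.
have := cf i iA; rewrite /= => h; move: lt; rewrite h.
by have := cardsD1 i A; rewrite iA eA => -[] ->; rewrite ltnn.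
Qed.

Hypothesis si : injective s.

Lemma hrk_gt1 (A : {set I}) : (1 < #|A|)%N -> (1 < hrk A)%N.
Proof.
case/card_gt1P => i [j [iA jA ij]]; rewrite (hrk_adim iA) ltnS /adim lt0n dimv_eq0.
apply: contraNneq ij => h; rewrite -(inj_eq si) -subr_eq0.
have : s j - s i \in <<[seq s i0 - s i | i0 in A]>>%VS.
  by apply: memv_span; apply/imageP; exists j.
by rewrite h memv0 => /eqP e; rewrite -opprB e oppr0.
Qed.
End AffineRank.

Section Blocks.
Variables (F F' : fieldType) (U : vectType F) (U' : vectType F').
Variables (I J : finType) (s : I -> U) (t : I -> U').

(* Contracting the differences inside the blocks of a partition. *)
Lemma dtwin_blocks (A : {set I}) (h : I -> J) (g : J -> I) (j0 : J) : dtwin s t ->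
  (forall j, g j \in A) -> cancel g h ->
  exists (s' : J -> U) (t' : J -> U'), [/\ dtwin s' t',
    forall c : I -> F, \sum_(i in A) c i *: s i = 0 ->
      \sum_j (\sum_(i in A | h i == j) c i) *: s' j = 0
  & (hrk s A + #|J| <= \dim <<[seq (s' j - s' j0)%R | j : J]>> + 1 + #|A|)%N].
Proof.
move=> tw gA gK.
pose B := [set i in A | i != g (h i)].
have [p [p' [kp tw']]] := dtwin_contract [seq (i, g (h i)) | i <- enum B] tw.
exists (fun j => p (s (g j))), (fun j => p' (t (g j))).
have pE i : i \in A -> p (s i) = p (s (g (h i))).
  move=> iA; have [e|ne] := eqVneq i (g (h i)); first by rewrite {1}e.
  apply/eqP; rewrite -subr_eq0 -linearB /= -memv_ker kp; apply: memv_span.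
  apply/mapP; exists (i, g (h i)) => //; apply/mapP; exists i => //.
  by rewrite mem_enum inE iA.
split; first exact: dtwin_comp tw'.
  move=> c hc; have := congr1 p hc; rewrite linear0 linear_sum /= => e.
  rewrite -[RHS]e [RHS](partition_big h predT) //=; apply: eq_bigr => j _.
  rewrite scaler_suml; apply: eq_bigr => i /andP[iA /eqP <-].
  by rewrite linearZ /= (pE i iA).
rewrite (hrk_adim _ (gA j0)) /adim.
have cB : (#|B| + #|J| <= #|A|)%N.
  have -> : #|J| = #|g @: setT| by rewrite card_imset ?cardsT //; apply: can_inj gK.
  rewrite -cardsUI; have -> : B :&: g @: setT = set0.
    apply/setP => i; rewrite !inE; apply/negbTE/negP => /andP[/andP[_ /eqP ne]].
    by case/imsetP => j _ ei; apply: ne; rewrite ei gK.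
  rewrite cards0 addn0; apply/subset_leq_card/subsetP => i; rewrite !inE.
  by case/orP => [/andP[]//|/imsetP[j _ ->]].
have dk : (\dim (lker p) <= #|B|)%N.
  by rewrite kp; apply: leq_trans (dim_span _) _; rewrite !size_map -cardE.
have := dim_map_ker (fun i => s i - s (g j0)) p (enum A).
have : (\dim <<[seq (s i - s (g j0))%R | i in A]>> <=
    \dim (<<[seq (s i - s (g j0))%R | i <- enum A]>> + lker p))%N.
  by rewrite span_image; apply/dimvS/addvSl.
have : (\dim <<[seq p (s x - s (g j0))%R | x <- enum A]>> <=
   \dim <<[seq (p (s (g j)) - p (s (g j0)))%R | j : J]>>)%N.
  apply/dimvS/span_subvP => u /mapP[i iA ->]; rewrite mem_enum in iA.
  by rewrite linearB /= (pE i iA); apply: memv_span; apply/imageP; exists (h i).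
move: (\dim _) (\dim _) (\dim _) (\dim _) dk (\dim _) => d1 d2 d3 d4 dk d5; lia.
Qed.
End Blocks.

(** * Affine circuits have at most four points *)

Section Circuits.
Variables (F : finFieldType) (F' : fieldType) (U : vectType F) (U' : vectType F').
Hypotheses (cF : #|F| = 4%N) (c3 : 3 \in [pchar F']).
Variables (I : finType) (s : I -> U) (t : I -> U').
Hypotheses (tw : dtwin s t) (si : injective s).

(** Contracting inside the blocks turns the dependency into four points with sum zero, a
    parallelogram over GF(4); the rank hypothesis keeps it nondegenerate. *)
Lemma four_blocks_absurd (A : {set I}) (c : I -> F) (h : I -> 'I_4) (g : 'I_4 -> I) c0 :
  (#|A| <= (hrk s A).+1)%N -> \sum_(i in A) c i *: s i = 0 -> (forall j, g j \in A) ->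
  cancel g h -> c0 != 0 -> (forall j, \sum_(i in A | h i == j) c i = c0) -> False.
Proof.
move=> rA s0 gA gK c00 hc.
have [s' [t' [tw' dep dim]]] := dtwin_blocks (0 : 'I_4) tw gA gK.
pose j1 : 'I_4 := @Ordinal 4 1 isT; pose j2 : 'I_4 := @Ordinal 4 2 isT.
pose j3 : 'I_4 := @Ordinal 4 3 isT.
have e3 : s' j3 = s' 0 + s' j1 + s' j2.
  have := dep c s0; under eq_bigr do rewrite hc.
  rewrite -scaler_sumr => /eqP; rewrite scaler_eq0 (negbTE c00) /=.
  rewrite !big_ord_recl big_ord0 addr0 !addrA addr_eq0.
  have -> : lift ord0 (lift ord0 (lift ord0 ord0)) = j3 by apply/val_inj.
  have -> : lift ord0 (lift ord0 ord0) = j2 by apply/val_inj.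
  have -> : lift ord0 ord0 = j1 by apply/val_inj.
  by rewrite oppv_card4 // => /eqP <-.
pose x := s' j1 - s' 0; pose y := s' j2 - s' 0.
have fr : free [:: x; y].
  have : (\dim <<[seq (s' j - s' 0)%R | j : 'I_4]>> <= \dim <<[:: x; y]>>)%N.
    apply/dimvS/span_subvP => _ /imageP[j _ ->].
    have xin : x \in <<[:: x; y]>>%VS by apply: memv_span; rewrite inE eqxx.
    have yin : y \in <<[:: x; y]>>%VS by apply: memv_span; rewrite !inE eqxx orbT.
    case: j => [[|[|[|[|//]]]] lt].
    - by rewrite (_ : Ordinal lt = 0) ?subrr ?mem0v //; apply/val_inj.
    - by rewrite (_ : Ordinal lt = j1) //; apply/val_inj.
    - by rewrite (_ : Ordinal lt = j2) //; apply/val_inj.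
    rewrite (_ : Ordinal lt = j3) ?e3; last by apply/val_inj.
    have -> : s' 0 + s' j1 + s' j2 - s' 0 = x + y by rewrite /x /y; vlin; ring4 cF.
    by rewrite memvD.
  rewrite /free /= eqn_leq dim_span /=; move: dim rA; rewrite card_ord.
  move: (\dim <<[seq _ | _ : _]>>) (hrk s A) => d1 d2; lia.
apply: (parallelogram_absurd cF c3 (a := 0) (b := j1) (c := j2) (d := j3) tw' fr).
- by rewrite /x addrC subrK.
- by rewrite /y addrC subrK.
by rewrite e3 /x /y; vlin; ring4 cF.
Qed.

(** In characteristic 2 the remaining coefficients add up to the common value too, so three
    singletons and the rest are four blocks of equal sum. *)
Lemma three_equal_absurd (A : {set I}) (c : I -> F) a b d :
  (#|A| <= (hrk s A).+1)%N -> \sum_(i in A) c i = 0 -> \sum_(i in A) c i *: s i = 0 ->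
  a \in A -> b \in A -> d \in A -> a != b -> b != d -> d != a ->
  c a != 0 -> c b = c a -> c d = c a -> False.
Proof.
move=> rA c0 s0 aA bA dA ab bd da ca cb cd.
pose o1 : 'I_4 := @Ordinal 4 1 isT; pose o2 : 'I_4 := @Ordinal 4 2 isT.
pose o3 : 'I_4 := @Ordinal 4 3 isT.
pose h i : 'I_4 := if i == a then 0 else if i == b then o1 else if i == d then o2 else o3.
have ha : h a = 0 by rewrite /h eqxx.
have hb : h b = o1 by rewrite /h eqxx eq_sym (negbTE ab).
have hd : h d = o2 by rewrite /h eqxx (negbTE da) eq_sym (negbTE bd).
have blk x j : x \in A -> h x = j -> (forall i, h i = j -> i = x) ->
    \sum_(i in A | h i == j) c i = c x.
  move=> xA hx ux; rewrite (big_pred1 x) // => i /=; apply/andP/eqP => [[_ /eqP/ux //]|->].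
  by rewrite hx.
have b0 : \sum_(i in A | h i == 0) c i = c a.
  by apply: blk => // i; rewrite /h; case: eqP => // _; case: ifP => // _; case: ifP.
have b1 : \sum_(i in A | h i == o1) c i = c a.
  rewrite -cb; apply: blk => // i; rewrite /h; case: ifP => // _; case: eqP => // _.
  by case: ifP.
have b2 : \sum_(i in A | h i == o2) c i = c a.
  rewrite -cd; apply: blk => // i; rewrite /h; case: ifP => // _; case: ifP => // _.
  by case: eqP.
have b3 : \sum_(i in A | h i == o3) c i = c a.
  move: c0; rewrite (partition_big h predT) //= !big_ord_recl big_ord0 addr0.
  have -> : lift ord0 (lift ord0 (lift ord0 ord0)) = o3 by apply/val_inj.
  have -> : lift ord0 (lift ord0 ord0) = o2 by apply/val_inj.
  have -> : lift ord0 ord0 = o1 by apply/val_inj.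
  rewrite b0 b1 b2; set y := \sum_(i in A | _) _ => e.
  by apply: subr0_eq; rewrite -[RHS]e; apply: subr0_eq; ring4 cF.
have [x xA hx] : exists2 x, x \in A & h x = o3.
  apply: boolp.contrapT => nex; move/eqP: ca; apply; rewrite -b3 big1 // => i /andP[iA /eqP hi].
  by exfalso; apply: nex; exists i.
pose g (j : 'I_4) := if j == 0 then a else if j == o1 then b else if j == o2 then d else x.
apply: (four_blocks_absurd (h := h) (g := g) rA s0 _ _ ca).
- by move=> j; rewrite /g; case: ifP => // _; case: ifP => // _; case: ifP.
- move=> [[|[|[|[|//]]]] lt]; rewrite /g /= ?ha ?hb ?hd ?hx; exact/val_inj.
move=> [[|[|[|[|//]]]] lt].
- by rewrite (_ : Ordinal lt = 0) //; apply/val_inj.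
- by rewrite (_ : Ordinal lt = o1) //; apply/val_inj.
- by rewrite (_ : Ordinal lt = o2) //; apply/val_inj.
by rewrite (_ : Ordinal lt = o3) //; apply/val_inj.
Qed.

(** A fifth element [a] must carry the third nonzero value, which is [c b + c d]. The blocks {a},
    {b, d}, {b', d'} and the rest all have this sum. *)
Lemma two_pairs_absurd (A : {set I}) (c : I -> F) b b' d d' :
  (#|A| <= (hrk s A).+1)%N -> (forall i, (c i != 0) = (i \in A)) ->
  \sum_(i in A) c i = 0 -> \sum_(i in A) c i *: s i = 0 -> (4 < #|A|)%N ->
  b \in A -> b' \in A -> d \in A -> d' \in A -> b != b' -> d != d' ->
  c b' = c b -> c d' = c d -> c b != c d -> False.
Proof.
move=> rA cA c0 s0 A5 bA b'A dA d'A bb' dd' cb cd bd.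
have neq i j : c i != c j -> i != j by apply: contraNneq => ->.
have bd1 := neq _ _ bd; have bd2 : b != d' by apply: neq; rewrite cd.
have bd3 : b' != d by apply: neq; rewrite cb.
have bd4 : b' != d' by apply: neq; rewrite cb cd.
have cb0 : c b != 0 by rewrite cA.
have cd0 : c d != 0 by rewrite cA.
have [a aA aN] : exists2 a, a \in A & a \notin [set b; b'; d; d'].
  have : (0 < #|A :\: [set b; b'; d; d']|)%N.
    have := cardsID [set b; b'; d; d'] A.
    have : (#|A :&: [set b; b'; d; d']| <= 4)%N.
      apply: leq_trans (subset_leq_card (subsetIr _ _)) _.
      by rewrite -!setUA !cardsU1 cards1; do 3!case: (_ \notin _).
    by move: A5; move: #|A| #|A :&: _| #|A :\: _| => p q r; clear; lia.
  by case/card_gt0P => a /setDP[]; exists a.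
move: aN; rewrite !inE !negb_or -!andbA => /and4P[ab ab' ad ad'].
have ca0 : c a != 0 by rewrite cA.
have cab : c a != c b.
  apply/eqP => h; apply: (three_equal_absurd rA c0 s0 bA b'A aA bb' _ ab cb0 cb h).
  by rewrite eq_sym.
have cad : c a != c d.
  apply/eqP => h; apply: (three_equal_absurd rA c0 s0 dA d'A aA dd' _ ad cd0 cd h).
  by rewrite eq_sym.
have cadd : c a = c b + c d.
  have l0 : c d / c b != 0 by rewrite mulf_neq0 ?invr_eq0.
  have l1 : c d / c b != 1 by apply: contra bd => /eqP/divr1_eq ->.
  have e x : x / c b * c b = x by rewrite -mulrA mulVf // mulr1.
  case: (mem_card4 cF (c a / c b) l0 l1) => h.
  - by move/eqP: ca0; case; rewrite -(e (c a)) h mul0r.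
  - by move/eqP: cab; case; rewrite -(e (c a)) h mul1r.
  - by move/eqP: cad; case; rewrite -(e (c a)) h e.
  by rewrite -(e (c a)) h mulrDl e mul1r addrC.
pose o1 : 'I_4 := @Ordinal 4 1 isT; pose o2 : 'I_4 := @Ordinal 4 2 isT.
pose o3 : 'I_4 := @Ordinal 4 3 isT.
pose h i : 'I_4 := if i == a then 0 else if (i == b) || (i == d) then o1 else
  if (i == b') || (i == d') then o2 else o3.
have h_a : h a = 0 by rewrite /h eqxx.
have h_b : h b = o1 by rewrite /h (eq_sym b a) (negbTE ab) eqxx.
have h_d : h d = o1 by rewrite /h (eq_sym d a) (negbTE ad) eqxx orbT.
have h_b' : h b' = o2.
  by rewrite /h (eq_sym b' a) (negbTE ab') (eq_sym b') (negbTE bb') (negbTE bd3) eqxx.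
have h_d' : h d' = o2.
  rewrite /h (eq_sym d' a) (negbTE ad') (eq_sym d' b) (negbTE bd2) (eq_sym d' d).
  by rewrite (negbTE dd') eqxx orbT.
have b0 : \sum_(i in A | h i == 0) c i = c a.
  rewrite (big_pred1 a) // => i /=; apply/andP/eqP => [[_]|->]; last by rewrite h_a.
  by rewrite /h; case: ifP => [/eqP //|_]; case: ifP => // _; case: ifP.
have pair x y j : x \in A -> y \in A -> x != y -> h x = j -> h y = j ->
    (forall i, h i = j -> i = x \/ i = y) -> \sum_(i in A | h i == j) c i = c x + c y.
  move=> xA yA xy hx hy u; rewrite (bigD1 x) /= ?xA ?hx ?eqxx //; congr (_ + _).
  rewrite (big_pred1 y) // => i /=; apply/idP/eqP => [/andP[/andP[_ /eqP/u[->|//]]]|->].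
    by rewrite eqxx.
  by rewrite yA hy eqxx eq_sym.
have b1 : \sum_(i in A | h i == o1) c i = c a.
  rewrite cadd; apply: pair => // i; rewrite /h; case: ifP => // _.
  case: ifP => [/orP[/eqP|/eqP]|_]; [by left | by right | by case: ifP].
have b2 : \sum_(i in A | h i == o2) c i = c a.
  rewrite cadd -cb -cd; apply: pair => // i; rewrite /h; case: ifP => // _; case: ifP => // _.
  by case: ifP => [/orP[/eqP|/eqP]|_]; [left | right |].
have b3 : \sum_(i in A | h i == o3) c i = c a.
  move: c0; rewrite (partition_big h predT) //= !big_ord_recl big_ord0 addr0.
  have -> : lift ord0 (lift ord0 (lift ord0 ord0)) = o3 by apply/val_inj.
  have -> : lift ord0 (lift ord0 ord0) = o2 by apply/val_inj.
  have -> : lift ord0 ord0 = o1 by apply/val_inj.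
  rewrite b0 b1 b2; set y := \sum_(i in A | _) _ => e.
  by apply: subr0_eq; rewrite -[RHS]e; apply: subr0_eq; ring4 cF.
have [x xA hx] : exists2 x, x \in A & h x = o3.
  apply: boolp.contrapT => nex; move/eqP: ca0; apply; rewrite -b3 big1 // => i /andP[iA /eqP hi].
  by exfalso; apply: nex; exists i.
pose g (j : 'I_4) := if j == 0 then a else if j == o1 then b else if j == o2 then b' else x.
apply: (four_blocks_absurd (h := h) (g := g) rA s0 _ _ ca0).
- by move=> j; rewrite /g; case: ifP => // _; case: ifP => // _; case: ifP.
- move=> [[|[|[|[|//]]]] lt]; rewrite /g /= ?h_a ?h_b ?h_b' ?hx; exact/val_inj.
move=> [[|[|[|[|//]]]] lt].
- by rewrite (_ : Ordinal lt = 0) //; apply/val_inj.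
- by rewrite (_ : Ordinal lt = o1) //; apply/val_inj.
- by rewrite (_ : Ordinal lt = o2) //; apply/val_inj.
by rewrite (_ : Ordinal lt = o3) //; apply/val_inj.
Qed.

(** Each of the three nonzero scalars occurs at most twice as a coefficient and, beyond four points,
    at most one of them occurs twice: 2 + 1 + 1 = 4. *)
Lemma circuit_le4 (A : {set I}) : @coloopfree (affine_matroid s) A ->
  #|A| = (hrk s A).+1 -> (#|A| <= 4)%N.
Proof.
move=> cf eA; have [c [cA c0 s0]] := circuit_dep cf eA.
rewrite leqNgt; apply/negP => A5.
have rA : (#|A| <= (hrk s A).+1)%N by rewrite eA.
pose cl v := [set i in A | c i == v].
have cl2 v : (#|cl v| <= 2)%N.
  rewrite leqNgt; apply/negP => /card_gt2P[x [y [z [[]]]]]; rewrite !inE.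
  move=> /andP[xA /eqP cx] /andP[yA /eqP cy] /andP[zA /eqP cz] [xy yz zx].
  apply: (three_equal_absurd rA c0 s0 xA yA zA xy yz zx); rewrite ?cA ?cx //.
have two v v' : v != v' -> (1 < #|cl v|)%N -> (1 < #|cl v'|)%N -> False.
  move=> vv' /card_gt1P[x [y []]]; rewrite !inE => /andP[xA /eqP cx] /andP[yA /eqP cy] xy.
  move=> /card_gt1P[z [u []]]; rewrite !inE => /andP[zA /eqP cz] /andP[uA /eqP cu] zu.
  by apply: (two_pairs_absurd rA cA c0 s0 A5 xA yA zA uA xy zu); rewrite ?cx ?cy ?cz ?cu.
have [w [w0 w1]] := exists_card4 cF.
have : (#|A| <= #|cl 1%R| + #|cl w| + #|cl (w + 1)%R|)%N.
  have sub : A \subset cl 1 :|: cl w :|: cl (w + 1).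
    apply/subsetP => i iA; rewrite !inE iA /=; have := cA i; rewrite iA.
    by case: (mem_card4 cF (c i) w0 w1) => ->; rewrite !eqxx ?orbT.
  apply: leq_trans (subset_leq_card sub) _; rewrite -!addnA.
  apply: leq_trans (leq_card_setU _ _) _; rewrite addnA leq_add2r.
  exact: leq_card_setU.
have t1 := two 1 w; have t2 := two 1 (w + 1); have t3 := two w (w + 1).
have n1 : 1 != w by rewrite eq_sym.
have n2 : 1 != w + 1 by rewrite -[X in X != _]add0r (inj_eq (addIr _)) eq_sym.
have n3 : w != w + 1 by rewrite -[X in X != _]addr0 (inj_eq (addrI _)) eq_sym oner_neq0.
move: (cl2 1) (cl2 w) (cl2 (w + 1)) (t1 n1) (t2 n2) (t3 n3) A5; clear.
move: #|cl 1| #|cl w| #|cl _| => x y z *.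
have [x2|x2] := ltnP 1 x; have [y2|y2] := ltnP 1 y; have [z2|z2] := ltnP 1 z; try lia; auto.
Qed.

Lemma circuit_ge3 (A : {set I}) : #|A| = (hrk s A).+1 -> (3 <= #|A|)%N.
Proof.
move=> eA; have [a aA] : exists a, a \in A by apply/card_gt0P; rewrite eA.
have h1 : (1 < #|A|)%N by rewrite eA ltnS (hrk_adim _ aA).
by rewrite eA ltnS; apply: hrk_gt1.
Qed.
End Circuits.

Lemma free_of_dim (F : fieldType) (U : vectType F) (X : seq U) (W : {vspace U}) :
  (W <= <<X>>)%VS -> (size X <= \dim W)%N -> free X.
Proof.
move=> WX le; rewrite /free eqn_leq dim_span /=.
by apply: leq_trans le _; apply: dimvS.
Qed.

(** * Configurations of affine nullity two *)

Section NullityTwo.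
Variables (F : finFieldType) (F' : fieldType) (U : vectType F) (U' : vectType F').
Hypotheses (cF : #|F| = 4%N) (c3 : 3 \in [pchar F']).

Section Pairs.
Variables (I : Type) (s : I -> U) (t : I -> U').
Hypotheses (tw : dtwin s t).
Variables (k k' : I) (r : F).
Hypothesis r0 : r != 0.

Let big i i' j j' := forall X : {vspace U}, s i - s k \in X -> s i' - s k \in X ->
  s j - s k \in X -> s j' - s k \in X -> s k' - s k \in X -> (3 <= \dim X)%N.

Lemma pairs_homothety_absurd i i' j j' : r != 1 -> big i i' j j' ->
  s j + r *: s j' + s k + r *: s k' = 0 -> s i + r *: s i' + s k + r *: s k' = 0 -> False.
Proof.
move=> r1 bg ej ei; have er := square_card4 cF r0 r1.
have hj : s j = r *: s j' + s k + r *: s k'.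
  by apply: subr0_eq; rewrite -[RHS]ej; vlin; ring4 cF.
have hi : s i = r *: s i' + s k + r *: s k'.
  by apply: subr0_eq; rewrite -[RHS]ei; vlin; ring4 cF.
have e1 : s i - s k = r *: (s i' - s k') by rewrite hi; vlin; ring4 cF.
have e2 : s k - s j = r *: (s k' - s j') by rewrite hj; vlin; ring4 cF.
apply: (homothety_absurd cF c3 tw r0 r1 _ e1 e2).
set X := [:: _; _; _].
have [a b c] : [/\ s i - s i' \in <<X>>%VS, s k - s k' \in <<X>>%VS & s j - s j' \in <<X>>%VS].
  by split; apply: memv_span; rewrite !inE eqxx ?orbT.
have r20 : r + 1 != 0 by rewrite addr_eq0 oppr_card4.
apply: (free_of_dim (subvv _)); apply: bg.
- have -> : s i - s k = (r + 1) *: ((s i - s i') - (s k - s k')).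
    by rewrite hi; vlin; ring4w cF er.
  by rewrite memvZ // memvB.
- have -> : s i' - s k = r *: (s i - s i') + (r + 1) *: (s k - s k').
    by rewrite hi; vlin; ring4w cF er.
  by rewrite memvD // memvZ.
- have -> : s j - s k = (r + 1) *: ((s j - s j') - (s k - s k')).
    by rewrite hj; vlin; ring4w cF er.
  by rewrite memvZ // memvB.
- have -> : s j' - s k = r *: (s j - s j') + (r + 1) *: (s k - s k').
    by rewrite hj; vlin; ring4w cF er.
  by rewrite memvD // memvZ.
by rewrite -opprB memvN.
Qed.

Lemma pairs_segments_absurd i i' j j' a b : big i i' j j' -> a != 0 -> b != 0 ->
  a *: s j + a *: s j' + s k + s k' = 0 -> b *: s i + b *: s i' + s k + s k' = 0 -> False.
Proof.
move=> bg a0 b0 ej ei.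
pose p := s k' - s k; pose l := a^-1; pose m := b^-1.
have l0 : l != 0 by rewrite invr_eq0.
have m0 : m != 0 by rewrite invr_eq0.
pose x := s j - s k; pose y := s i - s j.
have hk : s k' = s k + p by rewrite /p addrC subrK.
have hj : s j = s k + x by rewrite /x addrC subrK.
have hi : s i = s k + x + y by rewrite /x /y; vlin; ring.
have hj' : s j' = s k + x + l *: p.
  have : l *: (a *: s j + a *: s j' + s k + s k') = 0 by rewrite ej scaler0.
  rewrite !scalerDr !scalerA mulVf // hj hk !scale1r => e.
  by apply: subr0_eq; rewrite -[RHS]e; clearbody p x l; vlin; ring4 cF.
have hi' : s i' = s k + x + y + m *: p.
  have : m *: (b *: s i + b *: s i' + s k + s k') = 0 by rewrite ei scaler0.
  rewrite !scalerDr !scalerA mulVf // hi hk !scale1r => e.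
  by apply: subr0_eq; rewrite -[RHS]e; clearbody p x y m; vlin; ring4 cF.
have fr : free [:: p; x; y].
  apply: (free_of_dim (subvv _)); set X := [:: _; _; _].
  have [u v w] : [/\ p \in <<X>>%VS, x \in <<X>>%VS & y \in <<X>>%VS].
    by split; apply: memv_span; rewrite !inE eqxx ?orbT.
  apply: bg.
  - have -> : s i - s k = x + y by rewrite hi; clearbody x y; vlin; ring.
    by rewrite memvD.
  - have -> : s i' - s k = x + y + m *: p by rewrite hi'; clearbody x y p; vlin; ring.
    by rewrite memvD ?memvZ // memvD.
  - by [].
  - have -> : s j' - s k = x + l *: p by rewrite hj'; clearbody x p; vlin; ring.
    by rewrite memvD // memvZ.
  by [].
clearbody p x y; have /free3P f3 := fr.
have l1 : l != 1.
  apply/eqP => l1; apply: (parallelogram_absurd cF c3 (a := k) (b := k') (c := j) (d := j')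
    (x := p) (y := x) tw) => //; last by rewrite hj' l1; vlin; ring.
  apply/free2P => q q' h; have [] := f3 q q' 0; last by move=> -> ->.
  by rewrite scale0r addr0.
have m1 : m != 1.
  apply/eqP => m1; apply: (parallelogram_absurd cF c3 (a := k) (b := k') (c := i) (d := i')
    (x := p) (y := x + y) tw) => //; last by rewrite hi' m1; vlin; ring.
  - apply/free2P => q q' h; have [] := f3 q q' q'; last by move=> -> ->.
    by rewrite -[RHS]h; vlin; ring.
  by rewrite hi addrA.
have lm : m != l.
  apply/eqP => lm; apply: (parallelogram_absurd cF c3 (a := j) (b := j') (c := i) (d := i')
    (x := l *: p) (y := y) tw) => //.
  - apply/free2P => q q' h; have [] := f3 (q * l) 0 q'; first by rewrite -[RHS]h; vlin; ring.
    by move=> /eqP; rewrite mulf_eq0 (negbTE l0) orbF => /eqP -> _ ->.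
  - by rewrite hj hj'.
  - by rewrite hj hi.
  by rewrite hj hi' lm; vlin; ring.
have el : 1 + l + m = 0.
  case: (mem_card4 cF m l0 l1) => h; rewrite h ?eqxx // in m0 m1 lm *.
  by apply: subr0_eq; ring4 cF.
exact: (segments_absurd cF c3 tw fr el hk hj hj' hi hi').
Qed.

(** Two circuits share the pair [k], [k'] with ratio [r]. For [r = 1] the three pairs are parallel
    segments; otherwise each pair, suitably ordered, also has ratio [r], and the triangles are
    homothetic. *)
Lemma pairs_absurd i i' j j' aj aj' ai ai' : big i i' j j' ->
  aj != 0 -> aj' != 0 -> ai != 0 -> ai' != 0 ->
  aj + aj' + 1 + r = 0 -> ai + ai' + 1 + r = 0 ->
  aj *: s j + aj' *: s j' + s k + r *: s k' = 0 ->
  ai *: s i + ai' *: s i' + s k + r *: s k' = 0 -> False.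
Proof.
move=> bg aj0 aj'0 ai0 ai'0 sj si ej ei.
have sj' : aj' = aj + 1 + r by apply: subr0_eq; rewrite -[RHS]sj; apply: subr0_eq; ring4 cF.
have si' : ai' = ai + 1 + r by apply: subr0_eq; rewrite -[RHS]si; apply: subr0_eq; ring4 cF.
have [r1|r1] := eqVneq r 1.
  have aa (x : F) : x + 1 + 1 = x by apply: subr0_eq; ring4 cF.
  rewrite r1 aa in sj'; rewrite r1 aa in si'; rewrite sj' r1 scale1r in ej; rewrite si' r1 scale1r in ei.
  exact: (pairs_segments_absurd bg aj0 ai0 ej ei).
(* The two nonzero coefficients of a pair add up to [1 + r], so they are 1 and [r] in some order. *)
have ord x y (p p' : I) : x != 0 -> y != 0 -> y = x + 1 + r ->
    x *: s p + y *: s p' + s k + r *: s k' = 0 ->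
    exists P P', s P + r *: s P' + s k + r *: s k' = 0 /\
      (P = p /\ P' = p' \/ P = p' /\ P' = p).
  move=> x0 y0 ey e; case: (mem_card4 cF x r0 r1) => h.
  - by rewrite h eqxx in x0.
  - exists p, p'; split; last by left.
    rewrite -[RHS]e ey h; vlin; ring4 cF.
  - exists p', p; split; last by right.
    rewrite -[RHS]e ey h; vlin; ring4 cF.
  by move/eqP: y0; case; rewrite ey h; apply: subr0_eq; ring4 cF.
have [J [J' [eJ hJ]]] := ord _ _ _ _ aj0 aj'0 sj' ej.
have [I1 [I2 [eI hI]]] := ord _ _ _ _ ai0 ai'0 si' ei.
apply: (pairs_homothety_absurd r1 _ eJ eI) => X h1 h2 h3 h4 h5.
by apply: bg; case: hJ h3 h4 => -[-> ->] h3 h4; case: hI h1 h2 => -[-> ->] h1 h2.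
Qed.
End Pairs.

Variables (I : finType) (s : I -> U) (t : I -> U').
Hypotheses (tw : dtwin s t) (si : injective s).

(** Three equal coefficients being excluded, some [c a] and [c b] differ, and {a}, {b} and the rest
    have nonzero sums. Contraction inside these blocks leaves three collinear points. *)
Lemma circuit_blocks (C : {set I}) (c : I -> F) : #|C| = (hrk s C).+1 ->
  (forall i, (c i != 0) = (i \in C)) -> \sum_(i in C) c i = 0 ->
  \sum_(i in C) c i *: s i = 0 ->
  exists (h : I -> 'I_3) (g : 'I_3 -> I), [/\ forall j, g j \in C, cancel g h
    & forall j, \sum_(i in C | h i == j) c i != 0].
Proof.
move=> eC cC c0 s0; have C3 := circuit_ge3 si eC.
have [a [b [aC bC ab]]] : exists a b, [/\ a \in C, b \in C & c a != c b].
  have /card_gt2P[x [y [z [[xC yC zC] [xy yz zx]]]]] : (2 < #|C|)%N by [].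
  have [e1|n1] := eqVneq (c y) (c x); last by exists y, x.
  have [e2|n2] := eqVneq (c z) (c x); last by exists z, x.
  exfalso; apply: (three_equal_absurd cF c3 tw _ c0 s0 xC yC zC xy yz zx _ e1 e2).
    by rewrite eC.
  by rewrite cC.
have nab : a != b by apply: contraNneq ab => ->.
pose o1 : 'I_3 := @Ordinal 3 1 isT; pose o2 : 'I_3 := @Ordinal 3 2 isT.
pose h i : 'I_3 := if i == a then 0 else if i == b then o1 else o2.
have ha : h a = 0 by rewrite /h eqxx.
have hb : h b = o1 by rewrite /h eqxx eq_sym (negbTE nab).
have b0 : \sum_(i in C | h i == 0) c i = c a.
  rewrite (big_pred1 a) // => i /=; apply/andP/eqP => [[_]|->]; last by rewrite ha.
  by rewrite /h; case: ifP => [/eqP //|_]; case: ifP.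
have b1 : \sum_(i in C | h i == o1) c i = c b.
  rewrite (big_pred1 b) // => i /=; apply/andP/eqP => [[_]|->]; last by rewrite hb.
  by rewrite /h; case: ifP => // _; case: ifP => [/eqP //|].
have b2 : \sum_(i in C | h i == o2) c i != 0.
  move: c0; rewrite (partition_big h predT) //= !big_ord_recl big_ord0 addr0.
  have -> : lift ord0 (lift ord0 ord0) = o2 by apply/val_inj.
  have -> : lift ord0 ord0 = o1 by apply/val_inj.
  rewrite b0 b1 => e; apply: contraNneq ab => e2; rewrite e2 addr0 in e.
  by apply/eqP/subr0_eq; rewrite oppr_card4.
have [x xC hx] : exists2 x, x \in C & h x = o2.
  apply: boolp.contrapT => nex; move/eqP: b2; apply; rewrite big1 // => i /andP[iC /eqP hi].
  by exfalso; apply: nex; exists i.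
exists h, (fun j => if j == 0 then a else if j == o1 then b else x); split.
- by move=> j; case: ifP => // _; case: ifP.
- move=> [[|[|[|//]]] lt]; rewrite /= ?ha ?hb ?hx; exact/val_inj.
move=> [[|[|[|//]]] lt].
- by rewrite (_ : Ordinal lt = 0) ?b0 ?cC //; apply/val_inj.
- by rewrite (_ : Ordinal lt = o1) ?b1 ?cC //; apply/val_inj.
by rewrite (_ : Ordinal lt = o2) //; apply/val_inj.
Qed.

Lemma three_dep (P : 'I_3 -> U) (g : 'I_3 -> F) : (forall j, g j != 0) ->
  \sum_j g j = 0 -> \sum_j g j *: P j = 0 ->
  exists w, [/\ w != 0, w != 1 & P (inord 2) = P 0 + w *: (P (inord 1) - P 0)].
Proof.
move=> g0; rewrite !big_ord_recl !big_ord0 !addr0.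
have -> : lift ord0 (lift ord0 ord0) = inord 2 :> 'I_3 by apply/val_inj; rewrite /= inordK.
have -> : lift ord0 ord0 = inord 1 :> 'I_3 by apply/val_inj; rewrite /= inordK.
set g1 := g (inord 1); set g2 := g (inord 2); move=> sg sP.
have g20 : g2 != 0 by apply: g0.
have e0 : g ord0 = g1 + g2 by apply: subr0_eq; rewrite -[RHS]sg oppr_card4.
exists (g1 / g2); split; first by rewrite mulf_neq0 ?invr_eq0 ?g0.
  apply: contra (g0 ord0) => /eqP/divr1_eq h; rewrite e0 h.
  by apply/eqP/subr0_eq; ring4 cF.
apply: (scalerI g20); rewrite scalerDr scalerA mulrCA mulfV // mulr1.
by apply: subr0_eq; rewrite -[RHS]sP e0; vlin; ring4 cF.
Qed.

(** Contracting the blocks of both circuits leaves two collinear triples on skew lines, whose ratios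
    can be made equal for [grid_absurd]. *)
Lemma two_circuits_absurd (A C D : {set I}) : A = C :|: D -> [disjoint C & D] ->
  (#|A| <= hrk s A + 2)%N -> 
  @coloopfree (affine_matroid s) C -> #|C| = (hrk s C).+1 ->
  @coloopfree (affine_matroid s) D -> #|D| = (hrk s D).+1 -> False.
Proof.
move=> eA dis rA cfC eC cfD eD.
have [c [cC c0 s0]] := circuit_dep cfC eC; have [d [dD d0 u0]] := circuit_dep cfD eD.
have [hC [gC [gCC gCK bC]]] := circuit_blocks eC cC c0 s0.
have [hD [gD [gDD gDK bD]]] := circuit_blocks eD dD d0 u0.
have CD i : i \in D -> (i \in C) = false.
  by move=> iD; apply/negbTE; rewrite disjoint_sym in dis; rewrite (disjointFr dis).
pose h i : 'I_3 + 'I_3 := if i \in C then inl (hC i) else inr (hD i).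
pose g (j : 'I_3 + 'I_3) := match j with inl k => gC k | inr k => gD k end.
have gA j : g j \in A by rewrite eA inE; case: j => k /=; rewrite ?gCC ?gDD ?orbT.
have gK : cancel g h by case=> k; rewrite /h /= ?gCC ?gCK // (CD _ (gDD k)) gDK.
have [s' [t' [tw' dep dim]]] := dtwin_blocks (inl 0 : 'I_3 + 'I_3) tw gA gK.
have suppC (X : zmodType) (f : I -> X) P : (forall i, i \notin C -> f i = 0) ->
    \sum_(i in A | P i) f i = \sum_(i in C | P i) f i.
  move=> f0; rewrite [LHS]big_mkcond [RHS]big_mkcond; apply: eq_bigr => i _.
  rewrite eA inE; have [//|/f0 ->] := boolP (i \in C); by rewrite !if_same.
have suppD (X : zmodType) (f : I -> X) P : (forall i, i \notin D -> f i = 0) ->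
    \sum_(i in A | P i) f i = \sum_(i in D | P i) f i.
  move=> f0; rewrite [LHS]big_mkcond [RHS]big_mkcond; apply: eq_bigr => i _.
  rewrite eA inE orbC; have [//|/f0 ->] := boolP (i \in D); by rewrite !if_same.
have cN i : i \notin C -> c i = 0 by rewrite -cC negbK => /eqP.
have dN i : i \notin D -> d i = 0 by rewrite -dD negbK => /eqP.
have sc : \sum_(i in A) c i *: s i = 0.
  transitivity (\sum_(i in A | true) c i *: s i); first by apply: eq_bigl => i; rewrite andbT.
  rewrite suppC => [|i /cN ->]; last by rewrite scale0r.
  by rewrite -[RHS]s0; apply: eq_bigl => i; rewrite andbT.
have sd : \sum_(i in A) d i *: s i = 0.
  transitivity (\sum_(i in A | true) d i *: s i); first by apply: eq_bigl => i; rewrite andbT.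
  rewrite suppD => [|i /dN ->]; last by rewrite scale0r.
  by rewrite -[RHS]u0; apply: eq_bigl => i; rewrite andbT.
have e1 : \sum_k (\sum_(i in C | hC i == k) c i) *: s' (inl k) = 0.
  have := dep c sc; rewrite big_sumType /= [X in _ + X]big1 ?addr0 => [|k _].
    move=> e; rewrite -[RHS]e; apply: eq_bigr => k _; congr (_ *: _).
    rewrite suppC //; apply: eq_bigl => i; rewrite /h; by case: (i \in C).
  rewrite suppC // big1 ?scale0r // => i /andP[iC]; by rewrite /h iC.
have e2 : \sum_k (\sum_(i in D | hD i == k) d i) *: s' (inr k) = 0.
  have := dep d sd; rewrite big_sumType /= big1 ?add0r => [|k _].
    move=> e; rewrite -[RHS]e; apply: eq_bigr => k _; congr (_ *: _).
    rewrite suppD //; apply: eq_bigl => i; rewrite /h.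
    by case iD : (i \in D) => //=; rewrite (CD _ iD).
  rewrite suppD // big1 ?scale0r // => i /andP[iD]; by rewrite /h (CD _ iD).
have [w [w0 w1 ew]] : exists w, [/\ w != 0, w != 1 & s' (inl (inord 2)) = s' (inl 0) + w *: (s' (inl (inord 1)) - s' (inl 0))].
  apply: (three_dep (P := fun k => s' (inl k)) bC _ e1).
  by rewrite -[RHS]c0 [RHS](partition_big hC predT).
have [w' [w'0 w'1 ew']] : exists w, [/\ w != 0, w != 1 & s' (inr (inord 2)) = s' (inr 0) + w *: (s' (inr (inord 1)) - s' (inr 0))].
  apply: (three_dep (P := fun k => s' (inr k)) bD _ e2).
  by rewrite -[RHS]d0 [RHS](partition_big hD predT).
pose x := s' (inl (inord 1)) - s' (inl 0); pose y := s' (inr (inord 1)) - s' (inr 0).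
pose z := s' (inr 0) - s' (inl 0).
have hx : s' (inl (inord 1)) = s' (inl 0) + x by rewrite /x addrC subrK.
have hz : s' (inr 0) = s' (inl 0) + z by rewrite /z addrC subrK.
have hy : s' (inr (inord 1)) = s' (inl 0) + z + y by rewrite /y /z; vlin; ring.
have hy2 : s' (inr (inord 2)) = s' (inl 0) + z + w' *: y by rewrite ew' -/y hz.
have fr : free [:: x; y; z].
  have : (<<[seq (s' j - s' (inl 0))%R | j : 'I_3 + 'I_3]>> <= <<[:: x; y; z]>>)%VS.
    have [u v q] : [/\ x \in <<[:: x; y; z]>>%VS, y \in <<[:: x; y; z]>>%VS & z \in <<[:: x; y; z]>>%VS].
      by split; apply: memv_span; rewrite !inE eqxx ?orbT.
    have cases (k : 'I_3) : [\/ k = 0, k = inord 1 | k = inord 2].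
      case: k => [[|[|[|//]]] lt]; [constructor 1 | constructor 2 | constructor 3];
      apply/val_inj; by rewrite /= ?inordK.
    apply/span_subvP => _ /imageP[[k|k] _ ->]; case: (cases k) => ->.
    - by rewrite subrr mem0v.
    - by [].
    - have -> : s' (inl (inord 2)) - s' (inl 0) = w *: x by rewrite ew addrC addKr.
      by rewrite memvZ.
    - by [].
    - have -> : s' (inr (inord 1)) - s' (inl 0) = z + y by rewrite hy; clearbody x y z; vlin; ring.
      by rewrite memvD.
    have -> : s' (inr (inord 2)) - s' (inl 0) = z + w' *: y by rewrite hy2; clearbody x y z; vlin; ring.
    by rewrite memvD // memvZ.
  move=> sub; apply: (free_of_dim sub); move: dim rA.
  rewrite card_sum !card_ord; move: (hrk s A) (\dim _) => d1 d2 /=; lia.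
have [eww|nww] := eqVneq w' w.
  rewrite eww in hy2.
  exact: (grid_absurd cF c3 tw' w0 w1 fr hx ew hz hy hy2).
have ww : w' = w + 1.
  by case: (mem_card4 cF w' w0 w1) => // e; rewrite e eqxx in w'0 w'1 nww.
have ew2 := square_card4 cF w0 w1.
(* Exchanging the last two points of the second triple inverts its ratio, and the inverse of [w + 1]
   is [w]. *)
apply: (grid_absurd cF c3 (b0 := inr 0) (b1 := inr (inord 2)) (b2 := inr (inord 1))
  (y := w' *: y) tw' w0 w1 _ hx ew hz hy2).
  apply/free3P => a b e ha; have /free3P/(_ a (b * w') e) := fr.
  rewrite -scalerA => /(_ ha) [-> /eqP + ->].
  by rewrite mulf_eq0 (negbTE w'0) orbF => /eqP ->.
rewrite hy ww scalerA; clearbody x y z; vlin; ring4w cF ew2.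
Qed.
End NullityTwo.

Lemma card2_other (T : finType) (S : {set T}) i : #|S| = 2 -> i \in S ->
  exists i', [/\ i' != i, i' \in S & S = [set i; i']].
Proof.
move=> /eqP/cards2P[x [y [xy ->]]]; rewrite !inE => /orP[]/eqP ->.
  by exists y; rewrite !inE eqxx orbT eq_sym.
by exists x; rewrite !inE eqxx setUC.
Qed.

Section Nullity.
Variables (F : finFieldType) (F' : fieldType) (U : vectType F) (U' : vectType F').
Hypotheses (cF : #|F| = 4%N) (c3 : 3 \in [pchar F']).

Section Fixed.
Variables (I : finType) (s : I -> U) (t : I -> U').
Hypotheses (tw : dtwin s t) (si : injective s).
Local Notation M := (affine_matroid s).
Local Notation rkM A := (@rk M A).

Lemma diff_mem_span (A : {set I}) a i : i \in A ->
  s i - s a \in <<[seq s x - s a | x in A]>>%VS.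
Proof. by move=> iA; apply: memv_span; apply/imageP; exists i. Qed.

Lemma hrk2_le4 (A : {set I}) : (hrk s A <= 2)%N -> (#|A| <= 4)%N.
Proof.
move=> le; have [//|gt] := leqP #|A| 1; first by move=> h; apply: leq_trans h _.
have /card_gt1P[a [b [aA bA ab]]] := gt.
apply: leq_trans (card_line_set cF si a b); apply/subset_leq_card/subsetP => i iA.
rewrite inE; have b0 : s b - s a != 0 by rewrite subr_eq0 (inj_eq si) eq_sym.
suff -> : <[s b - s a]>%VS = <<[seq s x - s a | x in A]>>%VS by apply: diff_mem_span.
apply/eqP; rewrite eqEdim -memvE diff_mem_span //= dim_vline b0.
by move: le; rewrite (hrk_adim s aA).
Qed.

Definition sser (A : {set I}) (i : I) : {set I} := @ser M A i.

Lemma sser_id A i : i \in sser A i. Proof. exact: (@ser_id M). Qed.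

Lemma sser_sub (A : {set I}) i : i \in A -> sser A i \subset A.
Proof. exact: (@ser_sub M). Qed.

Lemma sser_sym (A : {set I}) i j : @coloopfree M A -> i \in A -> j \in sser A i ->
  i \in sser A j.
Proof. move=> _; exact: (@ser_sym M). Qed.

Lemma sser_disjoint (A : {set I}) i j : @coloopfree M A -> i \in A -> j \in A ->
  j \notin sser A i -> sser A j \subset A :\: sser A i.
Proof. by move=> cf iA jA h; exact: (@ser_disjoint M A cf i j iA jA h). Qed.

Lemma sser_coloop (A : {set I}) i j : @coloopfree M A -> i \in A -> j \in sser A i ->
  j != i -> (hrk s (A :\ i :\ j) < hrk s (A :\ i))%N.
Proof. by move=> cf iA jS ji; exact: (@ser_coloop M A cf i j iA jS ji). Qed.

Lemma ser_circuit (A : {set I}) n i : @coloopfree M A -> #|A| = (hrk s A + n.+1)%N -> i \in A ->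
  [/\ @coloopfree M (A :\: sser A i), #|A :\: sser A i| = (hrk s (A :\: sser A i) + n)%N
    & (#|A :\: sser A i| + #|sser A i| = #|A|)%N].
Proof.
move=> cf eA iA; have sub := sser_sub iA.
have cc : (#|A :\: sser A i| + #|sser A i| = #|A|)%N.
  by rewrite cardsD (setIidPr sub) subnK // subset_leq_card.
split=> //; first exact: (@coloopfree_ser M A cf i iA).
have := @rk_ser M A cf i iA; rewrite /= -/(sser A i); move: cc; rewrite eA.
move: #|_| #|_| (hrk s A) (hrk s _) => x y z u; lia.
Qed.

(** The complement of a series class is a circuit of three or four points, so with six points every
    class has at least two. If two classes cover [A], they are disjoint circuits. Otherwise there
    are three classes, sizes force them to be pairs, and [pairs_absurd] applies. *)
Lemma coloopfree2_le5 (A : {set I}) : @coloopfree M A -> #|A| = (hrk s A + 2)%N ->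
  (#|A| <= 5)%N.
Proof.
move=> cf eA; rewrite leqNgt; apply/negP => A6.
pose S (i : I) : {set I} := sser A i; pose C i := A :\: S i.
have selfS x : x \in S x := sser_id A x.
have CP i : i \in A -> [/\ @coloopfree M (C i), #|C i| = (hrk s (C i)).+1, (2 < #|C i| <= 4)%N,
    (2 <= #|S i|)%N & (#|C i| + #|S i| = #|A|)%N].
  move=> iA; have [h1 h2 h3] := ser_circuit cf eA iA; rewrite addn1 in h2.
  have h4 := circuit_le4 cF c3 tw h1 h2; have h5 := circuit_ge3 si h2.
  split=> //; first by rewrite h5.
  by rewrite -(leq_add2l 4) (leq_trans A6) // -h3 leq_add2r.
have [i iA] : exists i, i \in A by apply/card_gt0P; apply: leq_trans A6.
have [cfi eCi /andP[Ci3 Ci4] Si2 cci] := CP i iA.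
have [j jC] : exists j, j \in C i by apply/card_gt0P; apply: leq_trans Ci3.
have [jA jS] := setDP jC.
have [cfj eCj /andP[Cj3 Cj4] Sj2 ccj] := CP j jA.
have SjC : S j \subset C i by apply: (sser_disjoint cf).
have Si_C : S i \subset C j.
  apply: (sser_disjoint cf) => //; apply: contra jS; exact: (sser_sym cf).
have [sub|nsub] := boolP (C i \subset S j).
  have eS : S j = C i by apply/eqP; rewrite eqEsubset SjC.
  have eC : C j = S i.
    rewrite /C eS; apply/setP => x; rewrite !in_setD.
    case xS : (x \in S i) => /=; last by case: (x \in A).
    by rewrite (subsetP (sser_sub iA) x xS).
  apply: (two_circuits_absurd cF c3 tw si (A := A) (C := C i) (D := C j) _ _ _ cfi eCi cfj eCj).
  - rewrite eC /C; apply/setP => x; rewrite in_setU in_setD.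
    case xS : (x \in S i); rewrite /= ?orbT ?orbF //.
    by rewrite (subsetP (sser_sub iA) x xS).
  - by rewrite eC -setI_eq0 /C setIC setIDA setDIl setDv set0I.
  by rewrite eA.
have [k kC kS] := subsetPn nsub; have [kA kSi] := setDP kC.
have [_ _ _ Sk2 _] := CP k kA.
have SkC : S k \subset C i by apply: (sser_disjoint cf).
have SkCj : S k \subset C j by apply: (sser_disjoint cf).
have dis : [disjoint S j & S k].
  rewrite -setI_eq0; apply/eqP/setP => x; rewrite in_setI in_set0; apply/negbTE/negP => /andP[xj xk].
  by have /setDP[_ /negP] := subsetP SkCj x xk.
have dis2 : [disjoint S i & S k].
  rewrite -setI_eq0; apply/eqP/setP => x; rewrite in_setI in_set0; apply/negbTE/negP => /andP[xj xk].
  by have /setDP[_ /negP] := subsetP SkC x xk.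
have cjk : (#|S j :|: S k| = #|S j| + #|S k|)%N.
  by rewrite cardsU; move: dis; rewrite -setI_eq0 => /eqP ->; rewrite cards0 subn0.
have cik : (#|S i :|: S k| = #|S i| + #|S k|)%N.
  by rewrite cardsU; move: dis2; rewrite -setI_eq0 => /eqP ->; rewrite cards0 subn0.
have sjk : S j :|: S k \subset C i by rewrite subUset SjC.
have sik : S i :|: S k \subset C j by rewrite subUset Si_C.
have := subset_leq_card sjk; have := subset_leq_card sik; rewrite cjk cik => l1 l2.
have [c2j c2k c2i] : [/\ #|S j| = 2, #|S k| = 2 & #|S i| = 2].
  have gen (x y z u v : nat) : (x + z <= v)%N -> (y + z <= u)%N -> (u <= 4)%N -> (v <= 4)%N ->
    (2 <= x)%N -> (2 <= y)%N -> (2 <= z)%N -> [/\ y = 2, z = 2 & x = 2].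
    by clear => *; split; lia.
  exact: (gen _ _ _ _ _ l1 l2 Ci4 Cj4 Si2 Sj2 Sk2).
have eCi' : C i = S j :|: S k.
  by apply/eqP; rewrite eq_sym eqEcard sjk cjk c2j c2k.
have eCj' : C j = S i :|: S k.
  by apply/eqP; rewrite eq_sym eqEcard sik cik c2i c2k.
have [i' [i'i i'S eSi]] := card2_other c2i (selfS i).
have [j' [j'j j'S eSj]] := card2_other c2j (selfS j).
have [k' [k'k k'S eSk]] := card2_other c2k (selfS k).
have [c [cC c0 s0]] := circuit_dep cfi eCi; have [d [dC d0 u0]] := circuit_dep cfj eCj.
have sum2 (X : nmodType) (f : I -> X) x y : x != y -> \sum_(z in [set x; y]) f z = f x + f y.
  by move=> xy; rewrite big_setU1 ?inE //= big_set1.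
have ii' : i != i' by rewrite eq_sym.
have jj' : j != j' by rewrite eq_sym.
have kk' : k != k' by rewrite eq_sym.
have dC' : [disjoint [set j; j'] & [set k; k']] by rewrite -eSj -eSk.
have dD' : [disjoint [set i; i'] & [set k; k']] by rewrite -eSi -eSk.
have sumC (X : nmodType) (f : I -> X) : \sum_(z in C i) f z = f j + f j' + (f k + f k').
  by rewrite eCi' eSj eSk (eq_bigl _ _ (fun x => in_setU x _ _)) bigU // !sum2.
have sumD (X : nmodType) (f : I -> X) : \sum_(z in C j) f z = f i + f i' + (f k + f k').
  by rewrite eCj' eSi eSk (eq_bigl _ _ (fun x => in_setU x _ _)) bigU // !sum2.
have k'A : k' \in A := subsetP (sser_sub kA) _ k'S.
have ck0 : c k != 0 by rewrite cC.
have dk0 : d k != 0 by rewrite dC (subsetP SkCj) // selfS.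
(* The combination of both dependencies that vanishes at [k] must vanish at [k'] as well, which is a
   coloop of [A :\ k]. *)
have prop : c k * d k' = c k' * d k.
  pose e x := d k * c x - c k * d x.
  have supp (X : zmodType) (B : {set I}) (f : I -> X) : B \subset A ->
      (forall x, x \notin B -> f x = 0) -> \sum_(x in A) f x = \sum_(x in B) f x.
    move=> BA f0; rewrite [LHS](big_setID B) /= (setIidPr BA) [X in _ + X]big1 ?addr0 //.
    by move=> x /setDP[_ /f0].
  have cN x : x \notin C i -> c x = 0 by rewrite -cC negbK => /eqP.
  have dN x : x \notin C j -> d x = 0 by rewrite -dC negbK => /eqP.
  have ek : e k = 0 by rewrite /e mulrC subrr.
  have E0 : \sum_(x in A) e x = 0.
    rewrite sumrB -!mulr_sumr (supp _ (C i)) ?subsetDl // (supp _ (C j) d) ?subsetDl //.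
    by rewrite c0 d0 !mulr0 subrr.
  have E1 : \sum_(x in A) e x *: s x = 0.
    under eq_bigr do rewrite scalerBl -!scalerA.
    rewrite sumrB -!scaler_sumr (supp _ (C i) (fun x => c x *: s x)) ?subsetDl //; last first.
      by move=> x /cN ->; rewrite scale0r.
    rewrite (supp _ (C j) (fun x => d x *: s x)) ?subsetDl //; last first.
      by move=> x /dN ->; rewrite scale0r.
    by rewrite s0 u0 !scaler0 subrr.
  have : e k' = 0.
    apply: (dep_coloop (A := A :\ k) (s := s)).
    - by rewrite !inE k'k.
    - by rewrite -[RHS]E0 [RHS](big_setD1 k) //= ek add0r.
    - by rewrite -[RHS]E1 [RHS](big_setD1 k) //= ek scale0r add0r.
    exact: (sser_coloop cf kA k'S k'k).
  by rewrite /e => /subr0_eq; rewrite mulrC => ->; rewrite mulrC.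
have k'C : k' \in C i by rewrite (subsetP SkC).
have inC x : x \in C i -> c x / c k != 0 by move=> xC; rewrite mulf_neq0 ?invr_eq0 // cC.
have inD x : x \in C j -> d x / d k != 0 by move=> xC; rewrite mulf_neq0 ?invr_eq0 // dC.
have er : d k' / d k = c k' / c k.
  apply: (mulIf dk0); rewrite -mulrA mulVf // mulr1 mulrAC -prop mulrC mulrA mulVf // mul1r //.
apply: (@pairs_absurd F F' U U' cF c3 I s t tw k k' (c k' / c k) (inC _ k'C) i i' j j'
  (c j / c k) (c j' / c k) (d i / d k) (d i' / d k)).
- move=> X h1 h2 h3 h4 h5.
  have : (\dim <<[seq (s x - s k)%R | x in A]>> <= \dim X)%N.
    apply/dimvS/span_subvP => _ /imageP[x xA ->].
    have : x \in S i :|: C i by rewrite in_setU in_setD xA; case: (x \in S i).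
    rewrite eCi' eSi eSj eSk !inE -!orbA => /or4P[|||/or3P[]] /eqP -> //.
    by rewrite subrr mem0v.
  apply: leq_trans; rewrite -/(adim s A k) -ltnS -(hrk_adim s kA).
  by move: eA A6; clear; lia.
- exact: inC.
- by apply: inC; rewrite (subsetP SjC).
- by apply: inD; rewrite (subsetP Si_C) // selfS.
- by apply: inD; rewrite (subsetP Si_C).
- move: c0; rewrite sumC => h.
  apply: (mulIf ck0); rewrite !mulrDl -!mulrA !mulVf // !mulr1 mul0r mul1r -h.
  by rewrite !addrA.
- move: d0; rewrite sumD => h; rewrite -er.
  apply: (mulIf dk0); rewrite !mulrDl -!mulrA !mulVf // !mulr1 mul0r mul1r -h.
  by rewrite !addrA.
- move: s0; rewrite sumC => h.
  apply: (scalerI ck0); rewrite scaler0 -h !scalerDr !scalerA.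
  by rewrite !(mulrCA (c k)) !mulfV // !mulr1 !addrA.
move: u0; rewrite sumD => h; rewrite -er.
apply: (scalerI dk0); rewrite scaler0 -h !scalerDr !scalerA.
by rewrite !(mulrCA (d k)) !mulfV // !mulr1 !addrA.
Qed.

Lemma nullity2_ge4 (A : {set I}) : #|A| = (hrk s A + 2)%N -> (4 <= #|A|)%N.
Proof.
move=> eA; have A1 : (1 < #|A|)%N by rewrite eA addn2.
by rewrite eA addn2 !ltnS; apply: hrk_gt1.
Qed.

(** A minimal counterexample has no coloop and nullity 3, so the complement of a series class has
    nullity 2 and four or five points. With seven points or more every class has at least two
    elements, and a complement of five points would have to contain three disjoint pairs. With six
    points the affine rank is 3 and [six_points_absurd] applies; fewer would put five points on a
    line. *)
Lemma nullity_le2 (A : {set I}) : (#|A| <= hrk s A + 2)%N.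
Proof.
move: {2}#|A| (leqnn #|A|) => n; elim: n A => [|n IH] A; first by rewrite leqn0 => /eqP ->.
move=> An; rewrite leqNgt; apply/negP => gt.
have drop i : i \in A -> (#|A :\ i| <= hrk s (A :\ i) + 2)%N.
  by move=> iA; apply: IH; move: An; rewrite (cardsD1 i) iA.
have cf : @coloopfree M A.
  move=> i iA; have := drop i iA; have := cardsD1 i A; rewrite iA.
  have := rk_setD1 (M := M) A i; have : (rkM (A :\ i) <= rkM A)%N by apply/rk_mono/subsetDl.
  by move: gt; rewrite /=; lia.
have [i0 i0A] : exists i, i \in A by apply/card_gt0P; apply: leq_ltn_trans gt.
have eA : #|A| = (hrk s A + 3)%N.
  have := drop i0 i0A; have := cardsD1 i0 A; rewrite i0A.
  have := cf i0 i0A; rewrite /= => ->; move: gt; lia.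
pose S (i : I) : {set I} := sser A i; pose J i := A :\: S i.
have JP i : i \in A -> [/\ @coloopfree M (J i), #|J i| = (hrk s (J i) + 2)%N,
   (4 <= #|J i| <= 5)%N & (#|J i| + #|S i| = #|A|)%N].
  move=> iA; have [h1 h2 h3] := ser_circuit cf eA iA.
  by split=> //; rewrite (nullity2_ge4 h2) (coloopfree2_le5 h1 h2).
have [A7|A6] := ltnP 6 #|A|.
  have S2 i : i \in A -> (2 <= #|S i|)%N.
    by move=> iA; have [_ _ /andP[_ h1] h2] := JP i iA; move: h1 h2 A7; clear; lia.
  have [cfJ eJ /andP[J4 J5] _] := JP i0 i0A.
  have SJ j : j \in J i0 -> S j \subset J i0.
    by case/setDP => jA jS; apply: (sser_disjoint cf).
  have JA j : j \in J i0 -> j \in A by case/setDP.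
  have drop2 j j' : j \in J i0 -> j' \in S j -> j' != j ->
      (hrk s (J i0 :\ j :\ j') < hrk s (J i0))%N.
    move=> jJ jS nj; have := cfJ j jJ; rewrite /= => <-.
    apply: (coloop_sub (M := M) (A := A :\ j)); first by apply/setSD/subsetDl.
      by rewrite in_setD1 nj (subsetP (SJ j jJ)).
    exact: (sser_coloop cf (JA j jJ) jS nj).
  have J5' : #|J i0| = 5.
    apply/eqP; rewrite eqn_leq J5 /= ltn_neqAle J4 andbT; apply/eqP => e4.
    have [j jJ] : exists j, j \in J i0 by apply/card_gt0P; rewrite -e4.
    have /card_gt1P[x [y [xS yS xy]]] := S2 j (JA j jJ).
    have [j' [j'S nj]] : exists j', j' \in S j /\ j' != j.
      have [ex|nx] := eqVneq x j; last by exists x.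
      by exists y; split=> //; rewrite -ex eq_sym.
    have := drop2 j j' jJ j'S nj.
    have : (1 < hrk s (J i0 :\ j :\ j'))%N.
      apply: hrk_gt1 => //; have h2 := cardsD1 j (J i0); have h1 := cardsD1 j' (J i0 :\ j).
      rewrite jJ -e4 in h2; rewrite in_setD1 nj (subsetP (SJ j jJ)) // in h1.
      by move: h2; rewrite h1 !add1n => -[<-].
    by move: eJ e4; lia.
  have S2' j : j \in J i0 -> #|S j| = 2.
    move=> jJ; apply/eqP; rewrite eqn_leq S2 ?JA // andbT leqNgt; apply/negP => S3.
    have : (1 < #|S j :\ j|)%N.
      have h := cardsD1 j (S j); rewrite (sser_id A j : j \in S j) in h.
      by rewrite h add1n in S3.
    case/card_gt1P => x [y []]; rewrite !in_setD1 => /andP[xj xS] /andP[yj yS] xy.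
    have ySJ : y \in J i0 := subsetP (SJ j jJ) y yS.
    have xSJ : x \in J i0 := subsetP (SJ j jJ) x xS.
    have l1 := drop2 j x jJ xS xj.
    have l2 : (hrk s (J i0 :\ j :\ x :\ y) < hrk s (J i0 :\ j :\ x))%N.
      apply: (coloop_sub (M := M) (A := J i0 :\ j)); first exact: subsetDl.
        by rewrite !in_setD1 eq_sym xy yj.
      by have := cfJ j jJ; rewrite /= => ->; apply: drop2.
    have : (1 < hrk s (J i0 :\ j :\ x :\ y))%N.
      apply: hrk_gt1 => //; have h3 := cardsD1 j (J i0); have h2 := cardsD1 x (J i0 :\ j).
      have h1 := cardsD1 y (J i0 :\ j :\ x).
      rewrite jJ J5' in h3; rewrite in_setD1 xj xSJ in h2.
      rewrite !in_setD1 yj ySJ (eq_sym y) xy in h1.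
      by move: h3; rewrite h2 h1 !add1n => -[<-].
    by move: l1 l2 eJ J5'; lia.
  have [j1 j1J] : exists j, j \in J i0 by apply/card_gt0P; rewrite J5'.
  have s1 := S2' _ j1J; have sub1 := SJ _ j1J.
  have [j2] : exists j, j \in J i0 :\: S j1.
    by apply/card_gt0P; rewrite cardsD (setIidPr sub1) s1 J5'.
  case/setDP => j2J j21; have s2 := S2' _ j2J; have sub2 := SJ _ j2J.
  have d12 : S j2 \subset A :\: S j1 by apply: (sser_disjoint cf); rewrite ?JA.
  have c12 : #|S j1 :|: S j2| = 4.
    rewrite cardsU s1 s2; have -> : S j1 :&: S j2 = set0; last by rewrite cards0.
    apply/setP => x; rewrite in_setI in_set0; apply/negbTE/negP => /andP[x1 x2].
    by have /setDP[_ /negP] := subsetP d12 x x2.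
  have sub12 : S j1 :|: S j2 \subset J i0 by rewrite subUset sub1.
  have [j3] : exists j, j \in J i0 :\: (S j1 :|: S j2).
    by apply/card_gt0P; rewrite cardsD (setIidPr sub12) c12 J5'.
  case/setDP => j3J; rewrite inE negb_or => /andP[j31 j32].
  have s3 := S2' _ j3J; have sub3 := SJ _ j3J.
  have d13 : S j3 \subset A :\: S j1 by apply: (sser_disjoint cf); rewrite ?JA.
  have d23 : S j3 \subset A :\: S j2 by apply: (sser_disjoint cf); rewrite ?JA.
  have c123 : #|S j1 :|: S j2 :|: S j3| = 6.
    rewrite cardsU c12 s3; have -> : (S j1 :|: S j2) :&: S j3 = set0; last by rewrite cards0.
    apply/setP => x; rewrite in_setI in_setU in_set0; apply/negbTE/negP => /andP[/orP[]x1 x2].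
      by have /setDP[_ /negP] := subsetP d13 x x2.
    by have /setDP[_ /negP] := subsetP d23 x x2.
  have : (#|S j1 :|: S j2 :|: S j3| <= #|J i0|)%N.
    by apply: subset_leq_card; rewrite subUset sub12.
  by rewrite c123 J5'.
have [A5|e6] := leqP #|A| 5.
  have h2 : (hrk s A <= 2)%N by move: eA A5; lia.
  have := hrk2_le4 h2; rewrite eA => h4.
  have : (1 < hrk s A)%N by apply: hrk_gt1 => //; rewrite eA addn3.
  by move: h4; lia.
have h3 : hrk s A = 3 by move: eA e6 A6; lia.
pose T := {x : I | x \in A}.
have twT : dtwin (fun x : T => s (val x)) (fun x => t (val x)) by apply: dtwin_comp tw.
apply: (six_points_absurd cF c3 twT).
- by move=> x y /si/val_inj.
- by rewrite card_sig; apply: leq_trans e6 _; rewrite eq_leq //; apply: eq_card.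
move=> a b c i fr.
suff -> : <<[:: s (val b) - s (val a); s (val c) - s (val a)]>>%VS =
    <<[seq s x - s (val a) | x in A]>>%VS by apply: diff_mem_span; apply: (valP i).
apply/eqP; rewrite eqEdim; apply/andP; split.
  apply/span_subvP => u; rewrite !inE => /orP[]/eqP ->; apply: diff_mem_span.
    exact: (valP b).
  exact: (valP c).
have := eqP fr; rewrite /= => ->; rewrite -/(adim s A (val a)) -ltnS -(hrk_adim s (valP a)).
by rewrite h3.
Qed.

(** A coloop adds at most one direction for each of its new pairs, so the deficit persists. Without
    coloops there are four points on a line, 6 pairs with 1 direction, or five in a plane, 10 pairs
    while GF(4) allows only 5 directions. *)
Lemma directions (A : {set I}) : #|A| = (hrk s A + 2)%N -> exists D : seq U,
  (size D + 5 <= 'C(#|A|, 2))%N /\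
  forall i j, i \in A -> j \in A -> i != j -> exists2 d, d \in D & s i - s j \in <[d]>%VS.
Proof.
move: {2}#|A| (leqnn #|A|) => n; elim: n A => [|n IH] A.
  by rewrite leqn0 => /eqP -> /esym/eqP; rewrite addn2.
move=> An eA; have [[i /andP[iA lt]]|ncl] := boolp.pselect (exists i, (i \in A) && (rkM (A :\ i) < rkM A)%N).
  have cA := cardsD1 i A; rewrite iA in cA.
  have eAi : #|A :\ i| = (hrk s (A :\ i) + 2)%N.
    by have := rk_setD1 (M := M) A i; move: lt eA cA; rewrite /=; lia.
  have [|D [sD DP]] := IH _ _ eAi; first by move: An cA; lia.
  exists (D ++ [seq s i - s j | j in A :\ i]); split.
    rewrite size_cat size_image cA add1n binS bin1; move: sD; lia.
  move=> x y xA yA xy.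
  have mi z : z \in A -> z != i -> s i - s z \in [seq s i - s j | j in A :\ i].
    by move=> zA zi; apply/imageP; exists z => //; rewrite !inE zi.
  have [ex|nx] := eqVneq x i.
    exists (s i - s y); last by rewrite ex memv_line.
    by rewrite mem_cat mi ?orbT // -ex eq_sym.
  have [ey|ny] := eqVneq y i.
    exists (s i - s x); last by rewrite ey -opprB memvN memv_line.
    by rewrite mem_cat mi ?orbT.
  have [||d dD h] := DP x y _ _ xy; rewrite ?in_setD1 ?nx ?ny //.
  by exists d => //; rewrite mem_cat dD.
have cf : @coloopfree M A.
  move=> i iA; apply/eqP; rewrite eqn_leq rk_mono ?subsetDl //= leqNgt.
  by apply/negP => lt; apply: ncl; exists i; rewrite iA.
have A5 := coloopfree2_le5 cf eA; have A4 := nullity2_ge4 eA.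
have /card_gt1P[a [b [aA bA ab]]] : (1 < #|A|)%N by apply: leq_trans A4.
pose x := s b - s a; have x0 : x != 0 by rewrite subr_eq0 (inj_eq si) eq_sym.
pose W := <<[seq s i - s a | i in A]>>%VS.
have dW : \dim W = (hrk s A).-1 by rewrite (hrk_adim s aA).
have diffW i j : i \in A -> j \in A -> s i - s j \in W.
  move=> iA jA; have -> : s i - s j = (s i - s a) - (s j - s a) by vlin; ring.
  by rewrite memvB // diff_mem_span.
have [e4|n4] := eqVneq #|A| 4.
  exists [:: x]; rewrite e4; split=> // i j iA jA _; exists x; first by rewrite inE.
  suff -> : <[x]>%VS = W by apply: diffW.
  apply/eqP; rewrite eqEdim -memvE diffW //= dim_vline x0 dW.
  by move: eA e4; lia.
have e5 : #|A| = 5 by move: n4 A4 A5; lia.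
have [c cA cl] : exists2 c, c \in A & c \notin line_set s a b.
  apply: boolp.contrapT => h.
  have : (#|A| <= #|line_set s a b|)%N.
    apply/subset_leq_card/subsetP => c cA; apply: contraT => cl; exfalso; apply: h.
    by exists c.
  by have := card_line_set cF si a b; rewrite e5; case: #|_| => [|[|[|[|[|]]]]].
pose y := s c - s a.
have fr : free [:: x; y] by apply: free_off_line.
have eW : <<[:: x; y]>>%VS = W.
  apply/eqP; rewrite eqEdim; apply/andP; split.
    by apply/span_subvP => u; rewrite !inE => /orP[]/eqP ->; apply: diffW.
  by rewrite (eqP fr) dW /=; move: eA e5; lia.
exists (y :: [seq x + k *: y | k : F]); split.
  by rewrite /= size_image cF e5.
move=> i j iA jA _; have : s i - s j \in <<[:: x; y]>>%VS by rewrite eW diffW.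
case/span2P => p [q e]; have [p0|p0] := eqVneq p 0.
  exists y; first by rewrite inE eqxx.
  by rewrite e p0 scale0r add0r memvZ ?memv_line.
exists (x + (q / p) *: y); first by rewrite inE image_f ?orbT.
apply/vlineP; exists p; rewrite e [RHS]scalerDr scalerA mulrCA mulfV // mulr1.
by [].
Qed.
End Fixed.

(* Contracting a vector of the span that is parallel to no difference would give
   a configuration of larger nullity. *)
Lemma span_diff_parallel (I : finType) (s : I -> U) (t : I -> U') (u : U) (u' : U') (a : I) :
  twin (fun x : option (I * I) => if x is Some y then s y.1 - s y.2 else u)
       (fun x : option (I * I) => if x is Some y then t y.1 - t y.2 else u') ->
  injective s -> #|I| = (hrk s setT + 2)%N -> u != 0 ->
  u \in <<[seq s i - s a | i : I]>>%VS ->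
  exists i j, i != j /\ s i - s j \in <[u]>%VS.
Proof.
move=> tw si eI u0 uW; apply: boolp.contrapT => nex.
have [p [p' [kp _ tw']]] := twin_contract_ex [:: None] tw.
rewrite /= span_seq1 in kp.
have twp : dtwin (fun i => p (s i)) (fun i => p' (t i)).
  apply: eq_twin (twin_comp (fun x : I * I => Some x) tw') => x /=; by rewrite linearB.
have pi : injective (fun i => p (s i)).
  move=> i j e; apply/eqP; apply: contraT => ij; exfalso; apply: nex; exists i, j; split=> //.
  by rewrite -kp memv_ker linearB /= e subrr.
have := nullity_le2 twp pi [set: I]; rewrite cardsT eI.
rewrite (hrk_adim (fun i => p (s i)) (in_setT a)) (hrk_adim s (in_setT a)) /adim.
have := dim_map_ker (fun i => s i - s a) p (enum [set: I]).
have eW : <<[seq s i - s a | i <- enum [set: I]]>>%VS = <<[seq s i - s a | i : I]>>%VS.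
  by rewrite /image_mem; apply: eq_span_map => x; rewrite !mem_enum !inE.
have -> : (<<[seq (s i - s a)%R | i <- enum [set: I]]>> + lker p)%VS = <<[seq (s i - s a)%R | i in [set: I]]>>%VS.
  by rewrite [RHS]span_image; apply/addv_idPl; rewrite kp -memvE eW.
have -> : <<[seq (p (s i) - p (s a))%R | i in [set: I]]>>%VS = <<[seq p (s x - s a)%R | x <- enum [set: I]]>>%VS.
  by rewrite span_image; under eq_map do rewrite -linearB.
rewrite kp dim_vline u0; move: (\dim _) (\dim _) => d1 d2; lia.
Qed.
End Nullity.

(** * Matroids conforming to a template *)

Section TemplateTwin.
Variables (F : fieldType) (Phi : frame_template F).
Local Notation X := (ft_X Phi).
Local Notation W := (ft_C Phi + (ft_Y0 Phi + ft_Y1 Phi))%type.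

Definition char3_rep (M : rmatroid F) : Prop :=
  exists F' : fieldType, 3 \in [pchar F'] /\ representable F' (underlying M).

Section Elements.
Variables (B E : finType) (A : X + B -> W + E -> F).

Definition tmatroid : rmatroid F :=
  let N := @rcontract F (of_matrix A) (ftC_set Phi E) in
  @rdelete F N [set e : N | val e \in ftY1_set Phi E].

(** What survives the contraction of C and the deletion of Y1 is Y0 and [E]; this names the elements
    of [tmatroid] without its nested subtypes. *)
Definition telt (x : ft_Y0 Phi + E) : W + E :=
  match x with inl y => inl (inr (inl y)) | inr e => inr e end.

Definition Cspan : {vspace {ffun X + B -> F^o}} :=
  <<[seq mxcol A (inl (inl c)) | c : ft_C Phi]>>%VS.

Lemma telt_notC x : telt x \in ~: ftC_set Phi E.
Proof. by rewrite inE; apply/negP => /imsetP[c _]; case: x. Qed.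

Lemma telt_notY1 x : (Sub (telt x) (telt_notC x) : rcontract (ftC_set Phi E : {set of_matrix A})) \in
  ~: [set e : rcontract (ftC_set Phi E : {set of_matrix A}) | val e \in ftY1_set Phi E].
Proof. by rewrite !inE SubK; apply/negP => /imsetP[c _]; case: x. Qed.

Definition temb x : tmatroid := Sub (Sub (telt x) (telt_notC x)) (telt_notY1 x).

Lemma temb_val x : val (val (temb x)) = telt x. Proof. by rewrite !SubK. Qed.

Lemma temb_inj : injective temb.
Proof.
move=> x y /(congr1 (fun z => val (val z))); rewrite !temb_val.
by case: x => [x|x]; case: y => [y|y] //= [->].
Qed.

Lemma temb_surj e : exists x, e = temb x.
Proof.
have h2 := valP e; have h1 := valP (val e).
case ee : (val (val e)) => [[c|[y|y]]|x].
- by move: h1; rewrite inE ee; case/imsetP; exists c.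
- by exists (inl y); apply/val_inj/val_inj; rewrite temb_val.
- by move: h2; rewrite !inE ee; case/imsetP; exists y.
by exists (inr x); apply/val_inj/val_inj; rewrite temb_val.
Qed.

Lemma card_tmatroid : #|tmatroid| = #|{: ft_Y0 Phi + E}|.
Proof.
apply/esym/(bij_eq_card (f := temb)).
have [g gP] : exists g, forall e, e = temb (g e).
  by exists (fun e => projT1 (boolp.cid (temb_surj e))) => e; case: (boolp.cid _).
by exists g => // x; apply: temb_inj; rewrite -gP.
Qed.

Lemma dim_tmatroid (V : vectType F) (p : 'Hom({ffun X + B -> F^o}, V)) l :
  lker p = Cspan ->
  @rk (underlying tmatroid) [set temb x | x in l] = \dim <<map (fun x => p (mxcol A (telt x))) l>>.
Proof.
move=> kp; have := dim_map_ker (fun x => mxcol A (telt x)) p l; rewrite kp.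
rewrite rk_rdelete; set Y := val @: _.
have := @rk_rcontract F (of_matrix A) (ftC_set Phi E) Y.
rewrite !rk_of_matrix /col_rk.
have eC : <<[seq mxcol A e | e in ftC_set Phi E]>>%VS = Cspan.
  apply: eq_span => u; apply/imageP/imageP => [[_ /imsetP[c _ ->] ->]|[c _ ->]].
    by exists c.
  by exists (inl (inl c)) => //; apply: imset_f.
have -> : <<[seq mxcol A e | e in val @: Y :|: ftC_set Phi E]>>%VS =
   (<<map (fun x => mxcol A (telt x)) l>> + Cspan)%VS.
  rewrite -eC -span_cat; apply: eq_span => u; rewrite mem_cat; apply/imageP/orP.
    case=> e; rewrite inE => /orP[/imsetP[_ /imsetP[_ /imsetP[x xl ->] ->] ->] ->|eC' ->].
      by left; rewrite temb_val; apply/mapP; exists x.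
    by right; apply/imageP; exists e.
  case=> [/mapP[x xl ->]|/imageP[e eC' ->]]; last by exists e => //; rewrite inE eC' orbT.
  exists (telt x) => //; rewrite inE -[telt x]temb_val; apply/orP; left.
  by rewrite !imset_f.
by rewrite eC => e1 e2; apply: (@addIn (\dim Cspan)); rewrite e1 e2.
Qed.

Lemma conforms_class : conforms A -> template_class Phi tmatroid.
Proof.
move=> cA; exists B, E, A; split=> //; exists id, (fun _ => 1); split.
- by exists id.
- by move=> e; apply: oner_neq0.
move=> u; have -> : [ffun e => 1 * u e] = u by apply/ffunP => e; rewrite ffunE mul1r.
by [].
Qed.
End Elements.

Hypothesis HP : forall M, template_class Phi M -> char3_rep M.

Lemma template_twin (B E : finType) (A : X + B -> W + E -> F) (V : vectType F)
    (p : 'Hom({ffun X + B -> F^o}, V)) : conforms A -> lker p = Cspan A ->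
  exists (F' : fieldType) (V' : vectType F') (v' : ft_Y0 Phi + E -> V'),
    3 \in [pchar F'] /\ twin (fun x => p (mxcol A (telt x))) v'.
Proof.
move=> cA kp; have [F' [c3 /representableP[V' [v' rv']]]] := HP (conforms_class cA).
exists F', V', (fun x => v' (temb A x)); split=> // l.
rewrite -(dim_tmatroid l kp) -[RHS](congr1 (fun x => \dim <<x>>) (esym (map_comp v' (temb A) l))).
rewrite (vrep_seq _ rv'); congr rk; apply/setP => e; rewrite inE.
by apply/imsetP/mapP => -[x xl ->]; exists x.
Qed.
End TemplateTwin.

(** * Counting the elements of a frame configuration *)

Section FrameConfigurations.
Variables (F : finFieldType) (F' : fieldType) (U : vectType F) (U' : vectType F').
Hypotheses (cF : #|F| = 4%N) (c3 : 3 \in [pchar F']).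
Variables (S TT : finType) (s : S -> U) (t : TT -> U) (f : S -> U') (g : TT -> U').
Hypothesis tw : twin
  (fun x : (S * S + TT)%type => match x with inl y => s y.1 - s y.2 | inr z => t z end)
  (fun x => match x with inl y => f y.1 - f y.2 | inr z => g z end).
Hypothesis si : injective s.

Definition ev (B : finType) (b : B) : {ffun B -> F^o} := [ffun x => (x == b)%:R].

(** The tips, spokes and edges of the overview, split into a component in [U] and one indexed by
    vertices. Edges are sums because signs vanish over GF(4). *)
Definition frame_form (B : finType) (v : U * {ffun B -> F^o}) :=
  [\/ exists z, v = (t z, 0), exists b i, v = (s i, ev b)
    | exists b b', b != b' /\ v = (0, ev b + ev b')].

Lemma frame_dtwin : dtwin s f.
Proof. exact: (twin_comp (fun x : S * S => inl x) tw). Qed.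

(** The differences lie in [D], so the affine rank is at most [\dim D + 1], and [nullity_le2] adds
    2. *)
Lemma coset_card (D : {vspace U}) (w : U) (A : {set S}) :
  (forall i, i \in A -> s i - w \in D) -> (#|A| <= \dim D + 3)%N.
Proof.
move=> AD; have := nullity_le2 cF c3 frame_dtwin si A.
have [->|[a aA]] := set_0Vmem A; first by rewrite cards0.
rewrite (hrk_adim s aA) => le; apply: leq_trans le _; rewrite addSn -addnS leq_add2r.
rewrite /adim; apply/dimvS/span_subvP => _ /imageP[i iA ->].
have -> : s i - s a = (s i - w) - (s a - w) by vlin; ring.
by rewrite memvB ?AD.
Qed.

(** Equality in [coset_card] means nullity 2 with differences spanning [D]. By [span_diff_parallel]
    every tip in [D] is then parallel to a difference, and [directions] counts those. *)
Lemma tips_card (D : {vspace U}) (w : U) (A : {set S}) (T : finType) (h : T -> TT) :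
  (forall i, i \in A -> s i - w \in D) -> #|A| = (\dim D + 3)%N ->
  (forall x, t (h x) \in D) -> (forall x, t (h x) != 0) ->
  (forall x y, t (h y) \in <[t (h x)]>%VS -> x = y) ->
  (#|T| + 5 <= 'C(\dim D + 3, 2))%N.
Proof.
move=> AD cA tD t0 tp.
have [a aA] : exists a, a \in A by apply/card_gt0P; rewrite cA addn3.
have sub : (<<[seq s i - s a | i in A]>> <= D)%VS.
  apply/span_subvP => _ /imageP[i iA ->].
  have -> : s i - s a = (s i - w) - (s a - w) by vlin; ring.
  by rewrite memvB ?AD.
have nul := nullity_le2 cF c3 frame_dtwin si A.
have dle := dimvS sub.
have eD : <<[seq s i - s a | i in A]>>%VS = D.
  apply/eqP; rewrite eqEdim sub /=.
  by move: nul; rewrite (hrk_adim s aA) cA /adim; move: (\dim _) (\dim _) => x y; lia.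
have eA : #|A| = (hrk s A + 2)%N by rewrite (hrk_adim s aA) /adim eD cA addnS addSn.
have [Dr [sDr DrP]] := directions cF c3 frame_dtwin si eA.
rewrite -cA; apply: leq_trans sDr; rewrite leq_add2r.
pose I : finType := {i : S | i \in A}; pose a' : I := Sub a aA.
have sI : injective (fun i : I => s (val i)) by move=> x y /si/val_inj.
have cI : #|I| = #|A| by rewrite card_sig; apply: eq_card.
have spanI : <<[seq s (val i) - s a | i : I]>>%VS = D.
  rewrite -eD; apply: eq_span => u; apply/imageP/imageP => [[i _ ->]|[i iA ->]].
    by exists (val i); first exact: (valP i).
  by exists (Sub i iA).
have hI : hrk (fun i : I => s (val i)) setT = hrk s A.
  rewrite (hrk_adim _ (in_setT a')) (hrk_adim s aA) /adim eD; congr (_.+1).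
  rewrite -[in RHS]spanI; congr (\dim _); apply: eq_span => u.
  by apply/imageP/imageP => -[i _ ->]; exists i.
have ex x : exists2 e, e \in Dr & t (h x) \in <[e]>%VS.
  have twx : twin (fun y : option (I * I) => if y is Some y then s (val y.1) - s (val y.2) else t (h x))
       (fun y : option (I * I) => if y is Some y then f (val y.1) - f (val y.2) else g (h x)).
    have := twin_comp (fun y : option (I * I) => if y is Some y then inl (val y.1, val y.2) else inr (h x)) tw.
    by apply: eq_twin => -[].
  have [|||i [j [ij hij]]] := @span_diff_parallel F F' U U' cF c3 I (fun i => s (val i))
    (fun i => f (val i)) (t (h x)) (g (h x)) a' twx sI.
  - by rewrite cI hI.
  - exact: t0.
  - by rewrite spanI.
  have vij : val i != val j by apply: contraNneq ij => /val_inj ->.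
  have [e eDr he] := DrP _ _ (valP i) (valP j) vij; exists e => //.
  have d0 : s (val i) - s (val j) != 0 by rewrite subr_eq0 (inj_eq si).
  case/vlineP: hij => k ek; case/vlineP: he => l el.
  have k0 : k != 0 by apply: contraNneq d0 => k0; rewrite ek k0 scale0r.
  apply/vlineP; exists (k^-1 * l); rewrite -scalerA -el ek scalerA mulVf // scale1r.
  by [].
pose ix x := index (projT1 (boolp.cid2 (ex x))) Dr.
have ixP x : (ix x < size Dr)%N /\ t (h x) \in <[nth (0 : U)%R Dr (ix x)]>%VS.
  by rewrite /ix; case: (boolp.cid2 _) => e eDr he /=; rewrite index_mem nth_index.
pose k x : 'I_(size Dr) := Ordinal (ixP x).1.
rewrite -[leqRHS]card_ord -(card_imset predT (f := k)).
  exact: max_card.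
move=> x y exy; apply: tp.
have /vlineP[p ep] := (ixP x).2; have /vlineP[q eq] := (ixP y).2.
have ei : ix x = ix y := congr1 val exy.
have p0 : p != 0 by apply: contraNneq (t0 x) => p0; rewrite ep p0 scale0r.
apply/vlineP; exists (q / p); rewrite eq ep -ei scalerA -mulrA mulVf // mulr1.
by [].
Qed.

Section Count.
Variables (B T : finType) (u : T -> U * {ffun B -> F^o}).
Hypotheses (uf : forall x, frame_form (u x)) (u0 : forall x, u x != 0)
  (up : forall x y, u y \in <[u x]>%VS -> x = y).
Let P := <<map u (enum T)>>%VS.
Hypothesis sur : forall b, exists w, (w, ev b) \in P.

Let n := #|B|.

Lemma mem_P x : u x \in P.
Proof. by apply: memv_span; apply/mapP; exists x; rewrite ?mem_enum. Qed.

Lemma u_inj : injective u.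
Proof. by move=> x y e; apply: up; rewrite e memv_line. Qed.

Lemma dim_P : exists D : {vspace U}, (forall w, (w \in D) = ((w, 0) \in P)) /\
  \dim P = (n + \dim D)%N.
Proof.
pose g0 (w : U) : U * {ffun B -> F^o} := (w, 0).
have lg : linear g0.
  move=> k x y; have -> : k *: g0 x + g0 y = (k *: x + y, k *: (0 : {ffun B -> F^o}) + 0) by [].
  by rewrite scaler0 addr0.
pose G : {linear U -> (U * {ffun B -> F^o})%type} := HB.pack g0 (GRing.isLinear.Build _ _ _ _ g0 lg).
pose i := linfun G.
have iE w : i w = (w, 0) by rewrite lfunE.
pose q : 'Hom(_, {ffun B -> F^o}) := linfun (snd : U * {ffun B -> F^o} -> {ffun B -> F^o}).
have qE v : q v = v.2 by rewrite lfunE.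
exists (i @^-1: P)%VS; split=> [w|]; first by rewrite -memv_preim iE.
have := limg_ker_dim q P.
have -> : (q @: P)%VS = fullv.
  apply/eqP; rewrite eqEsubv subvf /=; apply/subvP => h _.
  have -> : h = \sum_b h b *: ev b.
    apply/ffunP => b; rewrite sum_ffunE (bigD1 b) //= big1 ?addr0 => [|b' nb].
      by rewrite !ffunE eqxx; apply/esym/mulr1.
    by rewrite !ffunE eq_sym (negbTE nb) scaler0.
  apply: memv_suml => b _; apply: memvZ; have [w wP] := sur b.
  by apply/memv_imgP; exists (w, ev b) => //; rewrite qE.
have -> : \dim {:{ffun B -> F^o}} = n.
  have := dim_orthv (0 : {vspace {ffun B -> F^o}}); rewrite dimv0 addn0 => e.
  rewrite /n -e; congr (\dim _); apply/esym/eqP; rewrite eqEsubv subvf /=; apply/subvP => h _.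
  apply/orthvP => x; rewrite memv0 => /eqP ->.
  by rewrite /dotf big1 // => b _; rewrite ffunE mul0r.
have -> : (P :&: lker q)%VS = (i @: (i @^-1: P))%VS.
  apply/vspaceP => v; apply/memv_capP/memv_imgP => [[vP]|[w wP ->]].
    rewrite memv_ker qE => /eqP v2; exists v.1; first by rewrite -memv_preim iE -v2 -surjective_pairing.
    by rewrite iE -v2 -surjective_pairing.
  by rewrite memv_ker qE iE eqxx; split=> //; rewrite -iE memv_preim.
rewrite limg_dim_eq; first by move=> <-; rewrite addnC.
apply/eqP; rewrite -subv0; apply/subvP => w /memv_capP[_]; rewrite memv_ker iE.
by rewrite memv0 => /eqP[->].
Qed.

(** The spokes at a vertex lie in one coset of [D], and edges join vertices of equal cosets. In the
    extremal case the three bounds add up to C(n+d+3, 2) - 5 with d = [\dim D]. Otherwise n - 1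
    edges or n spokes are missing, which outweighs the crude bound [#|TT|] on the tips because n is
    large. *)
Lemma count_full : (#|TT| + 6 + \dim {:U} <= \dim P)%N ->
  (2 * #|T| + 4 <= \dim P * \dim P + 5 * \dim P)%N.
Proof.
have [D [DP dP]] := dim_P; rewrite dP => big.
have dD : (\dim D <= \dim {:U})%N by apply/dimvS/subvf.
have nb : (#|TT| + 6 <= n)%N.
  by move: big dD; move: (\dim _) (\dim _) => x y; lia.
pose ub b := projT1 (boolp.cid (sur b)).
have ubP b : (ub b, ev b) \in P by rewrite /ub; case: (boolp.cid _).
have spk b w : (w, ev b) \in P -> w - ub b \in D.
  move=> wP; rewrite DP; have -> : (w - ub b, 0) = (w, ev b) - (ub b, ev b).
    by have -> : (w, ev b) - (ub b, ev b) = (w - ub b, ev b - ev b) by []; rewrite subrr.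
  by rewrite memvB.
have edg b b' : (0, ev b + ev b') \in P -> ub b - ub b' \in D.
  move=> wP; rewrite DP.
  have -> : (ub b - ub b', 0) = (ub b, ev b) + (ub b', ev b') - (0, ev b + ev b').
    have -> : (ub b, ev b) + (ub b', ev b') - (0, ev b + ev b') =
      (ub b + ub b' - 0, ev b + ev b' - (ev b + ev b')) by [].
    by rewrite subrr subr0 -{1}(oppv_card4 cF (ub b')) opprK.
  by rewrite memvB // memvD.
pose TA := [set x | boolp.asbool (exists z, u x = (t z, 0))].
pose TB := [set x | boolp.asbool (exists b i, u x = (s i, ev b))].
pose TC := [set x | boolp.asbool (exists b b', b != b' /\ u x = (0, ev b + ev b'))].
have cT : (#|T| <= #|TA| + #|TB| + #|TC|)%N.
  rewrite -cardsT; have -> : [set: T] = TA :|: TB :|: TC.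
    apply/setP => x; rewrite !inE; apply/esym; have [h|h|h] := uf x.
    - by have /boolp.asboolP -> := h.
    - by have /boolp.asboolP -> := h; rewrite orbT.
    by have /boolp.asboolP -> := h; rewrite orbT.
  apply: leq_trans (leq_card_setU _ _) _; rewrite leq_add2r; exact: leq_card_setU.
pose I b := [set i | s i - ub b \in D].
have I3 b : (#|I b| <= \dim D + 3)%N.
  by apply: (coset_card (w := ub b)) => i; rewrite inE.
have TAz x : x \in TA -> exists z, u x = (t z, 0) by rewrite inE => /boolp.asboolP.
have TBz x : x \in TB -> exists q : B * S, u x = (s q.2, ev q.1).
  by rewrite inE => /boolp.asboolP[b [i e]]; exists (b, i).
have TCz x : x \in TC -> exists A : {set B}, [/\ #|A| == 2, u x = (0, \sum_(b in A) ev b)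
    & forall b b', A = [set b; b'] -> ub b - ub b' \in D].
  rewrite inE => /boolp.asboolP[b [b' [nbb e]]]; exists [set b; b']; split.
  - by rewrite cards2 nbb.
  - by rewrite big_setU1 ?inE //= big_set1.
  move=> a a' eA; have xP := mem_P x; rewrite e in xP.
  have h := edg _ _ xP.
  have : a \in [set b; b'] by rewrite eA !inE eqxx.
  have : a' \in [set b; b'] by rewrite eA !inE eqxx orbT.
  rewrite !inE => /orP[]/eqP -> /orP[]/eqP -> //; rewrite ?subrr ?mem0v //.
  by rewrite -opprB memvN.
have cTA : (#|TA| <= #|TT|)%N.
  have [e|[x0 x0A]] := set_0Vmem TA; first by rewrite e cards0.
  have [z0 _] := TAz x0 x0A.
  have h x : exists z, x \in TA -> u x = (t z, 0).
    by case xA : (x \in TA); [have [z e] := TAz x xA; exists z | exists z0].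
  pose k x := projT1 (boolp.cid (h x)).
  have kP x : x \in TA -> u x = (t (k x), 0) by rewrite /k; case: (boolp.cid _).
  rewrite -(card_in_imset (f := k)); first exact: max_card.
  by move=> x y xA yA e; apply: u_inj; rewrite (kP x xA) (kP y yA) e.
have cTB m : (forall b, #|I b| <= m)%N -> (#|TB| <= n * m)%N.
  move=> Im; pose Q := [set q : B * S | q.2 \in I q.1].
  have cQ : (#|Q| <= n * m)%N.
    have -> : #|Q| = (\sum_b #|I b|)%N.
      rewrite -sum1_card (eq_bigl (fun q : B * S => q.2 \in I q.1)) => [|q]; last by rewrite inE.
      rewrite -(pair_big_dep predT (fun b i => i \in I b) (fun _ _ => 1%N)) /=.
      by apply: eq_bigr => b _; rewrite sum1_card.
    by rewrite -sum_nat_const; apply: leq_sum => b _.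
  apply: leq_trans cQ.
  have [e|[x0 x0A]] := set_0Vmem TB; first by rewrite e cards0.
  have [z0 _] := TBz x0 x0A.
  have h x : exists q : B * S, x \in TB -> u x = (s q.2, ev q.1).
    by case xA : (x \in TB); [have [z e] := TBz x xA; exists z | exists z0].
  pose k x := projT1 (boolp.cid (h x)).
  have kP x : x \in TB -> u x = (s (k x).2, ev (k x).1) by rewrite /k; case: (boolp.cid _).
  rewrite -(card_in_imset (f := k) (D := TB)); last first.
    by move=> x y xA yA e; apply: u_inj; rewrite (kP x xA) (kP y yA) e.
  apply/subset_leq_card/subsetP => _ /imsetP[x xB ->]; rewrite !inE.
  by apply: spk; rewrite -(kP x xB) mem_P.
have [k kP] : exists k : T -> {set B}, forall x, x \in TC -> [/\ #|k x| == 2,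
    u x = (0, \sum_(b in k x) ev b) & forall b b', k x = [set b; b'] -> ub b - ub b' \in D].
  have h x : exists A : {set B}, x \in TC -> [/\ #|A| == 2, u x = (0, \sum_(b in A) ev b)
    & forall b b', A = [set b; b'] -> ub b - ub b' \in D].
    by case xA : (x \in TC); [have [z e] := TCz x xA; exists z | exists set0].
  by exists (fun x => projT1 (boolp.cid (h x))) => x; case: (boolp.cid _).
have ki : {in TC &, injective k}.
  move=> x y xC yC e; apply: u_inj; have [_ -> _] := kP x xC; have [_ -> _] := kP y yC.
  by rewrite e.
pose pairs := [set A : {set B} | #|A| == 2].
have cpairs : #|pairs| = 'C(n, 2) by rewrite card_draws.
have kpairs : k @: TC \subset pairs.
  by apply/subsetP => _ /imsetP[x /kP[h _ _] ->]; rewrite inE.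
have bin2n : (2 * 'C(n, 2) = n * n.-1)%N.
  by rewrite bin2 mul2n halfK; case: (n) => // m; rewrite oddM /= andNb subn0.
have [[b1 [b2 nb12]]|all1] := boolp.pselect (exists b1 b2, ub b1 - ub b2 \notin D).
  have cTC : (#|TC| + n.-1 <= 'C(n, 2))%N.
    (* A vertex [b] is not in the coset of [b1] or not in that of [b2], so one of these two edges is
       missing; this gives [n.-1] distinct missing edges. *)
    pose ms b := if ub b - ub b1 \notin D then [set b1; b] else [set b2; b].
    have b12 : b1 != b2 by apply: contraNneq nb12 => ->; rewrite subrr mem0v.
    have msP b : b != b1 -> ms b \in pairs /\ ms b \notin k @: TC.
      move=> bb1; rewrite /ms; case: ifP => hb.
        split; first by rewrite inE cards2 (eq_sym b1 b) bb1.
        apply/negP => /imsetP[x /kP[_ _ hx] e]; have := hx b b1.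
        by rewrite -e setUC => /(_ erefl); rewrite (negbTE hb).
      have {}hb := negbFE hb.
      have bb2 : b2 != b.
        apply: contraNneq nb12 => eb; move: hb; rewrite -eb => hb.
        by rewrite -opprB memvN.
      split; first by rewrite inE cards2 bb2.
      apply/negP => /imsetP[x /kP[_ _ hx] e]; have := hx b b2.
      rewrite -e setUC => /(_ erefl) h2; move/negP: nb12; apply.
      have -> : ub b1 - ub b2 = (ub b - ub b2) - (ub b - ub b1) by vlin; ring.
      by rewrite memvB.
    have msI : {in [set~ b1] &, injective ms}.
      move=> b c; rewrite !inE => bb cb; rewrite /ms; case: ifP => hb; case: ifP => hc e.
      - have : b \in [set b1; c] by rewrite -e !inE eqxx orbT.
        by rewrite !inE (negbTE bb) => /eqP.
      - have : b1 \in [set b2; c] by rewrite -e !inE eqxx.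
        by rewrite !inE (negbTE b12) eq_sym (negbTE cb).
      - have : b1 \in [set b2; b] by rewrite e !inE eqxx.
        by rewrite !inE (negbTE b12) eq_sym (negbTE bb).
      have : b \in [set b2; c] by rewrite -e !inE eqxx orbT.
      rewrite !inE => /orP[/eqP eb|/eqP //].
      by move/negP: nb12; case; rewrite -opprB memvN -eb; move/negbFE: hb.
    have -> : n.-1 = #|ms @: [set~ b1]|.
      rewrite card_in_imset // /n -(cardsC [set b1]) cards1 //.
    rewrite -(card_in_imset ki) -cpairs -cardsUI.
    have -> : k @: TC :&: ms @: [set~ b1] = set0.
      apply/setP => A; rewrite in_setI in_set0; apply/negbTE/negP => /andP[h1 /imsetP[b hb eA]].
      by rewrite !inE in hb; have [_ /negP] := msP b hb; apply; rewrite -eA.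
    rewrite cards0 addn0; apply/subset_leq_card; rewrite subUset kpairs /=.
    by apply/subsetP => _ /imsetP[b hb ->]; rewrite !inE in hb; have [] := msP b hb.
  have := cTB _ I3; move: cT cTA cTC nb bin2n; clear.
  move: #|T| #|TA| #|TB| #|TC| #|TT| (n) (\dim D) 'C(n, 2) => T0 a b c tt m d bn; nia.
have cTC : (#|TC| <= 'C(n, 2))%N.
  by rewrite -(card_in_imset ki) -cpairs; apply: subset_leq_card.
have [b0 _] : exists b : B, b \in B by apply/card_gt0P; apply: leq_trans nb; rewrite addnS.
have Ib b : I b = I b0.
  apply/setP => i; rewrite !inE.
  have h : ub b - ub b0 \in D.
    by apply: contraT => h; exfalso; apply: all1; exists b, b0.
  have -> : s i - ub b0 = (s i - ub b) + (ub b - ub b0) by vlin; ring.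
  apply/idP/idP => hh; first by rewrite memvD.
  by rewrite -[s i - ub b](addrK (ub b - ub b0)) memvB.
(* All cosets are equal here. With [\dim D + 3] spokes available the sharp bound on tips is needed;
   one spoke fewer at every vertex already saves [n]. *)
have [e3|n3] := eqVneq #|I b0| (\dim D + 3)%N.
  have tips : (#|TA| + 5 <= 'C(\dim D + 3, 2))%N.
    pose TX : finType := {x : T | x \in TA}.
    have hz (x : TX) : exists z, u (val x) = (t z, 0) by apply: TAz; apply: (valP x).
    pose h (x : TX) := projT1 (boolp.cid (hz x)).
    have hP x : u (val x) = (t (h x), 0) by rewrite /h; case: (boolp.cid _).
    have eTX : #|TA| = #|TX| by rewrite card_sig; apply: eq_card.
    rewrite eTX; apply: (tips_card (w := ub b0) (A := I b0) (h := h)) => //.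
    - by move=> i; rewrite inE.
    - by move=> x; rewrite DP -hP mem_P.
    - move=> x; apply: contraNneq (u0 (val x)) => e; by rewrite hP e.
    move=> x y /vlineP[c e]; apply/val_inj/up; rewrite !hP; apply/vlineP; exists c.
    have -> : c *: (t (h x), (0 : {ffun B -> F^o})) = (c *: t (h x), c *: 0) by [].
    by rewrite scaler0 -e.
  have := cTB _ I3.
  have e2 : (2 * 'C(\dim D + 3, 2) = (\dim D + 3) * (\dim D + 2))%N.
    by rewrite bin2 mul2n halfK addn3 addn2 oddM /= andNb subn0.
  move: cT cTC nb bin2n tips e2; clear.
  move: #|T| #|TA| #|TB| #|TC| #|TT| (n) (\dim D) => T0 a b c tt m d; nia.
have I2 b : (#|I b| <= \dim D + 2)%N.
  by rewrite Ib -ltnS -addnS ltn_neqAle n3 I3.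
have := cTB _ I2; move: cT cTA cTC nb bin2n; clear.
move: #|T| #|TA| #|TB| #|TC| #|TT| (n) (\dim D) => T0 a b c tt m d; nia.
Qed.
End Count.

(* A vertex [b0] that is not reached by the span can be mapped to zero without
   changing the matroid, so that the previous lemma applies to a minimal [B]. *)
Lemma count_frame (i0 : S) (B T : finType) (u : T -> U * {ffun B -> F^o}) : s i0 = 0 ->
  (forall x, frame_form (u x)) -> (forall x, u x != 0) ->
  (forall x y, u y \in <[u x]>%VS -> x = y) ->
  (#|TT| + 6 + \dim {:U} <= \dim <<map u (enum T)>>)%N ->
  (2 * #|T| + 4 <= \dim <<map u (enum T)>> * \dim <<map u (enum T)>> +
                   5 * \dim <<map u (enum T)>>)%N.
Proof.
move=> s0; move: {2}#|B| (leqnn #|B|) => n.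
elim: n B u => [|n IH] B u Bn uf u0 up big.
  apply: count_full => // b; exfalso; move: Bn; rewrite leqn0 => /eqP/card0_eq/(_ b).
  by rewrite inE.
set P := <<map u (enum T)>>%VS in big *.
have [sur|] := boolp.pselect (forall b, exists w, (w, ev b) \in P); first exact: count_full.
move=> /boolp.existsNP[b0 nb0].
have uP x : u x \in P by apply: memv_span; apply/mapP; exists x; rewrite ?mem_enum.
pose q : 'Hom(_, {ffun B -> F^o}) := linfun (snd : U * {ffun B -> F^o} -> {ffun B -> F^o}).
have qE v : q v = v.2 by rewrite lfunE.
(* Such a [c] exists because [ev b0] is not in the projection of [P]. On [P] it expresses the
   coordinate [b0] by the others, so dropping that coordinate loses no rank. *)
have [c cQ cb0] : exists2 c, c \in orthv (q @: P) & c b0 != 0.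
  apply: boolp.contrapT => nex; apply: nb0.
  have : ev b0 \in (q @: P)%VS.
    rewrite -[(q @: P)%VS]orthv_orthv; apply/orthvP => c cQ.
    rewrite /dotf (bigD1 b0) //= ffunE eqxx mulr1 big1 ?addr0 => [|b nb].
      by apply/eqP; apply: contraT => h; exfalso; apply: nex; exists c.
    by rewrite ffunE (negbTE nb) mulr0.
  by case/memv_imgP => v vP; rewrite qE => e; exists v.1; rewrite e -surjective_pairing.
have cP v : v \in P -> \sum_b v.2 b * c b = 0.
  move=> vP; have /orthvP/(_ v.2) := cQ; apply; rewrite -qE; exact: memv_img.
have cev b : \sum_x ev b x * c x = c b.
  rewrite (bigD1 b) //= ffunE eqxx mul1r big1 ?addr0 // => x xb.
  by rewrite ffunE (negbTE xb) mul0r.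
pose B' : finType := {b : B | b != b0}.
pose th0 (v : U * {ffun B -> F^o}) : U * {ffun B' -> F^o} := (v.1, [ffun b => v.2 (val b)]).
have lth : linear th0.
  move=> k v w; rewrite /th0; congr (_, _); apply/ffunP => b; by rewrite !ffunE.
pose TH : {linear (U * {ffun B -> F^o})%type -> (U * {ffun B' -> F^o})%type} :=
  HB.pack th0 (GRing.isLinear.Build _ _ _ _ th0 lth).
pose th := linfun TH.
have thE v : th v = (v.1, [ffun b => v.2 (val b)]) by rewrite lfunE.
have kth v : v \in P -> th v = 0 -> v = 0.
  move=> vP; rewrite thE => -[v1 /ffunP v2].
  have h b : b != b0 -> v.2 b = 0 by move=> nb; have := v2 (Sub b nb); rewrite !ffunE SubK.
  rewrite [v]surjective_pairing v1; congr (_, _); apply/ffunP => b; rewrite ffunE.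
  have [->|/h //] := eqVneq b b0; have := cP v vP.
  rewrite (bigD1 b0) //= big1 ?addr0 => [/eqP|b' /h ->]; last by rewrite mul0r.
  by rewrite mulf_eq0 (negbTE cb0) orbF => /eqP.
have dP : \dim <<map (fun x => th (u x)) (enum T)>> = \dim P.
  rewrite -[RHS](limg_dim_eq (f := th)); last first.
    apply/eqP; rewrite -subv0; apply/subvP => v /memv_capP[vP]; rewrite memv_ker memv0.
    by move=> /eqP/(kth v vP) ->.
  have -> : [seq th (u x) | x <- enum T] = map th (map u (enum T)) by elim: (enum T) => //= x l ->.
  by rewrite -(limg_span th (map u (enum T))).
rewrite -dP in big *; apply: IH => //.
- have := cardC1 b0; rewrite /B' card_sig => h.
  by move: Bn; rewrite -(cardC (pred1 b0)) card1 add1n ltnS => le; apply: leq_trans le; rewrite eq_leq //; apply: eq_card => b; rewrite !inE.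
- move=> x; have := cP _ (uP x).
  have [[z e]|[b [i e]]|[b [b' [nb e]]]] := uf x.
  + by move=> _; constructor 1; exists z; rewrite thE e; congr (_, _); apply/ffunP => b; rewrite !ffunE.
  + rewrite e /= cev => cb; constructor 2.
    have nb : b != b0 by apply: contraNneq cb0 => <-; rewrite cb.
    exists (Sub b nb), i; rewrite thE; congr (_, _); apply/ffunP => a.
    by rewrite !ffunE -val_eqE SubK.
  move=> _; have [eb|neb] := eqVneq b b0.
    have nb' : b' != b0 by rewrite -eb eq_sym.
    constructor 2; exists (Sub b' nb'), i0; rewrite thE e s0; congr (_, _); apply/ffunP => a.
    by rewrite !ffunE -val_eqE SubK /= eb (negbTE (valP a)) add0r.
  have [eb'|neb'] := eqVneq b' b0.
    constructor 2; exists (Sub b neb), i0; rewrite thE e s0; congr (_, _); apply/ffunP => a.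
    by rewrite !ffunE -val_eqE SubK /= eb' (negbTE (valP a)) addr0.
  constructor 3; exists (Sub b neb), (Sub b' neb'); split; first by rewrite -val_eqE !SubK.
  by rewrite thE e; congr (_, _); apply/ffunP => a; rewrite !ffunE -!val_eqE !SubK.
- move=> x; apply: contraNneq (u0 x) => /(kth _ (uP x)) ->; exact: eqxx.
move=> x y /vlineP[k e]; apply: up; apply/vlineP; exists k.
apply/eqP; rewrite -subr_eq0; apply/eqP/kth; first by rewrite memvB ?memvZ.
by rewrite linearB linearZ /= e subrr.
Qed.
End FrameConfigurations.

(** * The extremal matroids *)

(** The labels are closed under contraction, with [Nil] for a loop. So ranks are computed on labels
    alone, and any two injective choices of four scalars give twins. *)
Inductive label (n : nat) := Edge (i j : 'I_n) | Spoke (i : 'I_n) (k : 'I_4) | Tip | Nil.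
Arguments Tip {n}.
Arguments Nil {n}.

Definition nonzero n (a : label n) : bool :=
  match a with Edge i j => i != j | Spoke _ _ => true | Tip => true | Nil => false end.

(* The label of the vector [b] after contracting the vector [a]. *)
Definition relabel n (a b : label n) : label n :=
  match a with
  | Edge i j => let m v := if v == j then i else v in
      match b with Edge u v => Edge (m u) (m v) | Spoke u k => Spoke (m u) k | _ => b end
  | Spoke i k =>
      match b with
      | Edge u v => if u == i then (if v == i then Nil else Spoke v k)
                    else if v == i then Spoke u k else b
      | Spoke u k' => if u == i then (if k' == k then Nil else Tip) else b
      | _ => b
      end
  | Tip => match b with Spoke u _ => Spoke u 0 | Tip => Nil | _ => b end
  | Nil => b
  end.

Section LabelVectors.
Variables (K : fieldType) (n : nat) (c : 'I_4 -> K).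
Hypothesis ci : injective c.
Local Notation V := {ffun option 'I_n -> K^o}.

Definition unit_vec (o : option 'I_n) : V := [ffun o' => (o' == o)%:R].

Definition lvec (a : label n) : V :=
  match a with
  | Edge i j => unit_vec (Some i) - unit_vec (Some j)
  | Spoke i k => unit_vec (Some i) + c k *: unit_vec None
  | Tip => unit_vec None
  | Nil => 0
  end.

(** A linear form with value 1 on the vector of [a], used to project along it. For [Tip] the second
    term sends every spoke at a vertex to the one with coefficient [c 0], so that parallel spokes
    get the same label. *)
Definition pivot_form (a : label n) (f : V) : K^o :=
  match a with
  | Edge i j => - f (Some j)
  | Spoke i k => f (Some i)
  | Tip => f None - c 0 * \sum_i f (Some i)
  | Nil => 0
  end.

Definition lscale (a b : label n) : K :=
  match a, b with
  | Spoke i k, Edge u v => if (u == i) && (v != i) then -1 else 1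
  | Spoke i k, Spoke u k' => if (u == i) && (k' != k) then c k' - c k else 1
  | _, _ => 1
  end.

Lemma lscale_neq0 a b : lscale a b != 0.
Proof.
case: a => [i j|i k||]; case: b => [u v|u k'||] /=; rewrite ?oner_neq0 //.
  by case: ifP => _; rewrite ?oppr_eq0 oner_neq0.
case: ifP => [/andP[_ nk]|_]; last exact: oner_neq0.
by rewrite subr_eq0 (inj_eq ci).
Qed.

Lemma pivot_form_linear a : linear (pivot_form a).
Proof.
move=> k f g; case: a => [i j|i k'||] /=; rewrite ?ffunE //.
- by rewrite opprD scalerN.
- under eq_bigr do rewrite !ffunE.
  rewrite big_split /= -scaler_sumr /GRing.scale /=; ring.
by rewrite scaler0 addr0.
Qed.

Lemma pivot_lvec a b : nonzero a ->
  lvec b - pivot_form a (lvec b) *: lvec a = lscale a b *: lvec (relabel a b).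
Proof.
have sumE (j : 'I_n) : \sum_i (Some i == Some j)%:R = 1 :> K.
  rewrite (bigD1 j) //= eqxx big1 ?addr0 // => i ij.
  by rewrite (inj_eq Some_inj) (negbTE ij).
case: a => [i j|i k||] //= na; apply/ffunP => o.
- case: b => [u v|u k'||] /=; rewrite ?scale1r !ffunE ?(inj_eq Some_inj) /=.
  + have mE w : (o == Some (if w == j then i else w))%:R =
       (o == Some w)%:R + (j == w)%:R * ((o == Some i)%:R - (o == Some j)%:R) :> K.
      rewrite (eq_sym j w); case: (w =P j) => [->|_] /=; ring.
    rewrite !mE /GRing.scale /=; ring.
  + have -> : (o == Some (if u == j then i else u))%:R =
       (o == Some u)%:R + (j == u)%:R * ((o == Some i)%:R - (o == Some j)%:R) :> K.
      rewrite (eq_sym j u); case: (u =P j) => [->|_] /=; ring.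
    rewrite /GRing.scale /=; ring.
  + by rewrite oppr0 /GRing.scale /= mul0r subr0.
  by rewrite oppr0 /GRing.scale /= mul0r subr0.
- case: b => [u v|u k'||] /=; rewrite !ffunE ?(inj_eq Some_inj) /=.
  + rewrite (eq_sym i u) (eq_sym i v).
    case: (u =P i) => [->|_] /=; case: (v =P i) => [->|_] /=;
      rewrite !ffunE /GRing.scale /=; ring.
  + rewrite (eq_sym i u); case: (u =P i) => [->|_] /=; last by rewrite !ffunE /GRing.scale /=; ring.
    case: (k' =P k) => [->|_] /=; rewrite !ffunE /GRing.scale /=; ring.
  + by rewrite /GRing.scale /=; ring.
  by rewrite /GRing.scale /=; ring.
case: b => [u v|u k'||] /=; rewrite ?scale1r.
- have -> : \sum_i (unit_vec (Some u) - unit_vec (Some v)) (Some i) = 0.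
    by under eq_bigr do rewrite !ffunE; rewrite sumrB !sumE subrr.
  by rewrite !ffunE /GRing.scale /=; ring.
- have -> : \sum_i (unit_vec (Some u) + c k' *: unit_vec None) (Some i) = 1.
    by under eq_bigr do rewrite !ffunE /= scaler0 addr0; rewrite sumE.
  by rewrite !ffunE /GRing.scale /=; ring.
- have -> : \sum_i unit_vec None (Some i) = 0 by rewrite big1 // => i _; rewrite ffunE.
  by rewrite !ffunE /GRing.scale /=; ring.
have -> : \sum_i (0 : V) (Some i) = 0 by rewrite big1 // => i _; rewrite ffunE.
by rewrite !ffunE /GRing.scale /=; ring.
Qed.

Lemma pivot_form_id a : nonzero a -> pivot_form a (lvec a) = 1.
Proof.
case: a => [i j|i k||] //= na; rewrite !ffunE ?eqxx /=.
- by rewrite (inj_eq Some_inj) eq_sym (negbTE na) sub0r opprK.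
- by rewrite scaler0 addr0.
by rewrite big1 ?mulr0 ?subr0 // => i _; rewrite ffunE.
Qed.

Lemma dim_lvec_cons a l :
  \dim <<map lvec (a :: l)>> = (nonzero a + \dim <<map lvec (map (relabel a) l)>>)%N.
Proof.
have [na|/negbTE na] := boolP (nonzero a); last first.
  rewrite add0n /= span_cons.
  have -> : lvec a = 0.
    case: a na => [i j|i k||] //= /negbFE/eqP ->; by rewrite subrr.
  have -> : map (relabel a) l = l.
    case: a na => [i j|i k||] //= na; last by rewrite map_id.
    rewrite -[RHS]map_id; move/negbFE/eqP: na => ->; apply: eq_map => b.
    by case: b => [u v|u k||] //=; [congr (Edge _ _) | congr (Spoke _ _)]; case: eqP.
  have -> : <[0 : V]>%VS = 0%VS.
    by apply/eqP; rewrite -subv0 -memvE mem0v.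
  by rewrite add0v.
pose g (f : V) : V := f - pivot_form a f *: lvec a.
have lg : linear g.
  move=> k x y; rewrite /g (pivot_form_linear a) scalerDl scalerBr !scalerA opprD.
  by rewrite addrACA.
pose G : {linear V -> V} := HB.pack g (GRing.isLinear.Build _ _ _ _ g lg).
pose p : 'End(V) := linfun G.
have pE f : p f = f - pivot_form a f *: lvec a by rewrite lfunE.
have kp : lker p = <[lvec a]>%VS.
  apply/vspaceP => f; rewrite memv_ker pE subr_eq0; apply/eqP/vlineP => [->|[k ->]].
    by exists (pivot_form a f).
  have -> : pivot_form a (k *: lvec a) = k.
    have := pivot_form_linear a k (lvec a) 0; rewrite addr0 => ->.
    have -> : pivot_form a 0 = 0.
      have := pivot_form_linear a (-1) 0 0; rewrite scaler0 addr0 scaleN1r => ->.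
      by rewrite addNr.
    by rewrite pivot_form_id // addr0 /GRing.scale /= mulr1.
  by [].
have a0 : lvec a != 0.
  apply: contraTneq (oner_neq0 K) => h; have := pivot_form_id na; rewrite h => <-.
  have := pivot_form_linear a (-1) 0 0; rewrite scaler0 addr0 scaleN1r => ->.
  by rewrite addNr eqxx.
have := dim_map_ker lvec p l; rewrite kp dim_vline a0 => e.
rewrite /= span_cons addvC -e addnC; congr (_ + \dim _)%N.
rewrite -map_comp; transitivity <<[seq lscale a b *: lvec (relabel a b) | b <- l]>>%VS.
  by congr (<<_>>)%VS; apply: eq_map => b; rewrite pE pivot_lvec.
by rewrite (@span_scale K V _ (fun b => lvec (relabel a b)) (lscale a)) //; apply: lscale_neq0.
Qed.
End LabelVectors.

Lemma lvec_twin (K K' : fieldType) n (c : 'I_4 -> K) (c' : 'I_4 -> K') :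
  injective c -> injective c' -> twin (@lvec K n c) (@lvec K' n c').
Proof.
move=> ci ci' l; move: {2}(size l) (leqnn (size l)) => m; elim: m l => [|m IH] [|a l] //= lm;
  rewrite ?span_nil ?dimv0 //.
rewrite -![lvec _ a :: _]/(map (lvec _) (a :: l)) !dim_lvec_cons //; congr addn; apply: IH; rewrite size_map; exact: lm.
Qed.

Section Pivot.
Variable K : fieldType.

(** Multiples of column [c0] clear the row [r0]; the Schur complement remains. *)
Lemma det_pivot k (A : 'M[K]_k.+1) (r0 c0 : 'I_k.+1) : A r0 c0 != 0 ->
  \det A = (-1) ^+ (r0 + c0) * A r0 c0 *
    \det (\matrix_(i, j) (A (lift r0 i) (lift c0 j) -
             A r0 (lift c0 j) / A r0 c0 * A (lift r0 i) c0)).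
Proof.
move=> a0; pose w j := if j == c0 then 0 else A r0 j / A r0 c0.
pose Q : 'M[K]_k.+1 := \matrix_(i, j) ((i == j)%:R - (i == c0)%:R * w j).
have dQ : \det Q = 1.
  rewrite (expand_det_col Q c0) (bigD1 c0) //= big1 ?addr0 => [|i ic].
    rewrite mxE eqxx /w eqxx mulr0 subr0 mul1r /cofactor addnn -signr_odd odd_double expr0 mul1r.
    have -> : row' c0 (col' c0 Q) = 1%:M; last exact: det1.
    apply/matrixP => i j; rewrite !mxE (inj_eq lift_inj) (eq_sym _ c0).
    by rewrite (negbTE (neq_lift _ _)) mul0r subr0.
  by rewrite mxE (negbTE ic) /w eqxx mulr0 subr0 mul0r.
have AQ i j : (A *m Q) i j = A i j - A i c0 * w j.
  rewrite mxE; under eq_bigr do rewrite mxE mulrBr.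
  rewrite sumrB (bigD1 j) //= eqxx mulr1 big1 ?addr0 => [|l lj].
    rewrite (bigD1 c0) //= eqxx mul1r big1 ?addr0 // => l lc.
    by rewrite (negbTE lc) mul0r mulr0.
  by rewrite (negbTE lj) mulr0.
have -> : \det A = \det (A *m Q) by rewrite det_mulmx dQ mulr1.
rewrite (expand_det_row _ r0) (bigD1 c0) //= big1 ?addr0 => [|j jc]; last first.
  rewrite AQ /w (negbTE jc); have -> : A r0 c0 * (A r0 j / A r0 c0) = A r0 j.
    by rewrite mulrCA mulfV // mulr1.
  by rewrite subrr mul0r.
rewrite AQ /w eqxx mulr0 subr0 /cofactor mulrCA mulrA; congr (_ * \det _).
apply/matrixP => i j; rewrite [LHS]mxE [LHS]mxE AQ /w eq_sym (negbTE (neq_lift _ _)).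
by rewrite [RHS]mxE mulrC.
Qed.

Lemma det_scale_col k (A : 'M[K]_k) (d : 'I_k -> K) :
  \det (\matrix_(i, j) (d j * A i j)) = (\prod_j d j) * \det A.
Proof.
have -> : \matrix_(i, j) (d j * A i j) = A *m diag_mx (\row_j d j).
  by apply/matrixP => i j; rewrite mul_mx_diag !mxE mulrC.
rewrite det_mulmx det_diag mulrC; congr (_ * _).
by apply: eq_bigr => j _; rewrite mxE.
Qed.
End Pivot.

(** * Subdeterminants that are powers of the golden mean *)

Section GoldenMean.
Variable R : realType.
Local Notation t := (tau R).

Lemma tau_gt0 : 0 < t.
Proof. by rewrite /tau divr_gt0 // ltr_pwDl // sqrtr_ge0. Qed.

Lemma tau_sqr : t ^+ 2 = t + 1.
Proof.
have h : Num.sqrt (5 : R) ^+ 2 = 5 by rewrite sqr_sqrtr.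
have -> : t ^+ 2 = (1 + 2 * Num.sqrt 5%:R + Num.sqrt (5 : R) ^+ 2) / 4 by rewrite /tau; field.
by rewrite h /tau; field.
Qed.

Definition good (d : R) := d = 0 \/ exists i : int, d = t ^ i \/ d = - t ^ i.

Lemma good_mul x y : good x -> good y -> good (x * y).
Proof.
have t0 := lt0r_neq0 tau_gt0.
case=> [->|[i hi]]; first by rewrite mul0r; left.
case=> [->|[j hj]]; first by rewrite mulr0; left.
right; exists (i + j); rewrite expfzDr //.
by case: hi => ->; case: hj => ->; rewrite ?mulNr ?mulrN ?opprK; [left | right | right | left].
Qed.

Lemma good1 : good 1. Proof. by right; exists 0; left. Qed.
Lemma good_tau : good t. Proof. by right; exists 1; left. Qed.

Lemma good_opp x : good x -> good (- x).
Proof.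
case=> [->|[i [->|->]]]; first by rewrite oppr0; left.
  by right; exists i; right.
by right; exists i; left; rewrite opprK.
Qed.

Lemma good_sign n x : good x -> good ((-1) ^+ n * x).
Proof.
by move=> gx; rewrite -signr_odd; case: (odd n); rewrite ?expr0 ?expr1 ?mulN1r ?mul1r //;
   apply: good_opp.
Qed.

Lemma good_prod (I : Type) (r : seq I) (f : I -> R) :
  (forall i, good (f i)) -> good (\prod_(i <- r) f i).
Proof. by move=> gf; elim/big_ind: _ => //; [apply: good1 | apply: good_mul]. Qed.

(** Four scalars whose pairwise differences are all powers of tau up to sign: tau - 1 = tau^-1,
    tau^2 - tau = 1 and tau^2 - 1 = tau. *)
Definition gcoef (k : 'I_4) : R := nth 0 [:: 0; 1; t; t ^+ 2] k.

Lemma good_sub k k' : good (gcoef k - gcoef k').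
Proof.
have t0 := lt0r_neq0 tau_gt0.
have g2 : good (t + 1) by rewrite -tau_sqr expr2; apply: good_mul; apply: good_tau.
have gi : good (t - 1).
  right; exists (-1); left; apply: (mulfI t0); rewrite mulfV // mulrBr -expr2 tau_sqr.
  by ring.
have gN : good (1 - t) by rewrite -opprB; apply: good_opp.
have gz : good 0 by left.
have gt := good_tau; have g1 := good1.
have gk (i : nat) : (i < 4)%N -> [\/ i = 0%N, i = 1%N, i = 2%N | i = 3%N].
  by case: i => [|[|[|[|]]]] // _; [constructor 1 | constructor 2 | constructor 3 | constructor 4].
rewrite /gcoef tau_sqr.
case: (gk k (ltn_ord k)) => ->; case: (gk k' (ltn_ord k')) => -> /=;
  rewrite ?subrr ?subr0 ?sub0r //; try exact: good_opp.
- have -> : 1 - (t + 1) = - t by ring.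
  exact: good_opp.
- have -> : t - (t + 1) = - 1 by ring.
  exact: good_opp.
- by have -> : t + 1 - 1 = t by ring.
by have -> : t + 1 - t = 1 by ring.
Qed.

Lemma gcoef_inj : injective gcoef.
Proof.
have t0 := tau_gt0.
have t1 : 1 < t.
  have : 0 < (t - 1) * t by rewrite mulrBl -expr2 tau_sqr mul1r addrC addKr ltr01.
  by rewrite pmulr_lgt0 // subr_gt0.
have u : uniq [:: 0; 1; t; t ^+ 2].
  rewrite tau_sqr /= !inE !negb_or.
  rewrite !(lt_eqF ltr01) (lt_eqF t0) (lt_eqF t1) (lt_eqF (addr_gt0 t0 ltr01)) /=.
  by rewrite lt_eqF ?ltrDr ?lt_eqF ?ltrDl.
move=> i j e; apply/val_inj/eqP; rewrite -(nth_uniq 0 _ _ u) ?ltn_ord //; exact/eqP.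
Qed.

(** Pivoting on the first column leaves a determinant of the same kind with relabelled columns,
    scaled by signs and differences of the four scalars. Columns may repeat or vanish after
    relabelling, hence no condition on [g]. *)
Lemma good_det n k (f : 'I_k -> option 'I_n) (g : 'I_k -> label n) : injective f ->
  good (\det (\matrix_(i, j) lvec gcoef (g j) (f i))).
Proof.
elim: k f g => [|k IH] f g fi; first by rewrite det_mx00; apply: good1.
set A := \matrix_(i, j) _.
have zero : (forall i, lvec gcoef (g ord0) (f i) = 0) -> good (\det A).
  move=> h; left; rewrite (expand_det_col A ord0) big1 // => i _.
  by rewrite mxE h mul0r.
have fl r0 : injective (fun i => f (lift r0 i)) by move=> i j /fi /lift_inj.
(* If the row used by [pivot_form] is not selected, the column has at most one nonzero entry, and
   the other columns stay as they are. *)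
have plain r0 : good (lvec gcoef (g ord0) (f r0)) ->
    (forall i, i != r0 -> lvec gcoef (g ord0) (f i) = 0) -> good (\det A).
  move=> ge h; have [e0|e0] := eqVneq (A r0 ord0) 0.
    apply: zero => i; have [->|/h //] := eqVneq i r0; by move: e0; rewrite mxE.
  rewrite (det_pivot e0) -mulrA; apply/good_sign/good_mul; first by rewrite mxE.
  rewrite [X in good (\det X)](_ : _ = \matrix_(i, j) lvec gcoef (g (lift ord0 j)) (f (lift r0 i))); last first.
    apply/matrixP => i j; rewrite !mxE [lvec _ (g ord0) (f (lift r0 i))]h ?mulr0 ?subr0 //.
    by rewrite eq_sym neq_lift.
  exact: (IH _ (fun j => g (lift ord0 j)) (fl r0)).
have pivot r0 : nonzero (g ord0) -> good (lvec gcoef (g ord0) (f r0)) ->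
    lvec gcoef (g ord0) (f r0) != 0 ->
    (forall b, lvec gcoef b (f r0) / lvec gcoef (g ord0) (f r0) =
       pivot_form gcoef (g ord0) (lvec gcoef b)) -> good (\det A).
  move=> na ge e0 h; rewrite (@det_pivot _ _ _ r0 ord0) ?mxE // -mulrA.
  apply/good_sign/good_mul => //.
  rewrite [X in good (\det X)](_ : _ = \matrix_(i, j) (lscale gcoef (g ord0) (g (lift ord0 j)) *
         (\matrix_(i, j) lvec gcoef (relabel (g ord0) (g (lift ord0 j))) (f (lift r0 i))) i j)); last first.
    apply/matrixP => i j; rewrite !mxE h.
    have := congr1 (fun u : {ffun option 'I_n -> R^o} => u (f (lift r0 i)))
      (pivot_lvec gcoef (g (lift ord0 j)) na).
    by rewrite !ffunE.
  rewrite det_scale_col; apply: good_mul; last exact: (IH _ (fun j => relabel _ (g (lift ord0 j))) (fl r0)).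
  apply: good_prod => j; case: (g ord0) => [x y|x l||] /=; case: (g (lift ord0 j)) => [u v|u l'||] /=;
    try exact: good1.
    by case: ifP => _; [apply/good_opp/good1 | apply: good1].
  by case: ifP => _; [apply: good_sub | apply: good1].
have row o : (exists r, f r = o) \/ (forall r, f r != o).
  case: (boolP [exists r, f r == o]) => [/existsP[r /eqP]|/existsPn h]; [by left; exists r | by right].
have gg k0 : good (gcoef k0) by rewrite -[gcoef k0]subr0 -[X in _ - X]/(gcoef 0); apply: good_sub.
case eg : (g ord0) => [i j|i l||].
- have [ij|ij] := eqVneq i j; first by apply: zero => r; rewrite eg ij /= subrr ffunE.
  have [[r er]|nj] := row (Some j).
    have e1 : lvec gcoef (g ord0) (f r) = -1.
      by rewrite eg /= !ffunE er (inj_eq Some_inj) (eq_sym j) (negbTE ij) eqxx sub0r.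
    apply: (pivot r); rewrite ?e1 ?eg ?oppr_eq0 ?oner_neq0 //.
    - exact/good_opp/good1.
    - by move=> b /=; rewrite er invrN1 mulrN1.
  have [[r er]|ni] := row (Some i).
    apply: (plain r) => [|q qr].
      by rewrite eg /= !ffunE er !(inj_eq Some_inj) (negbTE ij) eqxx subr0; apply: good1.
    rewrite eg /= !ffunE (negbTE (nj q)) -er (inj_eq fi) (negbTE qr) subr0 //.
  by apply: zero => q; rewrite eg /= !ffunE (negbTE (nj q)) (negbTE (ni q)) subr0.
- have [[r er]|ni] := row (Some i).
    have e1 : lvec gcoef (g ord0) (f r) = 1 by rewrite eg /= !ffunE er eqxx /= scaler0 addr0.
    apply: (pivot r); rewrite ?e1 ?eg ?oner_neq0 //; first exact: good1.
    by move=> b /=; rewrite er invr1 mulr1.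
  have [[r er]|nn] := row None.
    apply: (plain r) => [|q qr].
      rewrite eg /= !ffunE er /= add0r /GRing.scale /= mulr1; exact: gg.
    by rewrite eg /= !ffunE (negbTE (ni q)) -er (inj_eq fi) (negbTE qr) scaler0 addr0.
  by apply: zero => q; rewrite eg /= !ffunE (negbTE (nn q)) (negbTE (ni q)) scaler0 addr0.
- have [[r er]|nn] := row None.
    apply: (plain r) => [|q qr]; first by rewrite eg /= ffunE er eqxx; apply: good1.
    by rewrite eg /= ffunE -er (inj_eq fi) (negbTE qr).
  by apply: zero => q; rewrite eg /= ffunE (negbTE (nn q)).
by apply: zero => q; rewrite eg /= ffunE.
Qed.
End GoldenMean.

Section LowerBound.
Variables (R : realType) (n : nat).

Definition lground : finType := ({p : 'I_n * 'I_n | (p.1 < p.2)%N} + ('I_n * 'I_4 + unit))%type.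

Definition lab (e : lground) : label n :=
  match e with
  | inl p => Edge (val p).1 (val p).2
  | inr (inl q) => Spoke q.1 q.2
  | inr (inr _) => Tip
  end.

Definition lmatrix (o : option 'I_n) (e : lground) : R := lvec (@gcoef R) (lab e) o.

Definition lmatroid : matroid := column_matroid lmatrix.

Lemma vrep_lmatroid : @vrep _ _ lmatroid (fun e => lvec (@gcoef R) (lab e)).
Proof.
move=> X; rewrite /= /col_rk; congr (\dim _); rewrite !span_image; congr (<<_>>)%VS.
by apply: eq_map => e; apply/ffunP => o; rewrite ffunE.
Qed.

Lemma lmatroid_representable (K : fieldType) : at_least 4 K -> representable K lmatroid.
Proof.
move=> [c ci]; apply: (vrep_representable (v := fun e : lmatroid => lvec c (lab e))).
apply: twin_vrep vrep_lmatroid _; apply: (twin_comp lab); apply: lvec_twin ci.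
exact: gcoef_inj.
Qed.

Lemma lmatroid_golden_mean : golden_mean R lmatroid.
Proof.
exists (option 'I_n), lmatrix; split=> // k f g fi _ d d0.
have [h|//] := @good_det R n k f (fun j => lab (g j)) fi.
by move: d0; rewrite /d h eqxx.
Qed.

Lemma relabel_nonzero (x y : lground) : x != y -> nonzero (relabel (lab x) (lab y)).
Proof.
case: x => [p|[[i k]|[]]]; case: y => [q|[[u l]|[]]] //=.
- move=> ne; have ij := valP p; have uv := valP q; apply/eqP.
  case: ((val q).1 =P (val p).2) => [uj|_]; case: ((val q).2 =P (val p).2) => [vj|_].
  + by move: uv; rewrite /= uj vj ltnn.
  + by move=> iv; move: uv ij; rewrite /= uj iv; case: ltngtP.
  + move=> ui; case/eqP: ne; congr inl; apply/val_inj.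
    by rewrite /= [val p]surjective_pairing [val q]surjective_pairing -ui vj.
  by move=> e; move: uv; rewrite /= e ltnn.
- move=> _; have uv := valP q.
  case: ((val q).1 =P i) => [ui|_]; case: ((val q).2 =P i) => [vi|_] //=.
    by move: uv; rewrite /= ui vi ltnn.
  by rewrite neq_ltn uv.
- move=> ne; case: (u =P i) => [ui|_] //; case: (l =P k) => [lk|_] //.
  by move: ne; rewrite ui lk eqxx.
by move=> _; rewrite neq_ltn (valP q).
Qed.

Lemma lmatroid_simple : simple lmatroid.
Proof.
have nz (x : lground) : nonzero (lab x).
  by case: x => [p|[]] //=; rewrite neq_ltn (valP p).
have rkl l : @rk lmatroid [set x in l] = \dim <<map (lvec (@gcoef R)) (map lab l)>>.
  by rewrite -map_comp -(vrep_seq l vrep_lmatroid).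
have ci := @gcoef_inj R.
move=> X; rewrite /indep leq_eqVlt => /orP[/cards2P[x [y [xy ->]]]|].
  have -> : [set x; y] = [set z in [:: x; y]] by apply/setP => z; rewrite !inE.
  rewrite rkl /= -[lvec _ (lab x) :: _]/(map (lvec (@gcoef R)) [:: lab x; lab y]).
  rewrite dim_lvec_cons // [map (relabel _) _]/= dim_lvec_cons // nz relabel_nonzero //.
  rewrite /= span_nil dimv0.
  have -> : [set z in [:: x; y]] = [set x; y] by apply/setP => z; rewrite !inE.
  by rewrite cards2 xy.
rewrite ltnS leq_eqVlt => /orP[/cards1P[x ->]|].
  have -> : [set x] = [set z in [:: x]] by apply/setP => z; rewrite !inE.
  rewrite rkl /= -[[:: lvec _ (lab x)]]/(map (lvec (@gcoef R)) [:: lab x]).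
  rewrite dim_lvec_cons // nz /= span_nil dimv0.
  have -> : [set z in [:: x]] = [set x] by apply/setP => z; rewrite !inE.
  by rewrite cards1.
rewrite ltnS leqn0 cards_eq0 => /eqP ->.
have -> : (set0 : {set lground}) = [set z in [::]] by apply/setP => z; rewrite !inE.
rewrite rkl /= span_nil dimv0.
have -> : [set z in [::]] = (set0 : {set lground}) by apply/setP => z; rewrite !inE.
by rewrite cards0.
Qed.

Lemma rank_lmatroid : (rank lmatroid <= n.+1)%N.
Proof.
rewrite /rank vrep_lmatroid.
have := dim_orthv <<[seq lvec (@gcoef R) (lab e) | e in [set: lground]]>>%VS.
by rewrite card_option card_ord => <-; apply: leq_addl.
Qed.

Lemma card_lmatroid : #|lmatroid| = ('C(n, 2) + 4 * n + 1)%N.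
Proof.
rewrite /= !card_sum card_prod !card_ord card_unit addnA mulnC; congr (_ + _ + _)%N.
rewrite card_sig -sum1_card.
rewrite -(pair_big_dep predT (fun i j : 'I_n => (i < j)%N) (fun _ _ => 1%N)) /=.
rewrite (exchange_big_dep predT) //= -bin2_sum big_mkord; apply: eq_bigr => j _.
rewrite -(big_ord_widen n (fun _ => 1%N) (ltnW (ltn_ord j))).
by rewrite sum1_card card_ord.
Qed.
End LowerBound.

Lemma at_least_card (F : finFieldType) m : (m <= #|F|)%N -> at_least m F.
Proof.
move=> le; exists (fun i : 'I_m => enum_val (widen_ord le i)) => i j /enum_val_inj e.
by apply/val_inj; have := congr1 val e.
Qed.

Theorem lower_bound (R : realType) r : (0 < r)%N -> exists M : matroid,
  [/\ golden_mean R M, AC4 M, SL4 M & AF4 M] /\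
  [/\ simple M, (rank M <= r)%N & #|M| = ('C(r + 3, 2) - 5)%N].
Proof.
case: r => // n _; exists (lmatroid R n).
have rep := @lmatroid_representable R n.
have gf4 : GF4_representable (lmatroid R n).
  have [F pF cF] := @pPrimePowerField 2 2 isT isT.
  by exists F; split=> //; apply/rep/at_least_card; rewrite cF.
split; first split.
- exact: lmatroid_golden_mean.
- split=> // [p pp|].
    have [F pF cF] := @pPrimePowerField p 2 pp isT.
    exists F; split=> //; apply/rep/at_least_card; rewrite cF.
    by rewrite -[4%N]/(2 ^ 2)%N leq_exp2r // prime_gt1.
  exists rat; split; first exact: pchar_num.
  apply: rep; exists (fun i : 'I_4 => (i : nat)%:R) => i j e; apply/val_inj/eqP.
  by rewrite -(eqr_nat rat); apply/eqP.
- by split=> //; exists 4%N; [exists 2%N, 2%N | ].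
- exact: rep.
split; [exact: lmatroid_simple | exact: rank_lmatroid |].
rewrite card_lmatroid addn3 !binS !bin0 !bin1 /=; lia.
Qed.

(** * The normal form of a template *)

Lemma span_finP (F : fieldType) (V : vectType F) (T : finType) (f : T -> V) v :
  v \in <<[seq f i | i : T]>>%VS -> exists k : T -> F, v = \sum_i k i *: f i.
Proof.
rewrite span_def big_image /= => /memv_sumP[vs vsP ->].
have h i : exists k : F, vs i = k *: f i by apply/vlineP/vsP.
exists (fun i => projT1 (boolp.cid (h i))); apply: eq_bigr => i _.
by case: (boolp.cid _).
Qed.

Lemma parallel_inv (F : fieldType) (V : vectType F) (u v : V) : parallel u v -> parallel v u.
Proof.
by case=> k k0 ->; exists k^-1; rewrite ?invr_eq0 // scalerA mulVf // scale1r.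
Qed.

(** * Normalizing the scalars of a frame twin *)

Section Normalize.
Variables (F : finFieldType) (F' : fieldType) (U : vectType F) (V' : vectType F').
Hypothesis cF : #|F| = 4%N.
Variables (S TT : finType) (s : S -> U) (t : TT -> U) (i0 : S).
Hypothesis s0 : s i0 = 0.
Local Notation W := (U * {ffun S -> F^o})%type.
Local Notation T := (S * S + S * S + TT)%type.
Variables (v : T -> W) (v' : T -> V').
Hypothesis tw : twin v v'.
Hypotheses (vS : forall b i, v (inl (inl (b, i))) = (s i, ev F b))
  (vE : forall b b', b != b' -> v (inl (inr (b, b'))) = (0, ev F b + ev F b'))
  (vT : forall z, v (inr z) = (t z, 0)).

Let O b : T := inl (inl (b, i0)).
Let Sp b i : T := inl (inl (b, i)).
Let Ed b b' : T := inl (inr (b, b')).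

Let vO b : v (O b) = (0, ev F b). Proof. by rewrite vS s0. Qed.

Lemma ev_sum (K : S -> F) b : (\sum_c K c *: ev F c) b = K b.
Proof.
rewrite sum_ffunE (bigD1 b) //= big1 ?addr0 => [|c cb].
  by rewrite !ffunE eqxx; apply: mulr1.
by rewrite !ffunE eq_sym (negbTE cb) scaler0.
Qed.

Lemma pairD (u u2 : U) (h h2 : {ffun S -> F^o}) : (u, h) + (u2, h2) = (u + u2, h + h2).
Proof. by []. Qed.

Lemma pairZ k (u : U) (h : {ffun S -> F^o}) : k *: (u, h) = (k *: u, k *: h).
Proof. by []. Qed.

Lemma free_O2 b b' : b != b' -> free [:: v (O b); v (O b')].
Proof.
move=> bb; apply/free2P => x y; rewrite !vO !pairZ pairD => -[_ /ffunP e].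
have := e b; have := e b'; rewrite !ffunE !eqxx (negbTE bb) eq_sym (negbTE bb).
by rewrite !scaler0 addr0 add0r /GRing.scale /= !mulr1 => -> ->.
Qed.

Lemma free_O3 b b' c : b != b' -> b != c -> b' != c -> free [:: v (O b); v (O b'); v (O c)].
Proof.
move=> bb bc b'c; apply/free3P => x y z; rewrite !vO !pairZ !pairD => -[_ /ffunP e].
have := e b; have := e b'; have := e c; rewrite !ffunE !eqxx.
rewrite (negbTE bb) (negbTE bc) (negbTE b'c) (eq_sym b' b) (eq_sym c b) (eq_sym c b').
rewrite (negbTE bb) (negbTE bc) (negbTE b'c) !scaler0 !addr0 !add0r /GRing.scale /= !mulr1.
by move=> -> -> ->.
Qed.

(** The scale of each [e b] is free, and the edge joining [b] to [i0] fixes it. *)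
Lemma exists_base : exists e : S -> V', (forall b, parallel (v' (O b)) (e b)) /\
  forall b, b != i0 -> parallel (v' (Ed i0 b)) (e b - e i0).
Proof.
have h b : exists e, parallel (v' (O b)) e /\
    (if b == i0 then e = v' (O i0) else parallel (v' (Ed i0 b)) (e - v' (O i0))).
  have [->|nb] := eqVneq b i0; first by exists (v' (O i0)); split=> //; exists 1; rewrite ?oner_neq0 ?scale1r.
  have o0 := oner_neq0 F.
  have [|x [y [x0 y0 e]]] := twin_line (c := Ed i0 b) tw (free_O2 nb) o0 o0.
    by rewrite !scale1r !vO vE 1?eq_sym // pairD addr0 addrC.
  exists (- (x / y) *: v' (O b)); split.
    apply: parallel_inv; exists (- (x / y)) => //.
    by rewrite oppr_eq0 mulf_neq0 ?invr_eq0.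
  exists (- y); first by rewrite oppr_eq0.
  rewrite e scalerBr scalerA mulrNN mulrCA mulfV // mulr1 scaleNr opprK.
  by [].
pose e b := projT1 (boolp.cid (h b)).
have eP b : parallel (v' (O b)) (e b) /\
    (if b == i0 then e b = v' (O i0) else parallel (v' (Ed i0 b)) (e b - v' (O i0))).
  by rewrite /e; case: (boolp.cid _).
exists e; split=> [b|b nb]; first exact: (eP b).1.
have := (eP b).2; rewrite (negbTE nb); have := (eP i0).2; rewrite eqxx => <-.
by [].
Qed.

(** Edges at [i0] are differences of the [e b], and triangles extend this to all edges. The spoke
    [i] at [b] lies on the line of the spoke [i] at [i0] and the edge from [i0] to [b]. Comparing
    [b] and [b'] along their edge shows that the ratio on this line does not depend on the vertex,
    and [f i] can be solved for. *)
Lemma exists_potential : exists (e : S -> V') (f : S -> V'),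
  forall b i, parallel (v' (Sp b i)) (f i + e b).
Proof.
have [e [eO eE]] := exists_base; exists e; have o0 := oner_neq0 F.
have fe2 b b' : b != b' -> forall x y, x *: e b + y *: e b' = 0 -> x = 0 /\ y = 0.
  move=> bb x y h; have [k k0 ek] := parallel_inv (eO b); have [l l0 el] := parallel_inv (eO b').
  have /free2P fr : free (map v' [:: O b; O b']) by rewrite -(twin_free _ tw) /= free_O2.
  have [] := fr (x * k) (y * l); first by rewrite -!scalerA -ek -el.
  by move=> /eqP + /eqP; rewrite !mulf_eq0 (negbTE k0) (negbTE l0) !orbF => /eqP -> /eqP ->.
have fe3 b b' c : b != b' -> b != c -> b' != c -> forall x y z,
    x *: e b + y *: e b' + z *: e c = 0 -> [/\ x = 0, y = 0 & z = 0].
  move=> bb bc b'c x y z h; have [k k0 ek] := parallel_inv (eO b).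
  have [l l0 el] := parallel_inv (eO b'); have [m m0 em] := parallel_inv (eO c).
  have /free3P fr : free (map v' [:: O b; O b'; O c]) by rewrite -(twin_free _ tw) /= free_O3.
  have [] := fr (x * k) (y * l) (z * m); first by rewrite -!scalerA -ek -el -em.
  move=> /eqP + /eqP + /eqP; rewrite !mulf_eq0 (negbTE k0) (negbTE l0) (negbTE m0) !orbF.
  by move=> /eqP -> /eqP -> /eqP ->.
have eEE b b' : b != b' -> b != i0 -> b' != i0 -> parallel (v' (Ed b b')) (e b - e b').
  move=> bb b0 b'0.
  have [|x [y [x0 y0 h1]]] := twin_line (c := Ed b b') tw (free_O2 bb) o0 o0.
    by rewrite !scale1r !vO vE // pairD addr0.
  have fr2 : free [:: v (Ed i0 b); v (Ed i0 b')].
    apply/free2P => p q; rewrite !vE 1?eq_sym // !pairZ pairD => -[_ /ffunP h].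
    have := h b; have := h b'; rewrite !ffunE !eqxx (eq_sym b' b) (negbTE bb).
    rewrite (negbTE b0) (negbTE b'0) !add0r !scaler0 addr0 add0r /GRing.scale /= !mulr1.
    by move=> -> ->.
  have [|z [w [z0 w0 h2]]] := twin_line (c := Ed b b') tw fr2 o0 o0.
    have i0b : i0 != b by rewrite eq_sym.
    have i0b' : i0 != b' by rewrite eq_sym.
    rewrite !scale1r (vE bb) (vE i0b) (vE i0b') pairD addr0; congr (_, _); apply/ffunP => c.
    by rewrite !ffunE; apply: subr0_eq; ring4 cF.
  have [k k0 ek] := eO b; have [l l0 el] := eO b'.
  have [m m0 em] := eE b b0; have [n n0 en] := eE b' b'0.
  have hh : (x * k - z * m) *: e b + (y * l - w * n) *: e b' + (z * m + w * n) *: e i0 = 0.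
    have E : x *: v' (O b) + y *: v' (O b') = z *: v' (Ed i0 b) + w *: v' (Ed i0 b').
      by rewrite -h1 -h2.
    move: E; rewrite ek el em en => E.
    have -> : (x * k - z * m) *: e b + (y * l - w * n) *: e b' + (z * m + w * n) *: e i0 =
       (x *: (k *: e b) + y *: (l *: e b')) -
         (z *: (m *: (e b - e i0)) + w *: (n *: (e b' - e i0))).
      by clear; move: (e b) (e b') (e i0) => v1 v2 v3; vlin; ring.
    by rewrite E subrr.
  have [E1 E2 E3] := fe3 b b' i0 bb b0 b'0 _ _ _ hh.
  exists (x * k); first by rewrite mulf_neq0.
  rewrite h1 ek el !scalerA; have -> : y * l = - (x * k).
    by rewrite (subr0_eq E1) (subr0_eq E2); apply/eqP; rewrite -addr_eq0 addrC; apply/eqP.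
  by vlin; ring.
have hi i : exists fi, forall b, parallel (v' (Sp b i)) (fi + e b).
  have [si|si] := eqVneq (s i) 0.
    exists 0 => b; rewrite add0r.
    have : v (Sp b i) \in <<map v [:: O b]>>%VS.
      by rewrite /= span_seq1 vS vO si memv_line.
    rewrite (twin_mem _ _ tw) /= span_seq1 => /vlineP[k ek].
    have [l l0 el] := eO b; exists (k * l); last by rewrite ek el scalerA.
    rewrite mulf_neq0 //; apply: contraTneq (oner_neq0 F) => k0.
    have : \dim <<map v [:: Sp b i]>> = 0%N.
      by rewrite (tw [:: Sp b i]) /= span_seq1 dim_vline ek k0 scale0r eqxx.
    rewrite /= span_seq1 dim_vline vS => /eqP; rewrite eqb0 negbK => /eqP[_ /ffunP/(_ b)].
    by rewrite !ffunE eqxx negbK => h; apply/eqP; exact: h.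
  pose Vi := v' (Sp i0 i).
  have fr2 b : b != i0 -> free [:: v (Sp i0 i); v (Ed i0 b)].
    move=> nb; apply/free2P => p q; rewrite vS vE 1?eq_sym // !pairZ pairD => -[h1 /ffunP h2].
    have p0 : p = 0.
      by move/eqP: h1; rewrite scaler0 addr0 scaler_eq0 (negbTE si) orbF => /eqP.
    split=> //; have := h2 b; rewrite p0 scale0r add0r !ffunE (negbTE nb) eqxx add0r.
    by rewrite /GRing.scale /= mulr1.
  have hb b : b != i0 -> exists x k, [/\ x != 0, k != 0 & v' (Sp b i) = x *: (Vi + k *: (e b - e i0))].
    move=> nb; have [|x [y [x0 y0 h1]]] := twin_line (c := Sp b i) tw (fr2 b nb) o0 o0.
      rewrite !scale1r !vS vE 1?eq_sym // pairD addr0; congr (_, _); apply/ffunP => c.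
      by rewrite !ffunE; apply: subr0_eq; ring4 cF.
    have [m m0 em] := eE b nb; exists x, (y * m / x); split=> //.
      by rewrite !mulf_neq0 ?invr_eq0.
    by rewrite h1 em [RHS]scalerDr !scalerA mulrCA mulfV // mulr1.
  have uni b b' x k x' k' : b != i0 -> b' != i0 -> x != 0 -> x' != 0 ->
      v' (Sp b i) = x *: (Vi + k *: (e b - e i0)) ->
      v' (Sp b' i) = x' *: (Vi + k' *: (e b' - e i0)) -> k = k'.
    move=> nb nb' x0 x'0 h1 h2.
    have [ebb|bb] := eqVneq b b'.
      have E : (x - x') *: Vi + (x * k - x' * k') *: (e b - e i0) = 0.
        by apply: subr0_eq; rewrite subr0 -(subrr (v' (Sp b i))) {1}h1 ebb h2; vlin; ring.
      have frV : free (map v' [:: Sp i0 i; Ed i0 b]) by rewrite -(twin_free _ tw) /= fr2.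
      have [m m0 em] := parallel_inv (eE b nb).
      have /free2P/(_ (x - x') ((x * k - x' * k') * m)) := frV.
      rewrite -scalerA -em => /(_ E) [/subr0_eq xx].
      move=> /eqP; rewrite mulf_eq0 (negbTE m0) orbF xx -mulrBr mulf_eq0 (negbTE x'0) /=.
      by move=> /eqP/subr0_eq.
    have fr2' : free [:: v (Sp b i); v (Sp b' i)].
      apply/free2P => p q; rewrite !vS !pairZ pairD => -[_ /ffunP h].
      have := h b; have := h b'; rewrite !ffunE !eqxx (eq_sym b' b) (negbTE bb).
      by rewrite !scaler0 addr0 add0r /GRing.scale /= !mulr1 => -> ->.
    have [|p [q [p0 q0 h3]]] := twin_line (c := Ed b b') tw fr2' o0 o0.
      rewrite !scale1r !vS vE // pairD; congr (_, _); apply/esym.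
      by rewrite -{1}(oppv_card4 cF (s i)) addNr.
    have [z z0 ez] := eEE b b' bb nb nb'.
    have fr4 : free (map v' [:: Sp i0 i; O b; O b'; O i0]).
      rewrite -(twin_free _ tw) /=; apply/free4P => a1 a2 a3 a4.
      rewrite vS !vO !pairZ !pairD => -[g1 /ffunP g2].
      have a10 : a1 = 0.
        by move/eqP: g1; rewrite !scaler0 !addr0 scaler_eq0 (negbTE si) orbF => /eqP.
      have := g2 b; have := g2 b'; have := g2 i0; rewrite !ffunE !eqxx a10.
      rewrite (negbTE nb) (negbTE nb') (negbTE bb) (eq_sym b' b) (eq_sym i0 b) (eq_sym i0 b').
      rewrite (negbTE nb) (negbTE nb') (negbTE bb) !scale0r !scaler0 !addr0 !add0r.
      by rewrite /GRing.scale /= !mulr1 => -> -> ->.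
    have [k1 k10 ek1] := parallel_inv (eO b); have [k2 k20 ek2] := parallel_inv (eO b').
    have [k3 k30 ek3] := parallel_inv (eO i0).
    have /free4P/(_ (p * x + q * x') ((p * x * k - z) * k1) ((q * x' * k' + z) * k2)
      (- (p * x * k + q * x' * k') * k3)) := fr4.
    case.
      rewrite -!scalerA -ek1 -ek2 -ek3 -/Vi; apply: subr0_eq; rewrite subr0.
      rewrite -(subrr (v' (Ed b b'))) {1}h3 h1 h2 ez; vlin; ring.
    move=> g1 /eqP g2 /eqP g3 _.
    move: g2 g3; rewrite !mulf_eq0 (negbTE k10) (negbTE k20) !orbF => /eqP/subr0_eq g2 /eqP g3.
    have px0 : p * x != 0 by rewrite mulf_neq0.
    apply: (mulfI px0); rewrite g2; have -> : p * x = - (q * x') by apply/eqP; rewrite -addr_eq0; apply/eqP.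
    by rewrite mulNr; apply/eqP; rewrite -addr_eq0 addrC; apply/eqP.
  have [k k0 kP] : exists2 k, k != 0 & forall b, b != i0 -> exists2 x, x != 0 &
      v' (Sp b i) = x *: (Vi + k *: (e b - e i0)).
    have [[b1 nb1]|none] := boolp.pselect (exists b1, b1 != i0).
      have [x1 [k1 [x10 k10 h1]]] := hb b1 nb1; exists k1 => // b nb.
      have [x [k [x0 k0 h]]] := hb b nb; exists x => //.
      by rewrite h (uni b b1 x k x1 k1).
    by exists 1; rewrite ?oner_neq0 // => b nb; exfalso; apply: none; exists b.
  exists (k^-1 *: Vi - e i0) => b; have [->|nb] := eqVneq b i0.
    exists k => //; rewrite subrK scalerA mulfV // scale1r //.
  have [x x0 h] := kP b nb; exists (x * k); first by rewrite mulf_neq0.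
  have eV : Vi = k *: (k^-1 *: Vi) by rewrite scalerA mulfV // scale1r.
  rewrite h; move: (k^-1 *: Vi) eV => V1 ->.
  by move: (e b) (e i0) => w1 w2; clear; vlin; ring.
exists (fun i => projT1 (boolp.cid (hi i))) => b i; by case: (boolp.cid _).
Qed.

(** There is one vertex for each index of [s]. Contracting the spoke [i] at vertex [i] identifies
    the unit vector of [i] with [- s i], so the spoke [i] at vertex [j] becomes [s i - s j]. The
    potential makes the same happen in the twin. *)
Lemma frame_normalize : exists (f : S -> V') (g : TT -> V'), twin
  (fun x : (S * S + TT)%type => match x with inl y => s y.1 - s y.2 | inr z => t z end)
  (fun x => match x with inl y => f y.1 - f y.2 | inr z => g z end).
Proof.
have [e [f fP]] := exists_potential.
have kP (x : T) : exists2 k : F', k != 0 & forall b i, x = Sp b i -> k *: v' x = f i + e b.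
  case: x => [[[b i]|y]|z]; last 2 first.
  - by exists 1; rewrite ?oner_neq0 // => b i.
  - by exists 1; rewrite ?oner_neq0 // => b i.
  have [k k0 ek] := parallel_inv (fP b i); exists k => // b' i' [<- <-].
  by rewrite ek.
pose k x := projT1 (boolp.cid2 (kP x)).
have k0 x : k x != 0 by rewrite /k; case: (boolp.cid2 _).
have kE b i : k (Sp b i) *: v' (Sp b i) = f i + e b.
  by rewrite /k; case: (boolp.cid2 _) => /= c _; apply.
have tw1 := twin_scale (fun _ => oner_neq0 F) k0 tw.
have [p [p' [kp kp' tw2]]] := twin_contract_ex [seq Sp i i | i <- enum S] tw1.
have pS i : p (s i, ev F i) = 0.
  apply/eqP; rewrite -memv_ker kp; apply: memv_span; rewrite -map_comp.
  by apply/mapP; exists i; rewrite ?mem_enum //= scale1r vS.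
have p'S i : p' (f i + e i) = 0.
  apply/eqP; rewrite -memv_ker kp'; apply: memv_span; rewrite -map_comp.
  by apply/mapP; exists i; rewrite ?mem_enum //= kE.
exists (fun i => p' (f i)), (fun z => p' (k (inr z) *: v' (inr z))).
have := twin_comp (fun x : (S * S + TT)%type => match x with inl y => Sp y.2 y.1 | inr z => inr z end) tw2.
pose g0 (w : U) : W := (w, 0).
have lg : linear g0.
  move=> c x y; have -> : c *: g0 x + g0 y = (c *: x + y, c *: (0 : {ffun S -> F^o}) + 0) by [].
  by rewrite scaler0 addr0.
pose G : {linear U -> W} := HB.pack g0 (GRing.isLinear.Build _ _ _ _ g0 lg).
pose h : 'Hom(U, W) := (p \o linfun G)%VF.
have hE w : h w = p (w, 0) by rewrite comp_lfunE lfunE.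
have hi : injective h.
  move=> x y e1; apply/eqP; rewrite -subr_eq0; have : h (x - y) = 0 by rewrite linearB /= e1 subrr.
  rewrite hE => /eqP; rewrite -memv_ker kp -map_comp.
  have -> : [seq ((fun x0 : T => 1 *: v x0) \o (fun i => Sp i i)) i | i <- enum S] =
     [seq (s i, ev F i) | i : S] by apply: eq_map => i; rewrite /= scale1r vS.
  move=> /span_finP[c]; rewrite /= => ec.
  have c0 i : c i = 0.
    have := congr1 (fun z : W => z.2 i) ec; rewrite (raddf_sum snd) /= ffunE => /esym.
    by rewrite ev_sum.
  have := congr1 fst ec; rewrite (raddf_sum fst) /= => ->.
  by apply/eqP; rewrite big1 // => i _; rewrite c0 scale0r.
move=> tw3 l; have := tw3 l.
have -> : [seq p (1 *: v (match x with inl y => Sp y.2 y.1 | inr z => inr z end)) | x : (S * S + TT)%type <- l]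
   = [seq h (match x with inl y => s y.1 - s y.2 | inr z => t z end) | x <- l].
  apply: eq_map => -[[i j]|z] /=; rewrite scale1r hE ?vT // vS.
  have -> : (s i, ev F j) = (s i - s j, 0) + (s j, ev F j) by rewrite pairD subrK add0r.
  by rewrite linearD /= pS addr0.
rewrite (dim_map_inj (fun x : (S * S + TT)%type => match x with inl y => s y.1 - s y.2 | inr z => t z end)) // => ->.
congr (\dim <<_>>); apply: eq_map => -[[i j]|z] //=.
rewrite kE; have -> : f i + e j = (f i - f j) + (f j + e j) by vlin; ring.
by rewrite linearD /= p'S addr0 linearB.
Qed.
End Normalize.

(** * Explicit matrices conforming to a template *)

Section Build.
Variables (F : fieldType) (Phi : frame_template F).
Local Notation X := (ft_X Phi).
Local Notation W := (ft_C Phi + (ft_Y0 Phi + ft_Y1 Phi))%type.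
Variables (B E : finType) (kind : E -> option (B * ft_Y1 Phi)) (fr : E -> B -> F).
Variables (la : E -> {ffun X -> F^o}) (de : B -> {ffun W -> F^o}).

(** The respecting matrix assembled from free data. [kind e = Some (b, y)] puts [e] in Z with unit
    vector at [b], and [y] is the column added to it in the conforming matrix. *)
Definition tbase (r : X + B) (c : W + E) : F :=
  match c, r with
  | inl w, inl x => ft_A1 Phi x w
  | inl w, inr b => de b w
  | inr e, inl x => if kind e is Some _ then 0 else la e x
  | inr e, inr b => if kind e is Some y then (b == y.1)%:R else fr e b
  end.

Definition tmx (r : X + B) (c : W + E) : F :=
  match c with
  | inl w => tbase r c
  | inr e => if kind e is Some y then tbase r c + tbase r (inl (inr (inr y.2)))
             else tbase r c
  end.

Lemma tmx_conforms : (forall e, kind e = None -> frame_column (ft_Gamma Phi) (fr e)) ->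
  (forall e, kind e = None -> la e \in ft_Lambda Phi) ->
  (forall b, de b \in ft_Delta Phi) -> conforms tmx.
Proof.
move=> hf hl hd; exists tbase, [set e | kind e != None]; split=> //.
- split; first by [].
  split=> [e|]; first by rewrite inE /=; case: (kind e) => // y _; split=> //; exists y.1.
  split=> [e|b]; last by rewrite (_ : [ffun w => _] = de b) //; apply/ffunP => w; rewrite ffunE.
  rewrite inE negbK => /eqP ke; have := hf e ke; have := hl e ke; rewrite /= ke => h1 h2.
  split=> //; rewrite (_ : [ffun x => _] = la e) //; by apply/ffunP => w; rewrite ffunE.
- by move=> b e; rewrite inE negbK /tmx => /eqP ->.
by move=> e; rewrite inE /tmx; case: (kind e) => // y _; exists y.2.
Qed.
End Build.

Section FrameColumns.
Variables (F : fieldType) (Gamma : {pred F}) (B : finType).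

(** The degenerate case [b = b'] encodes the unit vector, so that edges and unit columns share one
    family. *)
Definition fcol (b b' : B) (c : F) (x : B) : F :=
  (x == b)%:R + (if b == b' then 0 else c * (x == b')%:R).

Lemma frame_column0 : frame_column Gamma (fun _ : B => 0).
Proof.
split=> [|[b]]; last by rewrite eqxx.
by rewrite (_ : [set _ | _] = set0) ?cards0 //; apply/setP => b; rewrite !inE eqxx.
Qed.

Lemma frame_column_fcol b b' c : c = 0 \/ - c \in Gamma -> frame_column Gamma (fcol b b' c).
Proof.
move=> hc; split.
  apply: leq_trans (subset_leq_card (B := mem [set b; b']) _) _; last by rewrite cards2; case: eqP.
  apply/subsetP => x; rewrite !inE /fcol; case: (x =P b) => //= _; rewrite add0r.
  by case: ifP => _; rewrite ?eqxx //; case: (x == b'); rewrite // mulr0 eqxx.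
move=> _; exists b; rewrite /fcol eqxx; split.
  by case: ifP => [_|bb]; rewrite ?addr0 // bb mulr0 addr0.
move=> x xb; rewrite (negbTE xb) add0r; case: ifP => bb; first by rewrite eqxx.
case: (x =P b') => [_|_]; last by rewrite mulr0 eqxx.
rewrite mulr1 => c0; case: hc => [c0'|hc]; first by rewrite c0' eqxx in c0.
by exists (- c) => //; rewrite opprK.
Qed.
End FrameColumns.

(** * What characteristic 3 imposes on a template *)

Section Four.
Variables (F : finFieldType) (Phi : frame_template F).
Hypothesis cF : #|F| = 4%N.
Hypothesis HP : forall M, template_class Phi M -> char3_rep M.
Local Notation X := (ft_X Phi).
Local Notation W := (ft_C Phi + (ft_Y0 Phi + ft_Y1 Phi))%type.

Lemma Delta0 : 0 \in ft_Delta Phi. Proof. exact: (ft_Delta_group Phi).1. Qed.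
Lemma Lambda0 : 0 \in ft_Lambda Phi. Proof. exact: (ft_Lambda_group Phi).1. Qed.
Lemma Gamma1 : 1 \in ft_Gamma Phi. Proof. exact: (ft_Gamma_group Phi).1. Qed.
Lemma GammaM g : g \in ft_Gamma Phi -> g ^+ 2 \in ft_Gamma Phi.
Proof.
have [h1 hd] := ft_Gamma_group Phi; move=> hg.
have := hd _ _ hg (hd _ _ h1 hg); by rewrite mul1r invrK.
Qed.

Lemma Gamma_trivial g : g \in ft_Gamma Phi -> g = 1.
Proof.
move=> gG; apply/eqP/negPn/negP => g1.
have g0 : g != 0 by apply: contraNneq (ft_Gamma0 Phi) => <-.
pose E : finType := ('I_3 * 'I_3 * F)%type.
(* Columns are indexed by all scalars; an inadmissible coefficient is replaced by 0, so that every
   column is a frame column. *)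
pose ok c := (c == 0) || (- c \in ft_Gamma Phi).
pose fr (e : E) := fcol e.1.1 e.1.2 (if ok e.2 then e.2 else 0).
pose A := @tmx F Phi 'I_3 E (fun _ => None) fr (fun _ => 0) (fun _ => 0).
have cA : conforms A.
  apply: tmx_conforms => [e _|e _|b]; last first.
  - exact: Delta0.
  - exact: Lambda0.
  apply: frame_column_fcol; rewrite /ok; case: ifP => [/orP[/eqP ->|h]|_]; by [left | right | left].
have [p kp] := exists_ker (Cspan A).
have [F' [V' [v' [c3 tw]]]] := template_twin HP cA kp.
pose el i j c : ft_Y0 Phi + E := inr (i, j, c).
pose o0 : 'I_3 := inord 0; pose o1 : 'I_3 := inord 1; pose o2 : 'I_3 := inord 2.
have o01 : o0 != o1 by rewrite -val_eqE /= !inordK.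
have o02 : o0 != o2 by rewrite -val_eqE /= !inordK.
have o12 : o1 != o2 by rewrite -val_eqE /= !inordK.
have colE i j c b : ok c -> mxcol A (telt (el i j c)) (inr b) = fcol i j c b.
  by move=> oc; rewrite ffunE /A /= /fr /= oc.
have colX i j c x : mxcol A (telt (el i j c)) (inl x) = 0 by rewrite !ffunE /= ffunE.
have ok0 : ok 0 by rewrite /ok eqxx.
have ok1 : ok 1 by rewrite /ok oppr_card4 // Gamma1 orbT.
have okg : ok g by rewrite /ok oppr_card4 // gG orbT.
have okg1 : ok (g + 1) by rewrite /ok oppr_card4 // -square_card4 // GammaM // orbT.
have eq1 i j c : i != j -> ok c -> mxcol A (telt (el i j c)) =
    mxcol A (telt (el i i 0)) + c *: mxcol A (telt (el j j 0)).
  move=> ij oc; apply/ffunP => -[x|b].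
    rewrite colX; have := colX i i 0 x; have := colX j j 0 x.
    by move: (mxcol A _) (mxcol A _) => h1 h2 e1 e2; rewrite !ffunE e1 e2 scaler0 addr0.
  rewrite colE //; have := colE i i 0 b ok0; have := colE j j 0 b ok0.
  move: (mxcol A _) (mxcol A _) => h1 h2 e1 e2; rewrite !ffunE e1 e2 /fcol !eqxx (negbTE ij) !addr0.
  by [].
have par i j c : i != j -> ok c -> parallel (p (mxcol A (telt (el i j c))))
    (p (mxcol A (telt (el i i 0))) + c *: p (mxcol A (telt (el j j 0)))).
  by move=> ij oc; exists 1; rewrite ?oner_neq0 // scale1r eq1 // linearD linearZ.
have par1 i j : i != j -> parallel (p (mxcol A (telt (el i j 1))))
    (p (mxcol A (telt (el i i 0))) + p (mxcol A (telt (el j j 0)))).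
  by move=> ij; have := par i j 1 ij ok1; rewrite scale1r.
apply: (@dowling_absurd F F' _ _ cF c3 _ _ _ g (el o0 o0 0) (el o1 o1 0) (el o2 o2 0)
  (el o0 o1 1) (el o0 o1 g) (el o0 o1 (g + 1)) (el o1 o2 1) (el o1 o2 g)
  (el o0 o2 1) (el o0 o2 g) (el o0 o2 (g + 1)) tw) => //; try exact: par1; try exact: par.
apply/free3P => x y z; rewrite -!linearZ -!linearD => /eqP; rewrite -memv_ker kp => h.
have K b : (x *: mxcol A (telt (el o0 o0 0)) + y *: mxcol A (telt (el o1 o1 0)) +
   z *: mxcol A (telt (el o2 o2 0))) (inr b) = 0.
  have [k ->] := span_finP h; rewrite sum_ffunE big1 // => c _.
  by rewrite !ffunE /A /= ffunE scaler0.
have K' b : x * (b == o0)%:R + y * (b == o1)%:R + z * (b == o2)%:R = 0.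
  have := K b; have := colE o0 o0 0 b ok0; have := colE o1 o1 0 b ok0; have := colE o2 o2 0 b ok0.
  move: (mxcol A _) (mxcol A _) (mxcol A _) => h1 h2 h3 e1 e2 e3.
  by rewrite !ffunE e1 e2 e3 /fcol !eqxx !addr0.
have := K' o0; have := K' o1; have := K' o2; rewrite !eqxx (negbTE o01) (negbTE o02) (negbTE o12).
rewrite (eq_sym o2 o0) (eq_sym o2 o1) (eq_sym o1 o0) (negbTE o01) (negbTE o02) (negbTE o12) ?eqxx.
by rewrite !mulr0 !mulr1 !addr0 !add0r => -> -> ->.
Qed.

(** All sums of [l] and two unit vectors occur as columns and would form a Fano plane unless [l]
    becomes zero after the contraction of C. The resulting dependency is [u]: it gives [l] on the
    rows of X and 0 on all others. *)
Lemma Lambda_killed (l : {ffun X -> F^o}) : l \in ft_Lambda Phi ->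
  exists u : ft_C Phi -> F, (forall x, l x = \sum_c u c * ft_A1 Phi x (inl c)) /\
    forall d : {ffun W -> F^o}, d \in ft_Delta Phi -> \sum_c u c * d (inl c) = 0.
Proof.
move=> lL; apply: boolp.contrapT => nex.
(* One row for each element of Delta at once, so that a single [u] annihilates them all. *)
pose D : finType := {d : {ffun W -> F} | (d : {ffun W -> F^o}) \in ft_Delta Phi}.
pose B : finType := ('I_2 + D)%type.
pose E : finType := (bool * bool * bool)%type.
pose b0 : B := inl (inord 0); pose b1 : B := inl (inord 1).
have b01 : b0 != b1 by apply/eqP => -[/(congr1 val)] /=; rewrite !inordK.
pose fr (e : E) (x : B) : F := (e.1.2 && (x == b0))%:R + (e.2 && (x == b1))%:R.
pose de (b : B) : {ffun W -> F^o} := if b is inr d then val d else 0.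
pose A := @tmx F Phi B E (fun _ => None) fr (fun e => if e.1.1 then l else 0) de.
have cA : conforms A.
  apply: tmx_conforms => [[[a b] c] _|e _|[i|d]]; last first.
  - exact: (valP d).
  - exact: Delta0.
  - by case: ifP => _ //; exact: Lambda0.
  have m1 : - (1 : F) \in ft_Gamma Phi by rewrite oppr_card4 // Gamma1.
  rewrite /fr /=; case: b; case: c => /=.
  - rewrite (_ : (fun x => _) = fcol b0 b1 1); first by apply: frame_column_fcol; right.
    by apply: boolp.funext => x; rewrite /fcol (negbTE b01) mul1r.
  - rewrite (_ : (fun x => _) = fcol b0 b0 0); first by apply: frame_column_fcol; left.
    by apply: boolp.funext => x; rewrite /fcol eqxx.
  - rewrite (_ : (fun x => _) = fcol b1 b1 0); first by apply: frame_column_fcol; left.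
    by apply: boolp.funext => x; rewrite /fcol eqxx addr0 add0r.
  rewrite (_ : (fun x => _) = (fun _ => 0)); first exact: frame_column0.
  by apply: boolp.funext => x; rewrite addr0.
have [p kp] := exists_ker (Cspan A).
have [F' [V' [v' [c3 tw]]]] := template_twin HP cA kp.
pose el a b c : ft_Y0 Phi + E := inr (a, b, c).
pose col a b c := mxcol A (telt (el a b c)).
have colE a b c r : col a b c r = match r with inl x => if a then l x else 0
   | inr x => (b && (x == b0))%:R + (c && (x == b1))%:R end.
  by rewrite ffunE /A /=; case: r => x //; case: a => //; rewrite ffunE.
have colD a b c a' b' c' : ~~ (a && a') -> ~~ (b && b') -> ~~ (c && c') ->
    p (col (a || a') (b || b') (c || c')) = p (col a b c) + p (col a' b' c').
  move=> ha hb hc; rewrite -linearD; congr (p _); apply/ffunP => r.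
  have := colE a b c r; have := colE a' b' c' r; have := colE (a || a') (b || b') (c || c') r.
  move: (col _ _ _) (col _ _ _) (col _ _ _) => h1 h2 h3 -> e2 e3; rewrite [RHS]ffunE e2 e3.
  case: r {e2 e3} => x; first by case: a a' ha => [] [] //= _; rewrite ?addr0 ?add0r.
  by case: b b' hb => [] [] //= _; case: c c' hc => [] [] //= _; rewrite ?addr0 ?add0r //;
    rewrite ?(addrC (x == b1)%:R).
apply: (@fano_absurd F F' _ _ _ _ _ (el true false false) (el false true false) (el false false true)
  (el true true false) (el false true true) (el true false true) (el true true true) tw
  (pchar2_char3 c3) (pchar_card4 cF)).
- apply/free3P => x y z; rewrite -!linearZ -!linearD => /eqP; rewrite -memv_ker kp => h.
  have [k ek] := span_finP h.
  have K r : x * col true false false r + y * col false true false r + z * col false false true r =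
     \sum_c k c * A r (inl (inl c)).
    have := congr1 (fun f : {ffun X + B -> F^o} => f r) ek.
    have lhs (h1 h2 h3 : {ffun X + B -> F^o}) : (x *: h1 + y *: h2 + z *: h3) r = x * h1 r + y * h2 r + z * h3 r.
      by rewrite !ffunE.
    rewrite /= lhs => ->; rewrite sum_ffunE.
    by apply: eq_bigr => c _; rewrite !ffunE.
  have z0 : z = 0.
    have := K (inr b1); rewrite !colE /= eqxx eq_sym (negbTE b01) big1 => [|c _].
      by rewrite !addr0 !mulr0 !add0r mulr1.
    by rewrite ffunE mulr0.
  have y0 : y = 0.
    have := K (inr b0); rewrite !colE /= eqxx (negbTE b01) big1 => [|c _].
      by rewrite !addr0 !mulr0 !add0r mulr1 addr0.
    by rewrite ffunE mulr0.
  split=> //; apply/eqP; apply: contraT => x0; case: nex.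
  exists (fun c => x^-1 * k c); split=> [a|d dD].
    have := K (inl a); rewrite !colE y0 z0 !mul0r !addr0 => e.
    rewrite -[LHS](mulKf x0) e mulr_sumr; apply: eq_bigr => c _; by rewrite mulrA.
  have := K (inr (inr (Sub d dD))); rewrite !colE y0 z0 /= !mul0r !addr0 mulr0 => e.
  under eq_bigr do rewrite -mulrA; rewrite -mulr_sumr (_ : \sum_i _ = 0) ?mulr0 //.
- exact: (@colD true false false false true false).
- exact: (@colD false true false false false true).
- exact: (@colD true false false false false true).
rewrite -(@colD true false false false true false) //.
exact: (@colD true true false false false true).
Qed.

(** Four rows carry [d]. After contraction of C, Y0 and Y1, the combination of their columns with
    coefficients [w] says that a nonzero multiple of the sum of four unit vectors vanishes. The
    fourth unit vector is then the sum of the other three, and the edges among these complete a Fano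
    plane. *)
Lemma Delta_dot (d w : {ffun W -> F^o}) : d \in ft_Delta Phi ->
  (forall x, \sum_c ft_A1 Phi x c * w c = 0) -> \sum_c d c * w c = 0.
Proof.
move=> dD hw; apply/eqP/negPn/negP => dw.
(* Y1 is deleted from the matroid, so its columns are reached indirectly: with an extra row for [y],
   they are differences of a column of Z and the unit column of that row. *)
pose B : finType := ('I_4 + ft_Y1 Phi)%type.
pose E : finType := ('I_4 * 'I_4 + ft_Y1 Phi * bool)%type.
pose kind (e : E) : option (B * ft_Y1 Phi) := if e is inr (y, true) then Some (inr y, y) else None.
pose fr (e : E) : B -> F := match e with inl (i, j) => fcol (inl i) (inl j) 1
   | inr (y, _) => fcol (inr y) (inr y) 0 end.
pose de (b : B) : {ffun W -> F^o} := if b is inl _ then d else 0.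
pose A := @tmx F Phi B E kind fr (fun _ => 0) de.
have m1 : - (1 : F) \in ft_Gamma Phi by rewrite oppr_card4 // Gamma1.
have cA : conforms A.
  apply: tmx_conforms => [[[i j]|[y t]] _|e _|[i|y]].
  - by apply: frame_column_fcol; right.
  - by apply: frame_column_fcol; left.
  - exact: Lambda0.
  - exact: dD.
  exact: Delta0.
have [p kp] := exists_ker (Cspan A).
have [F' [V' [v' [c3 tw]]]] := template_twin HP cA kp.
pose Z : seq (ft_Y0 Phi + E) := [seq inl y | y <- enum (ft_Y0 Phi)] ++ [seq inr (inr z) | z <- enum {: ft_Y1 Phi * bool}].
have [p2 [p2' [kp2 _ tw2]]] := twin_contract_ex Z tw.
pose P := (p2 \o p)%VF.
have PE f : p2 (p f) = P f by rewrite comp_lfunE.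
have PZ z : z \in Z -> P (mxcol A (telt z)) = 0.
  move=> zZ; rewrite -PE; apply/eqP; rewrite -memv_ker kp2; apply: memv_span.
  by apply/mapP; exists z.
have PY1 y b : P (mxcol A (inr (inr (y, b)))) = 0.
  apply: (PZ (inr (inr (y, b)))); rewrite mem_cat; apply/orP; right.
  by apply/mapP; exists (y, b); rewrite ?mem_enum.
have Pw c : P (mxcol A (inl c)) = 0.
  case: c => [c|[y|y]].
  - rewrite -PE (_ : p _ = 0) ?linear0 //; apply/eqP; rewrite -memv_ker kp.
    by apply: memv_span; apply: image_f.
  - apply: (PZ (inl y)); rewrite mem_cat; apply/orP; left.
    by apply/mapP; exists y; rewrite ?mem_enum.
  have -> : mxcol A (inl (inr (inr y))) =
      mxcol A (inr (inr (y, true))) - mxcol A (inr (inr (y, false))).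
    apply/ffunP => r; rewrite !ffunE /A /=; case: r => [x|b] /=.
      by rewrite ffunE add0r subr0.
    by rewrite /fcol eqxx addr0 addrC addKr.
  by rewrite linearB /= !PY1 subrr.
pose el i j : ft_Y0 Phi + E := inr (inl (i, j)).
pose col i j := mxcol A (telt (el i j)).
have colE i j r : col i j r = match r with inl x => 0 | inr b => fcol (inl i) (inl j) 1 b end.
  by rewrite ffunE /A /=; case: r => x //=; rewrite ffunE.
have colD i j : i != j -> P (col i j) = P (col i i) + P (col j j).
  move=> ij; rewrite -linearD; congr (P _); apply/ffunP => r.
  have := colE i j r; have := colE i i r; have := colE j j r.
  move: (col _ _) (col _ _) (col _ _) => h1 h2 h3 e1 e2 ->; rewrite [RHS]ffunE e1 e2.
  case: r {e1 e2} => [x|b]; first by rewrite addr0.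
  rewrite /fcol !eqxx !addr0 mul1r; case: ifP => // /eqP[e]; by rewrite e eqxx in ij.
pose L0 (g : {ffun X + B -> F^o}) : {ffun 'I_4 -> F^o} :=
  [ffun i => g (inr (inl i)) - g (inr (inl (inord 3)))].
have lL : linear L0.
  by move=> k f g; apply/ffunP => i; rewrite !ffunE scalerBr opprD addrACA.
pose LL : {linear {ffun X + B -> F^o} -> {ffun 'I_4 -> F^o}} :=
  HB.pack L0 (GRing.isLinear.Build _ _ _ _ L0 lL).
pose K := lker (linfun LL).
have KP (g : {ffun X + B -> F^o}) : (forall i j, g (inr (inl i)) = g (inr (inl j))) -> g \in K.
  by move=> h; rewrite memv_ker lfunE; apply/eqP/ffunP => i; rewrite !ffunE (h _ (inord 3)) subrr.
have kP (g : {ffun X + B -> F^o}) i : P g = 0 -> g (inr (inl i)) = g (inr (inl (inord 3))).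
  rewrite -PE => /eqP; rewrite -memv_ker kp2.
  rewrite (map_comp p (fun x => mxcol A (telt x))) -limg_span => /memv_imgP[h hZ ph].
  suff : g \in K.
    rewrite memv_ker lfunE => /eqP/ffunP/(_ i); rewrite !ffunE => /eqP.
    by rewrite subr_eq0 => /eqP.
  have -> : g = (g - h) + h by rewrite subrK.
  apply: memvD.
    have : g - h \in lker p by rewrite memv_ker linearB /= ph subrr.
    rewrite kp; apply/subvP/span_subvP => _ /imageP[c _ ->]; apply: KP => a b.
    by rewrite !ffunE.
  move: hZ; apply/subvP/span_subvP => _ /mapP[z zZ ->].
  move: zZ; rewrite mem_cat => /orP[/mapP[y _ ->]|/mapP[[y t] _ ->]]; apply: KP => a b; rewrite !ffunE //.
  by rewrite /A /= /tmx /tbase; case: t => /=.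
pose o i : 'I_4 := inord i.
have oo i j : (i < 4)%N -> (j < 4)%N -> (o i == o j) = (i == j).
  by move=> hi hj; rewrite -val_eqE /= !inordK.
have P3 : P (col (o 3) (o 3)) = P (col (o 0) (o 0)) + P (col (o 1) (o 1)) + P (col (o 2) (o 2)).
  have h0 : P (\sum_c w c *: mxcol A (inl c)) = 0.
    by rewrite linear_sum big1 // => c _; rewrite linearZ /= Pw scaler0.
  have e : \sum_c w c *: mxcol A (inl c) = (\sum_c d c * w c) *:
     (col (o 3) (o 3) + (col (o 0) (o 0) + col (o 1) (o 1) + col (o 2) (o 2))).
    apply/ffunP => r; rewrite sum_ffunE.
    have := colE (o 0) (o 0) r; have := colE (o 1) (o 1) r; have := colE (o 2) (o 2) r; have := colE (o 3) (o 3) r.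
    move: (col _ _) (col _ _) (col _ _) (col _ _) => h1 h2 h3 h4 e1 e2 e3 e4.
    have lhs (g1 g2 g3 g4 : {ffun X + B -> F^o}) (k : F) :
      (k *: (g1 + (g2 + g3 + g4))) r = k * (g1 r + (g2 r + g3 r + g4 r)) by rewrite !ffunE.
    rewrite lhs e1 e2 e3 e4; case: r {lhs e1 e2 e3 e4} => [x|b].
      rewrite !addr0 mulr0 -[RHS](hw x); apply: eq_bigr => c _; rewrite !ffunE /A /=.
      exact: mulrC.
    rewrite /fcol !eqxx !addr0; case: b => [i|y]; last first.
      by rewrite !addr0 mulr0 big1 // => c _; rewrite !ffunE /A /= ffunE scaler0.
    have -> : (inl i == inl (o 3) :> B)%:R + ((inl i == inl (o 0) :> B)%:R + (inl i == inl (o 1) :> B)%:R +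
         (inl i == inl (o 2) :> B)%:R) = 1 :> F.
      rewrite -![inl _ == inl _ :> B]/(_ == _ :> 'I_4) -!val_eqE /= !inordK //.
      by case: i => -[|[|[|[|]]]] //= _; rewrite ?addr0 ?add0r.
    rewrite mulr1; apply: eq_bigr => c _; rewrite !ffunE /A /=; exact: mulrC.
  move: h0; rewrite e linearZ /= => /eqP; rewrite scaler_eq0 (negbTE dw) /= linearD addr_eq0 => /eqP ->.
  by rewrite oppv_card4 // !linearD.
apply: (@fano_absurd F F' _ _ _ _ _ (el (o 0) (o 0)) (el (o 1) (o 1)) (el (o 2) (o 2))
  (el (o 0) (o 1)) (el (o 1) (o 2)) (el (o 0) (o 2)) (el (o 3) (o 3)) tw2
  (pchar2_char3 c3) (pchar_card4 cF)); rewrite !PE; try by apply: colD; rewrite oo.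
- apply/free3P => x y z; rewrite -!linearZ -!linearD => h.
  have K' i : x * (i == o 0)%:R + y * (i == o 1)%:R + z * (i == o 2)%:R = 0.
    have := kP _ i h; have := colE (o 0) (o 0); have := colE (o 1) (o 1); have := colE (o 2) (o 2).
    rewrite /col; move: (mxcol A _) (mxcol A _) (mxcol A _) => h1 h2 h3 e1 e2 e3.
    rewrite !ffunE !e1 !e2 !e3 /fcol !eqxx !addr0.
    rewrite -![inl _ == inl _ :> B]/(_ == _ :> 'I_4) -/(o 3) !oo // => ->.
    by rewrite !scaler0 !addr0.
  have := K' (o 0); have := K' (o 1); have := K' (o 2); rewrite !oo // !mulr0 !mulr1 !addr0 !add0r.
  by move=> -> -> ->.
exact: P3.
Qed.

(** By [Delta_dot], [d] is orthogonal to everything orthogonal to the rows of A_1, so it lies in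
    their span by double orthogonality. *)
Lemma Delta_rowspace (d : {ffun W -> F^o}) : d \in ft_Delta Phi ->
  exists m : X -> F, forall c, d c = \sum_x m x * ft_A1 Phi x c.
Proof.
move=> dD.
have : d \in <<[seq mxrow (ft_A1 Phi) x | x : X]>>%VS.
  rewrite -[<<_>>%VS]orthv_orthv; apply/orthvP => w /orthvP hw.
  rewrite /dotf; under eq_bigr do rewrite mulrC; apply: (Delta_dot dD) => x.
  have := hw (mxrow (ft_A1 Phi) x); rewrite /dotf; under eq_bigr do rewrite ffunE.
  by apply; apply/memv_span/image_f.
move=> /span_finP[m ->]; exists m => c; rewrite sum_ffunE; apply: eq_bigr => x _.
by rewrite !ffunE.
Qed.

Lemma frame_columnP (B : finType) (v : B -> F) : frame_column (ft_Gamma Phi) v ->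
  [\/ [ffun b => v b] = 0, exists b, [ffun b => v b] = ev F b
    | exists b b', b != b' /\ [ffun b => v b] = ev F b + ev F b'].
Proof.
case=> cv hv; have [ex|nex] := boolp.pselect (exists b, v b != 0); last first.
  constructor 1; apply/ffunP => b; rewrite !ffunE; apply/eqP; apply: contraT => h.
  by case: nex; exists b.
have [b [vb hb]] := hv ex.
have hb1 b' : b' != b -> v b' != 0 -> v b' = 1.
  by move=> n1 n2; have [g /Gamma_trivial -> ->] := hb b' n1 n2; rewrite oppr_card4.
have [[b' [nb n0]]|none] := boolp.pselect (exists b', b' != b /\ v b' != 0).
  constructor 3; exists b, b'; split; first by rewrite eq_sym.
  have sub : [set b; b'] \subset [set x | v x != 0].
    by apply/subsetP => x; rewrite !inE => /orP[] /eqP ->; rewrite // vb oner_neq0.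
  have /eqP es : [set b; b'] == [set x | v x != 0].
    by rewrite eqEcard sub cards2 (eq_sym b) nb.
  apply/ffunP => x; rewrite !ffunE; have [->|xb] := eqVneq x b.
    by rewrite eq_sym (negbTE nb) vb addr0.
  have [->|xb'] := eqVneq x b'; first by rewrite add0r hb1.
  rewrite addr0; apply/eqP; apply: contraT => h.
  have : x \in [set x | v x != 0] by rewrite inE.
  by rewrite -es !inE (negbTE xb) (negbTE xb').
constructor 2; exists b; apply/ffunP => x; rewrite !ffunE; have [->//|xb] := eqVneq x b.
by apply/eqP; apply: contraT => h; case: none; exists x.
Qed.

Section NormalForm.
Local Notation U := {ffun X -> F^o}.
Variable q : 'End(U).
Hypothesis kq : lker q = <<[seq mxcol (ft_A1 Phi) (inl c) | c : ft_C Phi]>>%VS.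
Variables (B E : finType) (m : B -> X -> F).

(** Row operations with the coefficients [m] clear the part in Delta of the rows in [B], and [q]
    kills the columns of C. The kernel is then exactly the span of the contracted columns. *)
Definition nform_fun (f : {ffun X + B -> F^o}) : U * {ffun B -> F^o} :=
  (q [ffun x => f (inl x)], [ffun b => f (inr b) - \sum_x m b x * f (inl x)]).

Lemma nform_linear : linear nform_fun.
Proof.
move=> k f g; rewrite /nform_fun.
have -> : [ffun x => (k *: f + g) (inl x)] = k *: [ffun x => f (inl x)] + [ffun x => g (inl x)] :> U.
  by apply/ffunP => x; rewrite !ffunE.
rewrite linearP; congr (_, _); apply/ffunP => b; rewrite !ffunE.
have -> : \sum_x m b x * (k *: f + g) (inl x) =
   k * (\sum_x m b x * f (inl x)) + \sum_x m b x * g (inl x).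
  rewrite mulr_sumr -big_split; apply: eq_bigr => x _; rewrite !ffunE mulrDr; congr (_ + _).
  exact: mulrCA.
by rewrite /GRing.scale /=; ring.
Qed.

HB.instance Definition _ := GRing.isLinear.Build F {ffun X + B -> F^o} (U * {ffun B -> F^o})%type _
  nform_fun nform_linear.
Definition nform : 'Hom({ffun X + B -> F^o}, (U * {ffun B -> F^o})%type) := linfun nform_fun.

Lemma nformE f : nform f = nform_fun f. Proof. by rewrite lfunE. Qed.

Variable A : X + B -> W + E -> F.
Hypotheses (AX : forall x w, A (inl x) (inl w) = ft_A1 Phi x w)
  (AB : forall b w, A (inr b) (inl w) = \sum_x m b x * ft_A1 Phi x w).

Lemma nform_W w : nform (mxcol A (inl w)) = (q (mxcol (ft_A1 Phi) w), 0).
Proof.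
rewrite nformE; congr (_, _); first by congr (q _); apply/ffunP => x; rewrite !ffunE AX.
apply/ffunP => b; rewrite !ffunE AB; apply/eqP; rewrite subr_eq0; apply/eqP.
by apply: eq_bigr => x _; rewrite !ffunE AX.
Qed.

Lemma lker_nform : lker nform = Cspan A.
Proof.
apply/eqP; rewrite eqEsubv; apply/andP; split; last first.
  apply/span_subvP => _ /imageP[c _ ->]; rewrite memv_ker nform_W.
  have : mxcol (ft_A1 Phi) (inl c) \in lker q by rewrite kq; apply/memv_span/image_f.
  by rewrite memv_ker => /eqP ->.
apply/subvP => f; rewrite memv_ker nformE => /eqP[f1 f2].
have : [ffun x => f (inl x)] \in lker q by rewrite memv_ker f1.
rewrite kq => /span_finP[k ek].
have e1 x : f (inl x) = \sum_c k c * ft_A1 Phi x (inl c).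
  move/ffunP/(_ x): ek; rewrite ffunE sum_ffunE => ->; apply: eq_bigr => c _; by rewrite !ffunE.
suff -> : f = \sum_c k c *: mxcol A (inl (inl c)).
  by apply: memv_suml => c _; apply/memvZ/memv_span/image_f.
apply/ffunP => -[x|b]; rewrite sum_ffunE.
  by rewrite e1; apply: eq_bigr => c _; rewrite !ffunE AX.
have := congr1 (fun h : {ffun B -> F^o} => h b) f2; rewrite !ffunE => /eqP; rewrite subr_eq0 => /eqP ->.
under eq_bigr do rewrite e1 mulr_sumr; rewrite exchange_big; apply: eq_bigr => c _.
rewrite !ffunE AB /GRing.scale /= mulr_sumr; apply: eq_bigr => x _; exact: mulrCA.
Qed.
End NormalForm.

(** The matrix built here has a vertex for each spoke, every spoke at every vertex, and all edges,
    as [frame_normalize] requires. The index [None] is the bare unit vector, whose component in X is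
    0. *)
Lemma star_twin : exists q : 'End({ffun X -> F^o}),
  lker q = <<[seq mxcol (ft_A1 Phi) (inl c) | c : ft_C Phi]>>%VS /\
  let s (i : option (ft_Y1 Phi)) := if i is Some y then q (mxcol (ft_A1 Phi) (inr (inr y))) else 0 in
  let t z := q (mxcol (ft_A1 Phi) (inr (inl z))) in
  exists (F' : fieldType) (V' : vectType F') (f : option (ft_Y1 Phi) -> V') (g : ft_Y0 Phi -> V'),
  3 \in [pchar F'] /\ twin
    (fun x : (option (ft_Y1 Phi) * option (ft_Y1 Phi) + ft_Y0 Phi)%type =>
       match x with inl y => s y.1 - s y.2 | inr z => t z end)
    (fun x => match x with inl y => f y.1 - f y.2 | inr z => g z end).
Proof.
have [q kq] := exists_ker <<[seq mxcol (ft_A1 Phi) (inl c) | c : ft_C Phi]>>%VS.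
exists q; split=> // s t.
pose S : finType := option (ft_Y1 Phi).
pose E : finType := (S * S + S * S)%type.
pose kind (e : E) : option (S * ft_Y1 Phi) := if e is inl (b, Some y) then Some (b, y) else None.
pose fr (e : E) : S -> F := match e with inl (b, _) => fcol b b 0 | inr (b, b') => fcol b b' 1 end.
pose A := @tmx F Phi S E kind fr (fun _ => 0) (fun _ => 0).
have m1 : - (1 : F) \in ft_Gamma Phi by rewrite oppr_card4 // Gamma1.
have cA : conforms A.
  apply: tmx_conforms => [[[b i]|[b b']] _|e _|b]; last first.
  - exact: Delta0.
  - exact: Lambda0.
  - by apply: frame_column_fcol; right.
  by apply: frame_column_fcol; left.
pose m (b : S) (x : X) : F := 0.
have AX x w : A (inl x) (inl w) = ft_A1 Phi x w by [].
have AB b w : A (inr b) (inl w) = \sum_x m b x * ft_A1 Phi x w.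
  by rewrite big1 /A /= ?ffunE // => x _; rewrite mul0r.
have kp := lker_nform kq AX AB.
have [F' [V' [v' [c3 tw]]]] := template_twin HP cA kp.
have tw1 := twin_comp (fun x : (S * S + S * S + ft_Y0 Phi)%type =>
   match x with inl e => inr e | inr z => inl z end) tw.
have nX (f : {ffun X + S -> F^o}) : (forall x, f (inl x) = 0) -> nform q m f = (0, [ffun b => f (inr b)]).
  move=> fX; rewrite nformE; congr (_, _).
    by rewrite (_ : [ffun x => _] = 0) ?linear0 //; apply/ffunP => x; rewrite !ffunE fX.
  by apply/ffunP => b; rewrite !ffunE big1 ?subr0 // => x _; rewrite mul0r.
have [f [g tw2]] : exists (f : S -> V') (g : ft_Y0 Phi -> V'), twin
    (fun x : (S * S + ft_Y0 Phi)%type => match x with inl y => s y.1 - s y.2 | inr z => t z end)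
    (fun x => match x with inl y => f y.1 - f y.2 | inr z => g z end).
  apply: (frame_normalize cF (i0 := None) _ tw1) => //.
  - move=> b [y|] /=; last first.
      rewrite nX => [|x]; last by rewrite !ffunE /= ffunE.
      congr (_, _); apply/ffunP => x; by rewrite !ffunE /= /fcol eqxx addr0.
    have -> : mxcol A (inr (inl (b, Some y))) =
       mxcol A (inr (inl (b, None))) + mxcol A (inl (inr (inr y))).
      apply/ffunP => -[x|x]; rewrite !ffunE /A /= ?ffunE //.
      by rewrite /fcol eqxx !addr0.
    rewrite linearD /= (nform_W q AX AB) nX => [|x]; last by rewrite !ffunE /= ffunE.
    rewrite -[LHS]/(0 + _, _ + 0) add0r addr0; congr (_, _); apply/ffunP => x.
    by rewrite !ffunE /= /fcol eqxx addr0.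
  - move=> b b' bb /=; rewrite nX => [|x]; last by rewrite !ffunE /= ffunE.
    by congr (_, _); apply/ffunP => x; rewrite !ffunE /= /fcol (negbTE bb) mul1r.
  by move=> z /=; rewrite (nform_W q AX AB).
by exists F', V', f, g.
Qed.

Lemma template_bound : exists R0 : nat, forall M, template_class Phi M ->
  simple (underlying M) -> (R0 <= rank (underlying M))%N ->
  (2 * #|M| + 4 <= rank (underlying M) * rank (underlying M) + 5 * rank (underlying M))%N.
Proof.
have [q [kq hs]] := star_twin; cbv zeta in hs; case: hs => F' [V' [f [g [c3 tw]]]].
set s := (fun i : option (ft_Y1 Phi) => if i is Some y then q (mxcol (ft_A1 Phi) (inr (inr y))) else 0).
set t := (fun z => q (mxcol (ft_A1 Phi) (inr (inl z)))).
exists (#|ft_Y0 Phi| + 6 + \dim {: {ffun X -> F^o}})%N => M [B [E [A [cA [h [c [hb c0 hM]]]]]]] sM.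
set N : rmatroid F := rdelete _ in h hb hM.
have rkM := rk_risom hb c0 hM.
have eN : N = tmatroid A by [].
have hT : h @: setT = setT.
  by apply/setP => y; rewrite !inE; apply/imsetP; case: hb => h' _ hk; exists (h' y).
have rM : rank (underlying M) = rank (underlying (tmatroid A)) by rewrite /rank rkM hT.
have cM : #|M| = #|{: ft_Y0 Phi + E}| by rewrite -(card_tmatroid A) (bij_eq_card hb).
have sN : simple (underlying (tmatroid A)).
  move=> Y cY; case: (hb) => h' hk hk'.
  have eY : Y = h @: (h' @: Y).
    by rewrite -imset_comp -[LHS]imset_id; apply: eq_imset => y; rewrite /= hk'.
  have cY' : #|h' @: Y| = #|Y| by rewrite card_imset //; apply: can_inj hk'.
  have := sM (h' @: Y); rewrite /indep rkM -eY cY' => /(_ cY).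
  by [].
case: (cA) => A' [Z [[rX [rZ [rF rD]]] eW eF eZ]].
have mP b : exists m : X -> F, forall c, A (inr b) (inl c) = \sum_x m x * ft_A1 Phi x c.
  have [m hm] := Delta_rowspace (rD b); exists m => w.
  by rewrite eW -hm ffunE.
pose m b := projT1 (boolp.cid (mP b)).
have AB b w : A (inr b) (inl w) = \sum_x m b x * ft_A1 Phi x w.
  by rewrite /m; case: (boolp.cid _).
have AX x w : A (inl x) (inl w) = ft_A1 Phi x w by rewrite eW rX.
have kp := lker_nform kq AX AB.
pose u x := nform q m (mxcol A (telt x)).
have dimE l : @rk (underlying (tmatroid A)) [set temb A x | x in l] = \dim <<map u l>>.
  exact: (dim_tmatroid l kp).
have fr l : uniq l -> (size l <= 2)%N -> free (map u l).
  move=> ul sl; rewrite /free -dimE size_map.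
  have cl : #|[set temb A x | x in l]| = size l.
    by rewrite card_imset; [apply/card_uniqP | exact: temb_inj].
  by have := sN [set temb A x | x in l]; rewrite /indep cl; apply.
have u0 x : u x != 0 by have := fr [:: x] isT isT; rewrite /= seq1_free.
have up x y : u y \in <[u x]>%VS -> x = y.
  move=> h1; apply/eqP; apply: contraT => xy.
  have := fr [:: y; x]; rewrite /= inE eq_sym xy => /(_ isT isT).
  by rewrite free_cons span_seq1 h1.
have dimu : \dim <<map u (enum {: ft_Y0 Phi + E})>> = rank (underlying M).
  rewrite rM -dimE /rank; congr rk; apply/setP => e; rewrite !inE; apply/imsetP.
  by have [x ->] := temb_surj e; exists x; rewrite // mem_enum.
pose S : finType := option (ft_Y1 Phi).
(* Different elements of Y1 may give the same value of [s]; the count needs an injective family, so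
   one index is chosen for each value. *)
pose rep (i : S) : S := odflt i [pick j | s j == s i].
have repP i : s (rep i) = s i.
  by rewrite /rep; case: pickP => [j /eqP //|/(_ i)]; rewrite eqxx.
have rep_eq i j : s i = s j -> rep i = rep j.
  move=> e; rewrite /rep (eq_pick (Q := fun k => s k == s j)); last by move=> k /=; rewrite e.
  by case: pickP => // /(_ j); rewrite eqxx.
have repK i : rep (rep i) == rep i by rewrite (rep_eq (rep i) i) ?repP.
pose S1 : finType := {i : S | rep i == i}.
pose r1 i : S1 := exist _ (rep i) (repK i).
have r1P i : s (val (r1 i)) = s i by rewrite /= repP.
have s1i : injective (fun i : S1 => s (val i)).
  by move=> i j /rep_eq; rewrite (eqP (valP i)) (eqP (valP j)) => /val_inj.
have tw1 : twin
  (fun x : (S1 * S1 + ft_Y0 Phi)%type => match x with inl y => s (val y.1) - s (val y.2) | inr z => t z end)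
  (fun x => match x with inl y => f (val y.1) - f (val y.2) | inr z => g z end).
  have := twin_comp (fun x : (S1 * S1 + ft_Y0 Phi)%type => match x with inl y => inl (val y.1, val y.2) | inr z => inr z end) tw.
  by apply: eq_twin => -[].
have uf x : frame_form (fun i : S1 => s (val i)) t (u x).
  case: x => [z|e]; first by constructor 1; exists z; rewrite /u /= (nform_W q AX AB).
  have [eZ'|eZ'] := boolP (e \in Z).
    have [rX0 [b0 rB]] := rZ e eZ'; have [y ey] := eZ e eZ'.
    constructor 2; exists b0, (r1 (Some y)); rewrite r1P /u /=.
    pose h0 : {ffun X + B -> F^o} := [ffun r => A' r (inr e)].
    have -> : mxcol A (inr e) = h0 + mxcol A (inl (inr (inr y))).
      by apply/ffunP => r; rewrite !ffunE ey eW.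
    rewrite linearD /= (nform_W q AX AB) nformE.
    have -> : nform_fun q m h0 = (0, ev F b0).
      congr (_, _).
        by rewrite (_ : [ffun x => _] = 0) ?linear0 //; apply/ffunP => x; rewrite !ffunE rX0.
      apply/ffunP => b; rewrite !ffunE rB big1 ?subr0 // => x _; by rewrite ffunE rX0 mulr0.
    by rewrite -[LHS]/(0 + _, _ + 0) add0r addr0.
  have [fc lL] := rF e eZ'; have [k [k1 k2]] := Lambda_killed lL.
  have uE : u (inr e) = (0, [ffun b => A' (inr b) (inr e)]).
    rewrite /u nformE; congr (_, _).
      apply/eqP; rewrite -memv_ker kq.
      have -> : [ffun x => mxcol A (telt (inr e)) (inl x)] =
          \sum_c k c *: mxcol (ft_A1 Phi) (inl c) :> {ffun X -> F^o}.
        apply/ffunP => x; rewrite sum_ffunE !ffunE eF //; have := k1 x; rewrite ffunE => ->.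
        by apply: eq_bigr => c' _; rewrite !ffunE.
      by apply: memv_suml => c' _; apply/memvZ/memv_span/image_f.
    apply/ffunP => b; rewrite !ffunE eF // -[RHS]subr0; congr (_ - _).
    have -> : \sum_x m b x * mxcol A (telt (inr e)) (inl x) =
        \sum_x m b x * \sum_c k c * ft_A1 Phi x (inl c).
      by apply: eq_bigr => x _; rewrite ffunE eF //; have := k1 x; rewrite ffunE => ->.
    rewrite -[RHS](k2 _ (rD b)); under eq_bigr do rewrite mulr_sumr.
    rewrite exchange_big; apply: eq_bigr => c' _; rewrite ffunE -eW AB mulr_sumr.
    by apply: eq_bigr => x _; exact: mulrCA.
  have [v0|[b eb]|[b [b' [bb eb]]]] := frame_columnP fc.
  - by have := u0 (inr e); rewrite uE v0 eqxx.
  - by constructor 2; exists b, (r1 None); rewrite uE eb r1P.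
  by constructor 3; exists b, b'; split; rewrite // uE eb.
move=> big; rewrite cM -dimu.
by apply: (@count_frame F F' _ _ cF c3 S1 _ (fun i => s (val i)) t (fun i => f (val i)) g tw1 s1i (r1 None));
  rewrite ?r1P // dimu.
Qed.
End Four.

(** * The four classes *)

Section ColumnRank.
Variables (F : fieldType) (B E : finType) (A : B -> E -> F) (X : {set E}).

Definition colmx : 'M[F]_(#|X|, #|B|) := \matrix_(i, j) A (enum_val j) (enum_val i).

Lemma rank_colmx : \rank colmx = col_rk A X.
Proof.
have rfree := maxrowsub_free colmx; set g := maxrankfun colmx in rfree.
have fr : free [seq mxcol A (enum_val (g i)) | i : 'I_(\rank colmx)].
  set Y := image _ _; have sY : size Y == \rank colmx by rewrite size_map size_enum_ord.
  have YE i : (Tuple sY)`_i = nth 0 Y i by [].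
  suff : free (Tuple sY) by [].
  apply/freeP => k hk i.
  have Yi (j : 'I_(\rank colmx)) : (Tuple sY)`_j = mxcol A (enum_val (g j)).
    by rewrite YE /Y (nth_map j) ?size_enum_ord // nth_ord_enum.
  have : (\row_j k j) *m rowsub g colmx = 0.
    apply/rowP => b; rewrite !mxE; have /ffunP/(_ (enum_val b)) := hk.
    rewrite sum_ffunE ffunE => h; rewrite -[RHS]h; apply: eq_bigr => j _.
    by rewrite Yi !mxE !ffunE.
  move/eqP; rewrite mulmx_free_eq0 // => /eqP/rowP/(_ i); by rewrite !mxE.
have eqs : <<[seq mxcol A e | e in X]>>%VS =
    <<[seq mxcol A (enum_val (g i)) | i : 'I_(\rank colmx)]>>%VS.
  apply/eqP; rewrite eqEsubv; apply/andP; split; apply/span_subvP => _ /imageP[e eX ->]; last first.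
    by apply/memv_span/image_f/enum_valP.
  have sub : (colmx <= rowsub g colmx)%MS.
    have : (rowsub g colmx == colmx)%MS.
      rewrite -(geq_leqif (mxrank_leqif_eq (rowsub_sub _ _))).
      by move: rfree; rewrite /row_free => /eqP ->.
    by case/andP.
  have /submxP[D eD] := submx_trans (row_sub (enum_rank_in eX e) colmx) sub.
  have -> : mxcol A e = \sum_j D 0 j *: mxcol A (enum_val (g j)).
    apply/ffunP => b; rewrite sum_ffunE ffunE.
    have /rowP/(_ (enum_rank b)) := eD; rewrite !mxE enum_rankK enum_rankK_in // => ->.
    by apply: eq_bigr => j _; rewrite !mxE !ffunE enum_rankK.
  by apply: memv_suml => j _; apply/memvZ/memv_span/image_f.
rewrite /col_rk eqs; move: fr; rewrite /free size_image card_ord => /eqP ->.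
by [].
Qed.
End ColumnRank.

(** The rank is the size of a largest nonsingular square submatrix; one is selected in [A] and
    survives in [A']. *)
Lemma col_rk_le_minors (F F' : fieldType) (B E : finType) (A : B -> E -> F) (A' : B -> E -> F') X :
  (forall k (f : 'I_k -> B) (g : 'I_k -> E), injective f -> injective g ->
     \det (\matrix_(i < k, j < k) A (f i) (g j)) != 0 ->
     \det (\matrix_(i < k, j < k) A' (f i) (g j)) != 0) ->
  (col_rk A X <= col_rk A' X)%N.
Proof.
move=> h; rewrite -!rank_colmx; set N := colmx A X; set N' := colmx A' X.
have rf := maxrowsub_free N; have gi := @maxrankfun_inj _ _ _ N.
move: (maxrankfun N) rf gi => g rf gi.
have rf' : row_full (rowsub g N)^T by rewrite /row_full mxrank_tr.
have ff := fullrowsub_full rf'; have fi := @fullrankfun_inj _ _ _ _ rf'.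
move: (fullrankfun rf') ff fi => f ff fi.
pose D := \matrix_(i < \rank N, j < \rank N) A (enum_val (f i)) (enum_val (g j)).
pose D' := \matrix_(i < \rank N, j < \rank N) A' (enum_val (f i)) (enum_val (g j)).
have eD : rowsub f (rowsub g N)^T = D by apply/matrixP => i j; rewrite !mxE.
have dD : \det D != 0 by rewrite -unitfE -unitmxE -row_full_unit -eD.
have dD' : \det D' != 0.
  apply: (h _ (fun i => enum_val (f i)) (fun j => enum_val (g j))) => // i j.
    by move=> /enum_val_inj/fi.
  by move=> /enum_val_inj/gi.
have rD' : \rank D' = \rank N.
  by apply: mxrank_unit; rewrite unitmxE unitfE.
have eD' : rowsub f (rowsub g N')^T = D' by apply/matrixP => i j; rewrite !mxE.
rewrite -rD' -eD'; apply: leq_trans (mxrankS (rowsub_sub _ _)) _.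
by rewrite mxrank_tr mxrankS // rowsub_sub.
Qed.

(** * Transfer of representations along Z[t] *)

Section GoldenTransfer.
Variables (K K' : fieldType) (t : K) (th : K').
Hypotheses (t2 : t ^+ 2 = t + 1) (th2 : th ^+ 2 = th + 1).
Hypothesis t0 : forall a b : int, a%:~R + b%:~R * t = 0 -> a%:~R + b%:~R * th = 0.

(** The graph of the ring homomorphism from Z[t] to Z[th] with [t] sent to [th]. As a relation it
    needs no subring type, and [t0] makes it single-valued. *)
Definition grel (x : K) (y : K') :=
  exists a b : int, x = a%:~R + b%:~R * t /\ y = a%:~R + b%:~R * th.

Lemma grel0 : grel 0 0. Proof. by exists 0, 0; rewrite !mul0r !addr0. Qed.
Lemma grel1 : grel 1 1. Proof. by exists 1, 0; rewrite !mul0r !addr0. Qed.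
Lemma grel_gen : grel t th. Proof. by exists 0, 1; rewrite !mul1r !add0r. Qed.

Lemma grelD x x' y y' : grel x y -> grel x' y' -> grel (x + x') (y + y').
Proof.
move=> [a [b [-> ->]]] [c [d [-> ->]]]; exists (a + c), (b + d); rewrite !intrD.
by split; ring.
Qed.

Lemma grelN x y : grel x y -> grel (- x) (- y).
Proof. by move=> [a [b [-> ->]]]; exists (- a), (- b); rewrite !rmorphN; split; ring. Qed.

Lemma grelM x x' y y' : grel x y -> grel x' y' -> grel (x * x') (y * y').
Proof.
move=> [a [b [-> ->]]] [c [d [-> ->]]].
exists (a * c + b * d), (a * d + b * c + b * d); rewrite !rmorphD !rmorphM /=.
split; apply: subr0_eq.
  rewrite (_ : _ - _ = b%:~R * d%:~R * (t ^+ 2 - (t + 1))); last by ring.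
  by rewrite t2 subrr mulr0.
rewrite (_ : _ - _ = b%:~R * d%:~R * (th ^+ 2 - (th + 1))); last by ring.
by rewrite th2 subrr mulr0.
Qed.

Lemma grel_eq x y y' : grel x y -> grel x y' -> y = y'.
Proof.
move=> [a [b [-> ->]]] [c [d [e ->]]]; apply: subr0_eq.
have := @t0 (a - c) (b - d); rewrite !rmorphB /= => h.
rewrite -(h _); first by ring.
by rewrite -[RHS](subrr (a%:~R + b%:~R * t)) {2}e; ring.
Qed.

Lemma grel_det n (N : 'M[K]_n) (N' : 'M[K']_n) :
  (forall i j, grel (N i j) (N' i j)) -> grel (\det N) (\det N').
Proof.
move=> h; rewrite /determinant; apply: (big_ind2 grel) => [||s _]; first exact: grel0.
  by move=> ? ? ? ?; apply: grelD.
apply: grelM; last by apply: (big_ind2 grel) => [||i _]; [exact: grel1 | by move=> ? ? ? ?; apply: grelM | exact: h].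
by case: (perm.odd_perm s); rewrite ?expr0 ?expr1; [apply/grelN/grel1 | exact: grel1].
Qed.

Lemma grel_pow (i : int) : grel (t ^ i) (th ^ i).
Proof.
have n0 (L : fieldType) (x : L) : x ^+ 2 = x + 1 -> x^-1 = x - 1.
  move=> x2; have x0 : x != 0.
    apply: contraTneq (oner_neq0 L) => e; move: x2; rewrite e expr0n /= add0r => <-.
    by rewrite eqxx.
  apply: (mulfI x0); rewrite mulfV // mulrBr -expr2 x2 mulr1 addrC addKr.
  by [].
have hX x y n : grel x y -> grel (x ^+ n) (y ^+ n).
  by move=> h; elim: n => [|n IH]; rewrite ?expr0 ?exprS; [exact: grel1 | exact: grelM].
case: i => n; first exact: hX grel_gen.
rewrite /exprz -!exprVn; apply: hX; rewrite !n0 //.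
exact: grelD grel_gen (grelN grel1).
Qed.

Lemma grel_representable (M : matroid) (B : finType) (A : B -> M -> K) :
  represents A -> (forall b e, exists y, grel (A b e) y) ->
  (forall k (f : 'I_k -> B) (g : 'I_k -> M) y, injective f -> injective g ->
     let d := \det (\matrix_(i < k, j < k) A (f i) (g j)) in
     d != 0 -> grel d y -> y != 0) ->
  representable K' M.
Proof.
move=> rA hy hd; pose A' b e := projT1 (boolp.cid (hy b e)).
have A'P b e : grel (A b e) (A' b e) by rewrite /A'; case: (boolp.cid _).
have dP k (f : 'I_k -> B) (g : 'I_k -> M) :
    grel (\det (\matrix_(i < k, j < k) A (f i) (g j))) (\det (\matrix_(i < k, j < k) A' (f i) (g j))).
  by apply: grel_det => i j; rewrite !mxE.
exists B, A' => X; rewrite rA /=; apply/eqP; rewrite eqn_leq; apply/andP; split.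
  by apply: col_rk_le_minors => k f g fi gi nz; apply: hd (dP k f g).
apply: col_rk_le_minors => k f g _ _; apply: contraNneq => z.
have := dP k f g; rewrite z => h; apply/eqP; exact: grel_eq h grel0.
Qed.
End GoldenTransfer.

(** Descent modulo 2: the form is odd unless both arguments are even, and then both can be
    halved. *)
Lemma golden_norm_eq0 (a b : int) : a * a + a * b - b * b = 0 -> a = 0 /\ b = 0.
Proof.
have [n] := ubnP (`|a| + `|b|)%N; elim: n a b => // n IH a b lt e.
have ha := divz_eq a 2; have hb := divz_eq b 2.
have ra : (0 <= (a %% 2)%Z < 2) by rewrite modz_ge0 // ltz_pmod.
have rb : (0 <= (b %% 2)%Z < 2) by rewrite modz_ge0 // ltz_pmod.
move: (a %/ 2)%Z (b %/ 2)%Z (a %% 2)%Z (b %% 2)%Z ha hb ra rb => a' b' r s ha hb ra rb.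
have [r0|r1] : r = 0 \/ r = 1 by lia.
  have [s0|s1] : s = 0 \/ s = 1 by lia.
    have e' : a' * a' + a' * b' - b' * b' = 0 by subst; lia.
    have [/andP[/eqP a0 /eqP b0]|nz] := boolP ((a' == 0) && (b' == 0)).
      by subst; split; lia.
    have [|ea eb] := IH a' b' _ e'; first by lia.
    by subst; split; lia.
  by exfalso; subst; lia.
have [s0|s1] : s = 0 \/ s = 1 by lia.
  by exfalso; subst; lia.
by exfalso; subst; lia.
Qed.

(** The product with the conjugate a + b(1 - tau) is the norm form above. *)
Lemma tau_irrational (R : realType) (a b : int) : a%:~R + b%:~R * tau R = 0 -> a = 0 /\ b = 0.
Proof.
move=> e; apply: golden_norm_eq0; apply/eqP; rewrite -(intr_eq0 R) !rmorphB !rmorphD !rmorphM /=.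
apply/eqP; have -> : a%:~R * a%:~R + a%:~R * b%:~R - b%:~R * b%:~R =
  (a%:~R + b%:~R * tau R) * (a%:~R + b%:~R * (1 - tau R)) +
  b%:~R * b%:~R * (tau R ^+ 2 - (tau R + 1)) by ring.
by rewrite e tau_sqr subrr mul0r mulr0 addr0.
Qed.

Lemma golden_mean_representable (R : realType) (K : fieldType) (th : K) (M : matroid) :
  th ^+ 2 = th + 1 -> golden_mean R M -> representable K M.
Proof.
move=> th2 [B [A [rA hA]]].
have t2 := tau_sqr R.
have t0 (a b : int) : a%:~R + b%:~R * tau R = 0 -> a%:~R + b%:~R * th = 0 :> K.
  by move=> /tau_irrational[-> ->]; rewrite mul0r addr0.
have th0 : th != 0.
  apply: contraTneq (oner_neq0 K) => e; move: th2; rewrite e expr0n /= add0r => <-.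
  by rewrite eqxx.
have good d : (exists i : int, d = tau R ^ i \/ d = - tau R ^ i) ->
    exists2 y, y != 0 & grel (tau R) th d y.
  case=> i [->|->]; [exists (th ^ i) | exists (- th ^ i)].
  - by rewrite expfz_eq0 negb_and th0 orbT.
  - exact: grel_pow.
  - by rewrite oppr_eq0 expfz_eq0 negb_and th0 orbT.
  exact/grelN/grel_pow.
apply: (grel_representable t2 th2 t0 rA) => [b e|k f g y fi gi d nz hy].
  have [z|nz] := eqVneq (A b e) 0; first by exists 0; rewrite z; apply: grel0.
  have := hA 1%N (fun _ => b) (fun _ => e); rewrite det_mx11 mxE => /(_ _ _ nz).
  have inj (T : Type) (x : T) : injective (fun _ : 'I_1 => x) by move=> i j _; rewrite !ord1.
  by move=> /(_ (inj _ _) (inj _ _)) /good[y _ hy]; exists y.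
have [y' y'0 hy'] := good _ (hA k f g fi gi nz).
by rewrite (grel_eq t0 hy hy').
Qed.

Lemma intr_char2 (K : fieldType) (a : int) : 2 \in [pchar K] -> a%:~R = (odd `|a|)%:R :> K.
Proof.
move=> c2; have nE n : n%:R = (odd n)%:R :> K.
  rewrite -[in LHS](odd_double_half n) natrD -muln2 natrM (pcharf0 c2) mulr0 addr0.
  by [].
case: a => n; first by rewrite -pmulrn [LHS]nE.
by rewrite NegzE rmorphN /= -pmulrn [X in - X]nE ?abszN oppr_pchar2.
Qed.

(** [AC4] and [SL4] come with a four-element field of their own. Sending [w] to [w'] moves
    representations to the fixed field, where Hypothesis B is applied. *)
Lemma representable_card4 (F F' : finFieldType) (M : matroid) :
  #|F| = 4%N -> #|F'| = 4%N -> representable F M -> representable F' M.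
Proof.
move=> cF cF' [B [A rA]].
have [w [w0 w1]] := exists_card4 cF; have [w' [w'0 w'1]] := exists_card4 cF'.
have w2 := square_card4 cF w0 w1; have w2' := square_card4 cF' w'0 w'1.
have H (K K' : finFieldType) (x : K) (x' : K') : #|K| = 4%N -> #|K'| = 4%N ->
    x != 0 -> x != 1 -> forall a b : int, a%:~R + b%:~R * x = 0 -> a%:~R + b%:~R * x' = 0.
  move=> cK cK' x0 x1 a b; rewrite !intr_char2 ?pchar_card4 //.
  case: (odd `|a|); case: (odd `|b|) => /=; rewrite ?mul1r ?mul0r ?addr0 ?add0r //.
  - by move=> /eqP; rewrite addrC addr_eq0 oppr_card4 // (negbTE x1).
  - by move=> /eqP; rewrite oner_eq0.
  by move=> /eqP; rewrite (negbTE x0).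
have t0 := H F F' w w' cF cF' w0 w1; have t0' := H F' F w' w cF' cF w'0 w'1.
apply: (grel_representable w2 w2' t0 rA) => [b e|k f g y fi gi d nz [a [b [ed ey]]]].
  have [] := mem_card4 cF (A b e) w0 w1 => ->.
  - by exists 0; apply: grel0.
  - by exists 1; apply: grel1.
  - by exists w'; apply: grel_gen.
  by exists (w' + 1); apply: grelD; [apply: grel_gen | apply: grel1].
by apply: contraNneq nz; rewrite ey ed => /t0' ->.
Qed.

Lemma exists_golden_char3 : exists K : fieldType, 3 \in [pchar K] /\ exists th : K, th ^+ 2 = th + 1.
Proof.
have [K [f _]] := countable_algebraic_closure 'F_3.
exists K; split; first by apply: (rmorph_pchar f); apply: pchar_Fp.
have [x ex] := @solve_monicpoly K 2 (fun _ => 1) isT.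
by exists x; rewrite ex !big_ord_recl big_ord0 /= !mul1r expr0 expr1 addr0 addrC.
Qed.

Definition char3_quaternary (F : fieldType) (M : matroid) : Prop :=
  representable F M /\ exists F' : fieldType, 3 \in [pchar F'] /\ representable F' M.

Section Inclusion.
Variable F : finFieldType.
Hypothesis cF : #|F| = 4%N.

Lemma AC4_quaternary M : AC4 M -> char3_quaternary F M.
Proof.
case=> [[F1 [c1 r1]] h _]; split; first exact: representable_card4 c1 cF r1.
exact: (h 3).
Qed.

Lemma SL4_quaternary M : SL4 M -> char3_quaternary F M.
Proof.
case=> [[F1 [c1 r1]] [q _ h]]; split; first exact: representable_card4 c1 cF r1.
have [F' p3 c3] := @pPrimePowerField 3 q.+1 isT isT.
exists F'; split=> //; apply/h/at_least_card; rewrite c3.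
by apply: leq_trans (leqnSn q) _; apply: ltnW; apply: ltn_expl.
Qed.

Lemma AF4_quaternary M : AF4 M -> char3_quaternary F M.
Proof.
move=> h; split; first by apply/h/at_least_card; rewrite cF.
have [F' p3 c3] := @pPrimePowerField 3 2 isT isT.
by exists F'; split=> //; apply/h/at_least_card; rewrite c3.
Qed.

Lemma golden_mean_quaternary (R : realType) M : golden_mean R M -> char3_quaternary F M.
Proof.
move=> g; split.
  have [w [w0 w1]] := exists_card4 cF.
  exact: golden_mean_representable (square_card4 cF w0 w1) g.
have [K [c3 [th th2]]] := exists_golden_char3.
by exists K; split=> //; apply: golden_mean_representable th2 g.
Qed.
End Inclusion.

(** * The upper bound *)

(** Hypothesis B speaks of represented matroids. An equality of records, rather than an isomorphism,
    lets its hypotheses and conclusions be rewritten directly for [M]. *)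
Lemma matroid_ext (M : matroid) (r : {set M} -> nat) c m s :
  (forall X : {set M}, rk X = r X) -> M = @Matroid M r c m s.
Proof.
case: M r c m s => T rk0 c0 m0 s0 /= r c m s h.
have er : rk0 = r by apply: boolp.funext.
subst r; congr Matroid; exact: boolp.Prop_irrelevance.
Qed.

Lemma underlying_of_matrix (F : fieldType) (M : matroid) (B : finType) (A : B -> M -> F) :
  represents A -> underlying (of_matrix A) = M.
Proof.
move=> rA; apply/esym/matroid_ext => X; rewrite rA -[LHS](rk_of_matrix A).
by [].
Qed.

Lemma misom_sym (M N : matroid) : misom M N -> misom N M.
Proof.
case=> f [g fK gK] h; exists g; first by exists f.
move=> Y; rewrite h -imset_comp; congr rk; apply/setP => y.
apply/idP/imsetP => [yY|[z zY ->]]; last by rewrite /= gK.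
by exists y; rewrite //= gK.
Qed.

Lemma char3_rep_minor_closed (F : fieldType) : minor_closed (@char3_rep F).
Proof.
split=> [M N [f [c [bf c0 h]]]|M X|M X] [F' [p3 r]]; exists F'; split=> //.
- by apply: representable_misom r; exists f => //; apply: rk_risom c0 h.
- have [V [v rv]] := (representableP _ _).1 r.
  have := vrep_representable (vrep_delete (M := underlying M) (D := X) rv); apply: representable_misom.
  by exists id; [exists id | move=> Y; rewrite imset_id; have := rk_rdelete Y].
have [V [v rv]] := (representableP _ _).1 r.
have [p kp] := exists_ker <<[seq v x | x in X]>>%VS.
have := vrep_representable (vrep_contract (M := underlying M) (C := X) rv kp); apply: representable_misom.
exists id; first by exists id.
move=> Y; rewrite imset_id; apply: (@addIn (@rk (underlying M) X)).
by rewrite (rk_rcontract (C := X)) (@rk_contract (underlying M) X).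
Qed.

Lemma normalized_F2 (m : nat) (v : 'rV['F_2]_m) : v != 0 -> normalized v.
Proof.
move=> v0; have [i vi] : exists i, v 0 i != 0.
  apply: boolp.contrapT => h; case/eqP: v0; apply/rowP => i; rewrite mxE; apply/eqP.
  by apply: contraT => vi; case: h; exists i.
have [j vj jm] := @arg_minnP _ i (fun i => v 0 i != 0) (fun i => i : nat) vi.
apply/existsP; exists j; apply/andP; split.
  by move: vj; case: (v 0 j) => -[|[|n]] hn //= _; apply/eqP/val_inj.
apply/forallP => k; apply/implyP => lt; apply: contraT => vk.
by have := jm k vk; rewrite leqNgt lt.
Qed.

(** [PG 3 'F_2] is the Fano plane, so the exclusion in Hypothesis B with parameter 3 holds for every
    member of the class. *)
Lemma PG_not_representable (F : fieldType) : 2 \notin [pchar F] -> ~ representable F (PG 3 'F_2).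
Proof.
move=> n2 /representableP[V' [v' rv']].
pose w (a b c : bool) : 'rV['F_2]_3 := \row_t (nth false [:: a; b; c] t)%:R.
have w0 a b c : [|| a, b | c] -> w a b c != 0.
  move=> h; apply/eqP => /rowP e; have := e (inord 0); have := e (inord 1); have := e (inord 2).
  by rewrite !mxE !inordK //; clear e; move: h; case: a; case: b; case: c.
pose pt a b c (h : [|| a, b | c]) : PG 3 'F_2 := exist _ (w a b c) (normalized_F2 (w0 a b c h)).
pose v (x : PG 3 'F_2) : {ffun 'I_3 -> ('F_2)^o} := [ffun i => val x 0 i].
have rv : vrep v by move=> X.
have vE a b c h i : v (@pt a b c h) i = (nth false [:: a; b; c] i)%:R by rewrite ffunE mxE.
have tw := vrep_twin rv rv'.
apply: (@fano_absurd _ _ _ _ _ _ _ (@pt true false false isT) (@pt false true false isT)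
  (@pt false false true isT) (@pt true true false isT) (@pt false true true isT)
  (@pt true false true isT) (@pt true true true isT) tw n2).
- exact: pchar_Fp.
- apply/free3P => x y z /ffunP e.
  have lin (h1 h2 h3 : {ffun 'I_3 -> ('F_2)^o}) i :
      (x *: h1 + y *: h2 + z *: h3) i = x * h1 i + y * h2 i + z * h3 i by rewrite !ffunE.
  have K i : x * v (@pt true false false isT) i + y * v (@pt false true false isT) i +
     z * v (@pt false false true isT) i = 0 by rewrite -lin e ffunE.
  have := K (inord 0); have := K (inord 1); have := K (inord 2); rewrite !vE !inordK //=.
  by rewrite !mulr0 !mulr1 !addr0 !add0r => -> -> ->.
all: apply/ffunP => i; rewrite !ffunE !mxE; case: i => -[|[|[|]]] //= _; by rewrite ?addr0 ?add0r.
Qed.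

Lemma card_simple_le (F : finFieldType) (M : matroid) : representable F M -> simple M ->
  (#|M| <= #|F| ^ rank M)%N.
Proof.
move=> [B [A rA]] sM.
pose P := <<[seq mxcol A x | x in [set: M]]>>%VS.
have dP : \dim P = rank M by rewrite /rank rA.
have cP (x : M) : exists c : 'rV[F]_(\dim P), mxcol A x = \sum_i c 0 i *: (vbasis P)`_i.
  exists (\row_i coord (vbasis P) i (mxcol A x)).
  rewrite {1}(coord_vbasis (v := mxcol A x) (U := P)); last by apply/memv_span/image_f.
  by apply: eq_bigr => i _; rewrite mxE.
pose c x := projT1 (boolp.cid (cP x)).
have cE x : mxcol A x = \sum_i c x 0 i *: (vbasis P)`_i by rewrite /c; case: (boolp.cid _).
have ci : injective c.
  move=> x y e; apply/eqP; apply: contraT => nxy.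
  have := sM [set x; y]; rewrite /indep rA /= /col_rk cards2 nxy => /(_ isT)/eqP.
  have -> : <<[seq mxcol A e | e in [set x; y]]>>%VS = <[mxcol A x]>%VS.
    apply/eqP; rewrite eqEsubv; apply/andP; split.
      apply/span_subvP => _ /imageP[z zxy ->]; move: zxy; rewrite !inE => /orP[] /eqP ->.
        exact: memv_line.
      by rewrite cE -e -cE memv_line.
    by rewrite -memvE; apply/memv_span/image_f; rewrite !inE eqxx.
  by rewrite dim_vline; case: (_ != 0).
by apply: leq_trans (leq_card c ci) _; rewrite card_mx mul1n dP.
Qed.

Lemma upper_bound (F : finFieldType) : hypothesis_B -> #|F| = 4%N ->
  exists R, forall M, char3_quaternary F M -> simple M -> (R <= rank M)%N ->
    (2 * #|M| + 4 <= rank M * rank M + 5 * rank M)%N.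
Proof.
move=> hB cF; have c2 := pchar_card4 cF.
have [k [n [s [t [k0 n0 [Phi [Psi [h1 _ h3 _]]]]]]]] :=
  hB F 2 3%N (@char3_rep F) c2 isT (@char3_rep_minor_closed F).
case: n n0 h3 => // n _ h3.
have [r0 hr0] := clique_minor n c2.
have tb i := template_bound cF (h1 i).
pose R0 i := projT1 (boolp.cid (tb i)).
have R0P i M : template_class (Phi i) M -> simple (underlying M) -> (R0 i <= rank (underlying M))%N ->
    (2 * #|M| + 4 <= rank (underlying M) * rank (underlying M) + 5 * rank (underlying M))%N.
  by rewrite /R0; case: (boolp.cid _) => /= r; apply.
apply: (bound_of_connected_bound (k := k) (R1 := maxn 1 (maxn r0 (\max_i R0 i)))) => //.
- move=> M D [/representableP[V [v rv]] [F' [p3 /representableP[V' [v' rv']]]]].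
  split; first exact: vrep_representable (vrep_delete rv).
  by exists F'; split=> //; apply: vrep_representable (vrep_delete rv').
- by move=> M [r _] sM; rewrite -cF; apply: card_simple_le.
move=> M [rF [F' [p3 rF']]] sM vM; rewrite !geq_max => /and3P[ge1 ger0 geR].
(* With fewer than r^2/2 elements the bound is immediate, as the rank is positive; otherwise
   [clique_minor] supplies the clique that Hypothesis B asks for. *)
have [lt|ge] := ltnP (2 * #|M|) (rank M ^ 2).
  by move: lt ge1; rewrite expnS expn1; move: (rank M) #|M| => a b; lia.
have mk := hr0 F' M (pchar2_char3 p3) sM rF rF' ger0 ge.
have [B [A rA]] := rF.
have eM := underlying_of_matrix rA.
have [||||| i ti] := h3 (of_matrix A); rewrite ?eM //.
- by exists F'; split; rewrite ?eM.
- move=> /(representable_minor rF')[N [iN rN]].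
  exact: PG_not_representable (pchar2_char3 p3) (representable_misom (misom_sym iN) rN).
have := R0P i _ ti; rewrite eM; apply=> //.
exact: leq_trans (leq_bigmax i) geR.
Qed.

Lemma double_extremal r : (0 < r)%N -> (2 * ('C(r + 3, 2) - 5) + 4 = r * r + 5 * r)%N.
Proof.
have := mul_bin_diag (r + 3) 1; rewrite addn3 /= bin1.
by case: r => [//|r]; move: ('C(_, _)) => x; nia.
Qed.

Theorem theorem1p1 (R : realType) (hB : hypothesis_B) :
  exists r0 : nat, forall r : nat, (r0 <= r)%N ->
    [/\ extremal (golden_mean R) r ('C(r + 3, 2) - 5)%N,
        extremal AC4 r ('C(r + 3, 2) - 5)%N,
        extremal SL4 r ('C(r + 3, 2) - 5)%N
      & extremal AF4 r ('C(r + 3, 2) - 5)%N].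
Proof.
have [F _ cF] := @pPrimePowerField 2 2 isT isT.
have [R1 hR1] := upper_bound hB cF.
(* This handles simple matroids of rank below [R1]: they have at most [4 ^ R1] elements, fewer than
   [r], while the bound is at least [r]. *)
exists (4 ^ R1).+1 => r ler; have r0 : (0 < r)%N by apply: leq_trans ler.
have up M : char3_quaternary F M -> simple M -> (rank M <= r)%N -> (#|M| <= 'C(r + 3, 2) - 5)%N.
  move=> qM sM lerM; have := double_extremal r0; move: ('C(r + 3, 2) - 5)%N => f ef.
  have [leR|ltR] := leqP R1 (rank M).
    have := hR1 M qM sM leR; move: (rank M) #|M| lerM => a b; nia.
  have := card_simple_le qM.1 sM; rewrite cF => h.
  have : (#|M| <= 4 ^ R1)%N by apply: leq_trans h _; rewrite leq_exp2l // ltnW.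
  move: #|M| (4 ^ R1)%N ler => a b; nia.
have [M [[gM aM sM fM] [simM rM cM]]] := lower_bound R r0.
split; (split; first by exists M) => N hN; apply: up.
- exact: golden_mean_quaternary hN.
- exact: AC4_quaternary hN.
- exact: SL4_quaternary hN.
exact: AF4_quaternary hN.
Qed.
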